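(* Let $p$ be odd and $A$ a nontrivial finite abelian $p$-group. For all $s\in A\setminus\{\mathrm{id}\}$ and $t\in A$, \[ \lim_{X\to\infty}\frac{\#\{\varphi\in\mathcal{F}(X):\ \text{there is no prime } q>\exp((\log X)^{1/2}) \text{ with } \varphi(\iota_q^*(\sigma_q))=s,\ \varphi(\iota_q^*(\mathrm{Frob}_q))=t\}}{\#\mathcal{F}(X)}=0. \]
   Context: $\mathcal{F}(X):=\{\varphi\in\mathrm{Epi}(G_\mathbb{Q},A):\mathfrak{f}(\varphi)\le X\}$, where $\mathfrak{f}(\varphi)$ is the product of primes ramified in the fixed field of $\ker\varphi$. Fixed embeddings $\overline{\mathbb{Q}}\to\overline{\mathbb{Q}_q}$ induce $\iota_q^*:G_{\mathbb{Q}_q}\to G_\mathbb{Q}$; $\sigma_q$ is a fixed topological generator of tame inertia and $\mathrm{Frob}_q\in G_{\mathbb{Q}_q}$ a fixed Frobenius lift. *)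

(* Defs.v *)
From HB Require Import structures.
From mathcomp Require Import all_boot all_order all_algebra all_fingroup all_solvable.
From mathcomp Require Import all_field.
From mathcomp Require Import all_classical all_reals all_analysis.

Set Implicit Arguments.
Unset Strict Implicit.
Unset Printing Implicit Defensive.
Import Order.TTheory GRing.Theory Num.Theory.
Local Open Scope ring_scope.

(* Every ring automorphism of algC fixes Q, so this is Gal(Qbar/Q). *)
Record galQ := GalQ {
  gal_fun :> algC -> algC;
  gal_add : {morph gal_fun : x y / x + y};
  gal_mul : {morph gal_fun : x y / x * y};
  gal_one : gal_fun 1 = 1;
  gal_bij : bijective gal_fun }.

(* A finite Galois-stable subset of Qbar (its pointwise stabilizers form a
   basis of open normal subgroups of the Krull topology). *)
Definition gal_stable (S : seq algC) : Prop :=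
  forall (r : galQ) (x : algC), x \in S -> r x \in S.

Definition is_epi (gT : finGroupType) (phi : galQ -> gT) : Prop :=
  [/\
      (forall s t r : galQ, (forall x, r x = s (t x)) -> phi r = (phi s * phi t)%g),
      (* continuous for the Krull topology (A discrete): locally constant *)
      (exists S : seq algC, forall s t : galQ,
          (forall x, x \in S -> s x = t x) -> phi s = phi t)
    &
      (forall a : gT, exists s : galQ, phi s = a)].

Definition prime_ideal_Aint (P : algC -> Prop) : Prop :=
  [/\ (forall x, P x -> x \in Aint),
      P 0,
      (forall x y, P x -> P y -> P (x + y)),
      (forall a x, a \in Aint -> P x -> P (a * x))
    & ~ P 1] /\
    (forall a b, a \in Aint -> b \in Aint -> P (a * b) -> P a \/ P b).

Definition qbar_prime_above (q : nat) (P : algC -> Prop) : Prop :=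
  prime_ideal_Aint P /\ P q%:R.

Definition in_fixed_field (gT : finGroupType) (phi : galQ -> gT) (x : algC) :=
  forall s : galQ, phi s = 1%g -> s x = x.

(* q is ramified in K iff q O_K is contained in p^2 for some prime p of O_K
   above q (i.e. some ramification index e(p|q) >= 2).  Primes of O_K above q
   are exactly the contractions P \cap O_K of primes P of Aint above q, and
   p^2 is the ideal of O_K generated by the products a*b with a, b in p. *)
Definition ramified (gT : finGroupType) (phi : galQ -> gT) (q : nat) : Prop :=
  exists P, qbar_prime_above q P /\
    exists (n : nat) (a b : 'I_n -> algC),
      (forall i, P (a i) /\ in_fixed_field phi (a i)) /\
      (forall i, P (b i) /\ in_fixed_field phi (b i)) /\
      q%:R = \sum_(i < n) a i * b i.

Definition cond_le (R : realType) (gT : finGroupType) (phi : galQ -> gT) (X : R) :=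
  exists s : seq nat,
    [/\ uniq s, (forall q, q \in s <-> (prime q /\ ramified phi q))
      & ((\prod_(q <- s) q)%N%:R <= X)].

Definition decomp (P : algC -> Prop) (s : galQ) : Prop :=
  forall x, P (s x) <-> P x.

Definition inertia (P : algC -> Prop) (s : galQ) : Prop :=
  decomp P s /\ forall x, x \in Aint -> P (s x - x).

(* maximal ideal of the valuation ring of Qbar at P (localisation of Aint at P) *)
Definition max_ideal_loc (P : algC -> Prop) (y : algC) : Prop :=
  exists a b, P a /\ b \in Aint /\ ~ P b /\ y = a / b.

Definition wild_inertia (P : algC -> Prop) (s : galQ) : Prop :=
  inertia P s /\ forall x, x != 0 -> max_ideal_loc P (s x / x - 1).

(* s (in inertia) is a topological generator of tame inertia I_P / W_P:
   the closure of <s> W_P is I_P *)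
Definition tame_generator (P : algC -> Prop) (s : galQ) : Prop :=
  inertia P s /\
  forall t : galQ, inertia P t ->
    forall S : seq algC, gal_stable S ->
      exists (n : nat) (w : galQ), wild_inertia P w /\
        forall x, x \in S -> t x = iter n s (w x).

Definition frob_lift (q : nat) (P : algC -> Prop) (s : galQ) : Prop :=
  decomp P s /\ forall x, x \in Aint -> P (s x - x ^+ q).

Definition ncard (T : Type) (S : set T) : nat :=
  xget 0%N [set n : nat | (S #= `I_n)%card].

(* Main.v *)
(** Let [c_r,a] denote the character of conductor [r] (a twist of the cyclotomic
character mod [r]) sending the tame generator at [r] to [a].  Dividing [phi] by
the product of the [c_r,a_r] with [a_r = phi (sig r)], [r <> p], leaves a
homomorphism [u] trivial on every tame generator.  For fixed [u] the [phi] of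
conductor at most [X] are thus the tuples [(a_r)] with [a_r^(r-1) = 1] and
[f * prod_(a_r <> 1) r <= X], where [f] is [1] or [p] and depends on [u] only;
the possible [u] never have to be determined.

The number of tuples with support [n] is multiplicative in [n].  By a sieve
estimate resting on Mertens' theorem in arithmetic progressions, all but a small
proportion of the tuples have a support [n] divisible by distinct small primes
[r_0, ..., r_(2H-1) = 1 mod #|gT|] and by large primes [q_j] such that the
Frobenius at [q_j] acts on the [r]-th roots of unity as the tame generator at [r]
for [r = r_2j, r_2j+1], and trivially for the other [r_i].  Then the value at
Frob_[q_j] is [C_j * a_(r_2j) * a_(r_2j+1)] with [C_j] independent of all [r_i]
coordinates, so the [H] good events have conditional probability bounded below
and all fail with exponentially small probability.  A tuple giving a
non-surjective [phi] misses some [s' <> 1] altogether, hence is bad for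
[(s', 1)]: these are negligible by the same estimate. *)

Require Import Defs.
From HB Require Import structures.
From mathcomp Require Import all_boot all_order all_algebra all_fingroup all_solvable.
From mathcomp Require Import all_field.
From mathcomp Require Import all_classical all_reals all_analysis.
From mathcomp Require Import ring lra zify.
From mathcomp Require complex classfun character.
Set Implicit Arguments.
Unset Strict Implicit.
Unset Printing Implicit Defensive.
Import Order.TTheory GRing.Theory Num.Theory.
Import numFieldNormedType.Exports.
Local Open Scope ring_scope.

(** * Galois automorphisms and continuous homomorphisms *)

(** Two primes [r_(2j)], [r_(2j+1)] accompany each [q_j] because both must keep nontrivial values:
    in a group with more than two elements every element is a product of two nontrivial ones, so
    some choice at the pair yields [t]. Oddness of [p] enters here. Congruence to 1 modulo the group
    order makes every nontrivial element admissible at these primes, so conditioning on the support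
    leaves uniform independent coordinates there. The small primes are known only through the
    support, so a class for [q_j] is prepared for every pair of split primes below a bound that
    depends on the required accuracy alone. A large sum of [1/q] over [(z, N]] then needs only
    [N >= z^K] with [K] constant, which [z = exp(sqrt(log X))] allows. The sieve compares counting
    functions through logarithmic means, without an asymptotic formula for either. On the arithmetic
    side fixed fields and their integers are predicates on algebraic numbers, and finite-level
    arguments use polynomials built from finite orbits. *)

Lemma galQ_zmod (s : galQ) : zmod_morphism s.
Proof. by move=> x y; apply: (addIr (s y)); rewrite -gal_add !subrK. Qed.

Lemma galQ_monoid (s : galQ) : monoid_morphism s.
Proof. by split=> [|x y]; [exact: Defs.gal_one | exact: Defs.gal_mul]. Qed.

HB.instance Definition _ (s : galQ) :=
  GRing.isZmodMorphism.Build algC algC (gal_fun s) (galQ_zmod s).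
HB.instance Definition _ (s : galQ) :=
  GRing.isMonoidMorphism.Build algC algC (gal_fun s) (galQ_monoid s).

Lemma galQ_ext (s t : galQ) : (forall x, s x = t x) -> s = t.
Proof.
move=> e; have {}e : gal_fun s = gal_fun t by apply/funext.
case: s e => f a m o b /= e; case: t e => g a' m' o' b' /= e.
by subst g; congr GalQ; exact: Prop_irrelevance.
Qed.

Lemma rmorph_algC_bij (nu : {rmorphism algC -> algC}) : bijective nu.
Proof. by exists (algC_invaut nu); [exact: algC_autK | exact: algC_invautK]. Qed.

Definition galQ_of_rmorph (nu : {rmorphism algC -> algC}) : galQ :=
  GalQ (rmorphD nu) (rmorphM nu) (rmorph1 nu) (rmorph_algC_bij nu).

Definition galQ_comp (s t : galQ) : galQ := galQ_of_rmorph (gal_fun s \o gal_fun t).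
Definition galQ_id : galQ := galQ_of_rmorph idfun.
Definition galQ_inv (s : galQ) : galQ := galQ_of_rmorph (algC_invaut (gal_fun s)).
Definition galQ_exp (s : galQ) (n : nat) : galQ := iter n (galQ_comp s) galQ_id.

Lemma galQ_invK (s : galQ) x : galQ_inv s (s x) = x.
Proof. exact: algC_autK. Qed.
Lemma galQ_Kinv (s : galQ) x : s (galQ_inv s x) = x.
Proof. exact: algC_invautK. Qed.
Lemma galQ_expE (s : galQ) n x : galQ_exp s n x = iter n s x.
Proof. by elim: n => //= n <-. Qed.
Lemma galQ_Aint (s : galQ) x : (s x \in Aint) = (x \in Aint).
Proof. exact: Aint_aut. Qed.

(** The minimal polynomial of [x] splits in a number field generated by its roots, which is
    therefore Galois over the rationals. Automorphisms of that field extend to [algC], so [x] is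
    fixed by the whole finite group. *)
Lemma rational_of_fixed (x : algC) : (forall s : galQ, s x = x) -> x \in Crat.
Proof.
move=> fx; have [p [Dp mp] pdv] := minCpolyP x.
have [r Dr] := closed_field_poly_normal (minCpoly x).
rewrite (monicP (minCpoly_monic x)) scale1r in Dr.
have [Qs [QsC [s1 Ds1 gen]]] := num_field_exists r.
pose pr := map_poly (in_alg Qs) p.
have Qpr: pr \is a polyOver 1%VS.
  by apply/polyOverP=> i; rewrite coef_map memvZ ?memv_line.
have Dpr : pr = \prod_(z <- s1) ('X - z%:P).
  apply/(map_poly_inj QsC); rewrite -map_poly_comp.
  transitivity (map_poly (ratr : rat -> algC) p).
    by apply: eq_map_poly => a; rewrite /= rmorphZ_num rmorph1 mulr1.
  rewrite -Dp Dr -Ds1 big_map rmorph_prod /=; apply: eq_bigr => z _.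
  by rewrite map_polyXsubC.
have splitQ : splittingFieldFor 1 pr {:Qs}.
  by exists s1 => //; rewrite Dpr eqpxx.
have spax : SplittingField.axiom Qs.
  by exists pr.
pose Qt : splittingFieldType rat := HB.pack Qs (FieldExt_isSplittingField.Build rat Qs spax).
have gal1 : galois 1%AS {:Qt}%AS.
  apply/and3P; split; [exact: sub1v | | exact: normalFieldf].
  apply/separableP => y _; apply: pcharf0_separable.
  by move=> k; rewrite (pchar_lalg Qt) pchar_num.
have rx : x \in r by rewrite -root_prod_XsubC -Dr root_minCpoly.
have [x1 Dx1] : exists x1 : Qt, QsC x1 = x.
  by move: rx; rewrite -Ds1 => /mapP[x1 _ ->]; exists x1.
have : x1 \in fixedField 'Gal({:Qt} / 1%AS)%g.
  apply/fixedFieldP; first exact: memvf.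
  move=> g _.
  pose gR : {rmorphism Qs -> Qs} := (gal_repr g : 'AEnd(Qt)).
  have [nu Dnu] := extend_algC_subfield_aut QsC gR.
  apply: (fmorph_inj QsC); rewrite /= (Dnu x1) Dx1.
  exact: (fx (galQ_of_rmorph nu)).
move: gal1 => /galois_fixedField -> /vlineP[a Da].
rewrite -Dx1 Da alg_num_field fmorph_rat; apply/CratP; by exists a.
Qed.

(** * Integrality criteria and denominators *)

Section Integers.

Lemma integral_AintP x : integralOver (intr : int -> algC) x <-> x \in Aint.
Proof.
split=> [[p mp px]|Ax].
  apply: (root_monic_Aint px); first by rewrite monic_map.
  by apply/polyOverP => i; rewrite coef_map /= intr_int.
have /floorpP[p Dp] : minCpoly x \is a polyOver Num.int by [].
exists p; last by rewrite -Dp root_minCpoly.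
have := minCpoly_monic x; rewrite Dp !monicE lead_coef_map_inj //; last exact: intr_inj.
by rewrite -[1]/((1 : int)%:~R) eqr_int.
Qed.

Lemma Aint_root_monic (p : {poly algC}) x :
  p \is monic -> p \is a polyOver Aint -> root p x -> x \in Aint.
Proof.
move=> mp Ap px; apply/integral_AintP; apply: (integral_root_monic mp px) => c cp.
by apply/integral_AintP; apply: (allP Ap).
Qed.

(** Multiplying [p.[x] = 0] by the leading coefficient to the power degree minus one gives a monic
    equation for [lead_coef p * x] with integral coefficients. *)
Lemma Aint_lead_coefM (p : {poly algC}) x :
  p \is a polyOver Aint -> root p x -> lead_coef p * x \in Aint.
Proof.
move=> Ap px; set c := lead_coef p.
have Ac : c \in Aint by rewrite /c lead_coefE (polyOverP Ap).
have [p0|nzp] := eqVneq p 0; first by rewrite /c p0 lead_coef0 mul0r Aint0.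
have nzc : c != 0 by rewrite lead_coef_eq0.
have [n Dn] : exists n, size p = n.+2.
  have := root_size_gt1 nzp px; case: (size p) => [|[|n]] // _; by exists n.
pose r := \poly_(i < n.+1) (p`_i * c ^+ (n - i)).
have := @Aint_root_monic ('X^(n.+1) + r) (c * x); apply.
- rewrite monicE lead_coefDl ?lead_coefXn // size_polyXn ltnS; exact: size_poly.
- apply: rpredD; first by rewrite rpredX // polyOverX.
  apply/polyOverP => i; rewrite coef_poly; case: ifP => _; last exact: Aint0.
  by rewrite rpredM ?rpredX // (polyOverP Ap).
rewrite /root hornerD hornerXn (horner_poly n.+1).
have : c ^+ n * p.[x] == 0 by rewrite (rootP px) mulr0.
rewrite horner_coef Dn big_ord_recr /= mulrDr addrC.
congr (_ == 0); congr (_ + _).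
  have -> : p`_n.+1 = c by rewrite /c lead_coefE Dn.
  by rewrite mulrA -exprSr exprMn.
rewrite mulr_sumr; apply: eq_bigr => i _; rewrite exprMn.
have -> : c ^+ n = c ^+ (n - i) * c ^+ i by rewrite -exprD subnK // -ltnS.
by rewrite mulrACA [_ * p`_i]mulrC.
Qed.

Lemma Aint_multiple (x : algC) : exists2 m : nat, (0 < m)%N & m%:R * x \in Aint.
Proof.
have [p [Dp mp] pdv] := minCpolyP x.
have [q [a nza Dq]] := rat_poly_scale p.
have nzp : p != 0 by rewrite monic_neq0.
have nzq : q != 0.
  by apply: contraNneq nzp => q0; rewrite Dq q0 map_poly0 scaler0.
exists `|lead_coef q|%N; first by rewrite absz_gt0 lead_coef_eq0.
have Aq : map_poly (intr : int -> algC) q \is a polyOver Aint.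
  by apply/polyOverP => i; rewrite coef_map Aint_int.
have rq : root (map_poly (intr : int -> algC) q) x.
  have : root (map_poly (ratr : rat -> algC) p) x by rewrite -Dp root_minCpoly.
  rewrite Dq map_polyZ rootZ ?fmorph_eq0 ?invr_eq0 ?intr_eq0 //.
  by rewrite -map_poly_comp (eq_map_poly (g := intr)) // => z /=; rewrite ratr_int.
have := Aint_lead_coefM Aq rq; rewrite lead_coef_map_inj //; last exact: intr_inj.
rewrite natr_absz.
by case: (lerP 0 (lead_coef q)) => [/ger0_norm->|/ltr0_norm->] //; rewrite rmorphN mulNr rpredN.
Qed.

End Integers.

(** * Finite Galois orbits and their polynomials *)

Section Orbits.

(** Conjugates of an entry are roots of its minimal polynomial. This finiteness stands in for the
    profinite topology. *)
Lemma orbit_list (xs : seq algC) :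
  exists C : seq (seq algC), forall s : galQ, map s xs \in C.
Proof.
elim: xs => [|x xs [C IH]]; first by exists [:: [::]].
have [r Dr] := closed_field_poly_normal (minCpoly x).
rewrite (monicP (minCpoly_monic x)) scale1r in Dr.
exists [seq y :: ys | y <- r, ys <- C] => s /=.
apply: allpairs_f => //; rewrite -root_prod_XsubC -Dr.
by rewrite -(minCpoly_aut s) root_minCpoly.
Qed.

Lemma orbit_under (H : galQ -> Prop) (xs : seq algC) :
  exists O : seq (seq algC), uniq O /\
    forall ys : seq algC, ys \in O <-> exists h, H h /\ ys = map h xs.
Proof.
have [C HC] := orbit_list xs.
exists (undup [seq ys <- C | `[< exists h, H h /\ ys = map h xs >]]).
rewrite undup_uniq; split=> // ys; rewrite mem_undup mem_filter; split.
  by case/andP => /asboolP.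
by move=> yh; rewrite (asboolT yh) /=; case: yh => h [_ ->].
Qed.

(* A tuple of algebraic numbers is encoded as the polynomial with these
   coefficients, so that one primality argument treats all entries at once. *)
Definition orbit_poly (O : seq (seq algC)) : {poly {poly algC}} :=
  \prod_(ys <- O) ('X - (Poly ys)%:P).

Lemma map_poly_Poly (s : galQ) ys : map_poly s (Poly ys) = Poly (map s ys).
Proof. by apply: map_Poly_id0; rewrite rmorph0. Qed.

Lemma map_orbit_poly (s : galQ) O :
  map_poly (map_poly s) (orbit_poly O) = orbit_poly (map (map s) O).
Proof.
rewrite /orbit_poly rmorph_prod big_map; apply: eq_bigr => ys _ /=.
by rewrite map_polyXsubC /= map_poly_Poly.
Qed.

Lemma orbit_poly_fixed (s : galQ) (O : seq (seq algC)) : uniq O ->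
  (forall ys : seq algC, ys \in O -> map s ys \in O) ->
  map_poly (map_poly s) (orbit_poly O) = orbit_poly O.
Proof.
move=> uO sO; rewrite map_orbit_poly; apply: perm_big.
have injs : injective (map s) by apply: inj_map; apply: fmorph_inj.
have uO' : uniq (map (map s) O) by rewrite map_inj_uniq.
have sub : {subset map (map s) O <= O} by move=> _ /mapP[ys yO ->]; apply: sO.
have [_ eqO] := uniq_min_size uO' sub (eq_leq (esym (size_map _ _))).
by apply: uniq_perm.
Qed.

Lemma horner_orbit_poly O b :
  (orbit_poly O).[b] = \prod_(ys <- O) (b - Poly ys).
Proof. by rewrite /orbit_poly horner_prod; apply: eq_bigr => ys _; rewrite !hornerE. Qed.

Lemma Poly_inj_size (R : nzRingType) (a b : seq R) :
  size a = size b -> Poly a = Poly b -> a = b.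
Proof.
move=> sab pab; apply: (@eq_from_nth _ 0 _ _ sab) => i _.
by have := congr1 (fun p : {poly R} => p`_i) pab; rewrite !coef_Poly.
Qed.

Lemma orbit_poly_Aint (O : seq (seq algC)) : (forall ys : seq algC, ys \in O -> {subset ys <= Aint}) ->
  forall i j, (orbit_poly O)`_i`_j \in Aint.
Proof.
move=> AO.
rewrite /orbit_poly big_seq.
pose Q (f : {poly {poly algC}}) := forall i j, f`_i`_j \in Aint.
apply: (big_ind Q) => [i j|f g Af Ag i j|ys /AO Ays i j].
- by rewrite coef1 coefMn coef1 rpredMn // rpredMn.
- rewrite coefM coef_sum; apply: rpred_sum => k _.
  by rewrite coefM; apply: rpred_sum => l _; rewrite rpredM ?Af ?Ag.
rewrite coefB coefX coefC coefB rpredB //.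
  by rewrite coefMn coef1 rpredMn // rpredMn.
case: (i == 0)%N => /=; last by rewrite coef0 Aint0.
rewrite coef_Poly.
by have [/(nth_default 0)-> | /(mem_nth 0)/Ays //] := leqP (size ys) j; rewrite Aint0.
Qed.

End Orbits.

(** [is_epi] without surjectivity: the twists and the quotient [u] are homomorphisms that may fail
    to be onto. *)
Definition is_hom (gT : finGroupType) (phi : galQ -> gT) : Prop :=
  (forall s t r : galQ, (forall x, r x = s (t x)) -> phi r = (phi s * phi t)%g) /\
  (exists S : seq algC, forall s t : galQ,
          (forall x, x \in S -> s x = t x) -> phi s = phi t).

(** The integers of the fixed field of the kernel, made a boolean predicate so that the [rpred]
    closure lemmas apply. *)
Definition ring_of_integers (gT : finGroupType) (phi : galQ -> gT) : {pred algC} :=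
  fun x => (x \in Aint) && `[< in_fixed_field phi x >].

Lemma ring_of_integersP (gT : finGroupType) (phi : galQ -> gT) x :
  x \in ring_of_integers phi <-> x \in Aint /\ in_fixed_field phi x.
Proof. by split=> [/andP[? /asboolP]|[? ?]]; last by apply/andP; split => //; apply/asboolP. Qed.

Lemma ring_of_integers_subring (gT : finGroupType) (phi : galQ -> gT) :
  subring_closed (ring_of_integers phi).
Proof.
split=> [|x y /ring_of_integersP[Ax Kx] /ring_of_integersP[Ay Ky]|
          x y /ring_of_integersP[Ax Kx] /ring_of_integersP[Ay Ky]];
  apply/ring_of_integersP; split; rewrite ?rpred1 ?rpredB ?rpredM // => s s1.
- by rewrite rmorph1.
- by rewrite rmorphB /= Kx ?Ky.
- by rewrite rmorphM /= Kx ?Ky.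
Qed.
HB.instance Definition _ (gT : finGroupType) (phi : galQ -> gT) :=
  GRing.isSubringClosed.Build _ (ring_of_integers phi) (ring_of_integers_subring phi).

Section Homs.

Variables (gT : finGroupType) (phi : galQ -> gT).
Hypothesis hphi : is_hom phi.
Local Notation OK := (ring_of_integers phi).

Lemma hom_comp s t : phi (galQ_comp s t) = (phi s * phi t)%g.
Proof. by apply: (hphi.1). Qed.

Lemma hom_id : phi galQ_id = 1%g.
Proof. by apply: (mulgI (phi galQ_id)); rewrite mulg1 -hom_comp; congr phi; apply: galQ_ext. Qed.

Lemma hom_inv s : phi (galQ_inv s) = (phi s)^-1%g.
Proof.
apply: (mulgI (phi s)); rewrite mulgV -hom_comp -hom_id; congr phi.
by apply: galQ_ext => x; rewrite /= galQ_Kinv.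
Qed.

Lemma hom_exp s n : phi (galQ_exp s n) = (phi s ^+ n)%g.
Proof. by elim: n => [|n IH]; rewrite ?hom_id // expgS -IH -hom_comp. Qed.

Lemma fixed_field_eq (s t : galQ) x : in_fixed_field phi x -> phi s = phi t -> s x = t x.
Proof.
move=> Kx e; rewrite -[s x](galQ_Kinv t); congr (t _).
apply: (Kx (galQ_comp (galQ_inv t) s)).
by rewrite hom_comp hom_inv e mulVg.
Qed.

Lemma fixed_field_gal (s : galQ) x : in_fixed_field phi x -> in_fixed_field phi (s x).
Proof.
move=> Kx t t1.
apply: (fixed_field_eq (s := galQ_comp t s)) => //.
by rewrite hom_comp t1 mul1g.
Qed.

Lemma ring_of_integers_gal (s : galQ) x : x \in OK -> s x \in OK.
Proof.
case/ring_of_integersP => Ax Kx; apply/ring_of_integersP; split.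
  by rewrite galQ_Aint.
exact: fixed_field_gal.
Qed.

(** Scaling the test elements by positive integers does not change when two automorphisms agree on
    them. Integral ones can be reduced modulo a prime. *)
Lemma continuity_Aint : exists S : seq algC, {subset S <= Aint} /\
  forall s t : galQ, (forall x, x \in S -> s x = t x) -> phi s = phi t.
Proof.
have [_ [S HS]] := hphi.
suff [S' [AS' S'S]] : exists S' : seq algC, {subset S' <= Aint} /\
    forall s t : galQ, (forall x, x \in S' -> s x = t x) -> forall x, x \in S -> s x = t x.
  by exists S'; split=> // s t /S'S; apply: HS.
elim: S {HS} => [|x S [S' [AS' S'S]]]; first by exists [::].
have [m m0 Am] := Aint_multiple x.
exists (m%:R * x :: S'); split.
  by move=> y; rewrite inE => /predU1P[-> //|/AS'].
move=> s t st y; rewrite inE => /predU1P[->|yS].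
  have := st (m%:R * x) (mem_head _ _); rewrite !rmorphM !rmorph_nat.
  by apply: mulfI; rewrite pnatr_eq0 -lt0n.
by apply: S'S yS => z zS'; apply: st; rewrite inE zS' orbT.
Qed.

(** If [s] fixed all integers of the fixed field, it would fix the orbit polynomial of [S] under the
    kernel and send its root [S] to another root [h S] with [phi h = 1]. Then [s] and [h] agree on
    [S], so [phi s = 1]. *)
Lemma hom_separation (s : galQ) : phi s != 1%g -> exists2 x, x \in OK & s x != x.
Proof.
have [S [AS HS]] := continuity_Aint.
have [Orb [uO HO]] := orbit_under (fun h => phi h = 1%g) S.
move=> ns1; apply: contrapT => nex.
have sK x : x \in OK -> s x = x.
  by move=> Kx; apply/eqP; apply: contrapT => /negP nx; apply: nex; exists x.
have OKc i j : (orbit_poly Orb)`_i`_j \in OK.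
  apply/ring_of_integersP; split.
    apply: orbit_poly_Aint => ys /HO[h [_ ->]] _ /mapP[x xS ->].
    by rewrite galQ_Aint AS.
  move=> t t1; have e : map_poly (map_poly t) (orbit_poly Orb) = orbit_poly Orb.
    apply: orbit_poly_fixed => // ys /HO[h [h1 ->]]; apply/HO; exists (galQ_comp t h).
    by rewrite hom_comp t1 h1 mulg1 -map_comp.
  by rewrite -[in RHS]e coef_map /= coef_map.
have fx : map_poly (map_poly s) (orbit_poly Orb) = orbit_poly Orb.
  by apply/polyP => i; rewrite coef_map; apply/polyP => j; rewrite /= coef_map /= sK.
have : (orbit_poly Orb).[Poly S] = 0.
  apply/eqP; rewrite horner_orbit_poly prodf_seq_eq0; apply/hasP.
  exists S; last by rewrite subrr eqxx.
  apply/HO; exists galQ_id; rewrite hom_id; split=> //.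
  by rewrite (eq_map (g := id)) ?map_id.
move/(congr1 (map_poly s)); rewrite rmorph0 -horner_map /= fx map_poly_Poly horner_orbit_poly.
move/eqP; rewrite prodf_seq_eq0 => /hasP[ys /HO[h [h1 ->]] /=].
rewrite subr_eq0 => /eqP/Poly_inj_size; rewrite !size_map => /(_ erefl) e.
case/negP: ns1; rewrite -h1; apply/eqP; apply: HS => x xS.
by move/eq_in_map : e; apply.
Qed.

End Homs.

Lemma fixed_field_ring_aut (gT : finGroupType) (phi : galQ -> gT) (p : {poly int}) x :
  in_fixed_field phi x -> in_fixed_field phi (map_poly intr p).[x].
Proof.
move=> Kx s s1; rewrite -horner_map /= Kx // -map_poly_comp.
by congr (_.[_]); apply: eq_map_poly => z /=; rewrite rmorph_int.
Qed.

(** * Primes above [q] in the ring of all algebraic integers *)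

Section Primes.

Variables (q : nat) (P : algC -> Prop).
Hypothesis (prq : prime q) (hP : qbar_prime_above q P).

Lemma primeA_Aint x : P x -> x \in Aint. Proof. by have [[[h _ _ _ _] _] _] := hP; apply: h. Qed.
Lemma primeA0 : P 0. Proof. by have [[[_ h _ _ _] _] _] := hP. Qed.
Lemma primeAD x y : P x -> P y -> P (x + y).
Proof. by have [[[_ _ h _ _] _] _] := hP; apply: h. Qed.
Lemma primeAMl a x : a \in Aint -> P x -> P (a * x).
Proof. by have [[[_ _ _ h _] _] _] := hP; apply: h. Qed.
Lemma primeAMr a x : a \in Aint -> P x -> P (x * a).
Proof. by rewrite mulrC; apply: primeAMl. Qed.
Lemma primeA1 : ~ P 1. Proof. by have [[[_ _ _ _ h] _] _] := hP. Qed.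
Lemma primeAM a b : a \in Aint -> b \in Aint -> P (a * b) -> P a \/ P b.
Proof. by have [[_ h] _] := hP; apply: h. Qed.
Lemma primeAq : P q%:R. Proof. by have [_ h] := hP. Qed.
Lemma primeAN x : P x -> P (- x).
Proof. by move=> Px; rewrite -mulN1r; apply: primeAMl Px; rewrite rpredN Aint1. Qed.
Lemma primeAB x y : P x -> P y -> P (x - y).
Proof. by move=> Px Py; apply: primeAD => //; apply: primeAN. Qed.
Lemma primeADr x y : P x -> P (x + y) -> P y.
Proof. by move=> Px /primeAB/(_ Px); rewrite addrC addKr. Qed.
Lemma primeABC x y : P (x - y) -> P (y - x).
Proof. by move=> /primeAN; rewrite opprB. Qed.
Lemma primeAtrans y x z : P (x - y) -> P (y - z) -> P (x - z).
Proof. by move=> xy yz; rewrite -(subrK y x) -addrA; apply: primeAD. Qed.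
Lemma primeA_sum (I : Type) (r : seq I) (Q : pred I) (F : I -> algC) :
  (forall i, Q i -> P (F i)) -> P (\sum_(i <- r | Q i) F i).
Proof. by move=> PF; apply: big_ind => //; [exact: primeA0 | exact: primeAD]. Qed.
Lemma primeAX a n : a \in Aint -> P (a ^+ n) -> P a.
Proof.
move=> Aa; elim: n => [|n IH]; first by rewrite expr0 => /primeA1.
by rewrite exprS => /(primeAM Aa)[||//]; rewrite ?rpredX.
Qed.
Lemma primeAnX a n : a \in Aint -> ~ P a -> ~ P (a ^+ n).
Proof. by move=> Aa nPa /(primeAX Aa). Qed.
Lemma primeA_prod (I : eqType) (r : seq I) (Q : pred I) (F : I -> algC) :
  (forall i, i \in r -> Q i -> F i \in Aint) -> P (\prod_(i <- r | Q i) F i) ->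
  exists2 i, i \in r & Q i /\ P (F i).
Proof.
elim: r => [|i r IH] AF; first by rewrite big_nil => /primeA1.
have AFr j : j \in r -> Q j -> F j \in Aint by move=> jr; apply: AF; rewrite inE jr orbT.
rewrite big_cons; case: ifP => Qi; last first.
  by move=> /(IH AFr)[j jr Pj]; exists j => //; rewrite inE jr orbT.
move=> /(primeAM (AF i (mem_head _ _) Qi))[|Pi|/(IH AFr)[j jr Pj]].
- by rewrite big_seq_cond; apply: rpred_prod => j /andP[]; apply: AFr.
- by exists i => //; rewrite mem_head.
by exists j => //; rewrite inE jr orbT.
Qed.

Lemma primeA_int (z : int) : P z%:~R <-> (q %| z)%Z.
Proof.
split=> [Pz|/dvdzP[k ->]]; last first.
  by rewrite rmorphM; apply: primeAMl; [exact: Aint_int | exact: primeAq].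
apply: contrapT => /negP nqz; apply: primeA1.
have /coprimezP[[u v] /= e] : coprimez q z by rewrite coprimezE /= prime_coprime.
have -> : 1 = u%:~R * q%:R + v%:~R * z%:~R :> algC.
  by rewrite -[q%:R]/((q : int)%:~R) -!rmorphM -rmorphD /= e.
by apply: primeAD; apply: primeAMl => //; [exact: Aint_int | exact: primeAq | exact: Aint_int].
Qed.

(** The powers of [y] have integer coordinates on finitely many integral generators, so two of them
    agree modulo [q] by the pigeonhole principle. The smaller power cancels because [P] is prime. *)
Lemma primeA_power_unit y : y \in Aint -> ~ P y ->
  exists2 k : nat, (0 < k)%N & P (y ^+ k - 1).
Proof.
move=> Ay nPy.
have [|S [ringS sS [[n Y] /= YS genS]]] := @Aint_subring_exists [:: y].
  by move=> z; rewrite inE => /eqP ->.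
have SA := fin_Csubring_Aint (ringS : mulr_closed S) genS.
have Sy : y \in S by apply: sS; rewrite mem_head.
have [S1 SB SM] := ringS.
have SX i : y ^+ i \in S by elim: i => // i IH; rewrite exprS SM.
have q0 : (0 < q)%N by rewrite prime_gt0.
have q0z : (q : int) != 0 by rewrite eqz_nat -lt0n.
pose c i : int ^ n := sval (cid (elimT (genS _) (SX i))).
have Dc i : y ^+ i = \sum_(k < n) Y`_k *~ c i k by rewrite /c; case: cid.
pose r i : {ffun 'I_n -> 'I_q.-1.+1} := [ffun k => inord `|(c i k %% q)%Z|%N].
have [i [j [ltij eqij]]] : exists i j, (i < j)%N /\ r i = r j.
  apply: contrapT => nex.
  pose N := #|{: {ffun 'I_n -> 'I_q.-1.+1}}|.
  have inj : injective (fun k : 'I_N.+1 => r k).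
    move=> a b e; apply: val_inj => /=; case: (ltngtP a b) => // lt; case: nex.
      by exists a, b.
    by exists b, a.
  have := leq_card _ inj; by rewrite card_ord ltnn.
have ckq k : (c j k = c i k %[mod q])%Z.
  have := congr1 (fun f : {ffun _ -> _} => val (f k)) eqij.
  rewrite /= !ffunE !inordK; last first.
  - by rewrite prednK // -ltz_nat gez0_abs ?modz_ge0 // ltz_pmod.
  - by rewrite prednK // -ltz_nat gez0_abs ?modz_ge0 // ltz_pmod.
  by move/(congr1 Posz); rewrite !gez0_abs ?modz_ge0.
exists (j - i)%N; first by rewrite subn_gt0.
have PX : P (y ^+ i * (y ^+ (j - i) - 1)).
  rewrite mulrBr mulr1 -exprD subnKC ?(ltnW ltij) // !Dc -sumrB.
  apply: primeA_sum => k _; rewrite -mulrzBr.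
  rewrite -mulrzr; apply: primeAMl; first by apply: SA; apply: YS; apply: mem_nth; rewrite size_tuple.
  by apply/primeA_int; rewrite -eqz_mod_dvd; apply/eqP.
have [||//|] := primeAM _ _ PX; rewrite ?rpredB ?rpredX ?rpred1 //.
by move=> /(primeAX Ay).
Qed.

(** The fixed field has a valuation ring at [P]. Let [B j] be the Horner tails at [x] of a primitive
    integer polynomial [g] with root [x]. All [B j] and [B j * x] are integral. They cannot all lie
    in [P], for then every coefficient [B j - B (j+1) * x] of [g] would be divisible by [q]. *)
Lemma valuation_dichotomy (gT : finGroupType) (phi : galQ -> gT) x :
  in_fixed_field phi x -> exists a b, [/\ a \in ring_of_integers phi,
    b \in ring_of_integers phi, ~ P a \/ ~ P b & b * x = a].
Proof.
move=> Kx.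
have [p [Dp mp] _] := minCpolyP x.
have [f [a nza Df]] := rat_poly_scale p.
have nzp : p != 0 by rewrite monic_neq0.
have nzf : f != 0.
  by apply: contraNneq nzp => f0; rewrite Df f0 map_poly0 scaler0.
pose g := zprimitive f.
pose gC : {poly algC} := map_poly intr g.
have rg : root gC x.
  have : root (map_poly (ratr : rat -> algC) p) x by rewrite -Dp root_minCpoly.
  rewrite Df map_polyZ rootZ ?fmorph_eq0 ?invr_eq0 ?intr_eq0 //.
  rewrite -map_poly_comp (eq_map_poly (g := intr)); last by move=> z /=; rewrite ratr_int.
  rewrite [f in map_poly _ f]zpolyEprim map_polyZ rootZ //.
  by rewrite intr_eq0 zcontents_eq0.
pose B j := (drop_poly j gC).[x].
have AgC : gC \is a polyOver Aint by apply/polyOverP => i; rewrite coef_map Aint_int.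
have BS j : B j = gC`_j + B j.+1 * x.
  rewrite /B.
  have -> : drop_poly j gC = (gC`_j)%:P + drop_poly j.+1 gC * 'X.
    apply/polyP => i; rewrite coefD coefC coefMX !coef_drop_poly.
    by case: i => [|i] /=; rewrite ?addr0 ?add0r // addSnnS.
  by rewrite !hornerE.
(* [B (j+1)] is the leading coefficient of [h], the low part of [g] plus [B (j+1) X^(j+1)], which
   also has the root [x]. *)
have ABx j : B j \in Aint -> B j * x \in Aint.
  case: j => [|j] ABj; first by rewrite /B drop_poly0l (rootP rg) mul0r Aint0.
  pose h := take_poly j.+1 gC + (B j.+1)%:P * 'X^(j.+1).
  have [B0|nB0] := eqVneq (B j.+1) 0; first by rewrite B0 mul0r Aint0.
  have lh : lead_coef h = B j.+1.
    rewrite /h addrC lead_coefDl; last first.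
      by rewrite size_Cmul // size_polyXn ltnS size_take_poly.
    by rewrite lead_coef_Mmonic ?monicXn // lead_coefC.
  rewrite -lh; apply: Aint_lead_coefM.
    rewrite rpredD ?rpredM ?polyOverC ?rpredX ?polyOverX //.
    apply/polyOverP => i; rewrite coef_take_poly; case: ifP => _; last exact: Aint0.
    by apply: (polyOverP AgC).
  rewrite /root /h !hornerE -[B j.+1]/((drop_poly j.+1 gC).[x]).
  rewrite -(hornerXn x j.+1) -hornerM -hornerD poly_take_drop; exact: rg.
have AB : forall j, B j \in Aint.
  have large j : (size gC <= j)%N -> B j \in Aint.
    by move=> sj; rewrite /B drop_poly_eq0 // horner0 Aint0.
  have down k : B (size gC - k)%N \in Aint.
    elim: k => [|k IH]; first by rewrite subn0; apply: large.
    have [lt|ge] := ltnP k (size gC); last first.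
      have e1 : (size gC - k = 0)%N by apply/eqP; rewrite subn_eq0.
      have -> : (size gC - k.+1 = 0)%N by apply/eqP; rewrite subn_eq0 leqW.
      by rewrite e1 in IH.
    have e : (size gC - k = (size gC - k.+1).+1)%N by rewrite subnSK.
    by rewrite BS -e rpredD ?(polyOverP AgC) // ABx.
  move=> j; have [le|/ltnW/large//] := leqP j (size gC).
  by rewrite -(subKn le).
have KB j : in_fixed_field phi (B j).
  have -> : B j = (map_poly intr (drop_poly j g)).[x].
    rewrite /B; congr (_.[_]); apply/polyP => i.
    by rewrite coef_map !coef_drop_poly coef_map.
  exact: fixed_field_ring_aut.
have OB j : B j \in ring_of_integers phi by apply/ring_of_integersP.
have OBx j : B j * x \in ring_of_integers phi.
  apply/ring_of_integersP; split; first exact: ABx.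
  by move=> s s1; rewrite rmorphM /= KB ?Kx.
apply: contrapT => nex.
have PB j : P (B j) /\ P (B j * x).
  apply: contrapT => nPB; apply: nex; exists (B j * x), (B j); split => //.
  have [PBj|nPBj] := pselect (P (B j)); last by right.
  by left => PBx; apply: nPB.
have Pg j : (q %| g`_j)%Z.
  apply/primeA_int; have -> : (g`_j)%:~R = B j - B j.+1 * x.
    by rewrite BS coef_map addrK.
  by apply: primeAB; have [? ?] := PB j; have [? ?] := PB j.+1.
have : (q %| zcontents g)%Z by rewrite dvdz_contents; apply/polyOverP => i; apply: Pg.
rewrite zcontents_primitive nzf /= dvdz1 /= => /eqP q1.
by move: prq; rewrite -[q]/(`|q|%N) q1.
Qed.

End Primes.

(** Representatives turn traces and norms into sums and products over the finite image of [phi].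
    Outside the image the value defaults to the identity. *)
Definition gal_rep (gT : finGroupType) (phi : galQ -> gT) (a : gT) : galQ :=
  if pselect (exists s, phi s = a) is left e then sval (cid e) else galQ_id.

Definition gal_image (gT : finGroupType) (phi : galQ -> gT) : pred gT :=
  fun a => `[< exists s, phi s = a >].

Lemma gal_repK (gT : finGroupType) (phi : galQ -> gT) a :
  gal_image phi a -> phi (gal_rep phi a) = a.
Proof. by move=> /asboolP e; rewrite /gal_rep; case: pselect => // e'; case: cid. Qed.

Lemma gal_image_phi (gT : finGroupType) (phi : galQ -> gT) s : gal_image phi (phi s).
Proof. by apply/asboolP; exists s. Qed.

Lemma integer_of_fixed (x : algC) : x \in Aint -> (forall s : galQ, s x = x) ->
  exists z : int, x = z%:~R.
Proof. by move=> Ax /rational_of_fixed Qx; apply/intrP; apply: Cint_rat_Aint. Qed.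

Section PrimePoly.

Variables (q : nat) (P : algC -> Prop).
Hypothesis (prq : prime q) (hP : qbar_prime_above q P).

(** Gauss's lemma: the lowest coefficients of [f] and [g] outside [P] produce a coefficient of the
    product with exactly one term outside [P]. *)
Lemma prime_polyM (f g : {poly algC}) :
  f \is a polyOver Aint -> g \is a polyOver Aint ->
  (forall i, P (f * g)`_i) -> (forall i, P f`_i) \/ (forall i, P g`_i).
Proof.
move=> Af Ag Pfg; apply: contrapT => /not_orP[nf ng].
have ef : exists i, ~~ `[< P f`_i >].
  by apply: contrapT => h; apply: nf => i; apply: contrapT => ni; apply: h; exists i; apply/asboolPn.
have eg : exists i, ~~ `[< P g`_i >].
  by apply: contrapT => h; apply: ng => i; apply: contrapT => ni; apply: h; exists i; apply/asboolPn.
case: (ex_minnP ef) => i /asboolPn nfi mi.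
case: (ex_minnP eg) => j /asboolPn ngj mj.
have lti k : (k < i)%N -> P f`_k.
  by move=> ki; apply: contrapT => nk; have := mi k; rewrite leqNgt ki => /(_ _)/notF; apply; apply/asboolPn.
have ltj k : (k < j)%N -> P g`_k.
  by move=> kj; apply: contrapT => nk; have := mj k; rewrite leqNgt kj => /(_ _)/notF; apply; apply/asboolPn.
have : P (f`_i * g`_j).
  have := Pfg (i + j)%N; rewrite coefM.
  have li : (i < (i + j).+1)%N by rewrite ltnS leq_addr.
  rewrite (bigD1 (Ordinal li)) //= addKn => Ps.
  rewrite addrC in Ps; apply: (primeADr hP) Ps; apply: (primeA_sum hP) => k nk.
  have [ki|ik] := ltnP k i.
    by apply: (primeAMr hP); [exact: (polyOverP Ag) | exact: lti].
  apply: (primeAMl hP); [exact: (polyOverP Af) | apply: ltj].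
  rewrite ltn_subLR; last by rewrite -ltnS.
  by rewrite ltn_add2r ltn_neqAle ik andbT; apply: contraNneq nk => e; apply/eqP/val_inj.
by move=> /(primeAM hP)[||//|//]; rewrite ?(polyOverP Af) ?(polyOverP Ag).
Qed.

Lemma prime_poly_prod (I : eqType) (r : seq I) (F : I -> {poly algC}) :
  (forall i, i \in r -> F i \is a polyOver Aint) ->
  (forall i, P (\prod_(i <- r) F i)`_i) -> exists2 i, i \in r & forall j, P (F i)`_j.
Proof.
elim: r => [|i r IH] AF; first by rewrite big_nil => /(_ 0%N); rewrite coef1 => /(primeA1 hP).
rewrite big_cons => /prime_polyM[||h|/IH[]]; first by rewrite AF ?mem_head.
- by rewrite big_seq rpred_prod // => j jr; rewrite AF // inE jr orbT.
- by exists i; rewrite ?mem_head.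
- by move=> j jr; rewrite AF // inE jr orbT.
by move=> j jr Pj; exists j; rewrite // inE jr orbT.
Qed.

End PrimePoly.

(* Sequential compactness of the Galois group. *)
Lemma galQ_cluster (h : nat -> galQ) : exists g : galQ,
  forall (xs : seq algC) (N : nat), exists2 n, (N <= n)%N & forall x, x \in xs -> g x = h n x.
Proof.
have [U [UU sU]] := ultraFilterLemma (eventually_filter : ProperFilter eventually).
have ufin (x : algC) : exists y, U [set n | h n x = y]%classic.
  have [C HC] := orbit_list [:: x].
  apply: contrapT => nex.
  have : forall L : seq (seq algC), U [set n | map (h n) [:: x] \notin L]%classic.
    elim=> [|ys L IH]; first by apply: filterS filterT => n _.
    have [U1|U1] := in_ultra_setVsetC [set n | map (h n) [:: x] = ys]%classic UU.
      case: nex; exists (head 0 ys); apply: filterS U1 => n /= <- //.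
    by apply: filterS (filterI IH U1) => n /= [nL neq]; rewrite inE negb_or nL andbT; apply/eqP.
  by move=> /(_ C)/filter_ex[n /=]; rewrite HC.
pose g x := sval (cid (ufin x)).
have Ug x : U [set n | h n x = g x]%classic by rewrite /g; case: cid.
have cl (xs : seq algC) N : exists2 n, (N <= n)%N & forall x, x \in xs -> g x = h n x.
  have : U [set n | forall x, x \in xs -> g x = h n x]%classic.
    elim: xs => [|x xs IH]; first by apply: filterS filterT.
    apply: filterS (filterI (Ug x) IH) => n /= [e ih] y; rewrite inE => /predU1P[->//|]; exact: ih.
  have UN : U [set n | (N <= n)%N]%classic by apply: sU; exists N.
  by move=> /(filterI UN)/filter_ex[n /= [? ?]]; exists n.
have gz : zmod_morphism g.
  move=> x y; have [n _ H] := cl [:: x; y; x - y] 0%N.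
  by rewrite !H ?inE ?eqxx ?orbT // rmorphB.
have gm : monoid_morphism g.
  split; first by have [n _ H] := cl [:: 1] 0%N; rewrite H ?inE // rmorph1.
  move=> x y; have [n _ H] := cl [:: x; y; x * y] 0%N.
  by rewrite !H ?inE ?eqxx ?orbT // rmorphM.
pose gzM := GRing.isZmodMorphism.Build _ _ g gz.
pose gmM := GRing.isMonoidMorphism.Build _ _ g gm.
pose gR : {rmorphism algC -> algC} := HB.pack g gzM gmM.
by exists (galQ_of_rmorph gR).
Qed.

(** * Lifting inertia from a finite level, and conjugacy of primes *)

Section Lifting.

Variables (gT : finGroupType) (phi : galQ -> gT).
Hypothesis hphi : is_hom phi.
Variables (q : nat) (P : algC -> Prop).
Hypothesis (prq : prime q) (hP : qbar_prime_above q P).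
Local Notation OK := (ring_of_integers phi).

Lemma orbit_poly_ker_coef (S : seq algC) (Orb : seq (seq algC)) :
  {subset S <= Aint} -> uniq Orb ->
  (forall ys : seq algC, ys \in Orb <-> exists h, phi h = 1%g /\ ys = map h S) ->
  forall i j, (orbit_poly Orb)`_i`_j \in OK.
Proof.
move=> AS uO HO i j; apply/ring_of_integersP; split.
  apply: orbit_poly_Aint => ys /HO[h [_ ->]] _ /mapP[x xS ->].
  by rewrite galQ_Aint AS.
move=> t t1; have e : map_poly (map_poly t) (orbit_poly Orb) = orbit_poly Orb.
  apply: orbit_poly_fixed => // ys /HO[h [h1 ->]]; apply/HO; exists (galQ_comp t h).
  by rewrite hom_comp // t1 h1 mulg1 -map_comp.
by rewrite -[in RHS]e coef_map /= coef_map.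
Qed.

Lemma polyOver_Poly (xs : seq algC) : {subset xs <= Aint} -> Poly xs \is a polyOver Aint.
Proof.
move=> Axs; apply/polyOverP => i; rewrite coef_Poly.
by have [/(nth_default 0)-> | /(mem_nth 0)/Axs //] := leqP (size xs) i; rewrite Aint0.
Qed.

Lemma map_gal_Aint (s : galQ) xs : {subset xs <= Aint} -> {subset map s xs <= Aint}.
Proof. by move=> Axs _ /mapP[x /Axs Ax ->]; rewrite galQ_Aint. Qed.

(** The orbit polynomial [f] of [xs] under the kernel has coefficients in [OK], so its image under
    [h] is congruent to [f] and vanishes modulo [P] at [xs]. One factor lies in [P] entry by entry;
    it is [xs - h g xs] with [phi g = 1], and [h g] is the lift. *)
Lemma inertia_lift_finite (h : galQ) (xs : seq algC) :
  (forall x, x \in OK -> P (h x - x)) -> {subset xs <= Aint} ->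
  exists2 h' : galQ, phi h' = phi h & forall x, x \in xs -> P (h' x - x).
Proof.
move=> hI Axs.
have [Orb [uO HO]] := orbit_under (fun g => phi g = 1%g) xs.
have OKc := orbit_poly_ker_coef Axs uO HO.
set f := orbit_poly Orb in OKc.
have f0 : f.[Poly xs] = 0.
  apply/eqP; rewrite horner_orbit_poly prodf_seq_eq0; apply/hasP.
  exists xs; last by rewrite subrr eqxx.
  apply/HO; exists galQ_id; rewrite hom_id //; split=> //.
  by rewrite (eq_map (g := id)) ?map_id.
have PD i j : P (map_poly (map_poly h) f - f)`_i`_j.
  by rewrite coefB coefB coef_map /= coef_map; apply: hI.
have : forall j, P ((map_poly (map_poly h) f).[Poly xs])`_j.
  move=> j; rewrite -[map_poly _ f](subrK f) hornerD f0 addr0 horner_coef coef_sum.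
  apply: (primeA_sum hP) => i _; rewrite coefM; apply: (primeA_sum hP) => k _.
  apply: (primeAMr hP); last exact: PD.
  by apply/(polyOverP (rpredX _ (polyOver_Poly Axs))).
rewrite map_orbit_poly horner_orbit_poly.
case/(prime_poly_prod hP) => [_ /mapP[ys /HO[g [g1 ->]] ->]|_ /mapP[ys /HO[g [g1 ->]] ->] Pj].
  by rewrite rpredB ?polyOver_Poly //; do 2!apply: map_gal_Aint.
exists (galQ_comp h g); first by rewrite hom_comp // g1 mulg1.
move=> x xS; have lx : (index x xs < size xs)%N by rewrite index_mem.
have := Pj (index x xs); rewrite coefB !coef_Poly !(nth_map 0) ?size_map // nth_index //.
exact: (primeABC hP).
Qed.

(** [algC] is countable, so finite lifts can be taken along an enumeration of the integers. A
    cluster point serves all integers at once, and continuity preserves its value under [phi]. *)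
Lemma inertia_lift (h : galQ) : (forall x, x \in OK -> P (h x - x)) ->
  exists2 h' : galQ, inertia P h' & phi h' = phi h.
Proof.
move=> hI.
pose xs n := [seq x <- pmap (unpickle : nat -> option algC) (iota 0 n) | x \in Aint].
have Axs n : {subset xs n <= Aint} by move=> x; rewrite mem_filter => /andP[].
pose hh n := s2val (cid2 (inertia_lift_finite hI (Axs n))).
have hh1 n : phi (hh n) = phi h by rewrite /hh; case: cid2.
have hh2 n x : x \in xs n -> P (hh n x - x) by rewrite /hh; case: cid2 => /= ? _; apply.
have [g Hg] := galQ_cluster hh.
have gP x : x \in Aint -> P (g x - x).
  move=> Ax; have [n len gx] := Hg [:: x] (pickle x).+1.
  rewrite gx ?mem_head //; apply: hh2; rewrite mem_filter Ax /=.
  by rewrite mem_pmap; apply/mapP; exists (pickle x); rewrite ?mem_iota ?add0n //= pickleK.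
exists g; last first.
  have [_ [S HS]] := hphi; have [n _ gx] := Hg S 0%N.
  by rewrite -(hh1 n); apply: HS => x /gx.
split=> // x; split=> Px.
  have Ax : x \in Aint by rewrite -(galQ_Aint g) (primeA_Aint hP).
  by apply: (primeADr hP (gP x Ax)) ; rewrite subrK.
by rewrite -(subrK x (g x)); apply: (primeAD hP) => //; apply: gP; apply: (primeA_Aint hP).
Qed.

(** Otherwise each class [a] has an integer [x_a] in [P'] whose image under a representative of [a]
    is outside [P]. The polynomial with coefficients [x_a] has a norm with integer coefficients in
    [P'], hence divisible by [q], hence in [P]. So all entries of one conjugate [s xs] lie in [P],
    against the entry indexed by [phi s]. *)
Lemma primes_conjugate (P' : algC -> Prop) : qbar_prime_above q P' ->
  exists s : galQ, forall x, x \in OK -> P' x -> P (s x).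
Proof.
move=> hP'; apply: contrapT => nex.
have ex (s : galQ) : exists x, [/\ x \in OK, P' x & ~ P (s x)].
  apply: contrapT => nx; apply: nex; exists s => x Kx P'x; apply: contrapT => nPx.
  by apply: nx; exists x.
pose xf a := sval (cid (ex (gal_rep phi a))).
have xfP a : [/\ xf a \in OK, P' (xf a) & ~ P (gal_rep phi a (xf a))] by rewrite /xf; case: cid.
pose xs := [seq xf a | a : gT].
have xsP x : x \in xs -> x \in OK /\ P' x by move=> /mapP[a _ ->]; have [] := xfP a.
have Axs : {subset xs <= Aint} by move=> x /xsP[/ring_of_integersP[]].
have [Orb [uO HO]] := orbit_under (fun _ => True) xs.
have AO ys : ys \in Orb -> {subset ys <= Aint}.
  by move=> /HO[h [_ ->]]; apply: map_gal_Aint.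
pose f := (orbit_poly Orb).[0].
have f_prod : f = \prod_(ys <- Orb) (0 - Poly ys) by rewrite /f horner_orbit_poly.
have fint j : exists z : int, f`_j = z%:~R.
  apply: integer_of_fixed => [|s]; first by rewrite /f horner_coef0 orbit_poly_Aint.
  have e : map_poly (map_poly s) (orbit_poly Orb) = orbit_poly Orb.
    apply: orbit_poly_fixed => // ys /HO[h [h1 ->]]; apply/HO; exists (galQ_comp s h).
    by rewrite -map_comp.
  by rewrite /f !horner_coef0 -[in RHS]e coef_map /= coef_map.
have P'f j : P' f`_j.
  have xO : xs \in Orb.
    by apply/HO; exists galQ_id; split=> //; rewrite (eq_map (g := id)) ?map_id.
  rewrite f_prod (big_rem _ xO) /= coefM; apply: (primeA_sum hP') => i _.
  apply: (primeAMr hP').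
    apply: (polyOverP (_ : \prod_(y <- rem xs Orb) (0 - Poly y) \is a polyOver Aint)).
    rewrite big_seq rpred_prod // => ys /mem_rem/AO Ays.
    by rewrite sub0r rpredN polyOver_Poly.
  rewrite sub0r coefN; apply: (primeAN hP'); rewrite coef_Poly.
  have [/(nth_default 0)-> | /(mem_nth 0)/xsP[]//] := leqP (size xs) i.
  exact: (primeA0 hP').
have Pf j : P (\prod_(ys <- Orb) (0 - Poly ys))`_j.
  by have [z Dz] := fint j; have := P'f j; rewrite -f_prod Dz !(primeA_int prq).
case: (prime_poly_prod hP _ Pf) => [ys /AO Ays|_ /HO[s [_ ->]] Ps].
  by rewrite sub0r rpredN polyOver_Poly.
have [Kx P'x nPx] := xfP (phi s); case: nPx.
have xin : xf (phi s) \in xs by apply/mapP; exists (phi s); rewrite ?mem_enum.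
have lx : (index (xf (phi s)) xs < size xs)%N by rewrite index_mem.
have := Ps (index (xf (phi s)) xs).
rewrite sub0r coefN => /(primeAN hP); rewrite opprK coef_Poly (nth_map 0) // nth_index //.
rewrite (fixed_field_eq hphi (t := s)) ?gal_repK ?gal_image_phi //.
by have [] := (ring_of_integersP _ _).1 Kx.
Qed.

End Lifting.

(** * Ramification and inertia *)

Section Ramification.

Variables (gT : finGroupType) (phi : galQ -> gT).
Hypothesis hphi : is_hom phi.
Variables (q : nat) (P : algC -> Prop).
Hypothesis (prq : prime q) (hP : qbar_prime_above q P).
Local Notation OK := (ring_of_integers phi).
Local Notation g_ := (gal_rep phi).
Local Notation Im := (gal_image phi).

(** [ramified] ranges over all primes above [q]; here [P] is fixed, and [primes_conjugate] relates
    the two notions. *)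
Definition ramified_at : Prop := exists (n : nat) (a b : 'I_n -> algC),
  [/\ forall i, P (a i) /\ a i \in OK, forall i, P (b i) /\ b i \in OK
    & q%:R = \sum_(i < n) a i * b i].

Lemma ringK x : x \in OK -> in_fixed_field phi x.
Proof. by case/ring_of_integersP. Qed.
Lemma ringA x : x \in OK -> x \in Aint.
Proof. by case/ring_of_integersP. Qed.

Lemma gal_rep_phi (s : galQ) x : x \in OK -> g_ (phi s) x = s x.
Proof. by move=> Kx; apply: (fixed_field_eq hphi (ringK Kx)); rewrite gal_repK ?gal_image_phi. Qed.

Lemma galois_reindex (R : Type) (idx : R) (op : Monoid.com_law idx) (s : galQ)
    (F : algC -> R) x : x \in OK ->
  \big[op/idx]_(a | Im a) F (s (g_ a x)) = \big[op/idx]_(a | Im a) F (g_ a x).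
Proof.
move=> Kx; rewrite [RHS](reindex_inj (mulgI (phi s))) /=.
have Ims a : Im (phi s * a)%g = Im a.
  apply/idP/idP => /asboolP[t Dt]; apply/asboolP.
    exists (galQ_comp (galQ_inv s) t).
    by rewrite hom_comp // hom_inv // Dt mulKg.
  by exists (galQ_comp s t); rewrite hom_comp // Dt.
rewrite (eq_bigl _ _ Ims); apply: eq_bigr => a Ia.
congr F; apply: (fixed_field_eq hphi (s := galQ_comp s (g_ a)) (ringK Kx)).
by rewrite hom_comp // !gal_repK // Ims.
Qed.

Lemma galois_trace_int x : x \in OK -> exists z : int, \sum_(a | Im a) g_ a x = z%:~R.
Proof.
move=> Kx; apply: integer_of_fixed => [|s].
  by apply: rpred_sum => a _; rewrite galQ_Aint ringA.
by rewrite rmorph_sum /=; apply: (galois_reindex _ s id).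
Qed.

Lemma galois_norm_int x : x \in OK -> exists z : int, \prod_(a | Im a) g_ a x = z%:~R.
Proof.
move=> Kx; apply: integer_of_fixed => [|s].
  by apply: rpred_prod => a _; rewrite galQ_Aint ringA.
by rewrite rmorph_prod /=; apply: (galois_reindex _ s id).
Qed.

(** Expanding the product, as in a tensor square of the field, separates what [s] moves from what
    stays fixed, so that traces can be taken termwise. *)
Lemma galois_coordinates (cx : seq (algC * algC)) :
  (forall c, c \in cx -> c.1 \in OK /\ c.2 \in OK) ->
  exists uv : seq (algC * algC), (forall c, c \in uv -> c.1 \in OK /\ c.2 \in OK) /\
    forall s : galQ, \prod_(c <- cx) (c.1 - s c.2) = \sum_(c <- uv) c.1 * s c.2.
Proof.
elim: cx => [|[c x] cx IH] Kcx.
  exists [:: (1, 1)]; split=> [d|s]; first by rewrite inE => /eqP -> /=; rewrite rpred1.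
  by rewrite big_nil big_seq1 /= rmorph1 mulr1.
have [|uv [Kuv Duv]] := IH; first by move=> d dcx; apply: Kcx; rewrite inE dcx orbT.
have [/= Kc Kx] := Kcx (c, x) (mem_head _ _).
exists ([seq (c * d.1, d.2) | d <- uv] ++ [seq (- d.1, x * d.2) | d <- uv]); split.
  move=> d; rewrite mem_cat => /orP[] /mapP[e /Kuv[Ke1 Ke2] ->] /=.
    by rewrite rpredM.
  by rewrite rpredN rpredM.
move=> s; rewrite big_cons Duv big_cat !big_map /= mulrBl !mulr_sumr -sumrN.
congr (_ + _); apply: eq_bigr => d _; first by rewrite mulrA.
by rewrite rmorphM mulNr; congr (- _); rewrite mulrCA.
Qed.

(** For each automorphism that does not map [P] into itself, [e] has a factor outside [P] whose
    image lies in [P]. For the other automorphisms [s x] is already in [P]. *)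
Lemma all_conj_in_prime :
  exists2 e, e \in OK /\ ~ P e & forall x, x \in OK -> P x -> forall s : galQ, P (s (e * x)).
Proof.
pose B a := Im a && `[< exists y, [/\ y \in OK, P y & ~ P (g_ a y)] >].
have exy a : exists y, y \in OK /\ (B a -> ~ P y /\ P (g_ a y)).
  have [/andP[Ia /asboolP[y [Ky Py nPy]]]|nB] := boolP (B a); last first.
    by exists 1; rewrite rpred1.
  apply: contrapT => nex.
  (* Iterating this from [g_ a y] through the order of [a] leads back to [y], which lies in [P]; so
     [g_ a y] would lie in [P] too. *)
  have step z : z \in OK -> P (g_ a z) -> P z.
    move=> Kz Pz; apply: contrapT => nPz; apply: nex; exists z; split => //.
  have iterK n z : z \in OK -> iter n (g_ a) z \in OK.
    by move=> Kz; elim: n => //= n; apply: ring_of_integers_gal.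
  have steps n z : z \in OK -> P (iter n (g_ a) z) -> P z.
    by move=> Kz; elim: n => //= n IH /step/IH; apply; apply: iterK.
  apply: nPy; apply: (steps (#[a]%g.-1)).
    exact: ring_of_integers_gal.
  rewrite -iterSr prednK ?order_gt0 // -galQ_expE.
  rewrite (ringK Ky) //.
  by rewrite hom_exp // gal_repK // expg_order.
pose y a := sval (cid (exy a)).
have yP a : y a \in OK /\ (B a -> ~ P (y a) /\ P (g_ a (y a))) by rewrite /y; case: cid.
exists (\prod_(a | B a) y a); first split.
- by apply: rpred_prod => a _; have [] := yP a.
- case/(primeA_prod hP) => [a _ _|a _ [Ba Pya]]; first by apply: ringA; have [] := yP a.
  by have [_ /(_ Ba)[]] := yP a.
move=> x Kx Px s; rewrite rmorphM /=.
have Ke : \prod_(a | B a) y a \in OK by apply: rpred_prod => a _; have [] := yP a.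
have [Bs|nBs] := boolP (B (phi s)).
  apply: (primeAMr hP); first by rewrite galQ_Aint ringA.
  rewrite (bigD1 (phi s)) //= rmorphM; have [Ky /(_ Bs)[_]] := yP (phi s).
  rewrite gal_rep_phi // => Pys; apply: (primeAMr hP) => //.
  by rewrite galQ_Aint; apply: rpred_prod => a _; apply: ringA; have [] := yP a.
apply: (primeAMl hP); first by rewrite galQ_Aint ringA.
apply: contrapT => nPx; case/negP: nBs; rewrite /B gal_image_phi.
by apply/asboolP; exists x; rewrite gal_rep_phi.
Qed.

(* [d = prod_(c <> 1) (g_c x_c - x_c)] is prime to [P]; expanding this product with
   [g_c x_c] kept fixed and taking traces shows that [q] divides [z * d] as soon as
   all conjugates of [z] lie in [P].  Applied to [e a_i] and [e b_i] this makes
   [(e d)^2] divisible by [q]. *)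
Lemma unramified_of_trivial_inertia :
  (forall h : galQ, (forall x, x \in OK -> P (h x - x)) -> phi h = 1%g) -> ~ ramified_at.
Proof.
move=> triv [n [a [b [Ka Kb Dq]]]].
have exx c : exists x, x \in OK /\ (Im c -> c != 1%g -> ~ P (g_ c x - x)).
  have [[Ic nc1]|nn] := pselect (Im c /\ c != 1%g); last first.
    by exists 1; rewrite rpred1; split=> // Ic nc1; case: nn.
  apply: contrapT => nex; case/eqP: nc1; rewrite -(gal_repK Ic); apply: triv => x Kx.
  by apply: contrapT => nPx; apply: nex; exists x.
pose x_ c := sval (cid (exx c)).
have x_P c : x_ c \in OK /\ (Im c -> c != 1%g -> ~ P (g_ c (x_ c) - x_ c)) by rewrite /x_; case: cid.
pose cx := [seq (g_ c (x_ c), x_ c) | c <- enum [pred c | Im c && (c != 1%g)]].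
have Kcx c : c \in cx -> c.1 \in OK /\ c.2 \in OK.
  move=> /mapP[d _ ->] /=; have [Kx _] := x_P d; split=> //.
  exact: ring_of_integers_gal.
have [uv [Kuv Duv]] := galois_coordinates Kcx.
(* [D] vanishes at the representative of each nontrivial class, so the sum of [g_ c z * D (g_ c)]
   over the group reduces to [z * d]. *)
pose D (s : galQ) := \prod_(c <- cx) (c.1 - s c.2).
pose d := D galQ_id.
have Kd : d \in OK.
  by rewrite /d /D big_seq; apply: rpred_prod => c /Kcx[K1 K2]; rewrite rpredB.
have nPd : ~ P d.
  case/(primeA_prod hP) => [c /Kcx[K1 K2] _|c /mapP[e]].
    by rewrite rpredB ?galQ_Aint ?ringA.
  rewrite mem_enum inE => /andP[Ie ne1] -> [_ /=].
  by have [_ /(_ Ie ne1)] := x_P e.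
have key z : z \in OK -> (forall s : galQ, P (s z)) -> exists2 c, c \in OK & z * d = q%:R * c.
  move=> Kz Pz.
  have tr v : v \in OK -> exists t : int, \sum_(c | Im c) g_ c (v * z) = q%:R * t%:~R.
    move=> Kv; have [t Dt] := galois_trace_int (rpredM Kv Kz).
    have : P t%:~R.
      rewrite -Dt; apply: (primeA_sum hP) => c _; rewrite rmorphM.
      by apply: (primeAMl hP); [rewrite galQ_Aint ringA | exact: Pz].
    move/(primeA_int prq hP)/dvdzP => [k Dk]; exists k.
    by rewrite Dt Dk rmorphM mulrC.
  have exc : exists2 c, c \in OK & \sum_(w <- uv) w.1 * \sum_(c | Im c) g_ c (w.2 * z) = q%:R * c.
    elim: uv {Duv} Kuv => [|w uv IH] Kuv; first by exists 0; rewrite ?rpred0 // big_nil mulr0.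
    have [|c Kc Dc] := IH; first by move=> e euv; apply: Kuv; rewrite inE euv orbT.
    have [Kw1 Kw2] := Kuv w (mem_head _ _).
    have [t Dt] := tr _ Kw2.
    exists (w.1 * t%:~R + c); first by rewrite rpredD ?rpredM ?rpred_int.
    by rewrite big_cons Dt Dc mulrDr mulrCA.
  have [c Kc Dc] := exc; exists c => //; rewrite -Dc.
  transitivity (\sum_(c | Im c) g_ c z * D (g_ c)).
    have I1 : Im 1%g by rewrite -(hom_id hphi) gal_image_phi.
    rewrite (bigD1 1%g) //= [X in _ + X]big1 ?addr0.
      have e1 x : x \in OK -> g_ 1%g x = x by move=> Kx; apply: (ringK Kx); rewrite gal_repK.
      rewrite e1 // /D /d /D; congr (_ * _); apply: eq_big_seq => e /Kcx[_ K2] /=.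
      by rewrite e1.
    move=> e /andP[Ie ne1]; rewrite /D (big_rem (g_ e (x_ e), x_ e)) /=; last first.
      by apply/mapP; exists e; rewrite // mem_enum inE Ie.
    by rewrite subrr mul0r mulr0.
  transitivity (\sum_(c | Im c) \sum_(w <- uv) w.1 * g_ c (w.2 * z)).
    apply: eq_bigr => e _; rewrite /D Duv mulr_sumr; apply: eq_bigr => w _.
    by rewrite rmorphM mulrCA; congr (_ * _); rewrite mulrC.
  by rewrite exchange_big; apply: eq_bigr => w _; rewrite mulr_sumr.
have [e [Ke nPe] He] := all_conj_in_prime.
have keya i : exists2 c, c \in OK & e * a i * d = q%:R * c.
  have [Pa Kai] := Ka i; apply: key; first by rewrite rpredM.
  exact: He.
have keyb i : exists2 c, c \in OK & e * b i * d = q%:R * c.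
  have [Pb Kbi] := Kb i; apply: key; first by rewrite rpredM.
  exact: He.
pose ca i := s2val (cid2 (keya i)); pose cb i := s2val (cid2 (keyb i)).
have caP i : ca i \in OK /\ e * a i * d = q%:R * ca i by rewrite /ca; case: cid2.
have cbP i : cb i \in OK /\ e * b i * d = q%:R * cb i by rewrite /cb; case: cid2.
have q0 : q%:R != 0 :> algC by rewrite pnatr_eq0 -lt0n prime_gt0.
have : (e * d) ^+ 2 = q%:R * \sum_(i < n) ca i * cb i.
  apply: (mulfI q0); rewrite {1}Dq mulr_suml mulrA mulr_sumr; apply: eq_bigr => i _.
  by rewrite [RHS]mulrACA -(caP i).2 -(cbP i).2; ring.
move=> e2.
have Aed : e * d \in Aint by rewrite rpredM ?ringA.
have : P ((e * d) ^+ 2).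
  rewrite e2; apply: (primeAMr hP); last exact: primeAq.
  by apply: rpred_sum => i _; rewrite rpredM // ringA //; [have [] := caP i | have [] := cbP i].
move=> /(primeAX hP Aed)/(primeAM hP)[||//|//]; exact: ringA.
Qed.

Lemma primeA_subX u v n : u \in Aint -> v \in Aint -> P (u - v) -> P (u ^+ n - v ^+ n).
Proof.
move=> Au Av Puv; rewrite subrXX; apply: (primeAMr hP) => //.
by apply: rpred_sum => i _; rewrite rpredM ?rpredX.
Qed.

(** Apply the valuation dichotomy to [z / q]. In the unwanted case [b * z = q * a] with [b] in [P]
    and [a] outside. As some power [a^k] is 1 modulo [P], the identity
    [q = a^(k-1) * b * z - (a^k - 1) * q] writes [q] as a sum of products of two elements of [P]. *)
Lemma unramified_uniformizer : ~ ramified_at -> forall z, z \in OK -> P z ->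
  exists c d, [/\ c \in OK, d \in OK, ~ P d & d * z = q%:R * c].
Proof.
move=> nram z Kz Pz.
have q0 : q%:R != 0 :> algC by rewrite pnatr_eq0 -lt0n prime_gt0.
have [|a [b [Ka Kb Pab Dz]]] := @valuation_dichotomy q P prq hP gT phi (z / q%:R).
  by move=> s s1; rewrite fmorph_div rmorph_nat /= (ringK Kz).
have {}Dz : b * z = q%:R * a by rewrite -Dz; field.
have [Pb|nPb] := pselect (P b); last by exists a, b.
have nPa : ~ P a by case: Pab => // /(_ Pb).
have [k k0 Pk] := primeA_power_unit prq hP (ringA Ka) nPa.
case: nram.
pose u i : algC := if i == 0%N then a ^+ k.-1 * b else - (a ^+ k - 1).
pose v i : algC := if i == 0%N then z else q%:R.
exists 2%N, (fun i : 'I_2 => u i), (fun i : 'I_2 => v i); split.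
- move=> i; rewrite /u; case: ifP => _; split.
  + by apply: (primeAMl hP) => //; rewrite rpredX ?ringA.
  + by rewrite rpredM ?rpredX.
  + exact: (primeAN hP).
  + by rewrite rpredN rpredB ?rpredX ?rpred1.
- move=> i; rewrite /v; case: ifP => _; split => //; first exact: (primeAq hP).
  exact: rpred_nat.
rewrite big_ord_recl big_ord1 /u /v /= -mulrA Dz mulrCA.
by rewrite -(prednK k0) exprS /=; ring.
Qed.

(* If [q] is a uniformizer at [P], then [x = x^N mod P] lets one improve
   [tau x = x mod q^j] to [mod q^(j+1)], so the norm of [tau x - x] would be
   divisible by every power of [q]. *)
Lemma ramified_of_inertia (frob tau : galQ) :
  frob_lift q P frob -> inertia P tau -> phi tau != 1%g -> ramified_at.
Proof.
move=> [Dfrob frobq] [Dtau Itau] ntau; apply: contrapT => nram.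
have unif := unramified_uniformizer nram.
have q0 : q%:R != 0 :> algC by rewrite pnatr_eq0 -lt0n prime_gt0.
pose k := #[phi frob]%g; pose N := (q ^ k)%N.
have k0 : (0 < k)%N by apply: order_gt0.
have frobN n x : x \in Aint -> P (iter n frob x - x ^+ (q ^ n)).
  move=> Ax; elim: n => [|n IH]; first by rewrite expn0 expr1 subrr; apply: (primeA0 hP).
  rewrite iterS; apply: (primeAtrans hP (y := frob (x ^+ (q ^ n)))).
    by rewrite -rmorphB; apply/Dfrob.
  by rewrite expnSr exprM; apply: frobq; rewrite rpredX.
have xN x : x \in OK -> P (x - x ^+ N).
  move=> Kx; have := frobN k x (ringA Kx); rewrite -galQ_expE (ringK Kx) //.
  by rewrite hom_exp // expg_order.
have nPM a b : a \in OK -> b \in OK -> ~ P a -> ~ P b -> ~ P (a * b).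
  by move=> Ka Kb nPa nPb /(primeAM hP)[||//|//]; apply: ringA.
have Ktau x : x \in OK -> tau x \in OK by apply: ring_of_integers_gal.
have nPtau x : ~ P x -> ~ P (tau x) by move=> nPx /Dtau.
have claim j x : x \in OK -> exists c d, [/\ c \in OK, d \in OK, ~ P d & d * (tau x - x) = q%:R ^+ j.+1 * c].
  elim: j x => [|j IH] x Kx.
    have [||c [d [Kc Kd nPd Dd]]] := unif (tau x - x); first by rewrite rpredB ?Ktau.
      by apply: Itau; apply: ringA.
    by exists c, d; rewrite expr1.
  have [|c [d [Kc Kd nPd Dd]]] := unif (x - x ^+ N) _ (xN x Kx); first by rewrite rpredB ?rpredX.
  have [c1 [e1 [Kc1 Ke1 nPe1 De1]]] := IH c Kc.
  have [c2 [e2 [Kc2 Ke2 nPe2 De2]]] := IH d Kd.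
  have [c3 [e3 [Kc3 Ke3 nPe3 De3]]] := IH x Kx.
  pose S := \sum_(i < N) tau x ^+ (N.-1 - i) * x ^+ i.
  have KS : S \in OK by apply: rpred_sum => i _; rewrite rpredM ?rpredX ?Ktau.
  have PS : P S.
    have : P (S - \sum_(i < N) x ^+ N.-1).
      rewrite -sumrB; apply: (primeA_sum hP) => i _.
      have -> : x ^+ N.-1 = x ^+ (N.-1 - i) * x ^+ i.
        rewrite -exprD subnK // -ltnS prednK // expn_gt0 prime_gt0 //.
      rewrite -mulrBl; apply: (primeAMr hP); first by rewrite rpredX ?ringA.
      by apply: primeA_subX; rewrite ?galQ_Aint ?ringA //; apply: Itau; apply: ringA.
    move=> PSd; rewrite -[S](subrK (\sum_(i < N) x ^+ N.-1)).
    apply: (primeAD hP PSd).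
    rewrite sumr_const card_ord -mulr_natl /N -(prednK k0) expnS natrM -mulrA.
    apply: (primeAMr hP); last exact: (primeAq hP).
    by rewrite rpredM ?rpredX ?rpred_nat ?ringA.
  have [c4 [e4 [Kc4 Ke4 nPe4 De4]]] := unif _ KS PS.
  have tauD : tau d * (tau x - tau x ^+ N) = q%:R * tau c.
    by rewrite -rmorphXn -rmorphB -rmorphM /= Dd rmorphM rmorph_nat.
  exists (d * tau d * e1 * e2 * c3 * c4 + e3 * e4 * (e2 * d * c1 - e1 * c * c2)).
  exists (d * tau d * e1 * e2 * e3 * e4); split.
  - by rewrite rpredD ?rpredM ?rpredB ?rpredM ?Ktau.
  - by rewrite !(rpredM, Ktau).
  - have Ktd := Ktau _ Kd; have n1 := nPM _ _ Kd Ktd nPd (nPtau _ nPd).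
    have K1 := rpredM Kd Ktd; have n2 := nPM _ _ K1 Ke1 n1 nPe1.
    have K2 := rpredM K1 Ke1; have n3 := nPM _ _ K2 Ke2 n2 nPe2.
    have K3 := rpredM K2 Ke2; have n4 := nPM _ _ K3 Ke3 n3 nPe3.
    exact: nPM _ _ (rpredM K3 Ke3) Ke4 n4 nPe4.
  (* [S] is in [P], being congruent to [N * x^(N-1)], so the last term gains a factor [q]. The
     difference [x - x^N] is locally [q * c / d], and the induction hypothesis for [c] and [d]
     improves the first two terms. *)
  have E1 : tau x - x = (tau x - tau x ^+ N) - (x - x ^+ N) + (tau x - x) * S.
    by rewrite -subrXX; ring.
  rewrite {1}E1 exprS.
  have -> : d * tau d * e1 * e2 * e3 * e4 *
    (tau x - tau x ^+ N - (x - x ^+ N) + (tau x - x) * S) =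
    e3 * e4 * (e1 * e2 * d * (tau d * (tau x - tau x ^+ N)) - e1 * e2 * tau d * (d * (x - x ^+ N)))
    + d * tau d * e1 * e2 * (e3 * (tau x - x)) * (e4 * S) by ring.
  rewrite tauD Dd De3 De4.
  have -> : e1 * e2 * d * (q%:R * tau c) - e1 * e2 * tau d * (q%:R * c) =
    q%:R * (e2 * d * (e1 * (tau c - c)) - e1 * c * (e2 * (tau d - d))) by ring.
  by rewrite De1 De2 exprS; ring.
have [x Kx ntx] := hom_separation hphi ntau.
pose y := tau x - x.
have Ky : y \in OK by rewrite rpredB ?Ktau.
have ny0 : y != 0 by rewrite subr_eq0.
have [n Dn] := galois_norm_int Ky.
have n0 : n != 0.
  apply: contraNneq ny0 => n0; move: Dn; rewrite n0 => /eqP/prodf_eq0[a _].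
  by rewrite fmorph_eq0.
have I1 : Im 1%g by rewrite -(hom_id hphi) gal_image_phi.
pose y' := \prod_(a | Im a && (a != 1%g)) g_ a y.
have Ky' : y' \in OK by apply: rpred_prod => a _; apply: ring_of_integers_gal.
have Dn' : n%:~R = y * y'.
  by rewrite -Dn (bigD1 1%g) //=; congr (_ * _); apply: (ringK Ky); rewrite gal_repK.
(* [y] divides its norm [n], so the claim at this [j] yields one factor [q] more than [n]
   contains. *)
pose j := logn q `|n|%N.
have [c [d [Kc Kd nPd Dd]]] := claim j x Kx.
have nn0 : (0 < `|n|)%N by rewrite absz_gt0.
have [m cm Dm] := pfactor_coprime prq nn0.
have Pdm : P (d * m%:R).
  have sg : n%:~R = (-1) ^+ (n < 0)%R * (m%:R * q%:R ^+ j) :> algC.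
    rewrite {1}[n]intEsign rmorphM rmorphXn rmorphN1 -/j; congr (_ * _).
    by rewrite Dm -natrX -natrM.
  have : d * m%:R = q%:R * ((-1) ^+ (n < 0)%R * (c * y')).
    have qj0 : q%:R ^+ j != 0 :> algC by rewrite expf_neq0.
    apply: (mulfI qj0).
    have s2 : (-1) ^+ (n < 0)%R * (-1) ^+ (n < 0)%R = 1 :> algC by rewrite -expr2 sqrr_sign.
    transitivity ((-1) ^+ (n < 0)%R * (d * n%:~R)).
      rewrite sg; move: s2; set eps := (-1) ^+ _ => s2.
      by transitivity ((eps * eps) * (q%:R ^+ j * (d * m%:R))); [rewrite s2 mul1r | ring].
    by rewrite Dn' mulrA Dd exprS; ring.
  move=> ->; apply: (primeAMr hP); last exact: (primeAq hP).
  by rewrite rpredM ?rpredX ?rpredN ?rpred1 // ringA // rpredM.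
case: (primeAM hP _ _ Pdm) => [||//|]; [exact: ringA | exact: rpred_nat |].
move=> /(primeA_int prq hP m) qm; have {}qm : (q %| m)%N := qm.
by move: cm; rewrite prime_coprime // qm.
Qed.

End Ramification.

(** Ramification at any prime is transported to [P] by conjugation. If inertia at [P] died under
    [phi], lifting would make the finite-level inertia trivial. *)
Lemma ramified_iff (gT : finGroupType) (phi : galQ -> gT) (q : nat) (P : algC -> Prop) (frob : galQ) :
  is_hom phi -> prime q -> qbar_prime_above q P -> frob_lift q P frob ->
  ramified phi q <-> exists2 tau, inertia P tau & phi tau != 1%g.
Proof.
move=> hphi prq hP hfrob; split.
  case=> P' [hP' [n [a [b [Pa [Pb Dq]]]]]].
  have Aa i : a i \in ring_of_integers phi.
    by apply/ring_of_integersP; split; [apply: (primeA_Aint hP'); case: (Pa i) | case: (Pa i)].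
  have Ab i : b i \in ring_of_integers phi.
    by apply/ring_of_integersP; split; [apply: (primeA_Aint hP'); case: (Pb i) | case: (Pb i)].
  have [s sP] := primes_conjugate hphi prq hP hP'.
  apply: contrapT => ntau.
  apply: (unramified_of_trivial_inertia hphi prq hP).
    move=> h /(inertia_lift hphi hP)[h' Ih' <-].
    by apply/eqP; apply: contrapT => /negP nh; apply: ntau; exists h'.
  exists n, (fun i => s (a i)), (fun i => s (b i)); split.
  - by move=> i; split; [apply: sP => //; case: (Pa i) | apply: ring_of_integers_gal].
  - by move=> i; split; [apply: sP => //; case: (Pb i) | apply: ring_of_integers_gal].
  rewrite -(rmorph_nat s) /= Dq rmorph_sum; apply: eq_bigr => i _; exact: rmorphM.
case=> tau Itau ntau.
have [n [a [b [Ha Hb Dq]]]] := ramified_of_inertia hphi prq hP hfrob Itau ntau.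
exists P; split=> //; exists n, a, b; split; last split => //.
- by move=> i; have [? /ring_of_integersP[]] := Ha i.
- by move=> i; have [? /ring_of_integersP[]] := Hb i.
Qed.

(** * Tame and wild inertia *)

Section LocalRing.

Variables (q : nat) (P : algC -> Prop).
Hypothesis (prq : prime q) (hP : qbar_prime_above q P).

Definition local_ring (x : algC) : Prop :=
  exists a b, [/\ a \in Aint, b \in Aint, ~ P b & x = a / b].
Local Notation mloc := (max_ideal_loc P).

Lemma nprime_neq0 b : ~ P b -> b != 0.
Proof. by move=> nPb; apply: contra_notN nPb => /eqP ->; apply: primeA0 hP. Qed.

Lemma nprimeM a b : a \in Aint -> b \in Aint -> ~ P a -> ~ P b -> ~ P (a * b).
Proof. by move=> Aa Ab nPa nPb /(primeAM hP)[]. Qed.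

Lemma local_ring_Aint x : x \in Aint -> local_ring x.
Proof.
by move=> Ax; exists x, 1; rewrite divr1 rpred1; split=> //; apply: primeA1 hP.
Qed.

Lemma max_ideal_prime x : P x -> mloc x.
Proof.
move=> Px; exists x, 1; rewrite divr1 rpred1; split=> //; split=> //; split=> //.
exact: primeA1 hP.
Qed.

Lemma max_ideal_local x : mloc x -> local_ring x.
Proof. by move=> [a [b [Pa [Ab [nPb ->]]]]]; exists a, b; rewrite (primeA_Aint hP). Qed.

Lemma local_ringD x y : local_ring x -> local_ring y -> local_ring (x + y).
Proof.
move=> [a [b [Aa Ab nPb ->]]] [c [d [Ac Ad nPd ->]]].
exists (a * d + c * b), (b * d); rewrite rpredD ?rpredM //; split=> //.
  exact: nprimeM.
have := nprime_neq0 nPb; have := nprime_neq0 nPd => d0 b0; field; exact/andP.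
Qed.

Lemma local_ringM x y : local_ring x -> local_ring y -> local_ring (x * y).
Proof.
move=> [a [b [Aa Ab nPb ->]]] [c [d [Ac Ad nPd ->]]].
exists (a * c), (b * d); rewrite !rpredM //; split=> //; first exact: nprimeM.
have := nprime_neq0 nPb; have := nprime_neq0 nPd => d0 b0; field; exact/andP.
Qed.

Lemma max_idealD x y : mloc x -> mloc y -> mloc (x + y).
Proof.
move=> [a [b [Pa [Ab [nPb ->]]]]] [c [d [Pc [Ad [nPd ->]]]]].
exists (a * d + c * b), (b * d); split; first by apply: (primeAD hP); apply: (primeAMr hP).
rewrite rpredM //; split=> //; split; first exact: nprimeM.
have := nprime_neq0 nPb; have := nprime_neq0 nPd => d0 b0; field; exact/andP.
Qed.

Lemma max_idealM x y : local_ring x -> mloc y -> mloc (x * y).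
Proof.
move=> [a [b [Aa Ab nPb ->]]] [c [d [Pc [Ad [nPd ->]]]]].
exists (a * c), (b * d); split; first exact: (primeAMl hP).
rewrite rpredM //; split=> //; split; first exact: nprimeM.
have := nprime_neq0 nPb; have := nprime_neq0 nPd => d0 b0; field; exact/andP.
Qed.

Lemma max_idealN x : mloc x -> mloc (- x).
Proof.
move=> mx; rewrite -mulN1r; apply: max_idealM mx.
by apply: local_ring_Aint; rewrite rpredN rpred1.
Qed.

Lemma max_ideal_sum (I : Type) (r : seq I) (Q : pred I) (F : I -> algC) :
  (forall i, Q i -> mloc (F i)) -> mloc (\sum_(i <- r | Q i) F i).
Proof.
by move=> mF; apply: big_ind => //; [apply/max_ideal_prime/(primeA0 hP) | exact: max_idealD].
Qed.

Lemma max_ideal_Aint x : x \in Aint -> mloc x -> P x.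
Proof.
move=> Ax [a [b [Pa [Ab [nPb Dx]]]]].
have : P (x * b) by rewrite Dx divfK ?nprime_neq0.
by case/(primeAM hP).
Qed.

Lemma max_ideal1 : ~ mloc 1.
Proof. by move=> /(max_ideal_Aint (rpred1 _)); apply: primeA1 hP. Qed.

Lemma local_ring_dichotomy x : x != 0 -> local_ring x \/ mloc x^-1.
Proof.
move=> x0.
(* [valuation_dichotomy] takes a map whose trivial fibre fixes [x]; the indicator of the stabilizer
   of [x], with values in a group of order two, is one. *)
pose phi (s : galQ) : {perm bool} := if `[< s x = x >] then 1%g else tperm true false.
have Kx : in_fixed_field phi x.
  move=> s; rewrite /phi; case: asboolP => // _ /(congr1 (fun g : {perm bool} => g true)).
  by rewrite tpermL perm1.
have [a [b [/ring_of_integersP[Aa _] /ring_of_integersP[Ab _] Pab Dx]]] := valuation_dichotomy prq hP Kx.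
have [Pb|nPb] := pselect (P b).
  have nPa : ~ P a by case: Pab => // /(_ Pb).
  right; exists b, a; split=> //; split=> //; split=> //.
  by rewrite -Dx invfM mulrA mulfV ?mul1r //; apply: contra_notN nPa => /eqP b0; rewrite -Dx b0 mul0r; apply: primeA0 hP.
by left; exists a, b; split=> //; rewrite -Dx [b * x]mulrC mulfK // nprime_neq0.
Qed.

(** Principal units. Calculating modulo them replaces calculation in the residue field. *)
Definition unit1 x := mloc (x - 1).

Lemma unit1_local x : unit1 x -> local_ring x.
Proof.
move=> /max_ideal_local ux; rewrite -(subrK 1 x); apply: local_ringD => //.
exact: local_ring_Aint (rpred1 _).
Qed.

Lemma unit1M x y : unit1 x -> unit1 y -> unit1 (x * y).
Proof.
move=> ux uy; rewrite /unit1; have -> : x * y - 1 = x * (y - 1) + (x - 1) by ring.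
by apply: max_idealD => //; apply: max_idealM => //; apply: unit1_local.
Qed.

Lemma unit1_id : unit1 1.
Proof. by rewrite /unit1 subrr; apply/max_ideal_prime/(primeA0 hP). Qed.

Lemma unit1X x n : unit1 x -> unit1 (x ^+ n).
Proof. by move=> ux; elim: n => [|n IH]; [exact: unit1_id | rewrite exprS; apply: unit1M]. Qed.

Lemma decomp_comp s t : decomp P s -> decomp P t -> decomp P (galQ_comp s t).
Proof. by move=> ds dt x; rewrite /= ds dt. Qed.

Lemma decomp_inv s : decomp P s -> decomp P (galQ_inv s).
Proof. by move=> ds x; rewrite -(ds (galQ_inv s x)) galQ_Kinv. Qed.

Lemma decomp_max_ideal s x : decomp P s -> mloc x -> mloc (s x).
Proof.
move=> ds [a [b [Pa [Ab [nPb ->]]]]]; exists (s a), (s b); split; first exact/ds.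
by rewrite galQ_Aint; split=> //; split; [move/ds | rewrite fmorph_div].
Qed.

Lemma galQ_finite_order (s : galQ) x : exists2 n, (0 < n)%N & iter n s x = x.
Proof.
have [C HC] := orbit_list [:: x].
have inC n : [:: iter n s x] \in C by rewrite -galQ_expE; apply: (HC (galQ_exp s n)).
have [i [j [ltij eqij]]] : exists i j, (i < j)%N /\ iter i s x = iter j s x.
  apply: contrapT => nex.
  have inj : injective (fun k : 'I_(size C).+1 => [:: iter k s x]).
    move=> a b [e]; apply: val_inj => /=; case: (ltngtP a b) => // lt; case: nex.
      by exists a, b.
    by exists b, a.
  have := uniq_leq_size (s1 := [seq [:: iter (val k) s x] | k <- enum 'I_(size C).+1]) (s2 := C).
  rewrite map_inj_uniq // enum_uniq size_map size_enum_ord => /(_ isT).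
  by rewrite ltnn => /(_ _)/notF; apply => _ /mapP[k _ ->].
exists (j - i)%N; first by rewrite subn_gt0.
move: eqij; rewrite -{1}(subnKC (ltnW ltij)) iterD => /esym.
elim: i {ltij} (iter (j - i) s x) => [|i IH] y //=.
by move/(fmorph_inj s)/IH.
Qed.

(** An automorphism moves [y] in a finite cycle. If [y / t y] were in the maximal ideal, so would be
    its images under [t], and their product along the cycle is 1. *)
Lemma decomp_unit s x : decomp P s -> x != 0 -> local_ring (s x / x) /\ local_ring (x / s x).
Proof.
have main t y : decomp P t -> y != 0 -> local_ring (t y / y).
  move=> dt y0; have ty0 : t y / y != 0 by rewrite mulf_neq0 ?invr_eq0 ?fmorph_eq0.
  have [//|] := local_ring_dichotomy ty0; rewrite invf_div => m1.
  have [n n0 Dn] := galQ_finite_order t y.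
  have iy0 i : iter i t y != 0 by rewrite -galQ_expE fmorph_eq0.
  have mi i : mloc (iter i t y / iter i.+1 t y).
    elim: i => // i IH; rewrite !iterS -fmorph_div.
    exact: decomp_max_ideal.
  have mn i : mloc (y / iter i.+1 t y).
    elim: i => [|i IH]; first exact: (mi 0%N).
    have -> : y / iter i.+2 t y = (y / iter i.+1 t y) * (iter i.+1 t y / iter i.+2 t y).
      by rewrite mulrA divfK.
    by apply: max_idealM => //; apply: max_ideal_local.
  by have := mn n.-1; rewrite prednK // Dn divff // => /max_ideal1.
move=> ds x0; split; first exact: main.
have := main (galQ_inv s) (s x) (decomp_inv ds); rewrite fmorph_eq0 => /(_ x0).
by rewrite galQ_invK.
Qed.

Lemma inertia_max_ideal t u : inertia P t -> local_ring u -> mloc (t u - u).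
Proof.
move=> [dt it] [a [b [Aa Ab nPb ->]]].
have b0 := nprime_neq0 nPb.
have nPtb : ~ P (t b) by move/dt.
have tb0 := nprime_neq0 nPtb.
exists (b * (t a - a) - a * (t b - b)), (b * t b); split.
  by apply: (primeAB hP); apply: (primeAMl hP) => //; apply: it.
rewrite rpredM ?galQ_Aint //; split=> //; split; first by apply: nprimeM; rewrite ?galQ_Aint.
by rewrite fmorph_div; field; apply/andP.
Qed.

Lemma frob_max_ideal s u : frob_lift q P s -> local_ring u -> mloc (s u - u ^+ q).
Proof.
move=> [ds fs] [a [b [Aa Ab nPb ->]]].
have b0 := nprime_neq0 nPb.
have nPsb : ~ P (s b) by move/ds.
have sb0 := nprime_neq0 nPsb.
exists ((s a - a ^+ q) * b ^+ q - a ^+ q * (s b - b ^+ q)), (s b * b ^+ q); split.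
  by apply: (primeAB hP); [apply: (primeAMr hP) | apply: (primeAMl hP)]; rewrite ?rpredX //; apply: fs.
rewrite rpredM ?galQ_Aint ?rpredX //; split=> //; split.
  by apply: nprimeM; rewrite ?galQ_Aint ?rpredX //; apply: (primeAnX hP).
have bq0 : b ^+ q != 0 by rewrite expf_neq0.
by rewrite fmorph_div expr_div_n; field; apply/andP.
Qed.

Lemma inertia_unit1 t u : inertia P t -> u != 0 -> local_ring u -> local_ring u^-1 -> unit1 (t u / u).
Proof.
move=> it u0 lu liu; rewrite /unit1.
have -> : t u / u - 1 = u^-1 * (t u - u) by field.
by apply: max_idealM => //; apply: inertia_max_ideal.
Qed.

Lemma local_ringX u n : local_ring u -> local_ring (u ^+ n).
Proof.
move=> lu; elim: n => [|n IH]; first exact: local_ring_Aint (rpred1 _).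
by rewrite exprS; apply: local_ringM.
Qed.

Lemma frob_unit1 s u : frob_lift q P s -> u != 0 -> local_ring u -> local_ring u^-1 -> unit1 (s u / u ^+ q).
Proof.
move=> fs u0 lu liu; rewrite /unit1.
have uq0 : u ^+ q != 0 by rewrite expf_neq0.
have -> : s u / u ^+ q - 1 = (u ^- q) * (s u - u ^+ q) by field.
by apply: max_idealM; [rewrite -exprVn; apply: local_ringX | apply: frob_max_ideal].
Qed.

Lemma inertia_comp s t : inertia P s -> inertia P t -> inertia P (galQ_comp s t).
Proof.
move=> [ds is1] [dt it]; split; first exact: decomp_comp.
move=> x Ax; apply: (primeAtrans hP (y := t x)); last exact: it.
by apply: is1; rewrite galQ_Aint.
Qed.

Lemma inertia_exp s n : inertia P s -> inertia P (galQ_exp s n).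
Proof.
move=> is1; elim: n => [|n IH]; last exact: inertia_comp.
by split=> // x _; rewrite /= subrr; apply: primeA0 hP.
Qed.

Lemma inertia_inv s : inertia P s -> inertia P (galQ_inv s).
Proof.
move=> [ds is1]; split; first exact: decomp_inv.
move=> x Ax; apply/(ds _); rewrite rmorphB /= galQ_Kinv; apply: (primeABC hP).
exact: is1.
Qed.

(** The classical relation between Frobenius and tame inertia. Modulo principal units, [sig^n y / y]
    is [(sig y / y)^n], the quotient [sig y / y] is the same for [y = s x2] and for [x2], and
    Frobenius acts on units as the [q]-th power. *)
Lemma tame_relation (sig s : galQ) : inertia P sig -> frob_lift q P s ->
  wild_inertia P (galQ_comp (galQ_exp sig q) (galQ_comp s (galQ_comp (galQ_inv sig) (galQ_inv s)))).
Proof.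
move=> isig fs; have [ds _] := fs; split.
  apply: inertia_comp; first exact: inertia_exp.
  split; first by do 3?apply: decomp_comp => //; apply: decomp_inv => //; case: isig.
  move=> x Ax /=; rewrite -{2}(galQ_Kinv s x) -rmorphB.
  have Ai : galQ_inv s x \in Aint by rewrite galQ_Aint.
  apply/ds; exact: ((inertia_inv isig).2 _ Ai).
move=> x x0; set x1 := galQ_inv s x; set x2 := galQ_inv sig x1.
have Dx : x = s (sig x2) by rewrite /x2 /x1 !galQ_Kinv.
have x20 : x2 != 0 by rewrite /x2 /x1 !fmorph_eq0.
set y := s x2.
have y0 : y != 0 by rewrite fmorph_eq0.
have [dsig _] := isig.
rewrite /= -/x1 -/x2 -/y.
have ny n : unit1 ((galQ_exp sig n y / y) / (sig y / y) ^+ n).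
  elim: n => [|n IH]; first by rewrite expr0 divr1 divff //; apply: unit1_id.
  have zn0 : galQ_exp sig n y != 0 by rewrite fmorph_eq0.
  have sy0 : sig y != 0 by rewrite fmorph_eq0.
  set v := galQ_exp sig n y / y in IH.
  have v0 : v != 0 by rewrite mulf_neq0 ?invr_eq0.
  have [lv liv] : local_ring v /\ local_ring v^-1.
    by rewrite invf_div; apply: decomp_unit => //; have [] := inertia_exp n isig.
  have -> : (galQ_exp sig n.+1 y / y) / (sig y / y) ^+ n.+1 =
     (sig v / v) * (v / (sig y / y) ^+ n).
    rewrite /= exprS /v fmorph_div -!/(galQ_exp sig n y) /=.
    have h0 : (sig y / y) ^+ n != 0 by rewrite expf_neq0 // mulf_neq0 ?invr_eq0.
    by field; rewrite zn0 y0 sy0 h0.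
  by apply: unit1M => //; apply: inertia_unit1.
have sx20 : sig x2 != 0 by rewrite fmorph_eq0.
have sy0 : sig y != 0 by rewrite fmorph_eq0.
pose v := s x2 / x2.
have v0 : v != 0 by rewrite mulf_neq0 ?invr_eq0.
have [lv liv] : local_ring v /\ local_ring v^-1 by rewrite invf_div; apply: decomp_unit.
have uv := inertia_unit1 isig v0 lv liv.
pose u := x2 / sig x2.
have u0 : u != 0 by rewrite mulf_neq0 ?invr_eq0.
have [liu lu] : local_ring u^-1 /\ local_ring u by rewrite invf_div; apply: decomp_unit.
have uu := frob_unit1 fs u0 lu liu.
have q0 : (sig y / y) ^+ q != 0 by rewrite expf_neq0 // mulf_neq0 ?invr_eq0.
have uq0 : u ^+ q != 0 by rewrite expf_neq0.
rewrite -/(unit1 _).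
(* Three principal units: the power rule for [sig], independence of the base point, and the
   Frobenius congruence for [u]. *)
have -> : galQ_exp sig q y / x = (galQ_exp sig q y / y / (sig y / y) ^+ q) *
    ((sig v / v) ^+ q * (s u / u ^+ q)).
  have -> : s u = y / x by rewrite Dx /u fmorph_div.
  have -> : sig v / v = (sig y / y) * u.
    by rewrite /v /u fmorph_div -/y; field; rewrite sx20 x20 y0.
  rewrite [(_ * u) ^+ q]exprMn; move: q0 uq0; move: ((sig y / y) ^+ q) (u ^+ q) => A B A0 B0.
  by field; rewrite x0 y0 A0 B0.
by apply: unit1M; [exact: ny | apply: unit1M => //; apply: unit1X].
Qed.

End LocalRing.

(** * Inertia away from [p] under a homomorphism to an abelian [p]-group *)

Section PGroupInertia.

Variables (p : nat) (gT : finGroupType) (phi : galQ -> gT).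
Hypothesis (hphi : is_hom phi) (hp : prime p) (hpg : pgroup p [set: gT]%SET)
  (hab : abelian [set: gT]%SET).
Variables (q : nat) (P : algC -> Prop).
Hypothesis (prq : prime q) (hP : qbar_prime_above q P) (npq : q != p).

(** On the fixed field the order of [w] divides [m], which is prime to [q]. The trace [T y] is
    nonzero for [y] nonzero, because [T y / y] is congruent to [m]. But [m * x - T x] has trace
    zero, so [x = T x / m] is fixed by [w]. *)
Lemma wild_inertia_trivial w : wild_inertia P w -> phi w = 1%g.
Proof.
move=> [iw ww]; apply/eqP; apply: contrapT => /negP nw.
have [x Kx nwx] := hom_separation hphi nw.
pose m := #|gT|.
have nPm : ~ P m%:R.
  move=> /(primeA_int prq hP m) qm; have {}qm : (q %| m)%N := qm.
  move: hpg; rewrite /pgroup cardsT -/m => /pnatP => /(_ _ q prq qm).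
  by rewrite inE (negPf npq) => /(_ _)/notF; apply; apply/card_gt0P; exists 1%g.
have u1 (y : algC) i : y != 0 -> unit1 P (iter i w y / y).
  move=> y0; elim: i => [|i IH]; first by rewrite divff //; apply: (unit1_id hP).
  have iy0 : iter i w y != 0 by rewrite -galQ_expE fmorph_eq0.
  have -> : iter i.+1 w y / y = (w (iter i w y) / iter i w y) * (iter i w y / y).
    by rewrite mulrA divfK.
  by apply: (unit1M hP) => //; apply: ww.
pose T y := \sum_(i < m) iter i w y.
have T0 y : y != 0 -> T y != 0.
  move=> y0; apply: contra_notN nPm => /eqP Ty.
  have : max_ideal_loc P (\sum_(i < m) (iter i w y / y - 1)).
    by apply: (max_ideal_sum hP) => i _; apply: u1.
  rewrite sumrB -mulr_suml -/(T y) Ty mul0r sub0r sumr_const card_ord.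
  by move=> /(max_idealN hP); rewrite opprK => /(max_ideal_Aint hP); apply; rewrite rpred_nat.
have wmx : iter m w x = x.
  rewrite -galQ_expE; apply: ringK Kx _ _; rewrite hom_exp //.
  by rewrite /m -cardsT expg_cardG ?inE.
have x0 : x != 0 by apply: contraNneq nwx => ->; rewrite rmorph0.
have wT : w (T x) = T x.
  rewrite /T rmorph_sum /=; have m0 : (0 < m)%N by apply/card_gt0P; exists 1%g.
  rewrite -(prednK m0) big_ord_recr /= [RHS]big_ord_recl /= addrC; congr (_ + _).
  by rewrite -iterS prednK.
have iT i : iter i w (T x) = T x by elim: i => //= i ->.
have z0 : m%:R * x - T x = 0.
  apply/eqP; apply: contrapT => /negP /T0 /eqP; apply.
  transitivity (m%:R * T x - \sum_(i < m) iter i w (T x)).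
    rewrite /T mulr_sumr -sumrB; apply: eq_bigr => i _.
    by rewrite -!galQ_expE rmorphB rmorphM rmorph_nat.
  by under eq_bigr => i _ do rewrite iT; rewrite sumr_const card_ord mulr_natl subrr.
case/eqP: nwx; have m0 : m%:R != 0 :> algC by apply: contra_notN nPm => /eqP ->; apply: primeA0 hP.
apply: (mulfI m0); rewrite -[in LHS](rmorph_nat w) -rmorphM.
by move/eqP: z0; rewrite subr_eq0 => /eqP ->.
Qed.

(** Wild inertia dies and conjugation is trivial in an abelian group, so the tame relation becomes
    [phi sig ^+ q = phi sig]. *)
Lemma tame_order (sig s : galQ) : inertia P sig -> frob_lift q P s -> (phi sig ^+ q.-1 = 1)%g.
Proof.
move=> isig fs; have := wild_inertia_trivial (tame_relation prq hP isig fs).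
rewrite !hom_comp // !hom_inv // hom_exp // -(prednK (prime_gt0 prq)) expgSr => <-.
have cc (a b : gT) : (a * b = b * a)%g by apply: (centsP hab); rewrite inE.
rewrite [(phi s * _)%g]cc mulgKV -mulgA mulgV mulg1.
by [].
Qed.

Lemma gal_stable_closure (S : seq algC) : exists2 S', gal_stable S' & {subset S <= S'}.
Proof.
have [Orb [_ HO]] := orbit_under (fun _ => True) S.
exists (flatten Orb).
  move=> r x /flattenP[ys /HO[h [_ ->]] /mapP[y yS ->]].
  apply/flattenP; exists (map (galQ_comp r h) S); first by apply/HO; exists (galQ_comp r h).
  by apply/mapP; exists y.
move=> x xS; apply/flattenP; exists S => //; apply/HO; exists galQ_id; split=> //.
by rewrite (eq_map (g := id)) ?map_id.
Qed.

Lemma tame_image (sig t : galQ) : tame_generator P sig -> inertia P t ->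
  exists n, phi t = (phi sig ^+ n)%g.
Proof.
move=> [isig gsig] it; have [_ [S HS]] := hphi.
have [S' stS' SS'] := gal_stable_closure S.
have [n [w [ww Ht]]] := gsig t it S' stS'.
exists n; rewrite -[RHS]mulg1 -(wild_inertia_trivial ww) -hom_exp // -hom_comp //.
by apply: HS => x /SS'/Ht ->; rewrite /= galQ_expE.
Qed.

Lemma ramified_tame (sig s : galQ) : tame_generator P sig -> frob_lift q P s ->
  ramified phi q <-> phi sig != 1%g.
Proof.
move=> tsig fs; apply: (iff_trans (ramified_iff hphi prq hP fs)); split.
  case=> t it nt; have [n Dn] := tame_image tsig it.
  by apply: contraNneq nt => e; rewrite Dn e expg1n.
by move=> ns; exists sig => //; case: tsig.
Qed.

End PGroupInertia.

(** * Characters of prime conductor *)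

Definition zeta (r : nat) : algC :=
  if pselect (exists z : algC, r.-primitive_root z) is left e then sval (cid e) else 1.

Definition cyc_exp (r : nat) (g : galQ) : nat :=
  if pselect (exists k, g (zeta r) = zeta r ^+ k) is left e then sval (cid e) else 0%N.

Section Cyclotomic.

Variable r : nat.
Hypothesis prr : prime r.

Lemma zetaP : r.-primitive_root (zeta r).
Proof.
rewrite /zeta; case: pselect => [e|[]]; first by case: cid.
by have [z pz] := C_prim_root_exists (prime_gt0 prr); exists z.
Qed.

Lemma zetaX : zeta r ^+ r = 1. Proof. exact: prim_expr_order zetaP. Qed.

Lemma zeta_Aint : zeta r \in Aint. Proof. exact: Aint_prim_root zetaP. Qed.

Lemma cyc_expP (g : galQ) : g (zeta r) = zeta r ^+ cyc_exp r g.
Proof.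
rewrite /cyc_exp; case: pselect => [e|[]]; first by case: cid.
have [|k ->] := prim_rootP zetaP (_ : g (zeta r) ^+ r = 1); last by exists k.
by rewrite -rmorphXn zetaX rmorph1.
Qed.

Lemma cyc_expE (g : galQ) k : g (zeta r) = zeta r ^+ k -> cyc_exp r g = k %[mod r].
Proof. by rewrite cyc_expP => /eqP; rewrite (eq_prim_root_expr zetaP) => /eqP. Qed.

Lemma coprime_cyc_exp (g : galQ) : coprime r (cyc_exp r g).
Proof.
rewrite prime_coprime //; apply/negP => rk.
have : g (zeta r) = 1.
  by rewrite cyc_expP; apply/eqP; rewrite -(prim_order_dvd zetaP).
move/(canRL (galQ_invK g)); rewrite rmorph1 => z1.
by have := prim_order_dvd zetaP 1; rewrite expr1 z1 eqxx dvdn1 => /eqP r1; move: prr; rewrite r1.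
Qed.

Lemma cyc_exp_comp (g h : galQ) : cyc_exp r (galQ_comp g h) = cyc_exp r g * cyc_exp r h %[mod r].
Proof. by apply: cyc_expE; rewrite /= cyc_expP rmorphXn /= cyc_expP exprM. Qed.

Definition cyc_char (g : galQ) : {unit 'F_r} := insubd (1%g : {unit 'F_r}) (cyc_exp r g)%:R.

Lemma cyc_charE g : FinRing.uval (cyc_char g) = (cyc_exp r g)%:R.
Proof. by rewrite /cyc_char; apply: (insubdK (1%g : {unit 'F_r})); rewrite -topredE /= unitFpE // coprime_cyc_exp. Qed.

Lemma cyc_char_eq (g h : galQ) : cyc_char g = cyc_char h <-> g (zeta r) = h (zeta r).
Proof.
split=> [e|e]; last first.
  apply: val_inj; rewrite /= !cyc_charE; apply: val_inj; rewrite /= !val_Fp_nat //.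
  by apply: cyc_expE; rewrite e cyc_expP.
have : (cyc_exp r g)%:R = (cyc_exp r h)%:R :> 'F_r by rewrite -!cyc_charE e.
move/(congr1 val); rewrite /= !val_Fp_nat // => em.
by rewrite !cyc_expP; apply/eqP; rewrite (eq_prim_root_expr zetaP); apply/eqP.
Qed.

Lemma cyc_char_hom : is_hom cyc_char.
Proof.
split; last by exists [:: zeta r] => s t e; apply/cyc_char_eq/e; rewrite mem_head.
move=> s t g e; have -> : g = galQ_comp s t by apply: galQ_ext.
apply: val_inj; rewrite /= !cyc_charE -natrM.
by apply: val_inj; rewrite /= !val_Fp_nat //; apply: cyc_exp_comp.
Qed.

Local Notation OK := (ring_of_integers cyc_char).
Local Notation z := (zeta r).
Local Notation pi_ := (1 - zeta r).

Lemma zeta_OK : z \in OK.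
Proof.
apply/ring_of_integersP; split; first exact: zeta_Aint.
move=> s; rewrite -(hom_id cyc_char_hom); exact: (cyc_char_eq _ _).1.
Qed.

Lemma prod_one_minus_zeta : \prod_(j < r.-1) (1 - z ^+ j.+1) = r%:R.
Proof.
have r1 := prime_gt1 prr.
have e := factor_Xn_sub_1 zetaP.
move: e; rewrite big_mkord -(prednK (prime_gt0 prr)) big_ord_recl expr0.
have -> : 'X^(r.-1.+1) - 1 = ('X - 1%:P) * \sum_(i < r.-1.+1) 'X^i :> {poly algC}.
  by rewrite subrX1 polyC1.
move/(mulfI _); rewrite polyXsubC_eq0 => /(_ isT).
move/(congr1 (fun p : {poly algC} => p.[1])).
rewrite horner_prod horner_sum.
under eq_bigr do rewrite hornerXsubC.
by under [in RHS]eq_bigr do rewrite hornerXn expr1n; rewrite sumr_const card_ord => ->.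
Qed.

Lemma r_pi : exists2 u, u \in Aint & r%:R = pi_ ^+ r.-1 * u.
Proof.
exists (\prod_(j < r.-1) \sum_(i < j.+1) z ^+ i).
  by apply: rpred_prod => j _; apply: rpred_sum => i _; rewrite rpredX ?zeta_Aint.
rewrite -prod_one_minus_zeta.
transitivity (\prod_(j < r.-1) (pi_ * \sum_(i < j.+1) z ^+ i)); last by rewrite big_split prodr_const card_ord.
by apply: eq_bigr => j _; rewrite -[1 in LHS](expr1n _ j.+1) subrXX; congr (_ * _); apply: eq_bigr => i _; rewrite expr1n mul1r.
Qed.

(** Fourier inversion: the coefficients are traces of [x / z^j]. Summing over [j] kills every other
    conjugate [g x], as [z / g z] is then a nontrivial [r]-th root of unity. *)
Lemma zeta_expansion x : x \in OK -> exists p : {poly int},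
  (size p <= r)%N /\ r%:R * x = (map_poly intr p).[z].
Proof.
move=> Kx.
have z0 : z != 0 by rewrite (prim_root_eq0 zetaP) -lt0n prime_gt0.
have zVOK : z^-1 \in OK.
  have -> : z^-1 = z ^+ r.-1.
    by apply: (mulfI z0); rewrite mulfV // -exprS prednK ?prime_gt0 // zetaX.
  by rewrite rpredX ?zeta_OK.
have tr j : exists t : int, \sum_(a | gal_image cyc_char a) gal_rep cyc_char a (x * z^-1 ^+ j) = t%:~R.
  by apply: (galois_trace_int cyc_char_hom); rewrite rpredM ?rpredX.
pose t j := sval (cid (tr j)).
have Dt j : \sum_(a | gal_image cyc_char a) gal_rep cyc_char a (x * z^-1 ^+ j) = (t j)%:~R by rewrite /t; case: cid.
exists (\poly_(j < r) t j); split; first exact: size_poly.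
have -> : map_poly intr (\poly_(j < r) t j) = \poly_(j < r) (t j)%:~R :> {poly algC}.
  by apply/polyP => i; rewrite coef_map !coef_poly; case: ifP.
rewrite horner_poly.
under eq_bigr do rewrite -Dt mulr_suml.
rewrite exchange_big /=.
have I1 : gal_image cyc_char 1%g by rewrite -(hom_id cyc_char_hom) gal_image_phi.
have term a j : gal_rep cyc_char a (x * z^-1 ^+ j) * z ^+ j =
   gal_rep cyc_char a x * (z / gal_rep cyc_char a z) ^+ j.
  by rewrite rmorphM rmorphXn fmorphV /= expr_div_n -mulrA; congr (_ * _); rewrite exprVn mulrC.
rewrite (bigD1 1%g) //= [X in _ + X]big1 ?addr0.
  have e1 y : y \in OK -> gal_rep cyc_char 1%g y = y.
    by move=> Ky; apply: (ringK Ky); rewrite gal_repK.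
  under eq_bigr do rewrite term !e1 ?zeta_OK // divff // expr1n mulr1.
  by rewrite sumr_const card_ord mulr_natl.
move=> a /andP[Ia na1].
under eq_bigr do rewrite term.
rewrite -mulr_sumr; set rho := z / _.
have nrho : rho != 1.
  apply: contra na1 => /eqP e; rewrite -(gal_repK Ia) -(hom_id cyc_char_hom).
  apply/eqP/cyc_char_eq; rewrite /=.
  have gz0 : gal_rep cyc_char a z != 0 by rewrite fmorph_eq0.
  by rewrite -[RHS](divfK gz0) -/rho e mul1r.
have rhor : rho ^+ r = 1.
  by rewrite /rho expr_div_n -rmorphXn zetaX rmorph1 divr1.
suff -> : \sum_(i < r) rho ^+ i = 0 by rewrite mulr0.
apply: (mulfI (_ : rho - 1 != 0)); first by rewrite subr_eq0.
by rewrite -subrX1 rhor subrr mulr0.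
Qed.

Variable P : algC -> Prop.
Hypothesis hP : qbar_prime_above r P.

Lemma pi_Aint : pi_ \in Aint. Proof. by rewrite rpredB ?rpred1 ?zeta_Aint. Qed.

(** Some [1 - z^j] lies in [P] since their product is [r], and [z] is a power of that [z^j]. *)
Lemma prime_pi : P pi_.
Proof.
have [u Au Dr] := r_pi; have := primeAq hP; rewrite Dr.
case/(primeAM hP) => [|//|/(primeAX hP pi_Aint)//|Pu]; first by rewrite rpredX ?pi_Aint.
have : P (\prod_(j < r.-1) (1 - z ^+ j.+1)) by rewrite prod_one_minus_zeta; apply: primeAq hP.
case/(primeA_prod hP) => [j _ _|j _ [_ Pj]]; first by rewrite rpredB ?rpred1 ?rpredX ?zeta_Aint.
have cj : coprime j.+1 r.
  rewrite coprime_sym prime_coprime //; apply/negP => /dvdn_leq/= => /(_ isT).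
  by rewrite leqNgt; have := ltn_ord j; rewrite -ltnS prednK ?prime_gt0 // => ->.
have [k _ /eqP Dk] : exists2 k, True & (k * j.+1 == 1 %[mod r])%N.
  case: (egcdnP r (isT : 0 < j.+1)%N) => k l Dkl _.
  exists k => //; move: Dkl; rewrite (eqP cj) => ->.
  by rewrite modnMDl.
have -> : pi_ = (1 - z ^+ j.+1) * \sum_(i < k) (z ^+ j.+1) ^+ i.
  rewrite -[_ * _]opprK -mulNr opprB -subrX1 opprB -exprM.
  congr (1 - _); apply/eqP; rewrite -{1}[z]expr1 (eq_prim_root_expr zetaP) mulnC.
  by rewrite eq_sym; apply/eqP.
apply: (primeAMr hP) => //; apply: rpred_sum => i _.
by rewrite !rpredX ?zeta_Aint.
Qed.

(** Lower coefficients are divisible by [r], which is a multiple of [pi_^(r-1)]. Hence only the term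
    of index [i] survives modulo [pi_^(i+1)], and its coefficient must be divisible by [pi_]. *)
Lemma pi_adic (c : {poly int}) y : (size c <= r.-1)%N -> y \in Aint ->
  (map_poly intr c).[pi_] = r%:R * y -> forall i, (r %| c`_i)%Z.
Proof.
move=> sc Ay Dc i; have [k] := ubnP i; elim: k i => // k IH i lik.
have [le|lt] := leqP r.-1 i; first by rewrite nth_default // (leq_trans sc).
have IHi j : (j < i)%N -> (r %| c`_j)%Z by move=> ji; apply: IH; apply: leq_trans ji _.
have pi0 : pi_ != 0.
  rewrite subr_eq0 eq_sym; apply/eqP => z1.
  by have := prim_order_dvd zetaP 1; rewrite expr1 z1 eqxx dvdn1 => /eqP r1; move: prr; rewrite r1.
have [u Au Dr] := r_pi.
have rpi : exists2 v, v \in Aint & r%:R = pi_ ^+ i.+1 * v.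
  exists (pi_ ^+ (r.-1 - i.+1) * u); first by rewrite rpredM ?rpredX ?pi_Aint.
  by rewrite mulrA -exprD subnKC.
have {u Au Dr} [v Av Dr] := rpi.
apply/(primeA_int prr hP).
suff [Y AY DY] : exists2 Y, Y \in Aint & (c`_i)%:~R * pi_ ^+ i = pi_ ^+ i.+1 * Y.
  have -> : (c`_i)%:~R = pi_ * Y.
    by apply: (mulIf (expf_neq0 i pi0)); rewrite DY exprS; ring.
  by apply: (primeAMr hP) => //; apply: prime_pi.
have : exists2 Y, Y \in Aint & (map_poly intr c).[pi_] = pi_ ^+ i.+1 * Y.
  by exists (v * y); rewrite ?rpredM // Dc Dr mulrA.
have sm : (size (map_poly (intr : int -> algC) c) <= r.-1)%N.
  by rewrite size_map_inj_poly //; apply: intr_inj.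
rewrite (horner_coef_wide _ sm) (bigD1 (Ordinal lt)) //= coef_map /=.
move=> [Y AY DY].
have [Z AZ DZ] : exists2 Z, Z \in Aint &
   \sum_(j < r.-1 | j != Ordinal lt) (map_poly intr c)`_j * pi_ ^+ j = pi_ ^+ i.+1 * Z.
  apply: (big_ind (fun s => exists2 Z, Z \in Aint & s = pi_ ^+ i.+1 * Z)).
  - by exists 0; rewrite ?rpred0 // mulr0.
  - by move=> _ _ [Z1 A1 ->] [Z2 A2 ->]; exists (Z1 + Z2); rewrite ?rpredD // mulrDr.
  move=> j nj; rewrite coef_map /=; have [ji|ij|e] := ltngtP j i.
  - have /dvdzP[e ->] := IHi _ ji.
    exists (e%:~R * v * pi_ ^+ j); first by rewrite !rpredM ?rpredX ?pi_Aint ?rpred_int.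
    by rewrite rmorphM /= -[(r : int)%:~R]/(r%:R) Dr; ring.
  - exists ((c`_j)%:~R * pi_ ^+ (j - i.+1)); first by rewrite rpredM ?rpredX ?pi_Aint ?rpred_int.
    by rewrite mulrCA -exprD subnKC.
  by case/eqP: nj; apply: val_inj.
exists (Y - Z); first by rewrite rpredB.
by rewrite mulrBr -DY -DZ addrK.
Qed.

(** Subtracting a multiple of [1 + z + ... + z^(r-1) = 0] writes [r * x] as a polynomial in [pi_] of
    degree below [r - 1]; [pi_adic] then cancels [r]. *)
Lemma cyclotomic_integers x : x \in OK -> exists c : {poly int}, x = (map_poly intr c).[pi_].
Proof.
move=> Kx; have [p [sp Dp]] := zeta_expansion Kx.
pose p1 : {poly int} := p - \poly_(j < r) p`_r.-1.
have r0 := prime_gt0 prr.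
have Dp1 : (map_poly intr p1).[z] = r%:R * x.
  rewrite /p1 rmorphB hornerD hornerN -Dp /=.
  suff -> : (map_poly intr (\poly_(j < r) p`_r.-1)).[z] = 0 by rewrite subr0.
  have -> : map_poly intr (\poly_(j < r) p`_r.-1) = (p`_r.-1)%:~R *: \sum_(j < r) 'X^j :> {poly algC}.
    apply/polyP => i; rewrite coef_map coef_poly coefZ coef_sum.
    have [ir|ri] := ltnP i r.
      rewrite (bigD1 (Ordinal ir)) //= coefXn eqxx big1 ?addr0 ?mulr1 //.
      by move=> j nj; rewrite coefXn; case: eqP => // e; case/eqP: nj; apply: val_inj; rewrite /= e.
    rewrite big1 ?mulr0 // => j _; rewrite coefXn; case: eqP => // e.
    by have := ltn_ord j; rewrite -e ltnNge ri.
  rewrite hornerZ horner_sum; under eq_bigr do rewrite hornerXn.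
  suff -> : \sum_(j < r) z ^+ j = 0 by rewrite mulr0.
  apply: (mulfI (_ : z - 1 != 0)); last by rewrite -subrX1 zetaX subrr mulr0.
  rewrite subr_eq0; apply/eqP => z1.
  by have := prim_order_dvd zetaP 1; rewrite expr1 z1 eqxx dvdn1 => /eqP r1; move: prr; rewrite r1.
have sp1 : (size p1 <= r.-1)%N.
  apply/leq_sizeP => j lej; rewrite /p1 coefB coef_poly.
  have [jr|rj] := ltnP j r; last by rewrite subr0 nth_default // (leq_trans sp).
  have -> : j = r.-1 by apply/eqP; rewrite eqn_leq lej andbT -ltnS prednK.
  by rewrite subrr.
pose c : {poly int} := p1 \Po (1 - 'X).
have s1X : size (1 - 'X : {poly int}) = 2%N.
  by rewrite -size_polyN opprB size_XsubC.
have sc : (size c <= r.-1)%N.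
  apply: leq_trans (size_comp_poly_leq _ _) _; rewrite s1X muln1.
  by case: (size p1) sp1 => [|n] //= _; have := prime_gt1 prr; case: (r) => [|[]].
have Dc : (map_poly intr c).[pi_] = r%:R * x.
  rewrite -Dp1 /c map_comp_poly horner_comp; congr (_.[_]).
  rewrite rmorphB /= rmorph1 map_polyX !hornerE; ring.
have [Ax _] := (ring_of_integersP _ _).1 Kx.
have rc := pi_adic sc Ax Dc.
pose c' : {poly int} := \poly_(i < size c) (c`_i %/ r)%Z.
have Dcc : c = (r : int) *: c'.
  apply/polyP => i; rewrite coefZ coef_poly; case: ltnP => [_|/leq_sizeP/(_ i)->//].
    by rewrite mulrC divzK.
  by rewrite mulr0.
exists c'.
have rn0 : r%:R != 0 :> algC by rewrite pnatr_eq0 -lt0n.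
by apply: (mulfI rn0); rewrite -Dc Dcc map_polyZ hornerZ.
Qed.

(** Total ramification: every automorphism fixes [pi_] modulo [P], hence all integers of the
    cyclotomic field, and so lifts to inertia. *)
Lemma cyclotomic_inertia k : coprime k r -> exists2 t, inertia P t & t z = z ^+ k.
Proof.
move=> ck; have [u Du] := Qn_aut_exists ck.
have [|t It Dt] := @inertia_lift _ cyc_char cyc_char_hom r P hP (galQ_of_rmorph u).
  move=> x /cyclotomic_integers[c ->].
  rewrite -horner_map /= -map_poly_comp (eq_map_poly (g := intr)); last first.
    by move=> a /=; rewrite rmorph_int.
  rewrite !horner_coef -sumrB; apply: (primeA_sum hP) => i _; rewrite -mulrBr.
  apply: (primeAMl hP); first by rewrite coef_map Aint_int.
  apply: (primeA_subX hP); rewrite ?pi_Aint ?(Aint_aut u) ?pi_Aint //.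
  rewrite rmorphB rmorph1 Du ?zetaX //.
  apply: (primeAB hP); last exact: prime_pi.
  have -> : 1 - z ^+ k = pi_ * \sum_(i < k) z ^+ i.
    by rewrite -opprB subrX1 -mulNr opprB.
  by apply: (primeAMr hP); [apply: rpred_sum => j _; rewrite rpredX ?zeta_Aint | exact: prime_pi].
exists t => //; have /cyc_char_eq -> := Dt; rewrite /= Du ?zetaX //.
Qed.

(** [w pi_ / pi_ = 1 + z + ... + z^(e-1)] is congruent to [e], and wildness makes it congruent to
    1. *)
Lemma wild_zeta w : wild_inertia P w -> w z = z.
Proof.
move=> [iw ww].
have pi0 : pi_ != 0.
  rewrite subr_eq0 eq_sym; apply/eqP => z1.
  by have := prim_order_dvd zetaP 1; rewrite expr1 z1 eqxx dvdn1 => /eqP r1; move: prr; rewrite r1.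
have := ww _ pi0; rewrite rmorphB rmorph1 /= cyc_expP.
set e := cyc_exp r w.
have -> : 1 - z ^+ e = pi_ * \sum_(i < e) z ^+ i.
  by rewrite -opprB subrX1 -mulNr opprB.
rewrite mulrAC divff // mul1r => m1.
have A1 : \sum_(i < e) z ^+ i - 1 \in Aint.
  by rewrite rpredB ?rpred1 //; apply: rpred_sum => i _; rewrite rpredX ?zeta_Aint.
have P1 := max_ideal_Aint hP A1 m1.
have : P ((e : int) - 1)%:~R.
  have -> : ((e : int) - 1)%:~R = (\sum_(i < e) z ^+ i - 1) - \sum_(i < e) (z ^+ i - 1) :> algC.
    rewrite sumrB sumr_const card_ord rmorphB rmorph1 /= -[(e : int)%:~R]/(e%:R); ring.
  apply: (primeAB hP) => //; apply: (primeA_sum hP) => i _.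
  rewrite subrX1; apply: (primeAMr hP).
    by apply: rpred_sum => j _; rewrite rpredX ?zeta_Aint.
  by apply: (primeABC hP); apply: prime_pi.
move/(primeA_int prr hP); rewrite -eqz_mod_dvd => /eqP; rewrite !modz_nat => [[em]].
by rewrite -{2}[z]expr1; apply/eqP; rewrite (eq_prim_root_expr zetaP); apply/eqP.
Qed.

Variable sig : galQ.
Hypothesis tsig : tame_generator P sig.

Lemma tame_generator_zeta (g : galQ) : exists n, g z = iter n sig z.
Proof.
have cg : coprime (cyc_exp r g) r by rewrite coprime_sym coprime_cyc_exp.
have [t It Dt] := cyclotomic_inertia cg.
have [S stS zS] := gal_stable_closure [:: z].
have [n [w [ww Ht]]] := tsig.2 t It S stS.
exists n; rewrite cyc_expP -Dt Ht ?wild_zeta //; apply: zS; exact: mem_head.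
Qed.

(** Inertia maps onto the units modulo [r] and wild inertia acts trivially, so [sig] maps to a
    generator of this group of order [r - 1]. *)
Lemma iter_sig_order n m : iter n sig z = iter m sig z <-> n = m %[mod r.-1].
Proof.
pose c := cyc_char sig.
have Dc : <[c]>%g = [set: {unit 'F_r}]%SET.
  apply/setP => u; rewrite inE; apply/cycleP.
  have [k ck Du] : exists2 k, coprime k r & FinRing.uval u = (k%:R : 'F_r).
    exists (FinRing.uval u : nat); last by rewrite natr_Zp.
    rewrite coprime_sym -unitFpE // natr_Zp; exact: (valP u).
  have [nu Dnu] := Qn_aut_exists ck.
  have [j Dj] := tame_generator_zeta (galQ_of_rmorph nu).
  exists j; rewrite -(hom_exp cyc_char_hom) -(_ : cyc_char (galQ_of_rmorph nu) = u).
    by apply/cyc_char_eq; rewrite galQ_expE.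
  apply: val_inj; rewrite /= cyc_charE Du; apply: val_inj; rewrite /= !val_Fp_nat //.
  by apply: cyc_expE; rewrite /= Dnu // zetaX.
have oc : #[c]%g = r.-1 by rewrite /order Dc card_finField_unit card_Fp.
have e j : iter j sig z = galQ_exp sig j z by rewrite galQ_expE.
rewrite !e -oc; split.
  by move/cyc_char_eq; rewrite !(hom_exp cyc_char_hom) => /eqP; rewrite eq_expg_mod_order => /eqP.
move/eqP; rewrite -eq_expg_mod_order -!(hom_exp cyc_char_hom) => /eqP.
exact: (cyc_char_eq _ _).1.
Qed.

Definition discrete_log (g : galQ) : nat := sval (cid (tame_generator_zeta g)).

Lemma discrete_logP (g : galQ) : g z = iter (discrete_log g) sig z.
Proof. by rewrite /discrete_log; case: cid. Qed.

(** [discrete_log] is a choice, determined modulo [r - 1] only; the condition [a ^+ r.-1 = 1]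
    removes the ambiguity. *)
Definition twist (gT : finGroupType) (a : gT) (g : galQ) : gT := (a ^+ discrete_log g)%g.

Lemma twistE (gT : finGroupType) (a : gT) (g : galQ) n : (a ^+ r.-1 = 1)%g ->
  g z = iter n sig z -> twist a g = (a ^+ n)%g.
Proof.
move=> ar; rewrite discrete_logP => /iter_sig_order e; rewrite /twist.
apply/eqP; rewrite eq_expg_mod_order.
have oa : (#[a]%g %| r.-1)%N by rewrite order_dvdn ar.
by rewrite -(modn_dvdm _ oa) e modn_dvdm.
Qed.

Lemma twist_hom (gT : finGroupType) (a : gT) : (a ^+ r.-1 = 1)%g -> is_hom (twist a).
Proof.
move=> ar; split; last first.
  exists [:: z] => s t e; apply: (twistE ar); rewrite e ?mem_head //.
  exact: discrete_logP.
move=> s t g e; rewrite -expgD; apply: (twistE ar).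
rewrite e (discrete_logP t) iterD -(discrete_logP t) cyc_expP.
have cs (k l : nat) : iter k sig (z ^+ l) = iter k sig z ^+ l.
  by rewrite -!galQ_expE rmorphXn.
by rewrite rmorphXn /= discrete_logP cs.
Qed.

Lemma twist_sig (gT : finGroupType) (a : gT) : (a ^+ r.-1 = 1)%g -> twist a sig = a.
Proof. by move=> ar; rewrite (twistE (n := 1) ar) ?expg1. Qed.

Lemma twist_frob_one (gT : finGroupType) (a : gT) (g : galQ) : (a ^+ r.-1 = 1)%g ->
  g z = z -> twist a g = 1%g.
Proof. by move=> ar gz; rewrite (twistE (n := 0) ar) ?expg0. Qed.

Lemma twist_frob_gen (gT : finGroupType) (a : gT) (g : galQ) : (a ^+ r.-1 = 1)%g ->
  g z = sig z -> twist a g = a.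
Proof. by move=> ar gz; rewrite (twistE (n := 1) ar) ?expg1. Qed.

Variables (l : nat) (Q : algC -> Prop).
Hypothesis (prl : prime l) (hQ : qbar_prime_above l Q) (nlr : l != r).

(** If two distinct powers met modulo [Q], some [1 - z^k] with [0 < k < r] would lie in [Q], and
    with it the product [r] of all such factors. *)
Lemma zeta_mod_prime i j : Q (z ^+ i - z ^+ j) -> z ^+ i = z ^+ j.
Proof.
wlog le : i j / (i <= j)%N.
  by move=> W; case: (leqP i j) => [|/ltnW] le Qij; [|symmetry]; apply: W => //; apply: (primeABC hQ).
move=> Qij; apply/eqP; rewrite (eq_prim_root_expr zetaP) eq_sym (eqn_mod_dvd _ le).
apply: contrapT => /negP nd.
have Qk : Q (1 - z ^+ (j - i)).
  have : Q (z ^+ i * (1 - z ^+ (j - i))) by rewrite mulrBr mulr1 -exprD subnKC.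
  case/(primeAM hQ) => [|||//]; rewrite ?rpredB ?rpred1 ?rpredX ?zeta_Aint //.
  move=> Qz; case: (primeA1 hQ).
  have Qz1 := primeAX hQ zeta_Aint Qz.
  have -> : (1 : algC) = z * z ^+ r.-1 by rewrite -exprS prednK ?prime_gt0 // zetaX.
  by apply: (primeAMr hQ _ Qz1); rewrite rpredX ?zeta_Aint.
have : Q r%:R.
  rewrite -prod_one_minus_zeta.
  have m0 : (0 < (j - i) %% r)%N by rewrite lt0n.
  have mr : ((j - i) %% r < r)%N by rewrite ltn_mod prime_gt0.
  have lt : (((j - i) %% r).-1 < r.-1)%N by rewrite -ltnS (prednK m0) (prednK (prime_gt0 prr)).
  rewrite (bigD1 (Ordinal lt)) //= prednK // (prim_expr_mod zetaP).
  apply: (primeAMr hQ) => //; apply: rpred_prod => k _.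
  by rewrite rpredB ?rpred1 ?rpredX ?zeta_Aint.
move=> /(primeA_int prl hQ r) h; have {}h : (l %| r)%N := h.
by move: nlr; rewrite -(dvdn_prime2 prl prr) h.
Qed.

Lemma inertia_zeta t : inertia Q t -> t z = z.
Proof.
move=> [_ it]; have := it z zeta_Aint; rewrite cyc_expP -{2}[z]expr1.
by move=> /zeta_mod_prime ->.
Qed.

Lemma frob_zeta s : frob_lift l Q s -> s z = z ^+ l.
Proof.
move=> [_ fs]; have := fs z zeta_Aint; rewrite cyc_expP.
by move=> /zeta_mod_prime ->.
Qed.

End Cyclotomic.

(** * Chebyshev and Mertens estimates *)

Lemma pfactor_ind (Q : nat -> Prop) : Q 1%N ->
  (forall p e m, prime p -> (0 < e)%N -> coprime p m -> (0 < m)%N -> Q m -> Q (p ^ e * m)%N) ->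
  forall n, (0 < n)%N -> Q n.
Proof.
move=> Q1 QM n; have [k] := ubnP n; elim: k n => // k IH n le n0.
have [->//|n1] := eqVneq n 1%N.
have ngt1 : (1 < n)%N by rewrite ltn_neqAle eq_sym n1.
have prp := pdiv_prime ngt1.
have [m cm Dn] := pfactor_coprime prp n0.
have m0 : (0 < m)%N by rewrite -(ltn_pmul2r (_ : 0 < pdiv n ^ logn (pdiv n) n)%N) -?Dn ?mul0n // expn_gt0 pdiv_gt0.
have l0 : (0 < logn (pdiv n) n)%N by rewrite logn_gt0 mem_primes prp n0 pdiv_dvd.
rewrite Dn mulnC; apply: QM => //; apply: IH => //.
rewrite -ltnS; apply: leq_trans le; rewrite ltnS [X in (_ < X)%N]Dn -{1}[m]muln1 ltn_pmul2l //.
by rewrite -{1}(expn0 (pdiv n)) ltn_exp2l ?prime_gt1.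
Qed.

Lemma divisors_pfactor p e m : prime p -> coprime p m -> (0 < m)%N ->
  perm_eq (divisors (p ^ e * m)) [seq (p ^ i * d)%N | i <- iota 0 e.+1, d <- divisors m].
Proof.
move=> pr cp m0; have p0 := prime_gt0 pr.
have pe0 : (0 < p ^ e * m)%N by rewrite muln_gt0 expn_gt0 p0.
have cpd d : (d %| m)%N -> coprime p d by move=> dm; apply: coprime_dvdr dm cp.
apply: uniq_perm; first exact: divisors_uniq.
  apply: allpairs_uniq => [||[i d] [j f]]; rewrite ?iota_uniq ?divisors_uniq //.
  case/allpairsPdep => [a [b [_ bm [-> ->]]]]; case/allpairsPdep => [a' [b' [_ bm' [-> ->]]]] /= e1.
  rewrite -!dvdn_divisors // in bm bm'.
  have b0 := dvdn_gt0 m0 bm; have b0' := dvdn_gt0 m0 bm'.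
  have ea : a = a'.
    have := congr1 (logn p) e1.
    rewrite !lognM ?expn_gt0 ?p0 // !pfactorK //.
    by rewrite !(logn_coprime (cpd _ _)) // !addn0.
  by move: e1; rewrite ea => /eqP; rewrite eqn_pmul2l ?expn_gt0 ?p0 // => /eqP ->.
move=> d; rewrite -dvdn_divisors //; apply/idP/allpairsPdep.
  move=> dn; have d0 := dvdn_gt0 pe0 dn.
  have [f cf Dd] := pfactor_coprime pr d0.
  exists (logn p d), f; split; last by rewrite mulnC.
    rewrite mem_iota add0n /= ltnS.
    have := dvdn_leq_log p pe0 dn; rewrite lognM ?expn_gt0 ?p0 // pfactorK //.
    by rewrite (logn_coprime cp) addn0.
  rewrite -dvdn_divisors // -(@Gauss_dvdr _ (p ^ e)); last by rewrite coprime_sym coprimeXl.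
  by apply: dvdn_trans dn; rewrite Dd dvdn_mulr.
case=> [i [f [ie fm ->]]]; rewrite mem_iota add0n /= ltnS in ie.
by rewrite dvdn_mul ?dvdn_exp2l // dvdn_divisors.
Qed.

Lemma big_divisors_pfactor (T : Type) (idx : T) (op : Monoid.com_law idx) p e m (F : nat -> T) :
  prime p -> coprime p m -> (0 < m)%N ->
  \big[op/idx]_(d <- divisors (p ^ e * m)) F d =
  \big[op/idx]_(i < e.+1) \big[op/idx]_(d <- divisors m) F (p ^ i * d)%N.
Proof.
move=> pr cp m0; rewrite (perm_big _ (divisors_pfactor e pr cp m0)) /=.
rewrite (big_allpairs_dep (h := fun i d => (p ^ i * d)%N) (r1 := iota 0 e.+1) (r2 := fun _ => divisors m)).
by rewrite -[X in iota 0 X]subn0 -/(index_iota 0 e.+1) big_mkord.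
Qed.

Lemma big_multiples (T : Type) (idx : T) (op : Monoid.law idx) (d x : nat) (g : nat -> T) : (0 < d)%N ->
  \big[op/idx]_(1 <= n < x.+1 | (d %| n)%N) g n = \big[op/idx]_(1 <= m < (x %/ d).+1) g (d * m)%N.
Proof.
move=> d0; elim: x => [|x IH]; first by rewrite div0n !big_geq.
rewrite big_mkcond big_nat_recr //= -big_mkcond /= IH divnS //.
have [dx|ndx] := boolP (d %| x.+1)%N; last by rewrite Monoid.mulm1.
rewrite add1n [in RHS]big_nat_recr //=; congr (op _ (g _)).
by have := divnK dx; rewrite divnS // dx add1n mulnC.
Qed.

(** Pairs with product at most [x] are listed by their product or by their first factor. All
    Dirichlet convolutions below are summed in this form. *)
Lemma big_divisors_exchange (T : Type) (idx : T) (op : Monoid.com_law idx) (x : nat) (f : nat -> nat -> T) :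
  \big[op/idx]_(1 <= n < x.+1) \big[op/idx]_(d <- divisors n) f d (n %/ d)%N =
  \big[op/idx]_(1 <= d < x.+1) \big[op/idx]_(1 <= m < (x %/ d).+1) f d m.
Proof.
transitivity (\big[op/idx]_(1 <= n < x.+1) \big[op/idx]_(1 <= d < x.+1 | (d %| n)%N) f d (n %/ d)%N).
  apply: eq_big_nat => n /andP[n0 nx].
  rewrite -[RHS]big_filter; apply: perm_big; apply: uniq_perm.
  - exact: divisors_uniq.
  - by rewrite filter_uniq ?iota_uniq.
  move=> d; rewrite -dvdn_divisors // mem_filter mem_index_iota; case dn: (d %| n)%N => //=.
  by rewrite (dvdn_gt0 n0 dn) /= (leq_ltn_trans (dvdn_leq n0 dn)).
under eq_bigr => n _ do rewrite big_mkcond.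
rewrite exchange_big_nat /=; apply: eq_big_nat => d /andP[d0 dx]; rewrite -big_mkcond /=.
rewrite (big_multiples op x (fun n => f d (n %/ d)%N) d0).
by apply: eq_bigr => m _; rewrite mulKn.
Qed.

Section Mangoldt.

Variable R : realType.
Local Notation lnn n := (ln (n%:R : R)).

(** The von Mangoldt function as a double sum over primes and exponents, ready for exchanging
    summations. *)
Definition mangoldt (d : nat) : R :=
  \sum_(0 <= p < d.+1 | prime p) \sum_(1 <= k < d.+1) (if d == (p ^ k)%N then lnn p else 0).

Lemma lnn_ge0 n : 0 <= lnn n.
Proof.
by case: n => [|n]; [rewrite ln0 | rewrite ln_ge0 // ler1n].
Qed.

Lemma mangoldt_ge0 d : 0 <= mangoldt d.
Proof.
apply: sumr_ge0 => p _; apply: sumr_ge0 => k _; case: ifP => // _; exact: lnn_ge0.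
Qed.

Lemma mangoldt_wide N d : (d <= N)%N ->
  mangoldt d = \sum_(0 <= p < N.+1 | prime p) \sum_(1 <= k < N.+1) (if d == (p ^ k)%N then lnn p else 0).
Proof.
move=> dN; rewrite /mangoldt.
have inner p : prime p -> \sum_(1 <= k < N.+1) (if d == (p ^ k)%N then lnn p else 0) =
     \sum_(1 <= k < d.+1) (if d == (p ^ k)%N then lnn p else 0).
  move=> pr; rewrite (big_cat_nat _ (n := d.+1)) //= [X in _ + X]big_nat_cond [X in _ + X]big1 ?addr0 //.
  move=> k; rewrite andbT => /andP[dk _]; case: eqP => // e.
  by move: dk; rewrite e ltnNge ltnW // ltn_expl // prime_gt1.
rewrite (eq_bigr _ inner) [RHS](big_cat_nat _ (n := d.+1)) //=.
rewrite [X in _ = _ + X]big_nat_cond [X in _ = _ + X]big1 ?addr0 // => p /andP[/andP[dp _] pr].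
rewrite big_nat_cond big1 // => k; rewrite andbT => /andP[k0 kd].
case: eqP => // e; move: dp; rewrite {1}e ltnNge.
by rewrite -{1}(expn1 p) leq_exp2l ?prime_gt1 // k0.
Qed.

Lemma ln_prod (I : Type) (r : seq I) (Q : pred I) (F : I -> nat) :
  (forall i, Q i -> (0 < F i)%N) ->
  lnn (\prod_(i <- r | Q i) F i) = \sum_(i <- r | Q i) lnn (F i).
Proof.
move=> F0; suff [_ ->] : (0 < \prod_(i <- r | Q i) F i)%N /\
  lnn (\prod_(i <- r | Q i) F i) = \sum_(i <- r | Q i) lnn (F i) by [].
elim: r => [|i r [pos IH]]; first by rewrite !big_nil ln1.
rewrite !big_cons; case: ifP => // Qi; split; first by rewrite muln_gt0 F0.
by rewrite natrM lnM ?posrE ?ltr0n ?F0 // IH.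
Qed.

Lemma ln_natX a k : (0 < a)%N -> lnn (a ^ k)%N = k%:R * lnn a.
Proof. by move=> a0; rewrite natrX lnXn ?ltr0n // mulr_natl. Qed.

Lemma ln_prod_logn n : (0 < n)%N -> lnn n = \sum_(0 <= p < n.+1 | prime p) (logn p n)%:R * lnn p.
Proof.
move=> n0; rewrite -{1}(partnT n0) /partn ln_prod.
  rewrite [RHS]big_mkcond; apply: eq_bigr => p _.
  case: ifP => [pr|npr]; first by rewrite ln_natX // prime_gt0.
  by rewrite lognE npr /= expn0 ln1.
move=> p _; have [pr|npr] := boolP (prime p); first by rewrite expn_gt0 prime_gt0.
by rewrite lognE (negPf npr).
Qed.

Lemma sum_mangoldt_divisors n : (0 < n)%N -> \sum_(d <- divisors n) mangoldt d = lnn n.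
Proof.
move=> n0; rewrite ln_prod_logn //.
transitivity (\sum_(0 <= p < n.+1 | prime p) \sum_(1 <= k < n.+1) \sum_(d <- divisors n)
   (if d == (p ^ k)%N then lnn p else 0)).
  rewrite (eq_big_seq (fun d => \sum_(0 <= p < n.+1 | prime p) \sum_(1 <= k < n.+1) (if d == (p ^ k)%N then lnn p else 0))).
    by rewrite exchange_big; apply: eq_bigr => p _; rewrite exchange_big.
  by move=> d; rewrite -dvdn_divisors // => /(dvdn_leq n0)/mangoldt_wide.
apply: eq_bigr => p pr.
have inner k : \sum_(d <- divisors n) (if d == (p ^ k)%N then lnn p else 0) = if (k <= logn p n)%N then lnn p else 0.
  rewrite -big_mkcond -pfactor_dvdn // dvdn_divisors //; case: ifP => [h|nh].
    rewrite -big_filter (perm_big [:: (p ^ k)%N]) ?big_seq1 //.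
    apply: uniq_perm; rewrite ?filter_uniq ?divisors_uniq // => d.
    by rewrite mem_filter inE; case: eqP => // ->.
  by rewrite big_seq_cond big1 // => d /andP[dn /eqP e]; move: nh; rewrite -e dn.
rewrite (eq_bigr _ (fun k _ => inner k)).
have ln_n : (logn p n < n.+1)%N.
  rewrite ltnS; apply: leq_trans (ltnW (ltn_expl _ (prime_gt1 pr))) _.
  by apply: dvdn_leq => //; apply: pfactor_dvdnn.
rewrite (big_cat_nat _ (n := (logn p n).+1)) //= [X in _ + X]big_nat_cond [X in _ + X]big1 ?addr0; last first.
  by move=> k; rewrite andbT => /andP[lk _]; rewrite leqNgt lk.
rewrite (eq_big_nat _ _ (F2 := fun _ => lnn p)).
  by rewrite sumr_const_nat subn1 /= mulr_natl.
by move=> k /andP[_]; rewrite ltnS => ->.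
Qed.

Definition psi (N : nat) : R := \sum_(1 <= d < N.+1) mangoldt d.
Definition lnfact (N : nat) : R := \sum_(1 <= n < N.+1) lnn n.

Lemma lnfactE N : lnfact N = lnn N`!.
Proof.
elim: N => [|N IH]; first by rewrite /lnfact big_geq // fact0 ln1.
rewrite /lnfact big_nat_recr // -/(lnfact N) IH factS natrM lnM; first exact: addrC.
  by rewrite posrE ltr0n.
by rewrite posrE ltr0n fact_gt0.
Qed.

Lemma lnfact_mangoldt N : lnfact N = \sum_(1 <= d < N.+1) mangoldt d * (N %/ d)%:R.
Proof.
rewrite /lnfact (eq_big_nat _ _ (F2 := fun n => \sum_(d <- divisors n) mangoldt d)).
  rewrite (big_divisors_exchange _ N (fun d m => mangoldt d)).
  apply: eq_bigr => d _; rewrite sumr_const_nat subn1 /= mulr_natr //.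
by move=> n /andP[n0 _]; rewrite sum_mangoldt_divisors.
Qed.

Lemma ln2_le1 : ln (2 : R) <= 1.
Proof.
have := @le_ln1Dx R 1; have -> : 1 + 1 = 2 :> R by ring.
by apply; lra.
Qed.

(** Chebyshev: the logarithm of the central binomial coefficient counts [mangoldt d] with a
    nonnegative multiplicity that is 1 for [n < d <= 2n], and the coefficient is at most
    [2^(2n)]. *)
Lemma psi_double n : psi (2 * n) - psi n <= 2 * n%:R.
Proof.
have -> : psi (2 * n) - psi n = \sum_(n.+1 <= d < (2 * n).+1) mangoldt d.
  have le : (n.+1 <= (2 * n).+1)%N by rewrite ltnS leq_pmull.
  rewrite /psi (@big_cat_nat _ _ _ n.+1 1 (2 * n).+1) //=.
  by rewrite [X in X - _]addrC addrK.
have le1 : lnfact (2 * n) - 2 * lnfact n <= 2 * n%:R.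
  have -> : lnfact (2 * n) = 2 * lnfact n + lnn ('C(2 * n, n)).
    rewrite !lnfactE -(bin_fact (leq_pmull n (isT : 0 < 2)%N)) mul2n -addnn addnK.
    have f0 : 0 < n`!%:R :> R by rewrite ltr0n fact_gt0.
    have c0 : 0 < 'C(n + n, n)%:R :> R by rewrite ltr0n bin_gt0 leq_addr.
    by rewrite !natrM !lnM ?posrE ?mulr_gt0 //; ring.
  rewrite addrC addKr.
  have le2 : ('C(2 * n, n) <= 2 ^ (2 * n))%N.
    have lt : (n < (2 * n).+1)%N by rewrite ltnS leq_pmull.
    have := expnDn 1 1 (2 * n); rewrite addn1 => ->.
    by rewrite (bigD1 (Ordinal lt)) //= !exp1n !muln1 leq_addr.
  have : lnn ('C(2 * n, n)) <= lnn (2 ^ (2 * n))%N.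
    by rewrite ler_ln ?posrE ?ltr0n ?bin_gt0 ?expn_gt0 ?leq_pmull // ler_nat.
  move/le_trans; apply; rewrite ln_natX // natrM.
  have := ln2_le1; have : 0 <= n%:R :> R by []; nra.
apply: le_trans le1.
have -> : lnfact n = \sum_(1 <= d < (2 * n).+1) mangoldt d * (n %/ d)%:R.
  rewrite lnfact_mangoldt [RHS](big_cat_nat _ (n := n.+1)) //=; last by rewrite ltnS leq_pmull.
  rewrite [X in _ + X]big_nat_cond [X in _ + X]big1 ?addr0 // => d; rewrite andbT => /andP[nd _].
  by rewrite divn_small // mulr0.
rewrite lnfact_mangoldt mulr_sumr -sumrB.
rewrite [X in _ <= X](big_cat_nat _ (n := n.+1)) //=; last by rewrite ltnS leq_pmull.
rewrite -[X in X <= _]add0r; apply: lerD.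
  rewrite big_nat_cond; apply: sumr_ge0 => d; rewrite andbT => /andP[d0 dn].
  rewrite mulrCA -mulrBr mulr_ge0 ?mangoldt_ge0 // subr_ge0 -natrM ler_nat.
  by rewrite leq_divRL // -mulnA leq_mul2l /= leq_trunc_div.
rewrite big_nat_cond [X in _ <= X]big_nat_cond; apply: ler_sum => d; rewrite andbT => /andP[nd dn].
rewrite (divn_small nd) mulr0 mulr0 subr0 -[X in X <= _]mulr1 ler_wpM2l ?mangoldt_ge0 //.
by rewrite ler1n divn_gt0 // (leq_trans _ nd).
Qed.

(** Induction through [n = uphalf N] gives [4n + 2n = 6n], which is at most [4N] for [N >= 2]. *)
Lemma psi_le N : psi N <= 4 * N%:R.
Proof.
have [k] := ubnP N; elim: k N => // k IH N; rewrite ltnS => le.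
have [N1|N1] := leqP N 1.
  rewrite /psi; case: N N1 {le} => [|[|//]] _; first by rewrite big_geq // mulr0.
  rewrite big_nat1 /mangoldt big_mkcond big_nat_recr //= big_nat1 /= addr0.
  by rewrite mulr1.
pose n := uphalf N.
have N2n : (N <= 2 * n)%N by rewrite mul2n -leq_uphalf_double.
have n2N : (2 * n <= N.+1)%N by rewrite mul2n -geq_uphalf_double.
have le1 : psi N <= psi (2 * n).
  rewrite [X in _ <= X](@big_cat_nat _ _ _ N.+1 1 (2 * n).+1) //= lerDl.
  by apply: sumr_ge0 => d _; apply: mangoldt_ge0.
have le2 : psi n <= 4 * n%:R by apply: IH; lia.
have le3 := psi_double n.
have le4 : 6 * n%:R <= 4 * N%:R :> R by rewrite -!natrM ler_nat; lia.
lra.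
Qed.

Lemma lnfact_ge N : N%:R * lnn N - N%:R <= lnfact N.
Proof.
elim: N => [|N IH]; first by rewrite /lnfact big_geq // mul0r subrr.
rewrite /lnfact big_nat_recr // -/(lnfact N) /=.
have [->|N0] := posnP N; first by rewrite ln1 /lnfact big_geq // !(mulr0, addr0) sub0r lerN10.
have Np : 0 < N%:R :> R by rewrite ltr0n.
have h : N%:R * (lnn N.+1 - lnn N) <= 1.
  rewrite -ln_div ?posrE ?ltr0n // mulrC -ler_pdivlMr // mul1r.
  have -> : N.+1%:R / N%:R = 1 + N%:R^-1 :> R by rewrite -natr1 mulrDl divff ?mul1r ?gt_eqF.
  by apply: le_ln1Dx; apply: lt_trans (ltrN10 _) _; rewrite invr_gt0.
rewrite -!natr1 in h *; lra.
Qed.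

Lemma lnfact_le N : lnfact N <= N%:R * lnn N.
Proof.
rewrite /lnfact big_nat_cond.
apply: (@le_trans _ _ (\sum_(1 <= n < N.+1 | (0 < n < N.+1)%N && true) lnn N)).
  apply: ler_sum => n; rewrite andbT ltnS => /andP[n0 nN].
  by rewrite ler_ln ?posrE ?ltr0n ?ler_nat // (leq_trans n0).
by rewrite -big_nat_cond sumr_const_nat subn1 /= mulr_natl.
Qed.

(** Multiply by [N]. Replacing [N / d] by its floor costs at most [mangoldt d] for each [d], in
    total [psi N], and leaves the logarithm of the factorial. *)
Lemma mertens_upper N : \sum_(1 <= d < N.+1) mangoldt d / d%:R <= lnn N + 4.
Proof.
have [->|N0] := posnP N; first by rewrite big_geq // ln0 // add0r.
have Np : 0 < N%:R :> R by rewrite ltr0n.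
rewrite -(ler_pM2l Np) mulr_sumr.
apply: (@le_trans _ _ (lnfact N + psi N)); last first.
  by rewrite mulrDr; apply: lerD; [exact: lnfact_le | rewrite mulrC psi_le].
rewrite lnfact_mangoldt /psi -big_split /= big_nat_cond [X in _ <= X]big_nat_cond.
apply: ler_sum => d; rewrite andbT => /andP[d0 _].
rewrite mulrCA -[X in _ + X]mulr1 -mulrDr ler_wpM2l ?mangoldt_ge0 //.
rewrite ler_pdivrMr ?ltr0n // natr1 -natrM ler_nat ltnW // ltn_ceil //.
Qed.

Lemma mertens_lower N : lnn N - 1 <= \sum_(1 <= d < N.+1) mangoldt d / d%:R.
Proof.
have [->|N0] := posnP N; first by rewrite big_geq // ln0 // sub0r lerN10.
have Np : 0 < N%:R :> R by rewrite ltr0n.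
rewrite -(ler_pM2l Np) mulr_sumr mulrBr mulr1; apply: le_trans (lnfact_ge N) _.
rewrite lnfact_mangoldt big_nat_cond [X in _ <= X]big_nat_cond.
apply: ler_sum => d; rewrite andbT => /andP[d0 _].
rewrite mulrCA ler_wpM2l ?mangoldt_ge0 //.
by rewrite ler_pdivlMr ?ltr0n // -natrM ler_nat leq_trunc_div.
Qed.

End Mangoldt.

(** * Partial summation and sums of inverse square roots *)

Section Summation.

Variable R : realType.

Lemma abel_summation (c a : nat -> R) m N : (m <= N)%N ->
  let S n := \sum_(0 <= k < n) c k in
  \sum_(m <= n < N) c n * a n = S N * a N - S m * a m + \sum_(m <= n < N) S n.+1 * (a n - a n.+1).
Proof.
move=> /subnK <- S; elim: (N - m)%N => [|k IH]; first by rewrite !big_geq // addr0 subrr.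
rewrite addSn !big_nat_recr ?leq_addl //= IH /S big_nat_recr //=; ring.
Qed.

Lemma abel_bound (c a : nat -> R) (B : R) (n0 : nat) :
  (forall N, `|\sum_(0 <= n < N) c n| <= B) ->
  (forall n, (n0 <= n)%N -> a n.+1 <= a n) -> (forall n, (n0 <= n)%N -> 0 <= a n) ->
  forall m N, (n0 <= m)%N -> (m <= N)%N -> `|\sum_(m <= n < N) c n * a n| <= 2 * B * a m.
Proof.
move=> cB da a0 m N n0m mN; rewrite abel_summation //.
have B0 : 0 <= B by apply: le_trans (cB 0%N).
have n0N := leq_trans n0m mN.
apply: (@le_trans _ _ (B * a N + B * a m + \sum_(m <= n < N) B * (a n - a n.+1))).
  apply: le_trans (ler_normD _ _) _; apply: lerD.
    apply: le_trans (ler_normB _ _) _.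
    by apply: lerD; rewrite normrM [X in _ * X]ger0_norm ?a0 // ler_wpM2r ?a0.
  apply: le_trans (ler_norm_sum _ _ _) _.
  rewrite big_nat_cond [X in _ <= X]big_nat_cond; apply: ler_sum => n; rewrite andbT => /andP[mn _].
  rewrite normrM; have h : 0 <= a n - a n.+1 by rewrite subr_ge0 da // (leq_trans n0m).
  by rewrite [X in _ * X]ger0_norm // ler_wpM2r.
rewrite -mulr_sumr (@telescope_sumr_eq _ m N (fun n => - a n)) //; last first.
  by move=> k _; rewrite opprK addrC.
by rewrite opprK le_eqVlt; apply/orP; left; apply/eqP; ring.
Qed.

(** Completeness with an explicit rate: the supremum of the left ends [s m - e m] lies in every
    interval of centre [s m] and radius [e m]. *)
Lemma nested_limit (s e : nat -> R) n0 :
  (forall m N, (n0 <= m)%N -> (m <= N)%N -> `|s N - s m| <= e m) ->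
  exists L, forall m, (n0 <= m)%N -> `|s m - L| <= e m.
Proof.
move=> H.
pose E := [set x | exists2 m, (n0 <= m)%N & x = s m - e m]%classic.
have e0 m : (n0 <= m)%N -> 0 <= e m by move=> n0m; apply: le_trans (H m m n0m (leqnn _)).
have ub N : (n0 <= N)%N -> ubound E (s N + e N).
  move=> n0N _ [m n0m ->]; have [mN|/ltnW Nm] := leqP m N.
    by have := H m N n0m mN; have := e0 N n0N; rewrite ler_norml => ? /andP[]; lra.
  by have := H N m n0N Nm; have := e0 m n0m; rewrite ler_norml => ? /andP[]; lra.
have E0 : (E !=set0)%classic by exists (s n0 - e n0); exists n0.
have hs : has_sup E by split=> //; exists (s n0 + e n0); apply: ub.
exists (sup E) => m n0m.
have l1 : s m - e m <= sup E by apply: ub_le_sup; [case: hs | exists m].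
have l2 : sup E <= s m + e m by apply: ge_sup => //; apply: ub.
by rewrite ler_norml; apply/andP; split; lra.
Qed.

Lemma ln_unbounded (C : R) : exists2 N : nat, (0 < N)%N & C < ln N%:R.
Proof.
exists (Num.bound (expR C)).+1 => //.
have h : expR C < (Num.bound (expR C)).+1%:R.
  apply: lt_le_trans (archi_boundP (expR_ge0 C)) _; by rewrite ler_nat.
by rewrite -[X in X < _]expRK ltr_ln ?posrE ?expR_gt0 // ltr0n.
Qed.

Lemma harmonic_ge N : ln N.+1%:R <= \sum_(1 <= k < N.+1) (k%:R)^-1 :> R.
Proof.
elim: N => [|N IH]; first by rewrite ln1 big_geq.
rewrite big_nat_recr //=; have Np : 0 < N.+1%:R :> R by rewrite ltr0n.
have h : ln N.+2%:R - ln N.+1%:R <= N.+1%:R^-1 :> R.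
  rewrite -ln_div ?posrE ?ltr0n //.
  have -> : N.+2%:R / N.+1%:R = 1 + N.+1%:R^-1 :> R by rewrite -natr1 mulrDl divff ?mul1r ?gt_eqF.
  by apply: le_ln1Dx; apply: lt_trans (ltrN10 _) _; rewrite invr_gt0.
by rewrite lerBlDr in h; apply: le_trans h _; rewrite [X in X <= _]addrC; apply: lerD.
Qed.

Local Notation isq n := ((Num.sqrt (n%:R : R))^-1).

Definition sum_isq (y : nat) : R := \sum_(1 <= m < y.+1) isq m.

Lemma sqrtn_gt0 n : (0 < n)%N -> 0 < Num.sqrt (n%:R : R).
Proof. by move=> n0; rewrite sqrtr_gt0 ltr0n. Qed.

Lemma sqr_sqrtn n : Num.sqrt (n%:R : R) * Num.sqrt (n%:R : R) = n%:R.
Proof. by rewrite -expr2 sqr_sqrtr. Qed.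

(** For consecutive square roots [a], [b] the increment is [(b - a) / (b (a + b))], dominated by the
    telescoping [1/a - 1/b]. *)
Lemma sum_isq_limit : exists c0 : R, forall y, (0 < y)%N ->
  `|sum_isq y - 2 * Num.sqrt y%:R - c0| <= isq y.
Proof.
pose s y := sum_isq y - 2 * Num.sqrt y%:R.
have step y : (0 < y)%N -> 0 <= s y - s y.+1 <= isq y - isq y.+1.
  move=> y0; rewrite /s /sum_isq [\sum_(1 <= m < y.+2) _]big_nat_recr //=.
  set a := Num.sqrt y%:R; set b := Num.sqrt y.+1%:R; set h := \sum_(_ <= _ < _) _.
  have a0 : 0 < a by apply: sqrtn_gt0.
  have b0 : 0 < b by apply: sqrtn_gt0.
  have ab : b * b = a * a + 1 by rewrite !sqr_sqrtn natr1.
  have le : a <= b by rewrite ler_wsqrtr // ler_nat.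
  have e1 : b - a = (a + b)^-1.
    have abn0 : a + b != 0 by rewrite gt_eqF // addr_gt0.
    apply: (mulIf abn0); rewrite mulVf //; lra.
  have -> : h - 2 * a - (h + b^-1 - 2 * b) = (b - a) / (b * (a + b)).
    have -> : h - 2 * a - (h + b^-1 - 2 * b) = 2 * (b - a) - b^-1 by ring.
    rewrite e1; have abn0 : a + b != 0 by rewrite gt_eqF // addr_gt0.
    have bn0 : b != 0 by rewrite gt_eqF.
    have e2 : b - a = (a + b)^-1 := e1.
    transitivity ((b - a) / (b * (a + b))); last by rewrite -e2.
    field; exact/andP.
  have -> : a^-1 - b^-1 = (b - a) / (b * a) by field; rewrite !gt_eqF.
  apply/andP; split.
    apply: divr_ge0; first by rewrite subr_ge0.
    by apply: mulr_ge0; [exact: ltW | apply: addr_ge0; exact: ltW].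
  rewrite ler_wpM2l ?subr_ge0 // lef_pV2 ?posrE ?mulr_gt0 ?addr_gt0 //.
  by rewrite ler_pM2l // lerDl ltW.
have [|c0 Hc] := @nested_limit s (fun y => isq y) 1%N.
  move=> m N m1 mN.
  have : 0 <= s m - s N <= isq m - isq N.
    move: mN => /subnK <-; elim: (N - m)%N => [|k IH]; first by rewrite !subrr lexx.
    have := step (k + m)%N (leq_trans m1 (leq_addl _ _)); rewrite addSn; move: IH.
    by move=> /andP[? ?] /andP[? ?]; apply/andP; split; lra.
  have h : 0 <= isq N by rewrite invr_ge0 sqrtr_ge0.
  by move=> /andP[h1 h2]; rewrite distrC ger0_norm //; lra.
by exists c0 => y y0; apply: Hc.
Qed.

Lemma sum_isq_le y : sum_isq y <= 2 * Num.sqrt y%:R.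
Proof.
elim: y => [|y IH]; first by rewrite /sum_isq big_geq // mulr_ge0 // sqrtr_ge0.
rewrite /sum_isq big_nat_recr //= -/(sum_isq y).
set b := Num.sqrt y.+1%:R; set a := Num.sqrt y%:R in IH.
have b0 : 0 < b by apply: sqrtn_gt0.
have a0 : 0 <= a by apply: sqrtr_ge0.
have ab : b * b = a * a + 1 by rewrite !sqr_sqrtn natr1.
have : b^-1 <= 2 * (b - a).
  rewrite -(ler_pM2r b0) mulVf ?gt_eqF //; nra.
lra.
Qed.

End Summation.

(** * Non-vanishing of L(1, chi) and primes in arithmetic progressions *)

Section RealCharacter.

Variable R : realType.
Variables (c : nat -> R) (B K : R).
Hypothesis (c1 : c 1%N = 1) (cM : forall m n, c (m * n)%N = c m * c n)
  (cv : forall n, [\/ c n = 0, c n = 1 | c n = -1])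
  (cB : forall N, `|\sum_(0 <= n < N) c n| <= B).

Lemma realchar_norm n : `|c n| <= 1.
Proof. by case: (cv n) => ->; rewrite ?normr0 ?normrN ?normr1. Qed.

Lemma realcharX p i : c (p ^ i)%N = c p ^+ i.
Proof. by elim: i => [|i IH]; rewrite ?expn0 // expnS cM IH exprS. Qed.

Definition rsum (n : nat) : R := \sum_(d <- divisors n) c d.

(** The divisor sum is multiplicative; at [p^e] it is 1, [e + 1] or the indicator of even [e],
    according as [c p] is 0, 1 or -1. *)
Lemma rsum_ge n : (0 < n)%N -> 0 <= rsum n /\ ((forall p, ~~ odd (logn p n)) -> 1 <= rsum n).
Proof.
move: n; apply: pfactor_ind; first by rewrite /rsum (_ : divisors 1 = [:: 1%N]) // big_seq1 c1.
move=> p e m pr e0 cp m0 [IH0 IH1].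
have -> : rsum (p ^ e * m) = (\sum_(i < e.+1) c p ^+ i) * rsum m.
  rewrite /rsum big_divisors_pfactor // mulr_suml; apply: eq_bigr => i _.
  by rewrite mulr_sumr; apply: eq_bigr => d _; rewrite cM realcharX.
have geo : 0 <= \sum_(i < e.+1) c p ^+ i /\ (~~ odd e -> 1 <= \sum_(i < e.+1) c p ^+ i).
  case: (cv p) => ->.
  - rewrite big_ord_recl expr0 big1 ?addr0; last by move=> i _; rewrite expr0n.
    by split.
  - under eq_bigr do rewrite expr1n.
    by rewrite sumr_const card_ord ler0n ler1n.
  have -> : \sum_(i < e.+1) (-1) ^+ i = (~~ odd e)%:R :> R.
    elim: (e) => [|k IH]; first by rewrite big_ord1 expr0.
    by rewrite big_ord_recr /= IH -signr_odd /=; case: (odd k); rewrite /= ?expr1 ?expr0; ring.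
  by rewrite ler0n; split=> // ->.
have [g0 g1] := geo; split; first by rewrite mulr_ge0.
have pe0 : (0 < p ^ e)%N by rewrite expn_gt0 prime_gt0.
move=> ev; rewrite -[1]mulr1; apply: ler_pM => //.
  by apply: g1; have := ev p; rewrite (lognM _ pe0 m0) pfactorK // (logn_coprime cp) addn0.
apply: IH1 => p'; have [->|np] := eqVneq p' p; first by rewrite (logn_coprime cp).
have := ev p'; rewrite (lognM _ pe0 m0) lognX.
have [pr'|npr'] := boolP (prime p'); last by rewrite (lognE p' m) (negPf npr').
by rewrite (logn_coprime (_ : coprime p' p)) ?muln0 // prime_coprime // dvdn_prime2.
Qed.

Local Notation isq n := ((Num.sqrt (n%:R : R))^-1).

Lemma realchar_lower N : ln N.+1%:R <= \sum_(1 <= n < (N * N).+1) rsum n * isq n.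
Proof.
apply: le_trans (harmonic_ge R N) _.
have -> : \sum_(1 <= k < N.+1) (k%:R)^-1 =
   \sum_(1 <= n < (N * N).+1) \sum_(1 <= k < N.+1) (if n == (k * k)%N then (k%:R)^-1 else 0) :> R.
  rewrite exchange_big_nat; apply: eq_big_nat => k /andP[k0 kN].
  have kk0 : (0 < k * k)%N by rewrite muln_gt0 k0.
  have kkN : (k * k < (N * N).+1)%N by rewrite ltnS leq_mul.
  rewrite (@big_cat_nat _ _ _ (k * k) 1 (N * N).+1) //=; last exact: ltnW.
  rewrite big_nat_cond big1 ?add0r; last first.
    by move=> n; rewrite andbT => /andP[_]; rewrite ltn_neqAle => /andP[/negPf ->].
  rewrite big_ltn // eqxx big_nat_cond big1 ?addr0 //.
  by move=> n; rewrite andbT => /andP[]; rewrite ltn_neqAle eq_sym => /andP[/negPf ->].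
rewrite big_nat_cond [X in _ <= X]big_nat_cond; apply: ler_sum => n; rewrite andbT => /andP[n0 nN].
have [r0 r1] := rsum_ge n0.
have i0 : 0 <= isq n by rewrite invr_ge0 sqrtr_ge0.
have [/existsP[k /eqP Dn]|/existsPn nk] := boolP [exists k : 'I_N.+1, n == (k * k)%N]; last first.
  rewrite big_nat_cond big1 ?mulr_ge0 // => k; rewrite andbT => /andP[_ kN].
  by have := nk (Ordinal kN); rewrite /= => /negPf ->.
have k0 : (0 < k)%N by move: n0; rewrite Dn muln_gt0 andbb.
rewrite (@big_cat_nat _ _ _ k 1 N.+1) //=; last by apply: ltnW.
rewrite big_nat_cond big1 ?add0r; last first.
  move=> l; rewrite andbT => /andP[_ lk]; case: eqP => // e; move: lk.
  by rewrite -ltn_sqr -!mulnn -e Dn ltnn.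
rewrite big_ltn // {1}Dn eqxx big_nat_cond big1 ?addr0; last first.
  move=> l; rewrite andbT => /andP[kl _]; case: eqP => // e; move: kl.
  by rewrite -ltn_sqr -!mulnn -e Dn ltnn.
have -> : isq n = (k%:R)^-1 by rewrite Dn natrM -expr2 sqrtr_sqr ger0_norm.
rewrite -[X in X <= _]mul1r ler_wpM2r ?invr_ge0 //; apply: r1 => p.
by rewrite Dn lognM // addnn odd_double.
Qed.

Hypothesis cK : forall N, `|\sum_(1 <= n < N.+1) c n / n%:R| <= K / N.+1%:R.

Lemma isq_decr n : (1 <= n)%N -> isq n.+1 <= isq n.
Proof. by move=> n0; rewrite lef_pV2 ?posrE ?sqrtn_gt0 // ler_wsqrtr // ler_nat. Qed.

(** For [d <= N] the inner sum is [2N / sqrt d + c0] up to [O(sqrt d / N)]. The first part is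
    controlled by [cK], the second by partial summation, and the errors add up to a constant. For
    [d > N] the sums are exchanged and partial summation is applied in [d]. *)
Lemma realchar_upper : exists C, forall N, \sum_(1 <= n < (N * N).+1) rsum n * isq n <= C.
Proof.
have [c0 Hc0] := sum_isq_limit R.
have B0 : 0 <= B by apply: le_trans (cB 0%N).
have K0 : 0 <= K by have := cK 0; rewrite big_geq // normr0 divr1.
exists (2 * K + `|c0| * (2 * B) + 4 + 4 * B) => N.
have [->|N0] := posnP N.
  by rewrite big_geq // !addr_ge0 ?mulr_ge0.
have Np : 0 < N%:R :> R by rewrite ltr0n.
have -> : \sum_(1 <= n < (N * N).+1) rsum n * isq n =
   \sum_(1 <= d < (N * N).+1) \sum_(1 <= m < ((N * N) %/ d).+1) (c d * isq d) * isq m.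
  rewrite -(big_divisors_exchange _ (N * N) (fun d m => (c d * isq d) * isq m)).
  apply: eq_big_nat => n /andP[n0 _]; rewrite /rsum mulr_suml; apply: eq_big_seq => d.
  rewrite -dvdn_divisors // => dn; rewrite -mulrA -invfM -sqrtrM // -natrM.
  by rewrite mulnC divnK.
rewrite (@big_cat_nat _ _ _ N.+1 1 (N * N).+1) //=; last by rewrite ltnS leq_pmull.
apply: lerD.
  pose err d := sum_isq R ((N * N) %/ d) - 2 * (N%:R * isq d) - c0.
  have -> : \sum_(1 <= d < N.+1) \sum_(1 <= m < ((N * N) %/ d).+1) (c d * isq d) * isq m =
    2 * N%:R * (\sum_(1 <= d < N.+1) c d / d%:R) + c0 * (\sum_(1 <= d < N.+1) c d * isq d)
      + \sum_(1 <= d < N.+1) c d * isq d * err d.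
    rewrite !mulr_sumr -!big_split /=; apply: eq_big_nat => d /andP[d0 _].
    rewrite -mulr_sumr -/(sum_isq R ((N * N) %/ d)) /err.
    have -> : (d%:R)^-1 = isq d * isq d by rewrite -invfM sqr_sqrtn.
    ring.
  apply: lerD; first apply: lerD.
  - apply: (@le_trans _ _ (2 * N%:R * (K / N.+1%:R))).
      rewrite ler_pM2l ?mulr_gt0 //; apply: le_trans (cK N); exact: ler_norm.
    rewrite -mulrA ler_pM2l // mulrCA -[X in _ <= X]mulr1 ler_wpM2l //.
    by rewrite ler_pdivrMr ?ltr0n // mul1r ler_nat.
  - apply: le_trans (ler_norm _) _; rewrite normrM ler_wpM2l //.
    have := abel_bound (n0 := 1) cB isq_decr _ (leqnn 1) (ltn0Sn N : (1 <= N.+1)%N).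
    rewrite sqrtr1 invr1 mulr1; apply => n _; by rewrite invr_ge0 sqrtr_ge0.
  apply: (@le_trans _ _ (\sum_(1 <= d < N.+1) 4 / N%:R)); last first.
    by rewrite sumr_const_nat subn1 /= -[_ *+ N]mulr_natr divfK ?gt_eqF.
  rewrite big_nat_cond [X in _ <= X]big_nat_cond; apply: ler_sum => d; rewrite andbT ltnS => /andP[d0 dN].
  apply: le_trans (ler_norm _) _; rewrite !normrM.
  have i0 : 0 < isq d by rewrite invr_gt0 sqrtn_gt0.
  have errd : `|err d| <= 4 * (Num.sqrt d%:R / N%:R).
    (* [y] is the floor of [z^2], so [z - sqrt y] is at most [1 / (2 sqrt y)]; rounding and the
       remainder of [sum_isq_limit] are both [O(1/z)]. *)
    pose y := ((N * N) %/ d)%N.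
    have y0 : (0 < y)%N by rewrite divn_gt0 // (leq_trans dN) // leq_pmull.
    set sy := Num.sqrt (y%:R : R); have sy0 : 0 < sy by apply: sqrtn_gt0.
    set sd := Num.sqrt (d%:R : R); have sd0 : 0 < sd by apply: sqrtn_gt0.
    pose z := N%:R / sd.
    have z0 : 0 < z by rewrite divr_gt0.
    have z2 : z * z = (N * N)%:R / d%:R.
      by rewrite /z mulrACA -invfM sqr_sqrtn natrM.
    have dp : 0 < d%:R :> R by rewrite ltr0n.
    have yz : sy * sy <= z * z.
      by rewrite sqr_sqrtn z2 ler_pdivlMr // -natrM ler_nat leq_trunc_div.
    have zy : z * z <= sy * sy + 1.
      by rewrite sqr_sqrtn z2 ler_pdivrMr // natr1 -natrM ler_nat ltnW // ltn_ceil.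
    have sy1 : 1 <= sy by rewrite -[1]sqrtr1 ler_wsqrtr // ler1n.
    have syz : sy <= z by nra.
    have h1 : z - sy <= 2^-1 / sy.
      rewrite -(ler_pM2r sy0) divfK ?gt_eqF //; nra.
    have := Hc0 y y0; rewrite -/sy => h2.
    have -> : err d = (sum_isq R y - 2 * sy - c0) - 2 * (z - sy) by rewrite /err -/y -/sd /z; ring.
    have h3 : sy^-1 <= 2 / z.
      rewrite ler_pdivlMr // mulrC ler_pdivrMr //; nra.
    have -> : sd / N%:R = z^-1 by rewrite /z invf_div.
    have h4 : `|2 * (z - sy)| <= sy^-1.
      rewrite ger0_norm; last by rewrite mulr_ge0 // subr_ge0.
      by move: h1; rewrite mulrC; lra.
    apply: le_trans (ler_normB _ _) _; lra.
  apply: (@le_trans _ _ (1 * isq d * (4 * (Num.sqrt d%:R / N%:R)))).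
    apply: ler_pM => //.
    by rewrite (ger0_norm (ltW i0)) ler_wpM2r ?realchar_norm // ltW.
  rewrite mul1r mulrCA [isq d * _]mulrA mulVf ?mul1r // gt_eqF // sqrtn_gt0 //.
have -> : \sum_(N.+1 <= d < (N * N).+1) \sum_(1 <= m < ((N * N) %/ d).+1) (c d * isq d) * isq m =
   \sum_(1 <= m < N.+1) isq m * \sum_(N.+1 <= d < ((N * N) %/ m).+1) c d * isq d.
  transitivity (\sum_(N.+1 <= d < (N * N).+1) \sum_(1 <= m < N.+1) (if (d * m <= N * N)%N then c d * isq d * isq m else 0)).
    apply: eq_big_nat => d /andP[Nd dN].
    have d0 : (0 < d)%N by apply: leq_trans Nd.
    rewrite [RHS](@big_cat_nat _ _ _ ((N * N) %/ d).+1) //=; last first.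
      by rewrite ltnS -(leq_pmul2r d0) (leq_trans (leq_trunc_div _ _)) // leq_mul2l ltnW ?orbT.
    rewrite [X in _ = _ + X]big_nat_cond [X in _ = _ + X]big1 ?addr0; last first.
      by move=> m; rewrite andbT => /andP[lm _]; rewrite leqNgt mulnC -ltn_divLR // lm.
    by apply: eq_big_nat => m /andP[_]; rewrite ltnS leq_divRL // mulnC => ->.
  rewrite exchange_big_nat; apply: eq_big_nat => m /andP[m0 mN].
  rewrite mulr_sumr.
  have [le|lt] := leqP N.+1 ((N * N) %/ m).+1; last first.
    rewrite [RHS]big_geq ?(ltnW lt) // big_nat_cond big1 // => d; rewrite andbT => /andP[Nd _].
    by rewrite leqNgt -ltn_divLR // (ltn_trans _ Nd).
  rewrite (@big_cat_nat _ _ _ ((N * N) %/ m).+1) //=; last by rewrite ltnS leq_div.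
  rewrite [X in _ + X]big_nat_cond [X in _ + X]big1 ?addr0; last first.
    by move=> d; rewrite andbT => /andP[ld _]; rewrite leqNgt -ltn_divLR // ld.
  by apply: eq_big_nat => d /andP[_]; rewrite ltnS leq_divRL // => ->; rewrite mulrC.
apply: (@le_trans _ _ (\sum_(1 <= m < N.+1) isq m * (2 * B * isq N.+1))).
  rewrite big_nat_cond [X in _ <= X]big_nat_cond; apply: ler_sum => m _.
  rewrite ler_wpM2l ?invr_ge0 ?sqrtr_ge0 //.
  have [le|lt] := leqP N.+1 ((N * N) %/ m).+1; last first.
    by rewrite big_geq ?(ltnW lt) // mulr_ge0 ?mulr_ge0 // invr_ge0 sqrtr_ge0.
  apply: le_trans (ler_norm _) _; apply: (abel_bound (n0 := 1) cB isq_decr) => //.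
rewrite -mulr_suml -/(sum_isq R N).
have h := sum_isq_le R N.
have s0 : 0 < Num.sqrt N.+1%:R :> R by apply: sqrtn_gt0.
have s1 : Num.sqrt N%:R <= Num.sqrt N.+1%:R :> R by rewrite ler_wsqrtr // ler_nat.
rewrite mulrA ler_pdivrMr //.
have : sum_isq R N * (2 * B) <= (2 * Num.sqrt N.+1%:R) * (2 * B).
  by rewrite ler_wpM2r ?mulr_ge0 //; lra.
lra.
Qed.

(* The sum of [(1 * c)(n) / sqrt n] over [n <= N^2] is at least [ln N] because of the
   squares, but the hyperbola method bounds it when the series of [c n / n] sums to 0. *)
Lemma realchar_nonvanishing : False.
Proof.
have [C HC] := realchar_upper.
have [N N0 HN] := ln_unbounded C.
have := realchar_lower N; have := HC N.
have : ln N%:R <= ln N.+1%:R :> R by rewrite ler_ln ?posrE ?ltr0n // ler_nat.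
lra.
Qed.

End RealCharacter.

(** * Multiplicative weights and Möbius inversion *)

Section SquarefreeWeight.

Variables (R : realType) (w : nat -> R).

(** It specializes to the Möbius function and, later, to the number of tuples with a given support.
    Integers that are not squarefree get 0. *)
Definition swt (n : nat) : R := \prod_(q <- primes n) (if logn q n == 1%N then w q else 0).

Lemma swt1 : swt 1 = 1.
Proof. by rewrite /swt big_nil. Qed.

Lemma swt_pfactor p e m : prime p -> (0 < e)%N -> coprime p m -> (0 < m)%N ->
  swt (p ^ e * m) = (if e == 1%N then w p else 0) * swt m.
Proof.
move=> pr e0 cp m0; have pe0 : (0 < p ^ e)%N by rewrite expn_gt0 prime_gt0.
have npm : p \notin primes m.
  by rewrite mem_primes pr m0 /= -prime_coprime.
have -> : swt (p ^ e * m) = \prod_(r <- p :: primes m) (if logn r (p ^ e * m) == 1%N then w r else 0).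
  apply: perm_big; apply: uniq_perm; rewrite ?primes_uniq //= ?npm ?primes_uniq //.
  by move=> r; rewrite primesM // primesX // primes_prime // !inE.
rewrite big_cons lognM // pfactorK // (logn_coprime cp) addn0; congr (_ * _).
apply: eq_big_seq => r rm; rewrite lognM // lognX.
have nrp : r != p by apply: contraNneq npm => <-.
have prr : prime r by move: rm; rewrite mem_primes => /and3P[].
by rewrite (logn_coprime (_ : coprime r p)) ?muln0 // prime_coprime // dvdn_prime2.
Qed.

End SquarefreeWeight.

Section Mobius.

Variable R : realType.

Definition mobius : nat -> R := swt (fun _ => -1).

Lemma mobius_norm n : `|mobius n| <= 1.
Proof.
rewrite /mobius /swt; elim/big_ind: _ => [|x y hx hy|p _]; first by rewrite normr1.
- by rewrite normrM mulr_ile1.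
by case: ifP => _; rewrite ?normrN ?normr1 ?normr0.
Qed.

Lemma mobius_pfactor p e m : prime p -> (0 < e)%N -> coprime p m -> (0 < m)%N ->
  mobius (p ^ e * m) = (if e == 1%N then -1 else 0) * mobius m.
Proof. exact: swt_pfactor. Qed.

(** Divisors with exponent at least 2 at [p] drop out, which leaves a difference in the direction of
    [p]. *)
Lemma sum_mobius_pfactor p e m (h : nat -> R) : prime p -> (0 < e)%N -> coprime p m -> (0 < m)%N ->
  \sum_(d <- divisors (p ^ e * m)) mobius d * h d = \sum_(d <- divisors m) mobius d * (h d - h (p * d)%N).
Proof.
move=> pr e0 cp m0.
have -> : \sum_(d <- divisors (p ^ e * m)) mobius d * h d =
  \sum_(i < e.+1) \sum_(d <- divisors m) mobius (p ^ i * d) * h (p ^ i * d)%N by exact: big_divisors_pfactor.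
case: e e0 => // e _.
rewrite 2!big_ord_recl [X in _ + (_ + X)]big1 ?addr0; last first.
  move=> i _; rewrite big_seq big1 // => d; rewrite -dvdn_divisors // => dm.
  by rewrite mobius_pfactor ?(dvdn_gt0 m0 dm) ?(coprime_dvdr dm) //= !mul0r.
rewrite -big_split /=; apply: eq_big_seq => d; rewrite -dvdn_divisors // => dm.
rewrite expn0 mul1n mobius_pfactor ?(dvdn_gt0 m0 dm) ?(coprime_dvdr dm) //= expn1.
by rewrite mulN1r mulrBr mulNr.
Qed.

Lemma sum_mobius n : (0 < n)%N -> \sum_(d <- divisors n) mobius d = (n == 1%N)%:R.
Proof.
move: n; apply: pfactor_ind; first by rewrite (_ : divisors 1 = [:: 1%N]) // big_seq1 /mobius swt1.
move=> p e m pr e0 cp m0 _.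
have -> : \sum_(d <- divisors (p ^ e * m)) mobius d = \sum_(d <- divisors (p ^ e * m)) mobius d * 1.
  by apply: eq_bigr => d _; rewrite mulr1.
rewrite (sum_mobius_pfactor (fun _ => 1)) // big1 => [|d _]; last by rewrite subrr mulr0.
case: eqP => // e1.
have := dvdn_mulr m (dvdn_exp e0 (dvdnn p)); rewrite e1 dvdn1 => /eqP p1.
by move: pr; rewrite p1.
Qed.

Lemma mangoldt_pfactor p e m : prime p -> (0 < e)%N -> coprime p m -> (0 < m)%N ->
  mangoldt R (p ^ e * m) = ln p%:R * (m == 1%N)%:R.
Proof.
move=> pr e0 cp m0; rewrite /mangoldt.
have pe0 : (0 < p ^ e)%N by rewrite expn_gt0 prime_gt0.
have key p' k : prime p' -> (0 < k)%N -> (p ^ e * m)%N = (p' ^ k)%N -> [/\ m = 1%N, p' = p & k = e].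
  move=> pr' k0 eq1.
  have pp : p' = p.
    have : (p %| p' ^ k)%N by rewrite -eq1 dvdn_mulr // dvdn_exp.
    by rewrite Euclid_dvdX // => /andP[]; rewrite dvdn_prime2 // => /eqP ->.
  have ke : k = e.
    have := congr1 (logn p) eq1; rewrite pp (lognM _ pe0 m0) !pfactorK //.
    by rewrite (logn_coprime cp) addn0.
  split=> //; move: eq1; rewrite pp ke -[in RHS](muln1 (p ^ e)%N) => /eqP.
  by rewrite eqn_pmul2l ?expn_gt0 ?prime_gt0 // => /eqP.
have [m1|nm1] := eqVneq m 1%N; last first.
  rewrite mulr0 big1 // => p' pr'; rewrite big_nat_cond big1 // => k; rewrite andbT => /andP[k0 _].
  by case: eqP => // /(key _ _ pr' k0)[m1]; rewrite m1 eqxx in nm1.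
rewrite mulr1 m1 muln1 in key *.
have lt1 : (p < (p ^ e).+1)%N by rewrite ltnS -{1}(expn1 p) leq_exp2l ?prime_gt1.
have lt2 : (e < (p ^ e).+1)%N by rewrite ltnS ltnW // ltn_expl // prime_gt1.
rewrite big_mkord (bigD1 (Ordinal lt1)) //= [X in _ + X]big1 ?addr0; last first.
  move=> p' /andP[pr' np]; rewrite big_nat_cond big1 // => k; rewrite andbT => /andP[k0 _].
  by case: eqP => // /(key _ _ pr' k0)[_ pp]; case/eqP: np; apply: val_inj.
rewrite (@big_cat_nat _ _ _ e) //=; last exact: ltnW.
rewrite big_nat_cond big1 ?add0r; last first.
  by move=> k; rewrite andbT => /andP[k0 ke]; case: eqP => // /(key _ _ pr k0)[_ _ kk]; rewrite kk ltnn in ke.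
rewrite big_ltn // eqxx big_nat_cond big1 ?addr0 // => k; rewrite andbT => /andP[ke _].
by case: eqP => // /(key _ _ pr (leq_trans e0 (ltnW ke)))[_ _ kk]; rewrite kk ltnn in ke.
Qed.

Lemma sum_mobius_ln n : (0 < n)%N -> \sum_(d <- divisors n) mobius d * ln d%:R = - mangoldt R n.
Proof.
move: n; apply: pfactor_ind.
  rewrite (_ : divisors 1 = [:: 1%N]) // big_seq1 ln1 mulr0 /mangoldt.
  by rewrite big_mkcond big_nat_recr //= big_nat1 /= addr0 oppr0.
move=> p e m pr e0 cp m0 _; rewrite sum_mobius_pfactor // mangoldt_pfactor //.
rewrite (eq_big_seq (fun d => mobius d * - ln p%:R)).
  by rewrite -mulr_suml sum_mobius // mulrN mulrC.
move=> d; rewrite -dvdn_divisors // => dm; have d0 := dvdn_gt0 m0 dm.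
have p0 := prime_gt0 pr.
by rewrite natrM lnM ?posrE ?ltr0n //; ring.
Qed.

End Mobius.

Section ComplexNorm.

Import complex.

Variable R : realType.
Local Notation C := (complex R).
Local Notation Re := complex.Re.
Local Notation Im := complex.Im.
Local Notation rc := (real_complex R).

(** The sum norm takes the place of the modulus: it is submultiplicative and splits complex
    estimates into two real ones. *)
Definition nm (z : C) : R := `|Re z| + `|Im z|.

Lemma cplx_ReD (z w : C) : Re (z + w) = Re z + Re w. Proof. by case: z; case: w. Qed.
Lemma cplx_ImD (z w : C) : Im (z + w) = Im z + Im w. Proof. by case: z; case: w. Qed.
Lemma cplx_ReM (z w : C) : Re (z * w) = Re z * Re w - Im z * Im w. Proof. by case: z; case: w. Qed.
Lemma cplx_ImM (z w : C) : Im (z * w) = Re z * Im w + Im z * Re w. Proof. by case: z => a b; case: w. Qed.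
Lemma cplx_ReZ (z : C) x : Re (z * rc x) = Re z * x. Proof. by rewrite cplx_ReM /= mulr0 subr0. Qed.
Lemma cplx_ImZ (z : C) x : Im (z * rc x) = Im z * x. Proof. by rewrite cplx_ImM /= mulr0 add0r. Qed.
Lemma cplx_Re_sum (I : Type) (r : seq I) (Q : pred I) (F : I -> C) :
  Re (\sum_(i <- r | Q i) F i) = \sum_(i <- r | Q i) Re (F i).
Proof. exact: (big_morph (@complex.Re R) cplx_ReD erefl). Qed.
Lemma cplx_Im_sum (I : Type) (r : seq I) (Q : pred I) (F : I -> C) :
  Im (\sum_(i <- r | Q i) F i) = \sum_(i <- r | Q i) Im (F i).
Proof. exact: (big_morph (@complex.Im R) cplx_ImD erefl). Qed.

Lemma nm_ge0 z : 0 <= nm z. Proof. by rewrite addr_ge0. Qed.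
Lemma nm0 : nm 0 = 0. Proof. by rewrite /nm /= !normr0 addr0. Qed.
Lemma nmD z w : nm (z + w) <= nm z + nm w.
Proof. by rewrite /nm cplx_ReD cplx_ImD addrACA lerD // ler_normD. Qed.
Lemma nmN z : nm (- z) = nm z. Proof. by case: z => a b; rewrite /nm /= !normrN. Qed.
Lemma nmB z w : nm (z - w) <= nm z + nm w. Proof. by rewrite -(nmN w) nmD. Qed.
Lemma nmM z w : nm (z * w) <= nm z * nm w.
Proof.
rewrite /nm cplx_ReM cplx_ImM mulrDl !mulrDr -!normrM.
have := ler_normB (Re z * Re w) (Im z * Im w).
have := ler_normD (Re z * Im w) (Im z * Re w); lra.
Qed.
Lemma nmZ z x : nm (z * rc x) = nm z * `|x|.
Proof. by rewrite /nm cplx_ReZ cplx_ImZ !normrM mulrDl. Qed.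
Lemma nm_rc x : nm (rc x) = `|x|. Proof. by rewrite /nm /= normr0 addr0. Qed.
Lemma nm_sum (I : Type) (r : seq I) (Q : pred I) (F : I -> C) :
  nm (\sum_(i <- r | Q i) F i) <= \sum_(i <- r | Q i) nm (F i).
Proof.
elim/big_ind2: _ => [|x1 x2 y1 y2 h1 h2|i _] //; first by rewrite nm0.
by apply: le_trans (nmD _ _) _; apply: lerD.
Qed.
Lemma Re_le_nm z : `|Re z| <= nm z. Proof. by rewrite lerDl. Qed.

End ComplexNorm.

(** * Nonprincipal characters against the von Mangoldt function *)

Section DirichletCharacter.

Import complex.

Variable R : realType.
Local Notation C := (complex R).
Local Notation Re := complex.Re.
Local Notation Im := complex.Im.
Local Notation rc := (real_complex R).

Definition dirichlet_char (M : nat) (chi : nat -> C) : Prop :=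
  [/\ chi 1%N = 1, forall m n, chi (m * n)%N = chi m * chi n, forall n, chi (n + M)%N = chi n
    & forall n, chi n = 0 \/ Re (chi n) ^+ 2 + Im (chi n) ^+ 2 = 1].

(** Stated as cancellation over a period, which is what bounds the partial sums. *)
Definition nonprincipal (M : nat) (chi : nat -> C) : Prop := \sum_(0 <= n < M) chi n = 0.

Lemma periodic_sum_bound (f : nat -> R) M : (0 < M)%N -> (forall n, f (n + M)%N = f n) ->
  \sum_(0 <= n < M) f n = 0 -> (forall n, `|f n| <= 1) -> forall N, `|\sum_(0 <= n < N) f n| <= M%:R.
Proof.
move=> M0 fM f0 f1 N; have [k] := ubnP N; elim: k N => // k IH N le.
have [NM|MN] := leqP N M.
  apply: le_trans (ler_norm_sum _ _ _) _.
  apply: (@le_trans _ _ (\sum_(0 <= n < N) 1)); first exact: ler_sum.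
  by rewrite sumr_const_nat subn0 ler_nat.
rewrite (@big_cat_nat _ _ _ M) //=; last exact: ltnW.
rewrite f0 add0r -{1}[M]add0n big_addn; under eq_bigr do rewrite fM.
apply: IH; rewrite -ltnS (leq_trans _ le) // ltnS ltn_subrL M0 /=.
exact: leq_trans MN.
Qed.

Variables (M : nat) (chi : nat -> C).
Hypothesis (M0 : (0 < M)%N) (dchi : dirichlet_char M chi) (nchi : nonprincipal M chi).

Lemma char_coord n : `|Re (chi n)| <= 1 /\ `|Im (chi n)| <= 1.
Proof.
have [_ _ _ /(_ n)[->|h]] := dchi; first by rewrite /= normr0.
by split; rewrite -(@ler_sqr _ _ 1) ?nnegrE // expr1n real_normK ?num_real // -h ?lerDl ?lerDr sqr_ge0.
Qed.

Lemma char_nm n : nm (chi n) <= 2.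
Proof. by have [h1 h2] := char_coord n; rewrite /nm; lra. Qed.

Lemma char_sum_Re N : `|\sum_(0 <= n < N) Re (chi n)| <= M%:R.
Proof.
apply: periodic_sum_bound => [//|n||n]; first by have [_ _ -> _] := dchi.
  by rewrite -cplx_Re_sum nchi.
by have [] := char_coord n.
Qed.

Lemma char_sum_Im N : `|\sum_(0 <= n < N) Im (chi n)| <= M%:R.
Proof.
apply: periodic_sum_bound => [//|n||n]; first by have [_ _ -> _] := dchi.
  by rewrite -cplx_Im_sum nchi.
by have [] := char_coord n.
Qed.

Lemma char_abel (a : nat -> R) n0 : (forall n, (n0 <= n)%N -> a n.+1 <= a n) ->
  (forall n, (n0 <= n)%N -> 0 <= a n) -> forall m N, (n0 <= m)%N -> (m <= N)%N ->
  nm (\sum_(m <= n < N) chi n * rc (a n)) <= 4 * M%:R * a m.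
Proof.
move=> da a0 m N n0m mN; rewrite /nm cplx_Re_sum cplx_Im_sum.
under eq_bigr do rewrite cplx_ReZ; under [X in _ + `|X|]eq_bigr do rewrite cplx_ImZ.
have := abel_bound char_sum_Re da a0 n0m mN.
have := abel_bound char_sum_Im da a0 n0m mN; lra.
Qed.

Definition Lpart (N : nat) : C := \sum_(1 <= n < N.+1) chi n * rc (n%:R^-1).

Lemma inv_decr n : (1 <= n)%N -> n.+1%:R^-1 <= n%:R^-1 :> R.
Proof. by move=> n0; rewrite lef_pV2 ?posrE ?ltr0n // ler_nat. Qed.

Lemma Lvalue_exists : exists L : C, forall N, nm (Lpart N - L) <= 4 * M%:R / N.+1%:R.
Proof.
have H (f : nat -> R) : (forall N, `|\sum_(0 <= n < N) f n| <= M%:R) ->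
    exists L : R, forall N, `|\sum_(1 <= n < N.+1) f n * n%:R^-1 - L| <= 2 * M%:R / N.+1%:R.
  move=> fM; have [|L HL] := @nested_limit R (fun N => \sum_(1 <= n < N) f n * n%:R^-1)
     (fun m => 2 * M%:R * m%:R^-1) 1%N.
    move=> m N m1 mN; rewrite (@big_cat_nat _ _ _ m) //= [X in X - _]addrC addrK.
    by apply: (abel_bound fM inv_decr) => // n _; rewrite invr_ge0.
  by exists L => N; apply: HL.
have [L1 H1] := H _ char_sum_Re; have [L2 H2] := H _ char_sum_Im.
exists (Complex L1 L2) => N; rewrite /nm /Lpart cplx_ReD cplx_ImD cplx_Re_sum cplx_Im_sum /=.
under eq_bigr do rewrite cplx_ReZ; under [X in _ + `|X - _|]eq_bigr do rewrite cplx_ImZ.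
have -> : 4 * M%:R / N.+1%:R = 2 * M%:R / N.+1%:R + 2 * M%:R / N.+1%:R :> R by ring.
exact: lerD.
Qed.

Definition Lvalue : C := sval (cid Lvalue_exists).

Lemma LvalueP N : nm (Lpart N - Lvalue) <= 4 * M%:R / N.+1%:R.
Proof. by rewrite /Lvalue; case: cid. Qed.

Definition mangoldt_sum (x : nat) : C := \sum_(1 <= d < x.+1) chi d * rc (mangoldt R d / d%:R).

Lemma Lpart_divisors x d : (0 < d)%N -> (0 < x)%N -> nm (Lpart (x %/ d) - Lvalue) <= 4 * M%:R * (d%:R / x%:R).
Proof.
move=> d0 x0; apply: le_trans (LvalueP _) _; rewrite ler_wpM2l //.
have dp : 0 < d%:R :> R by rewrite ltr0n.
have xp : 0 < x%:R :> R by rewrite ltr0n.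
rewrite -[d%:R / x%:R]invrK lef_pV2 ?posrE ?invr_gt0 ?divr_gt0 ?ltr0n //.
by rewrite invf_div ler_pdivrMr // -natrM ler_nat ltnW // ltn_ceil.
Qed.

(** The quotient decreases once [ln n >= 1]; from 4 on this follows from [ln 4 = 2 ln 2] and
    [ln 2 >= 1/2]. *)
Lemma ln_over_decr n : (4 <= n)%N -> ln n.+1%:R / n.+1%:R <= ln n%:R / n%:R :> R.
Proof.
move=> n4; have n0 : (0 < n)%N by apply: leq_trans n4.
have np : 0 < n%:R :> R by rewrite ltr0n.
have ln2 : 2^-1 <= ln 2 :> R.
  have h : ln (1 + - 2^-1) <= - 2^-1 :> R by apply: le_ln1Dx; lra.
  have e : 1 + - 2^-1 = 2^-1 :> R by lra.
  rewrite e lnV ?posrE in h; lra.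
have ln4 : 1 <= ln n%:R :> R.
  apply: (@le_trans _ _ (ln 4)); last by rewrite ler_ln ?posrE ?ltr0n // (ler_nat R 4).
  have -> : 4 = 2 ^+ 2 :> R by ring.
  by rewrite lnXn ?ltr0n // mulr2n; lra.
have h : n%:R * (ln n.+1%:R - ln n%:R) <= 1 :> R.
  rewrite -ln_div ?posrE ?ltr0n // mulrC -ler_pdivlMr // mul1r.
  have -> : n.+1%:R / n%:R = 1 + n%:R^-1 :> R by rewrite -natr1 mulrDl divff ?mul1r ?gt_eqF.
  by apply: le_ln1Dx; apply: lt_trans (ltrN10 _) _; rewrite invr_gt0.
rewrite ler_pdivrMr ?ltr0n // mulrAC ler_pdivlMr // -natr1 in h *.
by rewrite natr1 in h *; nra.
Qed.

Lemma log_sum_bounded : exists C0, forall x, nm (\sum_(1 <= n < x.+1) chi n * rc (ln n%:R / n%:R)) <= C0.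
Proof.
pose T := \sum_(1 <= n < 4) nm (chi n * rc (ln n%:R / n%:R)).
have T0 : 0 <= T by apply: sumr_ge0 => n _; apply: nm_ge0.
have l4 : 0 <= ln (4%:R : R) / 4%:R by rewrite divr_ge0 // ln_ge0 // (ler_nat R 1).
exists (T + 4 * M%:R * (ln 4%:R / 4%:R)) => x.
have [x4|x4] := leqP 4 x.+1.
  rewrite (@big_cat_nat _ _ _ 4) //=; apply: le_trans (nmD _ _) _; apply: lerD; first exact: nm_sum.
  apply: (char_abel ln_over_decr) => // n n4; rewrite divr_ge0 // ln_ge0 // (ler_nat R 1).
  by apply: leq_trans n4.
apply: le_trans (nm_sum _ _ _) _.
rewrite /T (@big_cat_nat _ _ _ x.+1 1 4) //=; last exact: ltnW.
apply: ler_wpDr; first by apply: mulr_ge0 => //; apply: mulr_ge0.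
by rewrite lerDl; apply: sumr_ge0 => n _; exact: nm_ge0.
Qed.

(** Expanding [ln n] over divisors writes the bounded sum of [chi n * ln n / n] as [mangoldt_sum]
    with each term multiplied by a partial sum of the L-series. Replacing these by [Lvalue] costs
    [O(d/x)] each, in total [O(psi x / x)]. *)
Lemma mangoldt_sum_L : exists C0, forall x, nm (Lvalue * mangoldt_sum x) <= C0.
Proof.
have [C0 HC] := log_sum_bounded; exists (C0 + 32 * M%:R) => x.
have [->|x0] := posnP x.
  have := HC 0%N; rewrite /mangoldt_sum !big_geq // mulr0 nm0 => h; rewrite addr_ge0 //.
have xp : 0 < x%:R :> R by rewrite ltr0n.
have [_ cM _ _] := dchi.
have e1 : \sum_(1 <= n < x.+1) chi n * rc (ln n%:R / n%:R) =
    \sum_(1 <= d < x.+1) chi d * rc (mangoldt R d / d%:R) * Lpart (x %/ d).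
  under [in RHS]eq_bigr do rewrite /Lpart mulr_sumr.
  rewrite -(big_divisors_exchange _ x (fun d m => chi d * rc (mangoldt R d / d%:R) * (chi m * rc (m%:R^-1)))).
  apply: eq_big_nat => n /andP[n0 _]; rewrite -sum_mangoldt_divisors // mulr_suml rmorph_sum mulr_sumr.
  apply: eq_big_seq => d; rewrite -dvdn_divisors // => dn.
  have Dn : n = (d * (n %/ d))%N by rewrite mulnC divnK.
  rewrite {1 2}Dn cM natrM invfM !rmorphM /=; ring.
have -> : Lvalue * mangoldt_sum x = \sum_(1 <= n < x.+1) chi n * rc (ln n%:R / n%:R) -
    \sum_(1 <= d < x.+1) chi d * rc (mangoldt R d / d%:R) * (Lpart (x %/ d) - Lvalue).
  rewrite e1 /mangoldt_sum mulr_sumr -sumrB; apply: eq_bigr => d _; ring.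
apply: le_trans (nmB _ _) _; apply: lerD => //.
apply: le_trans (nm_sum _ _ _) _.
apply: (@le_trans _ _ (\sum_(1 <= d < x.+1) mangoldt R d * (8 * M%:R / x%:R))).
  rewrite big_nat_cond [X in _ <= X]big_nat_cond; apply: ler_sum => d; rewrite andbT => /andP[d0 _].
  have dp : 0 < d%:R :> R by rewrite ltr0n.
  apply: le_trans (nmM _ _) _; rewrite nmZ ger0_norm ?divr_ge0 ?mangoldt_ge0 //.
  have h1 := Lpart_divisors d0 x0; have h2 := char_nm d.
  have h3 : 0 <= mangoldt R d / d%:R by rewrite divr_ge0 ?mangoldt_ge0.
  apply: (@le_trans _ _ (2 * (mangoldt R d / d%:R) * (4 * M%:R * (d%:R / x%:R)))).
    by apply: ler_pM => //; first [exact: nm_ge0 | exact: ler_wpM2r | by rewrite mulr_ge0 ?nm_ge0].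
  rewrite le_eqVlt; apply/orP; left; apply/eqP; field; rewrite !gt_eqF //.
rewrite -mulr_suml -/(psi R x).
apply: (@le_trans _ _ (4 * x%:R * (8 * M%:R / x%:R))).
  by rewrite ler_wpM2r ?psi_le // divr_ge0 ?mulr_ge0 // ltW.
rewrite le_eqVlt; apply/orP; left; apply/eqP; field; rewrite gt_eqF //.
Qed.

Lemma mangoldt_sum_bounded : Lvalue != 0 -> exists C0, forall x, nm (mangoldt_sum x) <= C0.
Proof.
move=> L0; have [C0 HC] := mangoldt_sum_L; exists (nm Lvalue^-1 * C0) => x.
rewrite -[mangoldt_sum x](mulKf L0); apply: le_trans (nmM _ _) _.
by rewrite ler_wpM2l ?nm_ge0.
Qed.

(** The divisor sum of [mobius d * (ln x - ln d)] is [mangoldt n], plus [ln x] at [n = 1]. As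
    [Lvalue] is zero the cofactors [Lpart (x %/ d)] are [O(d/x)], and the sum of [ln x - ln d] is at
    most [x] by [lnfact_ge]. *)
Lemma mangoldt_sum_zero : Lvalue = 0 -> exists C0, forall x, (0 < x)%N ->
  nm (mangoldt_sum x + rc (ln x%:R)) <= C0.
Proof.
move=> L0; exists (8 * M%:R) => x x0.
have xp : 0 < x%:R :> R by rewrite ltr0n.
have [c1 cM _ _] := dchi.
have -> : mangoldt_sum x + rc (ln x%:R) =
    \sum_(1 <= d < x.+1) chi d * rc (mobius R d / d%:R * (ln x%:R - ln d%:R)) * Lpart (x %/ d).
  under [in RHS]eq_bigr do rewrite /Lpart mulr_sumr.
  rewrite -(big_divisors_exchange _ x (fun d m => chi d * rc (mobius R d / d%:R * (ln x%:R - ln d%:R)) * (chi m * rc (m%:R^-1)))).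
  have -> : rc (ln x%:R) = \sum_(1 <= n < x.+1) chi n * rc ((n == 1%N)%:R * ln x%:R / n%:R).
    rewrite big_ltn // c1 (_ : (1%N == 1%N)%:R = 1 :> R) // divr1 !mul1r [X in _ + X]big_nat_cond big1 ?addr0 //.
    move=> n; rewrite andbT => /andP[n1 _]; rewrite gtn_eqF // !mul0r rmorph0 mulr0 //.
  rewrite /mangoldt_sum -big_split /=; apply: eq_big_nat => n /andP[n0 _].
  rewrite -sum_mobius // -[mangoldt R n]opprK -sum_mobius_ln // -mulrDr -rmorphD /=.
  rewrite !mulr_suml -sumrN mulr_suml -big_split /= rmorph_sum mulr_sumr.
  apply: eq_big_seq => d; rewrite -dvdn_divisors // => dn.
  have Dn : n = (d * (n %/ d))%N by rewrite mulnC divnK.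
  rewrite Dn mulKn ?(dvdn_gt0 n0 dn) // cM natrM invfM.
  rewrite [RHS]mulrACA -rmorphM; congr (_ * rc _); ring.
apply: le_trans (nm_sum _ _ _) _.
apply: (@le_trans _ _ (\sum_(1 <= d < x.+1) (ln x%:R - ln d%:R) * (8 * M%:R / x%:R))).
  rewrite big_nat_cond [X in _ <= X]big_nat_cond; apply: ler_sum => d; rewrite andbT ltnS => /andP[d0 dx].
  have dp : 0 < d%:R :> R by rewrite ltr0n.
  have l0 : 0 <= ln x%:R - ln d%:R :> R by rewrite subr_ge0 ler_ln ?posrE // ler_nat.
  apply: le_trans (nmM _ _) _; rewrite nmZ.
  have h1 := Lpart_divisors d0 x0; rewrite L0 subr0 in h1.
  have h2 := char_nm d.
  have h3 : `|mobius R d / d%:R * (ln x%:R - ln d%:R)| <= (d%:R)^-1 * (ln x%:R - ln d%:R).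
    rewrite !normrM (ger0_norm l0) ler_wpM2r // normfV (ger0_norm (ltW dp)).
    by rewrite -[X in _ <= X]mul1r ler_wpM2r ?invr_ge0 ?mobius_norm // ltW.
  apply: (@le_trans _ _ (2 * ((d%:R)^-1 * (ln x%:R - ln d%:R)) * (4 * M%:R * (d%:R / x%:R)))).
    apply: ler_pM => //; rewrite ?mulr_ge0 ?nm_ge0 //.
    by apply: ler_pM => //; rewrite nm_ge0.
  rewrite le_eqVlt; apply/orP; left; apply/eqP; field; rewrite !gt_eqF //.
rewrite -mulr_suml sumrB sumr_const_nat subn1 /= -/(lnfact R x).
have h := lnfact_ge R x.
have h2 : 0 <= 8 * M%:R / x%:R :> R by rewrite divr_ge0 ?mulr_ge0 // ltW.
apply: (@le_trans _ _ (x%:R * (8 * M%:R / x%:R))).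
  rewrite ler_wpM2r //; rewrite -[_ *+ x]mulr_natl; lra.
rewrite le_eqVlt; apply/orP; left; apply/eqP; field; rewrite gt_eqF //.
Qed.

End DirichletCharacter.

Section Nonvanishing.

Import complex.

Variable R : realType.
Local Notation C := (complex R).
Local Notation Re := complex.Re.
Local Notation Im := complex.Im.
Local Notation rc := (real_complex R).

Lemma dirichlet_char_sq M (chi : nat -> C) :
  dirichlet_char M chi -> dirichlet_char M (fun n => chi n ^+ 2).
Proof.
move=> [c1 cM cP cN]; split=> [|m n|n|n]; first by rewrite c1 expr1n.
- by rewrite cM exprMn.
- by rewrite cP.
have [->|h] := cN n; [by left; rewrite expr0n | right].
rewrite expr2 cplx_ReM cplx_ImM -(expr1n _ 2) -h; ring.
Qed.

Lemma Re_mangoldt_sum (chi : nat -> C) x :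
  Re (mangoldt_sum chi x) = \sum_(1 <= d < x.+1) Re (chi d) * (mangoldt R d / d%:R).
Proof. by rewrite /mangoldt_sum cplx_Re_sum; apply: eq_bigr => d _; rewrite cplx_ReZ. Qed.

Variables (M : nat) (chi : nat -> C).
Hypothesis (M0 : (0 < M)%N) (dchi : dirichlet_char M chi) (nchi : nonprincipal M chi).

(* [3 + 4 Re chi + Re (chi^2) = 2 (1 + Re chi)^2 >= 0] where [chi] does not vanish. *)
Lemma nonvanishing_complex : nonprincipal M (fun n => chi n ^+ 2) -> Lvalue M0 dchi nchi != 0.
Proof.
move=> nchi2; apply/eqP => L0; have dchi2 := dirichlet_char_sq dchi.
have [C1 H1] := mangoldt_sum_zero L0.
(* Only an upper bound is asked for: were the L-value of the square zero too, its sum would be near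
   [- ln x]. *)
have [C2 H2] : exists C2, forall x, (0 < x)%N -> Re (mangoldt_sum (fun n => chi n ^+ 2) x) <= C2.
  have [L2|L2] := eqVneq (Lvalue M0 dchi2 nchi2) 0.
    have [C2 H2] := mangoldt_sum_zero L2; exists C2 => x x0.
    have := H2 x x0; have := Re_le_nm (mangoldt_sum (fun n => chi n ^+ 2) x + rc (ln x%:R)).
    rewrite cplx_ReD /= => h1 h2; have := le_trans h1 h2; rewrite ler_norml => /andP[_ h3].
    have := lnn_ge0 R x; lra.
  have [C2 H2] := mangoldt_sum_bounded L2; exists C2 => x _.
  by apply: le_trans (H2 x); apply: le_trans (Re_le_nm _); apply: ler_norm.
(* The combination below is at most [3 (ln N + 4) + 4 (C1 - ln N) + C2], which is negative for this
   [N]. *)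
have [N N0 HN] := ln_unbounded (12 + 4 * C1 + C2).
have h1 : Re (mangoldt_sum chi N) <= C1 - ln N%:R.
  have := H1 N N0; have := Re_le_nm (mangoldt_sum chi N + rc (ln N%:R)).
  rewrite cplx_ReD /= => a b; have := le_trans a b; rewrite ler_norml => /andP[_]; lra.
have h2 := H2 N N0.
have h3 := mertens_upper R N.
have : 0 <= 3 * (\sum_(1 <= d < N.+1) mangoldt R d / d%:R) + 4 * Re (mangoldt_sum chi N)
     + Re (mangoldt_sum (fun n => chi n ^+ 2) N).
  rewrite !Re_mangoldt_sum !mulr_sumr -!big_split /=; apply: sumr_ge0 => d _.
  have l0 : 0 <= mangoldt R d / d%:R by rewrite divr_ge0 ?mangoldt_ge0.
  have -> : forall a u v : R, 3 * a + 4 * (u * a) + v * a = (3 + 4 * u + v) * a by move=> *; ring.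
  rewrite mulr_ge0 //.
  have [_ _ _ /(_ d)[->|h]] := dchi; first by rewrite expr0n /=; lra.
  rewrite expr2 cplx_ReM.
  have -> : 3 + 4 * Re (chi d) + (Re (chi d) * Re (chi d) - Im (chi d) * Im (chi d)) =
    2 * (1 + Re (chi d)) ^+ 2 by move: h; rewrite !expr2; lra.
  by rewrite mulr_ge0 // sqr_ge0.
lra.
Qed.

Lemma nonvanishing_real : (forall n, chi n ^+ 2 = 0 \/ chi n ^+ 2 = 1) -> Lvalue M0 dchi nchi != 0.
Proof.
move=> real; apply/eqP => L0.
have cv n : [\/ chi n = 0, chi n = 1 | chi n = -1].
  have [/eqP|/eqP] := real n; first by rewrite sqrf_eq0 => /eqP; constructor 1.
  by rewrite sqrf_eq1 => /orP[] /eqP; [constructor 2 | constructor 3].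
have im0 n : Im (chi n) = 0 by case: (cv n) => ->; rewrite /= ?oppr0.
have [c1 cM _ _] := dchi.
apply: (@realchar_nonvanishing R (fun n => Re (chi n)) M%:R (4 * M%:R)).
- by rewrite c1.
- by move=> m n; rewrite cM cplx_ReM !im0 mulr0 subr0.
- by move=> n; case: (cv n) => ->; [constructor 1 | constructor 2 | constructor 3].
- exact: (char_sum_Re M0 dchi nchi).
move=> N; have := LvalueP M0 dchi nchi N; rewrite L0 subr0.
apply: le_trans; apply: le_trans (Re_le_nm _); rewrite /Lpart cplx_Re_sum.
by under eq_bigr do rewrite -cplx_ReZ.
Qed.

Lemma nonprincipal_mangoldt_bounded :
  nonprincipal M (fun n => chi n ^+ 2) \/ (forall n, chi n ^+ 2 = 0 \/ chi n ^+ 2 = 1) ->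
  exists C0, forall x, nm (mangoldt_sum chi x) <= C0.
Proof.
by move=> [/nonvanishing_complex|/nonvanishing_real]; apply: mangoldt_sum_bounded.
Qed.

End Nonvanishing.

(** * Removing prime powers and primes dividing the modulus *)

Section PrimePowers.

Variable R : realType.
Local Notation lnn n := (ln (n%:R : R)).

Lemma geometric_sum_le (a : R) m N : 0 <= a -> a < 1 -> \sum_(m <= k < N) a ^+ k <= a ^+ m / (1 - a).
Proof.
move=> a0 a1; have d0 : 0 < 1 - a by rewrite subr_gt0.
have [mN|/ltnW Nm] := leqP m N; last by rewrite big_geq // divr_ge0 ?exprn_ge0 // ltW.
rewrite ler_pdivlMr // mulr_suml.
rewrite (@telescope_sumr_eq _ m N (fun k => - a ^+ k)) //; last by move=> k _; rewrite exprS; ring.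
by rewrite opprK addrC lerBlDr lerDl exprn_ge0.
Qed.

Lemma sum_delta_le (f : nat -> R) a x : (forall n, 0 <= f n) ->
  \sum_(1 <= d < x.+1) (if d == a then f d else 0) <= f a.
Proof.
move=> f0; rewrite -big_mkcond /= big_mkcond.
have [/andP[a0 ax]|na] := boolP ((1 <= a) && (a < x.+1))%N; last first.
  rewrite big_nat_cond big1 // => d; rewrite andbT => dr; case: eqP => // e.
  by rewrite -e dr in na.
rewrite (@big_cat_nat _ _ _ a 1 x.+1) //=; last exact: ltnW.
rewrite big_nat_cond big1 ?add0r; last first.
  by move=> d; rewrite andbT => /andP[_ da]; rewrite ltn_eqF.
rewrite big_ltn // eqxx big_nat_cond big1 ?addr0 // => d; rewrite andbT => /andP[ad _].
by rewrite gtn_eqF.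
Qed.

(** [Pp] records which primes, and [k0] which least exponent, the discarded integers [Q] can
    have. *)
Lemma mangoldt_filter_bound (Q : pred nat) (Pp : pred nat) k0 x :
  (forall p k, prime p -> (1 <= k)%N -> Q (p ^ k)%N -> Pp p && (k0 <= k)%N) ->
  \sum_(1 <= d < x.+1 | Q d) mangoldt R d / d%:R <=
  \sum_(0 <= p < x.+1 | prime p && Pp p) \sum_(k0 <= k < x.+1) lnn p * (p%:R^-1) ^+ k.
Proof.
move=> HQ.
have t0 p k : 0 <= lnn p * (p%:R^-1) ^+ k by rewrite mulr_ge0 ?lnn_ge0 // exprn_ge0 ?invr_ge0.
apply: (@le_trans _ _ (\sum_(1 <= d < x.+1) \sum_(0 <= p < x.+1 | prime p && Pp p) \sum_(1 <= k < x.+1 | (k0 <= k)%N)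
   (if d == (p ^ k)%N then lnn p / d%:R else 0))).
  rewrite big_mkcond big_nat_cond [X in _ <= X]big_nat_cond; apply: ler_sum => d; rewrite andbT ltnS => /andP[d0 dx].
  case: ifP => [Qd|_]; last first.
    apply: sumr_ge0 => p _; apply: sumr_ge0 => k _; case: ifP => // _; by rewrite divr_ge0 ?lnn_ge0.
  rewrite (mangoldt_wide R dx) mulr_suml [X in _ <= X]big_mkcond [X in X <= _]big_mkcond /=.
  apply: ler_sum => p _; case: ifP => //= pr.
  rewrite mulr_suml; case: ifP => [Pp1|nPp].
    rewrite [X in _ <= X]big_mkcond [X in X <= _]big_nat_cond [X in _ <= X]big_nat_cond.
    apply: ler_sum => k; rewrite andbT => /andP[k1 _].
    case: eqP => [e|_]; last by rewrite mul0r; case: ifP.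
    by have /andP[_ ->] := HQ p k pr k1 (eq_ind _ Q Qd _ e).
  rewrite big_nat_cond big1 // => k; rewrite andbT => /andP[k1 _].
  case: eqP => [e|_]; last by rewrite mul0r.
  by have := HQ p k pr k1 (eq_ind _ Q Qd _ e); rewrite nPp.
rewrite exchange_big; apply: ler_sum => p /andP[pr _].
rewrite exchange_big /=.
apply: (@le_trans _ _ (\sum_(1 <= k < x.+1 | (k0 <= k)%N) lnn p * (p%:R^-1) ^+ k)).
  apply: ler_sum => k _; apply: le_trans (sum_delta_le (f := fun d => lnn p / d%:R) _ _ _) _.
    by move=> n; rewrite divr_ge0 ?lnn_ge0.
  by rewrite natrX exprVn.
have [kx|xk] := leqP k0 x.+1; last first.
  rewrite [X in _ <= X]big_geq ?(ltnW xk) // big_nat_cond big1 // => k /andP[/andP[_ h1] h2].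
  by have := leq_trans h1 (leq_trans (ltnW xk) h2); rewrite ltnn.
have [k01|k01] := leqP 1 k0.
  rewrite (@big_cat_nat _ _ _ k0 1 x.+1) //= [X in X + _]big_nat_cond [X in X + _]big1 ?add0r; last first.
    by move=> k /andP[/andP[_ h1] h2]; rewrite ltnNge h2 in h1.
  by rewrite big_mkcond; apply: ler_sum => k _; case: ifP.
move: k01; rewrite ltnS leqn0 => /eqP k00.
by rewrite k00 [X in _ <= X]big_ltn // ler_wpDl // big_mkcond; apply: ler_sum => k _; case: ifP.
Qed.

Lemma inv_prime p : prime p -> 0 <= p%:R^-1 :> R /\ p%:R^-1 <= 2^-1 :> R.
Proof.
move=> pr; rewrite invr_ge0 ler0n; split=> //.
by rewrite lef_pV2 ?posrE ?ltr0n ?prime_gt0 // (ler_nat R 2) prime_gt1.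
Qed.

(** Only the finitely many primes dividing [M] are affected, each through a convergent geometric
    series. *)
Lemma mangoldt_coprime M : (0 < M)%N -> exists C0, forall x, (0 < x)%N ->
  `|\sum_(1 <= d < x.+1 | coprime M d) mangoldt R d / d%:R - lnn x| <= C0.
Proof.
move=> M0; exists (4 + \sum_(0 <= p < M.+1) lnn p) => x x0.
have T0 : 0 <= \sum_(0 <= p < M.+1) lnn p by apply: sumr_ge0 => p _; apply: lnn_ge0.
have up := mertens_upper R x; have lo := mertens_lower R x.
rewrite (bigID (coprime M)) /= in up lo.
have b0 : 0 <= \sum_(1 <= d < x.+1 | ~~ coprime M d) mangoldt R d / d%:R.
  by apply: sumr_ge0 => d _; rewrite divr_ge0 ?mangoldt_ge0.
have b1 : \sum_(1 <= d < x.+1 | ~~ coprime M d) mangoldt R d / d%:R <= \sum_(0 <= p < M.+1) lnn p.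
  apply: le_trans (@mangoldt_filter_bound (fun d => ~~ coprime M d) (fun p => p %| M)%N 1 x _) _.
    move=> p k pr k1; rewrite coprime_sym coprime_pexpl // prime_coprime // negbK => ->.
    by rewrite k1.
  apply: (@le_trans _ _ (\sum_(0 <= p < x.+1 | prime p && (p %| M)%N) lnn p)).
    apply: ler_sum => p /andP[pr _]; rewrite -mulr_sumr -[X in _ <= X]mulr1 ler_wpM2l ?lnn_ge0 //.
    have [i0 i1] := inv_prime pr.
    apply: le_trans (geometric_sum_le _ _ i0 _) _; first lra.
    by rewrite expr1 ler_pdivrMr; lra.
  rewrite big_mkcond [X in _ <= X]big_mkcond /=.
  have h p : prime p && (p %| M)%N -> (p < M.+1)%N by move=> /andP[_ /(dvdn_leq M0)]; rewrite ltnS.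
  have [le|/ltnW le] := leqP x.+1 M.+1.
    rewrite [X in _ <= X](@big_cat_nat _ _ _ x.+1) //= ler_wpDr //.
      by apply: sumr_ge0 => p _; apply: lnn_ge0.
    by apply: ler_sum => p _; case: ifP => // _; apply: lnn_ge0.
  rewrite (@big_cat_nat _ _ _ M.+1 0 x.+1) //= [X in _ + X]big_nat_cond [X in _ + X]big1 ?addr0; last first.
    move=> p; rewrite andbT => /andP[Mp _]; case: ifP => // /h; by rewrite ltnNge Mp.
  by apply: ler_sum => p _; case: ifP => // _; apply: lnn_ge0.
by rewrite ler_norml; apply/andP; split; lra.
Qed.

Lemma isq3_sum_le N : \sum_(2 <= n < N) (n%:R * Num.sqrt n%:R)^-1 <= 2 :> R.
Proof.
suff H : forall N, (2 <= N)%N -> \sum_(2 <= n < N) (n%:R * Num.sqrt n%:R)^-1 <= 2 - 2 / Num.sqrt (N.-1)%:R :> R.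
  have [le|/ltnW le] := leqP 2 N; last by rewrite big_geq.
  by apply: le_trans (H N le) _; rewrite lerBlDr lerDl divr_ge0 // sqrtr_ge0.
elim=> // n IH; rewrite leq_eqVlt => /predU1P[<-|]; first by rewrite big_geq // sqrtr1 divr1 subrr.
rewrite ltnS => n2; rewrite big_nat_recr //=; have := IH n2.
have [k Dk] : exists k, n = k.+1 by case: (n) n2 => // k _; exists k.
have k0 : (0 < k)%N by move: n2; rewrite Dk.
rewrite Dk /=; set a := Num.sqrt k%:R; set b := Num.sqrt k.+1%:R.
have a0 : 0 < a by apply: sqrtn_gt0.
have b0 : 0 < b by apply: sqrtn_gt0.
have ab : b * b = a * a + 1 by rewrite !sqr_sqrtn natr1.
have le : a <= b by rewrite ler_wsqrtr // ler_nat.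
have -> : k.+1%:R = b * b by rewrite sqr_sqrtn.
have : (b * b * b)^-1 <= 2 / a - 2 / b.
  have -> : 2 / a - 2 / b = 2 * (b - a) / (a * b) by field; rewrite !gt_eqF.
  have e1 : b - a = (a + b)^-1.
    have abn0 : a + b != 0 by rewrite gt_eqF // addr_gt0.
    apply: (mulIf abn0); rewrite mulVf //; lra.
  rewrite e1 ler_pdivlMr ?mulr_gt0 // mulrC ler_pdivrMr ?mulr_gt0 //.
  rewrite mulrAC ler_pdivlMr ?addr_gt0 //.
  have : a * (a + b) <= 2 * (b * b) by nra.
  move=> h; have := ler_wpM2l (ltW b0) h; lra.
lra.
Qed.

Lemma ln_le_sqrt n : (0 < n)%N -> lnn n <= 2 * Num.sqrt n%:R.
Proof.
move=> n0; rewrite -[X in ln X](sqr_sqrtn R) -expr2 lnXn ?sqrtn_gt0 //.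
rewrite mulr_natl lerMn2r /=.
have s0 := sqrtn_gt0 R n0.
have : ln (1 + (Num.sqrt n%:R - 1)) <= Num.sqrt n%:R - 1 :> R by apply: le_ln1Dx; lra.
by rewrite addrC subrK; lra.
Qed.

(** Summing over exponents from 2 on leaves [2 ln p / p^2], and [ln p <= 2 sqrt p] reduces it to the
    convergent series with exponent 3/2. *)
Lemma mangoldt_nonprime_bound x : \sum_(1 <= d < x.+1 | ~~ prime d) mangoldt R d / d%:R <= 8.
Proof.
apply: le_trans (@mangoldt_filter_bound (fun d => ~~ prime d) predT 2 x _) _.
  by move=> p [|[|k]] pr // _; rewrite expn1 pr.
apply: (@le_trans _ _ (\sum_(0 <= p < x.+1 | prime p && predT p) 4 * (p%:R * Num.sqrt p%:R)^-1)).
  apply: ler_sum => p /andP[pr _]; rewrite -mulr_sumr.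
  have [i0 i1] := inv_prime pr; have p0 := prime_gt0 pr.
  have s0 := sqrtn_gt0 R p0.
  apply: (@le_trans _ _ (lnn p * (2 * p%:R^-1 ^+ 2))).
    rewrite ler_wpM2l ?lnn_ge0 //; apply: le_trans (geometric_sum_le _ _ i0 _) _; first lra.
    rewrite ler_pdivrMr; last lra.
    by have := sqr_ge0 (p%:R^-1 : R); nra.
  apply: (@le_trans _ _ (2 * Num.sqrt p%:R * (2 * p%:R^-1 ^+ 2))).
    by rewrite ler_wpM2r ?mulr_ge0 ?sqr_ge0 // ln_le_sqrt.
  rewrite le_eqVlt; apply/orP; left; apply/eqP.
  move: s0 (sqr_sqrtn R p); move: (Num.sqrt p%:R) => s s0 e; rewrite -e; field.
  by rewrite gt_eqF.
apply: (@le_trans _ _ (\sum_(2 <= p < x.+1) 4 * (p%:R * Num.sqrt p%:R)^-1)).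
  have f0 p : 0 <= 4 * (p%:R * Num.sqrt p%:R)^-1 :> R by rewrite mulr_ge0 // invr_ge0 mulr_ge0 // sqrtr_ge0.
  case: x => [|x]; first by rewrite big_mkcond big_nat1 big_geq.
  rewrite big_mkcond (@big_cat_nat _ _ _ 2) //= big_mkord big_ord_recl big_ord1 /= !add0r.
  by apply: ler_sum => p _; case: ifP.
rewrite -mulr_sumr; have := isq3_sum_le x.+1; lra.
Qed.

End PrimePowers.

(** * Characters of a finite abelian group, given by exponents *)

Section CharacterGroup.

Import classfun character.

Variable gT : finGroupType.
Hypothesis abT : abelian [set: gT].
(** The factor 2 keeps [N] above 1, so that ['Z_N] has exactly [N] elements even for the trivial
    group. *)
Let N := (2 * #|gT|)%N.

Lemma char_order_gt1 : (1 < N)%N.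
Proof.
have : (0 < #|gT|)%N by apply/card_gt0P; exists 1%g.
by rewrite /N; case: #|gT| => // k _; rewrite mulnS.
Qed.

(** Storing exponents instead of values lets characters obtained over [algC] act in any field with a
    primitive [N]-th root of unity. *)
Definition homs : {set {ffun gT -> 'Z_N}} :=
  [set l : {ffun gT -> 'Z_N} | [forall u, forall v, l (u * v)%g == l u + l v]].

Lemma homsP (l : {ffun gT -> 'Z_N}) : reflect (forall u v, l (u * v)%g = l u + l v) (l \in homs).
Proof.
rewrite inE; apply: (iffP forallP) => [h u v|h u]; first by have /forallP/(_ v)/eqP := h u.
by apply/forallP => v; rewrite h.
Qed.

Lemma homs0 : 0 \in homs.
Proof. by apply/homsP => u v; rewrite !ffunE addr0. Qed.

Lemma homsD l m : l \in homs -> m \in homs -> l + m \in homs.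
Proof. by move=> /homsP hl /homsP hm; apply/homsP => u v; rewrite !ffunE hl hm addrACA. Qed.

Lemma homsN l : l \in homs -> - l \in homs.
Proof. by move=> /homsP hl; apply/homsP => u v; rewrite !ffunE hl opprD. Qed.

Lemma homs1 l : l \in homs -> l 1%g = 0.
Proof. by move=> /homsP /(_ 1%g 1%g); rewrite mulg1 => /eqP; rewrite -[X in X == _]addr0 (inj_eq (addrI _)) eq_sym => /eqP. Qed.

Section PrimitiveRoot.

Variables (K : fieldType) (w : K).
Hypothesis prw : N.-primitive_root w.

Lemma root_valD (a b : 'Z_N) : w ^+ (a + b : 'Z_N)%R = w ^+ a * w ^+ b.
Proof. have -> : ((a + b)%R = (a + b) %% N :> nat)%N.
  by congr modn; apply: Zp_cast char_order_gt1.
by rewrite (prim_expr_mod prw) exprD. Qed.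

Lemma root_val_inj (a b : 'Z_N) : w ^+ a = w ^+ b -> a = b.
Proof.
have lt (c : 'Z_N) : (c < N)%N by rewrite -[X in (_ < X)%N](Zp_cast char_order_gt1).
by move=> /eqP; rewrite (eq_prim_root_expr prw) !modn_small // => /eqP /val_inj.
Qed.

End PrimitiveRoot.

(** Irreducible characters of an abelian group are linear and their kernels meet trivially; one that
    is not 1 at [u] is converted to exponents. *)
Lemma homs_separate u : u != 1%g -> exists2 l, l \in homs & l u != 0.
Proof.
move=> u1; have N0 : (0 < N)%N by apply: ltn_trans char_order_gt1.
have [z0 prz] := C_prim_root_exists N0.
have lin := char_abelianP _ abT.
have root i v : 'chi[[set: gT]%G]_i v ^+ N = 1.
  have h : 'chi[[set: gT]%G]_i v ^+ #[v]%g = 1 by apply: lin_char_unity_root; rewrite ?inE.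
  have /dvdnP[k ->] : (#[v]%g %| N)%N by rewrite dvdn_mull // -cardsT order_dvdG ?inE.
  by rewrite mulnC exprM h expr1n.
have ex i v : exists k : 'Z_N, 'chi[[set: gT]%G]_i v = z0 ^+ k.
  have [k Dk] := prim_rootP prz (root i v).
  have lk : (k < (Zp_trunc N).+2)%N by rewrite (Zp_cast char_order_gt1).
  by exists (Ordinal lk).
have [i ci] : exists i, 'chi[[set: gT]%G]_i u != 1.
  apply/existsP; rewrite -negb_forall; apply: contraNN u1 => /forallP h.
  have : u \in \bigcap_i cfker 'chi[[set: gT]%G]_i.
    by apply/bigcapP => i _; rewrite cfkerEirr inE lin_char1 ?h.
  by rewrite TI_cfker_irr inE.
have [f Df] := choice (ex i).
exists [ffun v => f v].
  apply/homsP => v v'; rewrite !ffunE; apply: (root_val_inj prz).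
  by rewrite (root_valD prz) -!Df lin_charM ?inE.
by rewrite ffunE; apply: contra_neq ci => h; rewrite Df h expr0.
Qed.

(** Translating by a homomorphism that is nontrivial at [u] multiplies the sum by a scalar other
    than 1. *)
Lemma homs_orthogonal (K : fieldType) (w : K) u : N.-primitive_root w ->
  \sum_(l in homs) w ^+ l u = if u == 1%g then #|homs|%:R else 0.
Proof.
move=> prw; case: eqP => [->|/eqP u1].
  by rewrite (eq_bigr (fun _ => 1)) ?sumr_const // => l hl; rewrite homs1 ?expr0.
have [m hm mu] := homs_separate u1.
have wm : w ^+ m u != 1.
  by apply: contraNneq mu => h; apply/eqP/(root_val_inj prw); rewrite h expr0.
apply/eqP; rewrite -(mulrI_eq0 _ (lregP (_ : w ^+ m u - 1 != 0))) ?subr_eq0 //.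
rewrite mulrBl mul1r subr_eq0 mulr_sumr [X in _ == X](reindex_inj (addrI m)) /=.
apply/eqP/eq_big => [l|l hl].
  apply/idP/idP => [/(homsD hm)//|h].
  by rewrite -(addKr m l) homsD ?homsN.
by rewrite ffunE (root_valD prw).
Qed.

Lemma homs_char_orthogonal (K : fieldType) (w : K) l : N.-primitive_root w -> l \in homs -> l != 0 ->
  exists2 u, w ^+ l u != 1 & forall v, w ^+ l (u * v)%g = w ^+ l u * w ^+ l v.
Proof.
move=> prw hl l0.
have [u lu] : exists u, l u != 0.
  apply/existsP; rewrite -negb_forall; apply: contraNN l0 => /forallP h.
  by apply/eqP/ffunP => u; rewrite ffunE; apply/eqP/h.
exists u; last by move=> v; rewrite (homsP _ hl) (root_valD prw).
by apply: contraNneq lu => h; apply/eqP/(root_val_inj prw); rewrite h expr0.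
Qed.

End CharacterGroup.

(** * Selecting a residue class by orthogonality *)

Section ArithmeticProgression.

Import complex.

Variables (R : realType) (M : nat).
Hypothesis M1 : (1 < M)%N.
Local Notation C := (complex R).
Local Notation Re := complex.Re.
Local Notation Im := complex.Im.
Local Notation rc := (real_complex R).
Local Notation lnn n := (ln (n%:R : R)).
Local Notation G := {unit 'Z_M}.
Local Notation N := (2 * #|{: G}|)%N.

Lemma complex_prim_root n : (n > 0)%N -> exists z : C, n.-primitive_root z.
Proof.
pose p : {poly C} := 'X^n - 1; have [r Dp] := closed_field_poly_normal p.
move=> n_gt0; rewrite (monicP _) ?monicXnsubC // scale1r in Dp.
have rn1 : all n.-unity_root r by apply/allP=> z; rewrite -root_prod_XsubC -Dp.
have sz_r : (n < (size r).+1)%N by rewrite -(size_prod_XsubC r id) -Dp size_XnsubC.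
have [|z] := hasP (has_prim_root n_gt0 rn1 _ sz_r); last by exists z.
by rewrite -separable_prod_XsubC -Dp separable_Xn_sub_1 // pnatr_eq0 -lt0n.
Qed.

Lemma unity_root_modulus (z : C) n : (0 < n)%N -> z ^+ n = 1 -> Re z ^+ 2 + Im z ^+ 2 = 1.
Proof.
move=> n0 zn; pose m (z : C) := Re z ^+ 2 + Im z ^+ 2.
have mM a b : m (a * b) = m a * m b by rewrite /m cplx_ReM cplx_ImM; ring.
have m1 : m 1 = 1 by rewrite /m /= expr0n expr1n addr0.
have mX k : m (z ^+ k) = m z ^+ k by elim: k => [|k IH]; rewrite ?m1 // !exprS mM IH.
have m0 : 0 <= m z by rewrite addr_ge0 ?sqr_ge0.
by apply/eqP; rewrite -(@pexpr_eq1 _ _ n) // -mX zn m1.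
Qed.

Lemma abelian_units : abelian [set: G].
Proof. by apply/centsP => u _ v _; apply: unit_Zp_mulgC. Qed.

Definition unit_of (n : nat) : G := insubd (1%g : G) (n%:R : 'Z_M).

Lemma unit_ofE n : coprime M n -> val (unit_of n) = n%:R.
Proof. by move=> c; rewrite val_insubd unitZpE // c. Qed.

Lemma unit_ofM m n : coprime M m -> coprime M n -> unit_of (m * n) = (unit_of m * unit_of n)%g.
Proof.
by move=> cm cn; apply: val_inj; rewrite /= !unit_ofE ?coprimeMr ?cm // natrM.
Qed.

Lemma unit_of_eq m n : coprime M m -> coprime M n -> (unit_of m == unit_of n) = (m == n %[mod M]).
Proof.
move=> cm cn; rewrite -val_eqE /= !unit_ofE // -val_eqE /= !val_Zp_nat //.
Qed.

Lemma unit_of_repr (u : G) : exists2 n, coprime M n & unit_of n = u.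
Proof.
have vu : (val u : nat)%:R = val u by rewrite natr_Zp.
have c : coprime M (val u : nat) by rewrite -unitZpE // vu (valP u).
by exists (val u : nat) => //; apply: val_inj; rewrite unit_ofE.
Qed.

Variable w : C.
Hypothesis prw : N.-primitive_root w.

Definition residue_char (l : {ffun G -> 'Z_N}) (n : nat) : C :=
  if coprime M n then w ^+ l (unit_of n) else 0.

Lemma Gorder_gt0 : (0 < N)%N.
Proof. exact: ltn_trans (char_order_gt1 _). Qed.

Lemma residue_char_dirichlet l : l \in homs _ -> dirichlet_char M (residue_char l).
Proof.
move=> hl; split=> [|m n|n|n].
- rewrite /residue_char coprimen1.
  have -> : unit_of 1 = 1%g by apply: val_inj; rewrite unit_ofE ?coprimen1.
  by rewrite homs1 // expr0.
- rewrite /residue_char coprimeMr; case: (boolP (coprime M m)) => cm /=; last by rewrite mul0r.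
  case: (boolP (coprime M n)) => cn /=; last by rewrite mulr0.
  by rewrite unit_ofM // (homsP _ hl) (root_valD prw).
- have e : coprime M (n + M) = coprime M n by rewrite -(coprime_modr M (n + M)) modnDr coprime_modr.
  rewrite /residue_char e; case: ifP => // cn.
  by congr (w ^+ l _); apply/eqP; rewrite unit_of_eq ?e // modnDr.
rewrite /residue_char; case: ifP => _; [right | by left].
apply: (@unity_root_modulus _ N Gorder_gt0).
by rewrite -exprM mulnC exprM (prim_expr_order prw) expr1n.
Qed.

(** Multiplication by a unit of character value other than 1 permutes the residues and rescales the
    sum. *)
Lemma residue_char_nonprincipal l : l \in homs _ -> l != 0 -> nonprincipal M (residue_char l).
Proof.
move=> hl l0; have [u wu _] := homs_char_orthogonal prw hl l0.
have [a ca Da] := unit_of_repr u.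
have [_ cM cP _] := residue_char_dirichlet hl.
have M0 : (0 < M)%N by apply: ltn_trans M1.
have per n : residue_char l (n %% M) = residue_char l n.
  by rewrite {2}(divn_eq n M); elim: (n %/ M)%N => [|k IH]; rewrite ?mul0n // mulSn -addnA addnC cP.
have wa : residue_char l a != 1 by rewrite /residue_char ca Da.
rewrite /nonprincipal; apply/eqP.
rewrite -(mulrI_eq0 _ (lregP (_ : residue_char l a - 1 != 0))) ?subr_eq0 //.
rewrite mulrBl mul1r subr_eq0 mulr_sumr; apply/eqP.
rewrite big_mkord [RHS]big_mkord.
pose f (i : 'I_M) : 'I_M := Ordinal (ltn_pmod (a * i) M0).
have finj : injective f.
  move=> i j /(congr1 val) /= /eqP; wlog le : i j / (j <= i)%N => [hw|].
    by case: (leqP j i) => [/hw//|/ltnW le] e; rewrite (hw _ _ le) // eq_sym.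
  rewrite eqn_mod_dvd ?leq_mul // -mulnBr Gauss_dvdr // -eqn_mod_dvd //.
  by rewrite !modn_small // => /eqP /val_inj.
rewrite [RHS](reindex_inj finj).
by apply: eq_bigr => i _; rewrite /= per cM.
Qed.

Lemma residue_char_sq l n : residue_char l n ^+ 2 = residue_char (l + l) n.
Proof.
by rewrite /residue_char; case: ifP => _; rewrite ?expr0n // ffunE (root_valD prw) expr2.
Qed.

(** The square belongs to [l + l]: either this is 0, the real case, or the square is nonprincipal
    again. *)
Lemma residue_mangoldt_bounded l : l \in homs _ -> l != 0 ->
  exists C0, forall x, nm (mangoldt_sum (residue_char l) x) <= C0.
Proof.
move=> hl l0; have M0 : (0 < M)%N by apply: ltn_trans M1.
apply: (nonprincipal_mangoldt_bounded M0 (residue_char_dirichlet hl) (residue_char_nonprincipal hl l0)).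
have [e|ne] := eqVneq (l + l) 0.
  right=> n; rewrite residue_char_sq e /residue_char; case: ifP => _; [right | by left].
  by rewrite ffunE expr0.
left; rewrite /nonprincipal (eq_bigr (residue_char (l + l))); last by move=> n _; rewrite residue_char_sq.
by apply: residue_char_nonprincipal; rewrite ?homsD.
Qed.

Lemma residue_char_detect b d : coprime M b ->
  \sum_(l in homs _) w ^+ (l (unit_of b)^-1)%g * residue_char l d =
  if d == b %[mod M] then #|homs G|%:R else 0.
Proof.
move=> cb; rewrite /residue_char; case: (boolP (coprime M d)) => cd; last first.
  rewrite big1 => [|l _]; last by rewrite mulr0.
  case: eqP => // e; move: cd; rewrite -coprime_modr e coprime_modr cb //.
have e : (unit_of d == unit_of b) = ((unit_of b)^-1 * unit_of d == 1)%g by rewrite eq_sym eq_mulVg1.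
rewrite -unit_of_eq // e -(homs_orthogonal abelian_units ((unit_of b)^-1 * unit_of d)%g prw).
by apply: eq_bigr => l hl; rewrite (homsP _ hl) (root_valD prw).
Qed.

(** After weighting by inverse character values at [b], the trivial character supplies [ln x] and
    the others stay bounded. *)
Lemma mangoldt_class b : coprime M b -> exists C0, forall x, (0 < x)%N ->
  `|#|homs G|%:R * \sum_(1 <= d < x.+1 | d == b %[mod M]) mangoldt R d / d%:R - lnn x| <= C0.
Proof.
move=> cb.
have ex l : exists C0, l \in homs G -> l != 0 -> forall x, nm (mangoldt_sum (residue_char l) x) <= C0.
  have [hl|_] := boolP (l \in homs _); last by exists 0.
  have [_|l0] := eqVneq l 0; first by exists 0.
  by have [C0 H] := residue_mangoldt_bounded hl l0; exists C0.
have [f Hf] := choice ex.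
have [C1 H1] := mangoldt_coprime R (ltnW M1).
exists (\sum_(l in homs G | l != 0) 2 * f l + C1) => x x0.
have nmw k : nm (w ^+ k) <= 2.
  have : Re (w ^+ k) ^+ 2 + Im (w ^+ k) ^+ 2 = 1.
    by apply: (@unity_root_modulus _ N Gorder_gt0); rewrite -exprM mulnC exprM (prim_expr_order prw) expr1n.
  rewrite /nm -(real_normK (num_real (Re _))) -(real_normK (num_real (Im _))).
  move: (normr_ge0 (Re (w ^+ k))) (normr_ge0 (Im (w ^+ k))); set a1 := `|Re _|; set a2 := `|Im _| => p1 p2 h.
  have : a1 <= 1 by nra.
  have : a2 <= 1 by nra.
  lra.
have E : rc (#|homs G|%:R * \sum_(1 <= d < x.+1 | d == b %[mod M]) mangoldt R d / d%:R) =
   \sum_(l in homs G) w ^+ (l (unit_of b)^-1)%g * mangoldt_sum (residue_char l) x.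
  rewrite /mangoldt_sum; under [RHS]eq_bigr do rewrite mulr_sumr.
  rewrite exchange_big /= mulr_sumr rmorph_sum /= big_mkcond /=.
  apply: eq_bigr => d _; under eq_bigr do rewrite mulrA.
  rewrite -mulr_suml residue_char_detect //; case: ifP => _; last by rewrite mul0r.
  by rewrite rmorphM rmorph_nat.
rewrite (bigD1 (0 : {ffun G -> 'Z_N})) ?homs0 //= in E.
rewrite ffunE expr0 mul1r in E.
have E0 : mangoldt_sum (residue_char 0) x = rc (\sum_(1 <= d < x.+1 | coprime M d) mangoldt R d / d%:R).
  rewrite /mangoldt_sum rmorph_sum [RHS]big_mkcond /=; apply: eq_bigr => d _.
  by rewrite /residue_char ffunE expr0; case: ifP => _; rewrite ?mul1r ?mul0r.
rewrite -nm_rc rmorphB /= E E0 addrAC -rmorphB.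
apply: le_trans (nmD _ _) _; rewrite addrC lerD ?nm_rc ?H1 //.
apply: le_trans (nm_sum _ _ _) _; apply: ler_sum => l /andP[hl l0].
apply: le_trans (nmM _ _) _; apply: ler_pM => //; rewrite ?nm_ge0 //; exact: Hf.
Qed.

End ArithmeticProgression.

Section MertensAP.

Import complex.

Variable R : realType.
Local Notation lnn n := (ln (n%:R : R)).

Lemma mangoldt_prime q : prime q -> mangoldt R q = lnn q.
Proof.
by move=> pr; have := @mangoldt_pfactor R q 1 1 pr isT (coprimen1 _) isT; rewrite expn1 muln1 eqxx mulr1.
Qed.

(** The density is the inverse of the number of characters; afterwards only its positivity matters.
    Proper prime powers account for the extra 8. *)
Theorem mertens_AP M b : (1 < M)%N -> coprime M b ->
  exists2 delta : R, 0 < delta & exists C0, forall x, (0 < x)%N ->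
  `|\sum_(1 <= q < x.+1 | prime q && (q == b %[mod M])) lnn q / q%:R - delta * lnn x| <= C0.
Proof.
move=> M1 cb.
have [w prw] := complex_prim_root R (Gorder_gt0 M).
have [C0 H] := mangoldt_class M1 prw cb.
set h := #|homs _| in H.
have h0 : 0 < h%:R :> R by rewrite ltr0n; apply/card_gt0P; exists 0; apply: homs0.
exists h%:R^-1; first by rewrite invr_gt0.
exists (h%:R^-1 * C0 + 8) => x x0; have := H x x0.
rewrite (bigID prime) /=.
set A := \sum_(1 <= d < x.+1 | (d == b %[mod M]) && prime d) _.
set B := \sum_(1 <= d < x.+1 | (d == b %[mod M]) && ~~ prime d) _.
have -> : \sum_(1 <= q < x.+1 | prime q && (q == b %[mod M])) lnn q / q%:R = A.
  by apply: eq_big => [q|q /andP[pr _]]; rewrite 1?andbC // mangoldt_prime.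
have B0 : 0 <= B by apply: sumr_ge0 => d _; rewrite divr_ge0 ?mangoldt_ge0.
have B8 : B <= 8.
  apply: le_trans (mangoldt_nonprime_bound R x); rewrite /B big_mkcond [X in _ <= X]big_mkcond /=.
  apply: ler_sum => d _; case: (prime d); rewrite ?andbF ?andbT //=.
  by case: ifP => // _; rewrite divr_ge0 ?mangoldt_ge0.
move=> h1; have : `|h%:R^-1 * (h%:R * (A + B) - lnn x)| <= h%:R^-1 * C0.
  by rewrite normrM (ger0_norm (_ : 0 <= h%:R^-1)) ?ler_wpM2l // invr_ge0 ltW.
rewrite mulrBr mulKf ?gt_eqF // !ler_norml => /andP[h2 h3]; apply/andP; split; lra.
Qed.

End MertensAP.

(** * Multiplicative weights on squarefree integers *)

Lemma big_hyperbola (T : Type) (idx : T) (op : Monoid.com_law idx) (x : nat) (f : nat -> nat -> T) :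
  \big[op/idx]_(1 <= d < x.+1) \big[op/idx]_(1 <= m < (x %/ d).+1) f d m =
  \big[op/idx]_(1 <= m < x.+1) \big[op/idx]_(1 <= d < (x %/ m).+1) f d m.
Proof.
have H g : \big[op/idx]_(1 <= d < x.+1) \big[op/idx]_(1 <= m < (x %/ d).+1) g d m =
    \big[op/idx]_(1 <= d < x.+1) \big[op/idx]_(1 <= m < x.+1) (if (m * d <= x)%N then g d m else idx).
  apply: eq_big_nat => d /andP[d0 _].
  rewrite (big_nat_widen _ _ x.+1) ?ltnS ?leq_div // big_mkcond /=.
  by apply: eq_bigr => m _; rewrite ltnS leq_divRL.
rewrite H (H (fun m d => f d m)) exchange_big_nat /=.
by apply: eq_bigr => m _; apply: eq_bigr => d _; rewrite mulnC.
Qed.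

Lemma sum_nat_cut (R : realType) (f : nat -> R) z N : (forall n, 0 <= f n) ->
  \sum_(1 <= d < N.+1 | (d <= z)%N) f d <= \sum_(1 <= d < z.+1) f d.
Proof.
move=> f0; have [Nz|/ltnW zN] := leqP N z; last first.
  rewrite (big_nat_widen 1 z.+1 N.+1) ?ltnS //.
rewrite [X in _ <= X](@big_cat_nat _ _ _ N.+1) ?ltnS //= ler_wpDr ?sumr_ge0 //.
by rewrite big_mkcond; apply: ler_sum => d _; case: ifP.
Qed.

Lemma natural_root K y : (0 < K)%N -> (0 < y)%N -> exists z, [/\ (0 < z)%N, (z ^ K <= y)%N & (y < z.+1 ^ K)%N].
Proof.
move=> K0 y0.
have ex : exists z, (z ^ K <= y)%N by exists 0%N; rewrite exp0n.
have ub z : (z ^ K <= y)%N -> (z <= y)%N.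
  apply: leq_trans; case: z => // z; rewrite -{1}(expn1 z.+1).
  by case: z => [|z]; [rewrite !exp1n | rewrite leq_exp2l].
case: (ex_maxnP ex ub) => z zK zmax; exists z; split=> //.
  by apply: zmax; rewrite exp1n.
by rewrite ltnNge; apply/negP => /zmax; rewrite ltnn.
Qed.

Section Weights.

Variable R : realType.
Implicit Types (w : nat -> R) (x y m n q : nat).
Local Notation lnn n := (ln (n%:R : R)).

Lemma swt_ge0 w n : (forall q, 0 <= w q) -> 0 <= swt w n.
Proof. by move=> w0; apply: prodr_ge0 => q _; case: ifP. Qed.

Lemma swt_prime w q : prime q -> swt w q = w q.
Proof.
by move=> pr; have := swt_pfactor w pr (isT : (0 < 1)%N) (coprimen1 _) isT; rewrite expn1 muln1 eqxx swt1 mulr1.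
Qed.

Lemma swt_eq w1 w2 n : (0 < n)%N -> (forall q, (q <= n)%N -> w1 q = w2 q) -> swt w1 n = swt w2 n.
Proof.
move=> n0 h; apply: eq_big_seq => q; rewrite mem_primes => /and3P[_ _ qn].
by rewrite (h _ (dvdn_leq n0 qn)).
Qed.

Lemma swt_vanish w n q : q \in primes n -> w q = 0 -> swt w n = 0.
Proof.
by move=> qn wq; rewrite /swt (bigD1_seq q) ?primes_uniq //= wq if_same mul0r.
Qed.

Lemma swt_square w p n : prime p -> (0 < n)%N -> (p ^ 2 %| n)%N -> swt w n = 0.
Proof.
move=> pr n0 pn; have pm : p \in primes n by rewrite mem_primes pr n0 (dvdn_trans _ pn) ?dvdn_exp.
rewrite /swt (bigD1_seq p) ?primes_uniq //=; case: eqP => [l1|_]; last by rewrite mul0r.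
by move: pn; rewrite pfactor_dvdn // l1.
Qed.

(** No prime carries both weights, so a squarefree integer of nonzero weight splits in exactly one
    way. *)
Lemma swt_conv w1 w2 n : (forall q, w1 q * w2 q = 0) -> (0 < n)%N ->
  swt (fun q => w1 q + w2 q) n = \sum_(d <- divisors n) swt w1 d * swt w2 (n %/ d).
Proof.
move=> disj; move: n; apply: pfactor_ind.
  by rewrite (_ : divisors 1 = [:: 1%N]) // big_seq1 divn1 !swt1 mulr1.
move=> p e m pr e0 cp m0 IH.
pose c w i := if i == 0%N then 1 else if i == 1%N then w p else 0.
have cE w i d : coprime p d -> (0 < d)%N -> swt w (p ^ i * d) = c w i * swt w d.
  case: i => [|i] cd d0; first by rewrite expn0 mul1n mul1r.
  by rewrite swt_pfactor.
rewrite swt_pfactor // IH big_divisors_pfactor //=.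
transitivity (\sum_(i < e.+1) c w1 i * c w2 (e - i)%N * \sum_(d <- divisors m) swt w1 d * swt w2 (m %/ d)).
  rewrite -mulr_suml; congr (_ * _).
  case: e e0 => [//|[|[|e]]] _.
  - by rewrite !big_ord_recl big_ord0 /c /= mul1r mulr1 addr0 addrC.
  - by rewrite !big_ord_recl big_ord0 /c /= mulr0 add0r mul0r addr0 disj addr0.
  rewrite big1 // => -[[|[|i]] lt] _ /=.
  - by rewrite /c subn0 mulr0.
  - by rewrite /c subSS subn0 mulr0.
  by rewrite /c mul0r.
apply: eq_bigr => i _; rewrite mulr_sumr; apply: eq_big_seq => d; rewrite -dvdn_divisors // => dm.
have d0 := dvdn_gt0 m0 dm; have cd := coprime_dvdr dm cp.
have -> : ((p ^ e * m) %/ (p ^ i * d) = p ^ (e - i) * (m %/ d))%N.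
  have -> : (p ^ e * m = (p ^ i * d) * (p ^ (e - i) * (m %/ d)))%N.
    rewrite -{1}(divnK dm) -{1}(subnKC (ltnSE (ltn_ord i))) expnD; lia.
  by rewrite mulKn // muln_gt0 expn_gt0 prime_gt0.
have cmd : coprime p (m %/ d) by rewrite (coprime_dvdr _ cp) // dvdn_div.
rewrite !cE //; first ring.
by rewrite divn_gt0 // dvdn_leq.
Qed.

Definition swt_count w x := \sum_(1 <= n < x.+1) swt w n.
Definition swt_recip w x := \sum_(1 <= n < x.+1) swt w n / n%:R.

Lemma swt_term_ge0 w n : (forall q, 0 <= w q) -> 0 <= swt w n / n%:R.
Proof. by move=> w0; rewrite divr_ge0 ?swt_ge0. Qed.

Lemma swt_count_ge0 w x : (forall q, 0 <= w q) -> 0 <= swt_count w x.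
Proof. by move=> w0; apply: sumr_ge0 => n _; apply: swt_ge0. Qed.

Lemma swt_recip_ge0 w x : (forall q, 0 <= w q) -> 0 <= swt_recip w x.
Proof. by move=> w0; apply: sumr_ge0 => n _; apply: swt_term_ge0. Qed.

Lemma swt_recip_mono w x y : (forall q, 0 <= w q) -> (x <= y)%N -> swt_recip w x <= swt_recip w y.
Proof.
move=> w0 xy; rewrite /swt_recip [X in _ <= X](@big_cat_nat _ _ _ x.+1) ?ltnS //=.
by rewrite lerDl sumr_ge0 // => n _; apply: swt_term_ge0.
Qed.

Lemma swt_count_conv w1 w2 x : (forall q, w1 q * w2 q = 0) ->
  swt_count (fun q => w1 q + w2 q) x = \sum_(1 <= d < x.+1) swt w1 d * swt_count w2 (x %/ d).
Proof.
move=> disj; under eq_bigr do rewrite mulr_sumr.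
rewrite -(big_divisors_exchange _ x (fun d m => swt w1 d * swt w2 m)).
by apply: eq_big_nat => n /andP[n0 _]; rewrite swt_conv.
Qed.

Lemma swt_recip_conv w1 w2 x : (forall q, w1 q * w2 q = 0) ->
  swt_recip (fun q => w1 q + w2 q) x = \sum_(1 <= d < x.+1) swt w1 d / d%:R * swt_recip w2 (x %/ d).
Proof.
move=> disj; under eq_bigr do rewrite mulr_sumr.
rewrite -(big_divisors_exchange _ x (fun d m => swt w1 d / d%:R * (swt w2 m / m%:R))).
apply: eq_big_nat => n /andP[n0 _]; rewrite swt_conv // mulr_suml.
apply: eq_big_seq => d; rewrite -dvdn_divisors // => dn.
by rewrite -{2}(divnK dn) natrM invfM; ring.
Qed.

Lemma swt_recip_mul_ge w1 w2 x : (forall q, 0 <= w1 q) -> (forall q, 0 <= w2 q) -> (forall q, w1 q * w2 q = 0) ->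
  swt_recip (fun q => w1 q + w2 q) x <= swt_recip w1 x * swt_recip w2 x.
Proof.
move=> w10 w20 disj; rewrite swt_recip_conv // mulr_suml; apply: ler_sum => d _.
by rewrite ler_wpM2l ?swt_term_ge0 // swt_recip_mono // leq_div.
Qed.

Lemma swt_recip_mul_le w1 w2 x y : (forall q, 0 <= w1 q) -> (forall q, 0 <= w2 q) -> (forall q, w1 q * w2 q = 0) ->
  (0 < y)%N -> swt_recip w1 x * swt_recip w2 y <= swt_recip (fun q => w1 q + w2 q) (x * y).
Proof.
move=> w10 w20 disj y0; rewrite swt_recip_conv // mulr_suml.
rewrite [X in _ <= X](@big_cat_nat _ _ _ x.+1) ?ltnS ?leq_pmulr //= ler_wpDr //.
  by apply: sumr_ge0 => d _; rewrite mulr_ge0 ?swt_term_ge0 ?swt_recip_ge0.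
rewrite big_nat_cond [X in _ <= X]big_nat_cond; apply: ler_sum => d; rewrite andbT => /andP[d0 dx].
by rewrite ler_wpM2l ?swt_term_ge0 // swt_recip_mono // leq_divRL // mulnC leq_mul2r -ltnS dx orbT.
Qed.

(** [mangoldt] restricts [d] to prime powers, and squarefreeness of [d * m] to primes not dividing
    [m]. *)
Lemma swt_mangoldt w d m : (forall q, 0 <= w q) -> (0 < d)%N -> (0 < m)%N ->
  swt w (d * m) * mangoldt R d <= (if prime d then w d else 0) * swt w m * mangoldt R d.
Proof.
move=> w0 d0 m0.
have R0 : 0 <= (if prime d then w d else 0) * swt w m * mangoldt R d.
  by rewrite mulr_ge0 ?mangoldt_ge0 // mulr_ge0 ?swt_ge0 //; case: ifP.
have [d1|d1] := eqVneq d 1%N.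
  have := @sum_mangoldt_divisors R 1 isT; rewrite (_ : divisors 1 = [:: 1%N]) // big_seq1 ln1 => e.
  by rewrite d1 e !mulr0.
have dgt1 : (1 < d)%N by rewrite ltn_neqAle eq_sym d1.
have pr := pdiv_prime dgt1; set p := pdiv d in pr.
have [r cr Dd] := pfactor_coprime pr d0.
have l0 : (0 < logn p d)%N by rewrite logn_gt0 mem_primes pr d0 pdiv_dvd.
have r0 : (0 < r)%N by case: r cr Dd => // _ e; move: d0; rewrite e mul0n.
have [r1|r1] := eqVneq r 1%N; last first.
  suff -> : mangoldt R d = 0 by rewrite !mulr0.
  by rewrite Dd mulnC mangoldt_pfactor // (negbTE r1) mulr0.
move: Dd; rewrite r1 mul1n; case e: (logn p d) l0 => [//|[|k]] _ Dd; last first.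
  by rewrite (@swt_square w p) ?mul0r ?muln_gt0 ?d0 // Dd dvdn_mulr // dvdn_exp2l.
move: Dd; rewrite expn1 => Dd; rewrite Dd pr.
have [pm|npm] := boolP (p %| m)%N.
  have pm0 : (0 < p * m)%N by rewrite muln_gt0 m0 prime_gt0.
  have pp : (p ^ 2 %| p * m)%N by rewrite expnS expn1 dvdn_mul.
  rewrite (swt_square w pr pm0 pp) mul0r.
  by rewrite mulr_ge0 ?mangoldt_ge0 // mulr_ge0 ?swt_ge0.
have cpm : coprime p m by rewrite prime_coprime.
by have := swt_pfactor w pr (isT : (0 < 1)%N) cpm m0; rewrite expn1 eqxx => ->.
Qed.

Lemma ln_le_sub1 (t : R) : 0 < t -> ln t <= t - 1.
Proof. by move=> t0; have := @le_ln1Dx R (t - 1); rewrite (addrC 1) subrK; apply; lra. Qed.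

(** Write [ln x = ln n + ln (x/n)]. The first part is expanded by [mangoldt], with Chebyshev's bound
    applied for each cofactor; the second is at most [x/n]. *)
Lemma swt_count_upper w (k : R) x : (forall q, 0 <= w q) -> (forall q, w q <= k) -> (0 < x)%N ->
  swt_count w x * lnn x <= (4 * k + 1) * x%:R * swt_recip w x.
Proof.
move=> w0 wk x0; have k0 : 0 <= k by apply: le_trans (w0 0%N) (wk 0%N).
have x0' : 0 < x%:R :> R by rewrite ltr0n.
have H1 : \sum_(1 <= n < x.+1) swt w n * lnn n <= k * (4 * x%:R * swt_recip w x).
  have -> : \sum_(1 <= n < x.+1) swt w n * lnn n =
     \sum_(1 <= n < x.+1) \sum_(d <- divisors n) swt w (d * (n %/ d)) * mangoldt R d.
    apply: eq_big_nat => n /andP[n0 _]; rewrite -sum_mangoldt_divisors // mulr_sumr.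
    by apply: eq_big_seq => d; rewrite -dvdn_divisors // => dn; rewrite (mulnC d) divnK.
  rewrite (big_divisors_exchange _ x (fun d m => swt w (d * m) * mangoldt R d)) /=.
  apply: (@le_trans _ _ (\sum_(1 <= d < x.+1) \sum_(1 <= m < (x %/ d).+1) k * swt w m * mangoldt R d)).
    rewrite big_nat_cond [X in _ <= X]big_nat_cond; apply: ler_sum => d; rewrite andbT => /andP[d0 _].
    rewrite big_nat_cond [X in _ <= X]big_nat_cond; apply: ler_sum => m; rewrite andbT => /andP[m0 _].
    apply: le_trans (swt_mangoldt w0 d0 m0) _.
    by rewrite ler_wpM2r ?mangoldt_ge0 // ler_wpM2r ?swt_ge0 //; case: ifP.
  rewrite big_hyperbola /= /swt_recip !mulr_sumr.
  rewrite big_nat_cond [X in _ <= X]big_nat_cond; apply: ler_sum => m; rewrite andbT => /andP[m0 _].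
  rewrite -mulr_sumr -mulrA ler_wpM2l //.
  apply: (@le_trans _ _ (swt w m * (4 * (x %/ m)%:R))).
    by rewrite ler_wpM2l ?swt_ge0 // psi_le.
  have : (x %/ m)%:R <= x%:R / m%:R :> R.
    by rewrite ler_pdivlMr ?ltr0n // -natrM ler_nat leq_divM.
  have s0 := swt_ge0 m w0 => h; have := ler_wpM2l s0 h; lra.
have H2 : \sum_(1 <= n < x.+1) swt w n * (lnn x - lnn n) <= x%:R * swt_recip w x.
  rewrite /swt_recip mulr_sumr.
  rewrite big_nat_cond [X in _ <= X]big_nat_cond; apply: ler_sum => n; rewrite andbT => /andP[n0 _].
  have n0' : 0 < n%:R :> R by rewrite ltr0n.
  rewrite mulrCA ler_wpM2l ?swt_ge0 //.
  have := @ln_le_sub1 (x%:R / n%:R) (divr_gt0 x0' n0'); rewrite ln_div ?posrE //; lra.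
have -> : swt_count w x * lnn x = \sum_(1 <= n < x.+1) swt w n * lnn n + \sum_(1 <= n < x.+1) swt w n * (lnn x - lnn n).
  by rewrite -big_split /= mulr_suml; apply: eq_bigr => n _; ring.
lra.
Qed.

(** With [weight_on] it splits a weight into parts with disjoint supports, to which the convolution
    lemmas apply. *)
Definition weight_off (Q : pred nat) w q := if Q q then 0 else w q.
Definition weight_on (Q : pred nat) w q := if Q q then w q else 0.

Lemma weight_off_ge0 Q w : (forall q, 0 <= w q) -> forall q, 0 <= weight_off Q w q.
Proof. by move=> w0 q; rewrite /weight_off; case: ifP. Qed.

Lemma weight_on_ge0 Q w : (forall q, 0 <= w q) -> forall q, 0 <= weight_on Q w q.
Proof. by move=> w0 q; rewrite /weight_on; case: ifP. Qed.

Lemma weight_on_off Q w : (fun q => weight_on Q w q + weight_off Q w q) = w.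
Proof. by apply: funext => q; rewrite /weight_on /weight_off; case: ifP; rewrite ?addr0 ?add0r. Qed.

Lemma weight_disj Q w q : weight_on Q w q * weight_off Q w q = 0.
Proof. by rewrite /weight_on /weight_off; case: ifP; rewrite ?mulr0 ?mul0r. Qed.

(** A prime in [Q] times an integer free of [Q], both at most [x], is an integer up to [x * x] that
    determines the two factors. *)
Lemma swt_recip_sieve w Q x : (forall q, 0 <= w q) -> (0 < x)%N ->
  (\sum_(1 <= q < x.+1 | prime q && Q q) w q / q%:R) * swt_recip (weight_off Q w) x <= swt_recip w (x * x).
Proof.
move=> w0 x0; have on0 := weight_on_ge0 Q w0; have off0 := weight_off_ge0 Q w0.
have := swt_recip_mul_le x on0 off0 (weight_disj Q w) x0; rewrite weight_on_off.
apply: le_trans.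
rewrite ler_wpM2r ?swt_recip_ge0 //.
rewrite /swt_recip big_mkcond; apply: ler_sum => q _; case: ifP => [/andP[pr Qq]|_]; last exact: swt_term_ge0.
by rewrite swt_prime // /weight_on Qq.
Qed.

(** [B] is so large that Mertens' theorem at [u] and at [u / B] differs by more than 1 after both
    errors; on the interval [ln q / q] is at most [B ln u / u]. *)
Lemma prime_interval_AP M b : (1 < M)%N -> coprime M b -> exists B c, [/\ (1 < B)%N, 0 < c :> R &
  forall u, (B <= u)%N -> c * u%:R <= lnn u * \sum_((u %/ B).+1 <= q < u.+1 | prime q && (q == b %[mod M])) 1].
Proof.
move=> M1 cb; have [delta d0 [C0 H]] := mertens_AP R M1 cb.
have [B B0 HB] := ln_unbounded ((2 * `|C0| + 1) / delta).
have lB : 2 * `|C0| + 1 < delta * lnn B by rewrite (mulrC delta) -ltr_pdivrMr.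
have C0n : C0 <= `|C0| by apply: ler_norm.
have Cn0 := normr_ge0 C0.
have B1 : (1 < B)%N.
  case: B B0 lB {HB} => [//|[|//]] _; rewrite ln1 mulr0; lra.
exists B, B%:R^-1; split=> //; first by rewrite invr_gt0 ltr0n.
move=> u Bu; have u0 : (0 < u)%N by apply: leq_trans Bu.
set v := (u %/ B)%N; have v0 : (0 < v)%N by rewrite divn_gt0.
have vu : (v <= u)%N by apply: leq_div.
have u0' : 0 < u%:R :> R by rewrite ltr0n.
have B0' : 0 < B%:R :> R by rewrite ltr0n.
have lnvB : lnn v + lnn B <= lnn u.
  by rewrite -lnM ?posrE ?ltr0n // ler_ln ?posrE ?mulr_gt0 ?ltr0n // -natrM ler_nat leq_divM.
have Hu := H u u0; have Hv := H v v0.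
move: Hu; rewrite (@big_cat_nat _ _ _ v.+1) ?ltnS //=.
set Sv := \sum_(1 <= q < v.+1 | _) _ in Hv *.
set T := \sum_(v.+1 <= q < u.+1 | _) _.
move=> Hu; have T1 : 1 <= T.
  move: Hu Hv; rewrite !ler_norml => /andP[h1 h2] /andP[h3 h4].
  have := ler_wpM2l (ltW d0) lnvB; lra.
have : T <= lnn u * (B%:R / u%:R) * \sum_(v.+1 <= q < u.+1 | prime q && (q == b %[mod M])) 1.
  rewrite mulr_sumr /T big_nat_cond [X in _ <= X]big_nat_cond; apply: ler_sum => q /andP[/andP[vq qu] /andP[pr _]].
  rewrite mulr1; have q0 := prime_gt0 pr; apply: ler_pM; rewrite ?lnn_ge0 ?invr_ge0 //.
    by rewrite ler_ln ?posrE ?ltr0n // ler_nat.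
  rewrite ler_pdivlMr // mulrC ler_pdivrMr ?ltr0n // -natrM ler_nat.
  by apply: ltnW; apply: leq_trans (ltn_ceil u (ltnW B1)) _; rewrite mulnC leq_mul2l vq orbT.
move=> h; have {h} := le_trans T1 h.
have := u0'; move: (u%:R : R) => U U0 h.
move: h; set S := \sum_(_ <= q < _ | _) _ => h.
have Bi : 0 < B%:R^-1 :> R by rewrite invr_gt0.
have := ler_wpM2l (ltW (mulr_gt0 Bi U0)) h; rewrite mulr1.
rewrite (_ : B%:R^-1 * U * (ln U * (B%:R / U) * S) = ln U * S) //.
by field; rewrite !gt_eqF.
Qed.

(** Only products [d * q] are kept, with [d <= y] and [q > y] a prime of the class at most [x/d];
    for each [d] there are at least a constant times [x / (d ln x)] such [q]. *)
Lemma swt_count_lower M b : (1 < M)%N -> coprime M b -> exists B c, 0 < c :> R /\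
  forall w y x, (forall q, 0 <= w q) -> (forall q, prime q -> q == b %[mod M] -> 1 <= w q) ->
  (B <= y)%N -> (y ^ 4 <= x)%N -> c * x%:R * swt_recip w y <= swt_count w x * lnn x.
Proof.
move=> M1 cb; have [B [c [B1 c0 H]]] := prime_interval_AP M1 cb.
exists B, (c / 2); split; first by rewrite divr_gt0.
move=> w y x w0 w1 By yx.
have y0 : (0 < y)%N by apply: leq_trans By; apply: ltnW.
have yy : (y <= x)%N by apply: leq_trans yx; rewrite -{1}(expn1 y) leq_pexp2l.
pose Q q := (q <= y)%N.
have off0 := weight_off_ge0 Q w0.
rewrite -{2}(weight_on_off Q w) swt_count_conv; last exact: weight_disj.
rewrite (@big_cat_nat _ _ _ y.+1) ?ltnS //= mulrDl ler_wpDr //.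
  by rewrite mulr_ge0 ?lnn_ge0 // sumr_ge0 // => d _; rewrite mulr_ge0 ?swt_ge0 ?swt_count_ge0 //; apply: weight_on_ge0.
rewrite /swt_recip mulr_sumr mulr_suml big_nat_cond [X in _ <= X]big_nat_cond.
apply: ler_sum => d; rewrite andbT ltnS => /andP[d0 dy].
have -> : swt (weight_on Q w) d = swt w d.
  by apply: swt_eq => // q qd; rewrite /weight_on /Q (leq_trans qd dy).
rewrite [X in X <= _](_ : _ = swt w d * (c / 2 * x%:R / d%:R)); last by ring.
rewrite -[X in _ <= X]mulrA ler_wpM2l ?swt_ge0 //.
set u := (x %/ d)%N.
(* As [d] and [B] are at most [y] and [y^4 <= x], the primes found above [u / B] exceed [y]. *)
have yB : (y * B <= u)%N.
  rewrite leq_divRL //; apply: leq_trans yx; rewrite !expnS expn0 muln1 -mulnA leq_mul2l; apply/orP; right.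
  by apply: leq_trans (leq_mul By dy) _; rewrite leq_mul2l leq_pmulr // orbT.
have Bu : (B <= u)%N by apply: leq_trans yB; rewrite leq_pmull.
have u0 : (0 < u)%N by apply: leq_trans Bu; apply: ltnW.
have Hu := H u Bu.
have cnt : \sum_((u %/ B).+1 <= q < u.+1 | prime q && (q == b %[mod M])) 1 <= swt_count (weight_off Q w) u.
  rewrite /swt_count [X in _ <= X](@big_cat_nat _ _ _ (u %/ B).+1) ?ltnS ?leq_div //= ler_wpDl //.
    by apply: sumr_ge0 => n _; apply: swt_ge0.
  rewrite big_mkcond big_nat_cond [X in _ <= X]big_nat_cond; apply: ler_sum => q; rewrite andbT => /andP[uq _].
  case: ifP => [/andP[pr e]|_]; last exact: swt_ge0.
  rewrite swt_prime // /weight_off /Q leqNgt.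
  have -> /= : (y < q)%N by apply: leq_ltn_trans uq; rewrite leq_divRL // ltnW.
  exact: w1.
have ux : lnn u <= lnn x.
  have x0 : (0 < x)%N by apply: leq_trans yy.
  by rewrite ler_ln ?posrE ?ltr0n // ler_nat leq_div.
have xu : x%:R <= 2 * (u%:R * d%:R) :> R.
  rewrite -!natrM ler_nat mulnA; have := ltn_ceil x d0; rewrite -/u mulSn; nia.
have d0' : 0 < d%:R :> R by rewrite ltr0n.
apply: (@le_trans _ _ (c * u%:R)).
  rewrite ler_pdivrMr //.
  have := ler_wpM2l (ltW c0) xu; lra.
apply: le_trans Hu _; rewrite mulrC; apply: ler_pM; rewrite ?lnn_ge0 //.
by apply: sumr_ge0.
Qed.

(** The first moment of [ln n]: expanding it by [mangoldt] involves primes up to [z] only, and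
    Mertens' bound at [z] applies. *)
Lemma swt_smooth_log w (k : R) z N : (forall q, 0 <= w q) -> (forall q, w q <= k) ->
  (forall q, (z < q)%N -> w q = 0) ->
  \sum_(1 <= n < N.+1) swt w n / n%:R * lnn n <= k * (lnn z + 4) * swt_recip w N.
Proof.
move=> w0 wk wz; have k0 : 0 <= k by apply: le_trans (w0 0%N) (wk 0%N).
have -> : \sum_(1 <= n < N.+1) swt w n / n%:R * lnn n =
   \sum_(1 <= n < N.+1) \sum_(d <- divisors n) swt w (d * (n %/ d)) * mangoldt R d / (d * (n %/ d))%:R.
  apply: eq_big_nat => n /andP[n0 _]; rewrite -sum_mangoldt_divisors // mulr_sumr.
  by apply: eq_big_seq => d; rewrite -dvdn_divisors // => dn; rewrite (mulnC d) divnK // mulrAC.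
rewrite (big_divisors_exchange _ N (fun d m => swt w (d * m) * mangoldt R d / (d * m)%:R)) /=.
apply: (@le_trans _ _ (\sum_(1 <= d < N.+1 | (d <= z)%N) (k * (mangoldt R d / d%:R) * swt_recip w N))).
  rewrite [X in _ <= X]big_mkcond big_nat_cond [X in _ <= X]big_nat_cond; apply: ler_sum => d; rewrite andbT => /andP[d0 dN].
  have L0 : 0 <= mangoldt R d / d%:R by rewrite divr_ge0 ?mangoldt_ge0.
  apply: (@le_trans _ _ (\sum_(1 <= m < (N %/ d).+1) (if (d <= z)%N then k else 0) * (mangoldt R d / d%:R) * (swt w m / m%:R))).
    rewrite big_nat_cond [X in _ <= X]big_nat_cond; apply: ler_sum => m; rewrite andbT => /andP[m0 _].
    have := swt_mangoldt w0 d0 m0 => h.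
    have i0 : 0 <= (d * m)%:R^-1 :> R by rewrite invr_ge0.
    apply: le_trans (ler_wpM2r i0 h) _; rewrite natrM invfM.
    rewrite [X in _ <= X](_ : _ = (if (d <= z)%N then k else 0) * swt w m * mangoldt R d * (d%:R^-1 * m%:R^-1)); last by ring.
    rewrite ler_wpM2r ?mulr_ge0 ?invr_ge0 // ler_wpM2r ?mangoldt_ge0 // ler_wpM2r ?swt_ge0 //.
    case: (leqP d z) => [_|/wz ->]; last by rewrite if_same.
    by case: ifP.
  rewrite -mulr_sumr; case: ifP => _; last by rewrite !mul0r.
  by apply: ler_wpM2l; [rewrite mulr_ge0 | apply: (swt_recip_mono w0 (leq_div N d))].
rewrite -mulr_suml ler_wpM2r ?swt_recip_ge0 // -mulr_sumr ler_wpM2l //.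
apply: le_trans (mertens_upper R z).
by apply: sum_nat_cut => n; rewrite divr_ge0 ?mangoldt_ge0.
Qed.

Lemma swt_smooth_markov w (k : R) z y N : (forall q, 0 <= w q) -> (forall q, w q <= k) ->
  (forall q, (z < q)%N -> w q = 0) -> (1 < y)%N -> (y <= N)%N -> k * (lnn z + 4) <= lnn y / 2 ->
  swt_recip w N <= 2 * swt_recip w y.
Proof.
move=> w0 wk wz y1 yN hk.
have ly : 0 < lnn y by rewrite ln_gt0 // (ltr_nat R 1).
have h := swt_smooth_log N w0 wk wz.
have E : swt_recip w N = swt_recip w y + \sum_(y.+1 <= n < N.+1) swt w n / n%:R.
  by rewrite /swt_recip (@big_cat_nat _ _ _ y.+1).
have tail : (\sum_(y.+1 <= n < N.+1) swt w n / n%:R) * lnn y <= \sum_(1 <= n < N.+1) swt w n / n%:R * lnn n.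
  rewrite [X in _ <= X](@big_cat_nat _ _ _ y.+1) //= ler_wpDl //.
    by apply: sumr_ge0 => n _; rewrite mulr_ge0 ?lnn_ge0 ?swt_term_ge0.
  rewrite mulr_suml [X in X <= _]big_nat_cond [X in _ <= X]big_nat_cond; apply: ler_sum => n; rewrite andbT => /andP[yn _].
  rewrite ler_wpM2l ?swt_term_ge0 // ler_ln ?posrE ?ltr0n ?(ltn_trans _ yn) ?(ltnW y1) // ler_nat ltnW //.
have S0 := swt_recip_ge0 N w0.
have h2 := ler_wpM2r S0 hk.
have {}tail := le_trans (le_trans tail h) h2.
have : \sum_(y.+1 <= n < N.+1) swt w n / n%:R <= swt_recip w N / 2.
  by rewrite -(ler_pM2r ly) (le_trans tail) //; lra.
lra.
Qed.

Lemma swt_single w a n : (forall q, 0 <= w q) -> (0 < n)%N ->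
  swt (weight_on (pred1 a) w) n <= (n == 1%N)%:R + (if (n == a) && prime a then w a else 0).
Proof.
move=> w0; move: n; apply: pfactor_ind.
  by rewrite swt1 eqxx lerDl; case: ifP.
move=> p e m pr e0 cp m0 _.
have n1 : (p ^ e * m == 1)%N = false.
  by apply/negbTE; rewrite muln_eq1 -{1}(expn0 p) eqn_exp2l ?prime_gt1 // (gtn_eqF e0).
rewrite n1 add0r.
have R0 : 0 <= (if ((p ^ e * m)%N == a) && prime a then w a else 0) by case: ifP.
have [m1|m1] := eqVneq m 1%N; last first.
  have mgt1 : (1 < m)%N by rewrite ltn_neqAle eq_sym m1.
  have prq := pdiv_prime mgt1; set q := pdiv m in prq.
  have pe0 : (0 < p ^ e)%N by rewrite expn_gt0 prime_gt0.
  have n0 : (0 < p ^ e * m)%N by rewrite muln_gt0 pe0.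
  have pin : p \in primes (p ^ e * m) by rewrite mem_primes pr n0 dvdn_mulr // dvdn_exp.
  have qin : q \in primes (p ^ e * m) by rewrite mem_primes prq n0 dvdn_mull // pdiv_dvd.
  have npq : p != q.
    apply: contraTneq cp => ->; rewrite prime_coprime // negbK; exact: pdiv_dvd.
  have [pa|npa] := eqVneq p a.
    by rewrite (swt_vanish qin) // /weight_on /= -pa eq_sym (negbTE npq).
  by rewrite (swt_vanish pin) // /weight_on /= (negbTE npa).
rewrite m1 (swt_pfactor _ pr e0 (coprimen1 p) isT) swt1 mulr1 muln1.
case: eqP => [->|_]; last by move: R0; rewrite m1 muln1.
rewrite expn1 /weight_on /=; case: eqP => [<-|_]; first by rewrite pr.
by rewrite /= lexx.
Qed.

Lemma swt_recip_zero w N : (forall q, w q = 0) -> swt_recip w N <= 1.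
Proof.
move=> w0; apply: (@le_trans _ _ (\sum_(1 <= n < N.+1) (if n == 1%N then 1 else 0))).
  rewrite /swt_recip big_nat_cond [X in _ <= X]big_nat_cond; apply: ler_sum => n; rewrite andbT => /andP[n0 _].
  case: eqP => [->|/eqP n1]; first by rewrite swt1 divr1.
  have ngt1 : (1 < n)%N by rewrite ltn_neqAle eq_sym n1.
  by rewrite (@swt_vanish _ _ (pdiv n)) ?mul0r // mem_primes pdiv_prime // n0 pdiv_dvd.
exact: (@sum_delta_le R (fun=> 1) 1 N).
Qed.

Lemma swt_recip_single w a N : (forall q, 0 <= w q) ->
  swt_recip (weight_on (pred1 a) w) N <= 1 + (if prime a then w a / a%:R else 0).
Proof.
move=> w0; pose f n := if prime a then w a / n%:R else 0.
have f0 n : 0 <= f n by rewrite /f; case: ifP => // _; rewrite divr_ge0.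
apply: (@le_trans _ _ (\sum_(1 <= n < N.+1) ((if n == 1%N then 1 else 0) + (if n == a then f n else 0)))).
  rewrite /swt_recip big_nat_cond [X in _ <= X]big_nat_cond; apply: ler_sum => n; rewrite andbT => /andP[n0 _].
  have i0 : 0 <= n%:R^-1 :> R by rewrite invr_ge0.
  apply: le_trans (ler_wpM2r i0 (swt_single a w0 n0)) _; rewrite mulrDl lerD //.
    by case: eqP => [->|_]; rewrite ?mul0r // divr1.
  by rewrite /f; case: eqP => _ /=; [case: ifP => _; rewrite ?mul0r | rewrite mul0r].
by rewrite big_split lerD //; [exact: (@sum_delta_le R (fun=> 1) 1 N) | exact: sum_delta_le].
Qed.

Lemma swt_rough w (k : R) z j N : (forall q, 0 <= w q) -> (forall q, w q <= k) ->
  swt_recip (weight_on (fun q => (z < q <= j)%N) w) N <= expR (k * \sum_(z.+1 <= q < j.+1 | prime q) q%:R^-1).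
Proof.
move=> w0 wk; have k0 : 0 <= k by apply: le_trans (w0 0%N) (wk 0%N).
have triv i : (i <= z)%N -> swt_recip (weight_on (fun q => (z < q <= i)%N) w) N <= expR (k * \sum_(z.+1 <= q < i.+1 | prime q) q%:R^-1).
  move=> jz; rewrite big_geq // mulr0 expR0; apply: swt_recip_zero => q.
  by rewrite /weight_on; case: ifP => // /andP[h1 h2]; have := leq_trans h1 (leq_trans h2 jz); rewrite ltnn.
elim: j => [|j IH]; first exact: triv.
have [/triv//|] := leqP j.+1 z; rewrite ltnS => zj.
have Dw : weight_on (fun q => (z < q <= j.+1)%N) w =
    fun q => weight_on (pred1 j.+1) w q + weight_on (fun q => (z < q <= j)%N) w q.
  apply: funext => q; rewrite /weight_on /= (leq_eqVlt q) ltnS.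
  case: eqP => [->|_] /=; last by rewrite add0r.
  by rewrite ltnS zj ltnn andbF addr0.
have disj q : weight_on (pred1 j.+1) w q * weight_on (fun q => (z < q <= j)%N) w q = 0.
  by rewrite /weight_on /=; case: eqP => [->|_]; rewrite ?mul0r // ltnn andbF mulr0.
rewrite Dw; apply: le_trans (swt_recip_mul_ge _ _ _ disj) _; try exact: weight_on_ge0.
rewrite big_mkcond big_nat_recr //= -big_mkcond /= mulrDr expRD mulrC.
apply: ler_pM; rewrite ?swt_recip_ge0 //; try exact: weight_on_ge0.
apply: le_trans (swt_recip_single _ _ w0) _; apply: le_trans (expR_ge1Dx _).
rewrite lerD2l; case: ifP => _; last by rewrite mulr0.
by rewrite ler_wpM2r ?invr_ge0.
Qed.

Lemma sum_inv_prime z N : (1 < z)%N -> \sum_(z.+1 <= q < N.+1 | prime q) q%:R^-1 <= (lnn N + 4) / lnn z.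
Proof.
move=> z1; have lz : 0 < lnn z by rewrite ln_gt0 // (ltr_nat R 1).
rewrite ler_pdivlMr //; apply: le_trans (mertens_upper R N).
have [zN|/ltnW Nz] := leqP z N; last first.
  by rewrite big_geq // mul0r sumr_ge0 // => n _; rewrite divr_ge0 ?mangoldt_ge0.
rewrite [X in _ <= X](@big_cat_nat _ _ _ z.+1) //= ler_wpDl //.
  by apply: sumr_ge0 => n _; rewrite divr_ge0 ?mangoldt_ge0.
rewrite mulr_suml big_mkcond big_nat_cond [X in _ <= X]big_nat_cond; apply: ler_sum => q; rewrite andbT => /andP[zq _].
case: ifP => pr; last by rewrite divr_ge0 ?mangoldt_ge0.
have q0 := prime_gt0 pr; have z0 : (0 < z)%N by apply: ltnW.
rewrite mangoldt_prime // mulrC ler_wpM2r ?invr_ge0 // ler_ln ?posrE ?ltr0n //.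
by rewrite ler_nat ltnW.
Qed.

(* Split [w] at [z = y^(1/K)]: by Markov's inequality for [ln n] the [z]-smooth part of
   the sum comes from [n <= y], and the rough part is at most [prod (1 + k / q)] over
   [z < q <= y^9]. *)
Lemma swt_recip_growth (k : R) : 0 <= k -> exists C y0, forall w y,
  (forall q, 0 <= w q) -> (forall q, w q <= k) -> (y0 <= y)%N -> swt_recip w (y ^ 9) <= C * swt_recip w y.
Proof.
(* [K] absorbs the constant 4 of Mertens' bound, and [K'] makes the [K']-th root [z] of [y] small
   enough for Markov's inequality. *)
move=> k0; have [K K0 kK] := ln_unbounded (16 * k).
have [K' [K'0 kK']] : exists K', (0 < K')%N /\ 4 * k <= K'%:R.
  exists (Num.trunc (4 * k)).+1; split=> //; apply: ltW.
  have := trunc_itv (_ : 0 <= 4 * k); rewrite mulr_ge0 // => /(_ isT)/andP[_].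
  by rewrite -natr1.
(* From [y < (z+1)^K' <= z^(2K')] follows [ln (y^9) <= 18 K' ln z]; with [ln z >= ln 2] this bounds
   the sum of [1/q] over the rough range. *)
exists (2 * expR (k * (18 * K'%:R + 4 / ln 2))), (maxn K (2 ^ K'))%N => w y w0 wk.
rewrite geq_max => /andP[Ky y2].
have y0 : (0 < y)%N by apply: leq_trans y2; rewrite expn_gt0.
have [z [z0 zy yz]] := natural_root K'0 y0.
have z1 : (1 < z)%N.
  rewrite ltnNge; apply/negP => z1; move: yz; rewrite ltnNge => /negP; apply.
  by apply: leq_trans y2; rewrite leq_exp2r // ltnS.
have y1 : (1 < y)%N by apply: leq_trans y2; rewrite -{1}(expn0 2) ltn_exp2l.
have l2 : 0 < ln 2 :> R by rewrite ln_gt0 // (ltr_nat R 1).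
have lz2 : ln 2 <= lnn z by rewrite ler_ln ?posrE ?ltr0n // (ler_nat R 2).
have lz : 0 < lnn z by apply: lt_le_trans lz2.
have lzy : K'%:R * lnn z <= lnn y.
  by rewrite -ln_natX // ler_ln ?posrE ?ltr0n ?expn_gt0 ?z0 // ler_nat.
have lKy : lnn K <= lnn y by rewrite ler_ln ?posrE ?ltr0n // ler_nat.
pose N := (y ^ 9)%N.
have yN : (y <= N)%N by rewrite -{1}(expn1 y) leq_exp2l.
have lN : lnn N <= 18 * K'%:R * lnn z.
  rewrite /N ln_natX //.
  have : lnn y <= 2 * K'%:R * lnn z.
    have e2 : (z.+1 ^ K' <= z ^ (2 * K'))%N.
      by rewrite expnM leq_exp2r // expnS expn1; apply: leq_trans (_ : 2 * z <= _)%N; [lia | rewrite leq_mul2r z1 orbT].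
    have : lnn y <= lnn (z ^ (2 * K'))%N.
      rewrite ler_ln ?posrE ?ltr0n ?expn_gt0 ?z0 // ler_nat; apply: leq_trans e2; exact: ltnW.
    by rewrite ln_natX // natrM.
  lra.
pose Q q := (z < q)%N.
have on0 := weight_on_ge0 Q w0; have off0 := weight_off_ge0 Q w0.
have offk q : weight_off Q w q <= k by rewrite /weight_off; case: ifP.
have offz q : (z < q)%N -> weight_off Q w q = 0 by rewrite /weight_off /Q => ->.
have small : swt_recip (weight_off Q w) N <= 2 * swt_recip (weight_off Q w) y.
  apply: (swt_smooth_markov off0 offk offz) => //.
  have h1 := ler_wpM2r (ltW lz) kK'; lra.
have offle : swt_recip (weight_off Q w) y <= swt_recip w y.
  apply: ler_sum => n _; rewrite ler_wpM2r ?invr_ge0 //.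
  apply: ler_prod => q _; case: ifP => // _; last by rewrite lexx.
  by rewrite off0 /weight_off; case: ifP => _; rewrite ?w0 ?lexx.
have large : swt_recip (weight_on Q w) N <= expR (k * (18 * K'%:R + 4 / ln 2)).
  have -> : swt_recip (weight_on Q w) N = swt_recip (weight_on (fun q => (z < q <= N)%N) w) N.
    apply: eq_big_nat => n /andP[n0 nN]; congr (_ / _); apply: swt_eq => // q qn.
    by rewrite /weight_on /Q (leq_trans qn nN) andbT.
  apply: le_trans (swt_rough z N N w0 wk) _; rewrite ler_expR ler_wpM2l //.
  apply: le_trans (sum_inv_prime N z1) _; rewrite mulrDl lerD //.
    by rewrite ler_pdivrMr.
  by rewrite ler_wpM2l // lef_pV2 ?posrE.
rewrite -{1}(weight_on_off Q w); apply: le_trans (swt_recip_mul_ge _ on0 off0 (weight_disj Q w)) _.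
have := ler_pM (swt_recip_ge0 N on0) (swt_recip_ge0 N off0) large (le_trans small (ler_wpM2l (ler0n _ 2) offle)).
by rewrite mulrCA mulrA.
Qed.

(* With [F] and [S] for [swt_count] and [swt_recip], and [F'], [S'] for the same sums
   away from [Q]: [F'(x) ln x << x S'(x)], [S'(x) sum_Q 1/q <= S(x^2) << S(x^(1/4))] and
   [x S(x^(1/4)) << F(x) ln x]. *)
Lemma swt_sieve (k : R) M b : 0 <= k -> (1 < M)%N -> coprime M b -> exists C x0, forall w x (Q : pred nat),
  (forall q, 0 <= w q) -> (forall q, w q <= k) -> (forall q, prime q -> q == b %[mod M] -> 1 <= w q) ->
  (forall q, prime q -> Q q -> 1 <= w q) -> (x0 <= x)%N ->
  swt_count (weight_off Q w) x * \sum_(1 <= q < x.+1 | prime q && Q q) q%:R^-1 <= C * swt_count w x.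
Proof.
move=> k0 M1 cb.
have [B [c [c0 lower]]] := swt_count_lower M1 cb.
have [C1 [y0 growth]] := swt_recip_growth k0.
pose y1 := maxn (maxn B y0) 256.
exists ((4 * k + 1) * C1 / c), (y1 ^ 4)%N => w x Q w0 wk w1 Qw xx0.
have y10 : (0 < y1)%N by rewrite leq_max orbT.
have x0 : (0 < x)%N by apply: leq_trans xx0; rewrite expn_gt0 y10.
have [y [y00 yx xy]] := natural_root (isT : (0 < 4)%N) x0.
have yy1 : (y1 <= y)%N.
  by rewrite -ltnS -(ltn_exp2r _ _ (isT : (0 < 4)%N)); apply: leq_ltn_trans xy.
have : (y1 <= y)%N by [].
rewrite 2!geq_max => /andP[/andP[By y0y] y256].
have off0 := weight_off_ge0 Q w0.
have offk q : weight_off Q w q <= k by rewrite /weight_off; case: ifP.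
have h1 := swt_count_upper off0 offk x0.
have h2 := lower w y x w0 w1 By yx.
have h3 := growth w y w0 wk y0y.
have h4 := swt_recip_sieve Q w0 x0.
(* [x < (y+1)^4 <= (2y)^4], so [x^2 <= 2^8 y^8]; this explains both the threshold 256 and the
   exponent 9. *)
have xx : (x * x <= y ^ 9)%N.
  apply: (@leq_trans ((2 * y) ^ 8)).
    rewrite (_ : 8 = 4 + 4)%N // expnD; apply: leq_mul; apply: leq_trans (ltnW xy) _; rewrite leq_exp2r //; lia.
  by rewrite expnMn (expnS y 8) leq_mul2r y256 orbT.
have h5 := le_trans h4 (le_trans (swt_recip_mono w0 xx) h3).
set A := swt_count _ x in h1 *; set S := \sum_(_ <= q < _ | _) _.
have SS : S <= \sum_(1 <= q < x.+1 | prime q && Q q) w q / q%:R.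
  apply: ler_sum => q /andP[pr Qq]; rewrite -[X in X <= _]mul1r ler_wpM2r ?invr_ge0 //; exact: Qw.
have S0 : 0 <= S by apply: sumr_ge0.
have x1 : (1 < x)%N by apply: leq_trans yx; rewrite -{1}(expn0 2); apply: (@leq_trans (2 ^ 4)); rewrite // leq_exp2r //; lia.
have lx : 0 < lnn x by rewrite ln_gt0 // (ltr_nat R 1).
rewrite -(ler_pM2r lx).
have h6 : S * swt_recip (weight_off Q w) x <= C1 * swt_recip w y.
  by apply: le_trans h5; rewrite ler_wpM2r ?swt_recip_ge0.
have x0' : 0 <= x%:R :> R by [].
have h7 : A * S * lnn x <= (4 * k + 1) * x%:R * (C1 * swt_recip w y).
  have a0 : 0 <= (4 * k + 1) * x%:R by rewrite mulr_ge0 //; lra.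
  have := ler_wpM2r S0 h1; have := ler_wpM2l a0 h6; lra.
have h8 : x%:R * swt_recip w y <= swt_count w x * lnn x / c.
  by rewrite ler_pdivlMr // mulrC mulrA.
have C10 : 0 <= C1.
  have y90 : 0 < swt_recip w (y ^ 9).
    rewrite /swt_recip big_nat_recl //=; last by rewrite expn_gt0 y00.
    by rewrite swt1 divr1 ltr_wpDr // sumr_ge0 // => n _; apply: swt_term_ge0.
  have p0 := swt_recip_ge0 y w0; have := lt_le_trans y90 h3.
  by rewrite leNgt; apply: contraTN => C10; rewrite -leNgt mulr_le0_ge0 // ltW.
have a0 : 0 <= (4 * k + 1) * C1 by rewrite mulr_ge0 //; lra.
have := ler_wpM2l a0 h8; lra.
Qed.

End Weights.

(** * Reciprocals of primes in a class over long intervals *)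

Section PrimeReciprocals.

Variable R : realType.
Local Notation lnn n := (ln (n%:R : R)).

(** The interval [(v, v^2]] contributes at least [delta / 4]: there the sum of [ln q / q] is at
    least [delta ln v / 2], while [ln q <= 2 ln v]. After [J] squarings the exponent is [2^J]. *)
Lemma sum_inv_AP M b (L : R) : (1 < M)%N -> coprime M b -> exists v0 K, forall v N, (v0 <= v)%N -> (v ^ K <= N)%N ->
  L <= \sum_(v.+1 <= q < N.+1 | prime q && (q == b %[mod M])) q%:R^-1.
Proof.
move=> M1 cb; have [delta d0 [C0 H]] := mertens_AP R M1 cb.
have [v0 v00 Hv0] := ln_unbounded (4 * `|C0| / delta).
have Cn0 := normr_ge0 C0; have C0n := ler_norm C0.
have block v : (maxn v0 2 <= v)%N -> delta / 4 <= \sum_(v.+1 <= q < (v ^ 2).+1 | prime q && (q == b %[mod M])) q%:R^-1.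
  rewrite geq_max => /andP[vv v2].
  have v1 : (0 < v)%N by apply: ltnW.
  have v20 : (0 < v ^ 2)%N by rewrite expn_gt0 v1.
  have vle : (v <= v ^ 2)%N by rewrite -{1}(expn1 v) leq_exp2l.
  have lv0 : lnn v0 <= lnn v by rewrite ler_ln ?posrE ?ltr0n // ler_nat.
  have lv : 4 * `|C0| < delta * lnn v.
    by rewrite (mulrC delta) -ltr_pdivrMr //; apply: lt_le_trans lv0.
  have lvp : 0 < lnn v by rewrite ln_gt0 // (ltr_nat R 1).
  have := H _ v20; have := H _ v1; rewrite [X in _ -> `|X - _| <= _ -> _](@big_cat_nat _ _ _ v.+1) ?ltnS //=.
  set A := \sum_(1 <= q < v.+1 | _) _; set T := \sum_(v.+1 <= q < _ | _) _.
  rewrite ln_natX // !ler_norml => /andP[h1 h2] /andP[h3 h4].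
  have : T <= 2 * lnn v * \sum_(v.+1 <= q < (v ^ 2).+1 | prime q && (q == b %[mod M])) q%:R^-1.
    rewrite mulr_sumr /T big_nat_cond [X in _ <= X]big_nat_cond; apply: ler_sum => q /andP[/andP[_ qv] /andP[pr _]].
    rewrite ler_wpM2r ?invr_ge0 // -(ln_natX R 2 v1) ler_ln ?posrE ?ltr0n //; last exact: prime_gt0.
    by rewrite ler_nat -ltnS.
  set S := \sum_(_ <= q < _ | _) _ => hT.
  have : delta / 2 * lnn v <= 2 * lnn v * S by lra.
  rewrite (_ : 2 * lnn v * S = (2 * S) * lnn v); last by ring.
  by rewrite ler_pM2r // => ?; lra.
have many J v : (maxn v0 2 <= v)%N -> J%:R * (delta / 4) <= \sum_(v.+1 <= q < (v ^ (2 ^ J)).+1 | prime q && (q == b %[mod M])) q%:R^-1.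
  move=> vv; elim: J => [|J IH]; first by rewrite mul0r sumr_ge0 // => q _; rewrite invr_ge0.
  have v1 : (0 < v)%N by apply: leq_trans vv; rewrite leq_max orbT.
  have vJ : (v <= v ^ (2 ^ J))%N by rewrite -{1}(expn1 v) leq_pexp2l // expn_gt0.
  rewrite expnSr expnM (@big_cat_nat _ _ _ (v ^ (2 ^ J)).+1) ?ltnS //=; last first.
    by rewrite -{1}(expn1 (v ^ _)) leq_pexp2l // expn_gt0 v1.
  by rewrite -natr1 mulrDl mul1r lerD // block // (leq_trans vv).
pose J := (Num.trunc (`|L| / (delta / 4))).+1.
have LJ : L <= J%:R * (delta / 4).
  apply: le_trans (ler_norm L) _; rewrite -ler_pdivrMr ?divr_gt0 //; apply: ltW.
  have := trunc_itv (_ : 0 <= `|L| / (delta / 4)); rewrite divr_ge0 ?divr_ge0 ?(ltW d0) // => /(_ isT)/andP[_].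
  by [].
exists (maxn v0 2), (2 ^ J)%N => v N vv vN; apply: le_trans LJ (le_trans (many J v vv) _).
have v1 : (0 < v)%N by apply: leq_trans vv; rewrite leq_max orbT.
have vJ : (v <= v ^ (2 ^ J))%N by rewrite -{1}(expn1 v) leq_pexp2l // expn_gt0.
rewrite [X in _ <= X](@big_cat_nat _ _ _ (v ^ (2 ^ J)).+1) ?ltnS //= lerDl.
by apply: sumr_ge0 => q _; rewrite invr_ge0.
Qed.

End PrimeReciprocals.

(** * Random tuples *)

Section Update.

Variables (I T : finType) (D : I -> {set T}) (R : numDomainType).
Implicit Types (a : {ffun I -> T}) (r : I) (b : T).

Definition upd a r b : {ffun I -> T} := [ffun i => if i == r then b else a i].

Lemma upd_same a r b : upd a r b r = b.
Proof. by rewrite ffunE eqxx. Qed.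

Lemma upd_other a r b i : i != r -> upd a r b i = a i.
Proof. by move=> h; rewrite ffunE (negbTE h). Qed.

Lemma upd_upd a r b : upd (upd a r b) r (a r) = a.
Proof. by apply/ffunP => i; rewrite !ffunE; case: eqP => [->|]. Qed.

Lemma upd_family a r b : a \in family D -> b \in D r -> upd a r b \in family D.
Proof.
move=> /familyP ha hb; apply/familyP => i; rewrite ffunE; case: eqP => [->|_] //; exact: ha.
Qed.

(** Exchanging the stored coordinate with the new value is an involution on pairs. *)
Lemma upd_average r (f : {ffun I -> T} -> R) :
  \sum_(a in family D) \sum_(b in D r) f (upd a r b) = #|D r|%:R * \sum_(a in family D) f a.
Proof.
have -> : #|D r|%:R * \sum_(a in family D) f a = \sum_(a in family D) \sum_(b in D r) f a.
  by rewrite mulr_sumr; apply: eq_bigr => a _; rewrite sumr_const mulr_natl.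
rewrite !pair_big /=.
pose h (x : {ffun I -> T} * T) := (upd x.1 r x.2, x.1 r).
have hK : involutive h by case=> a b; rewrite /h /= upd_same upd_upd.
rewrite [RHS](reindex_inj (inv_inj hK)) /=; apply: eq_bigl => -[a b] /=.
apply/andP/andP => [[ha hb]|[ha hb]].
  by split; [apply: upd_family | move/familyP: ha => /(_ r)].
split; last by move/familyP: ha => /(_ r); rewrite upd_same.
by rewrite -(upd_upd a r b); apply: upd_family.
Qed.

End Update.

Section RandomTuples.

Variables (R : realType) (I : finType) (gT : finGroupType) (D : I -> {set gT}).
Variables (H : nat) (s t : gT) (q r r' : nat -> I) (Fr G : nat -> {ffun I -> gT} -> gT).
Let Nt := [set~ 1%g : gT].
Let K : R := #|Nt|%:R.
Hypothesis (s1 : s != 1%g) (card3 : (2 < #|gT|)%N).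
Hypothesis Dq : forall j, (j < H)%N -> D (q j) = Nt.
Hypothesis Dr : forall j, (j < H)%N -> D (r j) = Nt.
Hypothesis Dr' : forall j, (j < H)%N -> D (r' j) = Nt.
Hypothesis qinj : forall i j, (i < H)%N -> (j < H)%N -> i != j -> q i != q j.
Hypothesis qr : forall i j, (i < H)%N -> (j < H)%N -> q i != r j.
Hypothesis qr' : forall i j, (i < H)%N -> (j < H)%N -> q i != r' j.
Hypothesis FrG : forall j a b b', (j < H)%N -> a \in family D -> b \in Nt -> b' \in Nt ->
  Fr j (upd (upd a (r j) b) (r' j) b') = (G j a * b * b')%g.
Hypothesis Fr_r : forall i j a b, (i < H)%N -> (j < H)%N -> i != j -> a \in family D -> b \in Nt ->
  Fr i (upd a (r j) b) = Fr i a.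
Hypothesis Fr_r' : forall i j a b, (i < H)%N -> (j < H)%N -> i != j -> a \in family D -> b \in Nt ->
  Fr i (upd a (r' j) b) = Fr i a.

Let bad j (a : {ffun I -> gT}) := ~~ ((a (q j) == s) && (Fr j a == t)).
(** Bounds the chance of the [j]-th bad event once the coordinate at [q j] is known: if it is [s],
    at least one of the [K^2] pairs of values at [r j], [r' j] gives [t]. *)
Let m j (a : {ffun I -> gT}) : R := if a (q j) == s then 1 - K ^- 2 else 1.

Let K1 : 1 <= K.
Proof. by rewrite /K ler1n cardsC1; case: #|gT| card3 => [|[]]. Qed.

Let Kinv n : 0 <= K ^- n <= 1.
Proof.
have k0 : 0 < K by apply: lt_le_trans K1.
by rewrite invr_ge0 exprn_ge0 ?(ltW k0) //= invf_le1 ?exprn_gt0 // exprn_ege1.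
Qed.

Let m_ge0 j a : 0 <= m j a.
Proof. by have /andP[h1 h2] := Kinv 2; rewrite /m; case: ifP => _; rewrite ?subr_ge0. Qed.

Let K_average c (f : {ffun I -> gT} -> R) : D c = Nt ->
  K * \sum_(a in family D) f a = \sum_(a in family D) \sum_(b in Nt) f (upd a c b).
Proof. by move=> e; rewrite /K -e upd_average. Qed.

(** Pick [b] different from 1 and [g], which takes a third element of the group. *)
Lemma nontrivial_product (g : gT) : exists b b', [/\ b \in Nt, b' \in Nt & (b * b' = g)%g].
Proof.
have [b hb] : exists b, b \notin [set 1%g; g].
  apply/existsP; rewrite -negb_forall; apply: contraL card3 => /forallP h.
  have -> : #|gT| = #|[set 1%g; g]| by rewrite -cardsT; apply: eq_card => x; rewrite inE h.
  by rewrite -leqNgt cards2; case: (_ != _).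
move: hb; rewrite !inE negb_or => /andP[b1 bg].
exists b, (b^-1 * g)%g; rewrite !inE mulKVg; split=> //.
by rewrite -eq_mulVg1.
Qed.

Lemma pair_bad_average j a : (j < H)%N -> a \in family D ->
  \sum_(b in Nt) \sum_(b' in Nt) (bad j (upd (upd a (r j) b) (r' j) b'))%:R <= K ^+ 2 * m j a.
Proof.
move=> jH fa; have k0 : K != 0 by rewrite gt_eqF // (lt_le_trans _ K1).
have cst : \sum_(b in Nt) \sum_(b' in Nt) 1 = K ^+ 2 by rewrite !sumr_const -mulrnA natrM expr2.
have qE b b' : upd (upd a (r j) b) (r' j) b' (q j) = a (q j) by rewrite !upd_other ?qr ?qr'.
rewrite /m; case: ifP => [/eqP aqs|naqs]; last first.
  rewrite mulr1 -cst; apply: ler_sum => b _; apply: ler_sum => b' _.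
  by rewrite lern1 leq_b1.
rewrite mulrBr mulr1 divff ?expf_neq0 // -cst lerBrDr.
have [b0 [b0' [hb hb' Db]]] := nontrivial_product ((G j a)^-1 * t)%g.
rewrite (bigD1 b0) //= [in X in _ <= X](bigD1 b0) //= addrAC lerD //; last first.
  by apply: ler_sum => b _; apply: ler_sum => b' _; rewrite lern1 leq_b1.
rewrite (bigD1 b0') //= [X in _ <= X](bigD1 b0') //= addrAC lerD //; last first.
  by apply: ler_sum => b' _; rewrite lern1 leq_b1.
by rewrite /bad qE aqs eqxx FrG // -mulgA Db mulKVg eqxx /= add0r.
Qed.

(** Hybrid sums: the first [k] bad events are intact, the remaining ones already replaced by their
    bounds. *)
Let Phi k := \sum_(a in family D) (\prod_(0 <= j < k) (bad j a)%:R) * \prod_(k <= j < H) m j a.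

(* Averaging over the coordinates [r k] and [r' k] replaces the [k]-th bad event by a
   bound for its conditional probability, which depends on the coordinate [q k] only. *)
Lemma swap_bad_step k : (k < H)%N -> Phi k.+1 <= Phi k.
Proof.
move=> kH; pose h (a : {ffun I -> gT}) := (\prod_(0 <= j < k) (bad j a)%:R) * \prod_(k.+1 <= j < H) m j a.
have k0 : 0 < K by apply: lt_le_trans K1.
have h0 a : 0 <= h a by rewrite mulr_ge0 // prodr_ge0.
have E1 : Phi k.+1 = \sum_(a in family D) (bad k a)%:R * h a.
  by apply: eq_bigr => a _; rewrite big_nat_recr //= mulrAC mulrC.
have E0 : Phi k = \sum_(a in family D) m k a * h a.
  by apply: eq_bigr => a _; rewrite [X in _ * X]big_ltn // mulrCA.
rewrite -(ler_pM2l (exprn_gt0 2 k0)) E1 E0.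
(* The other bad events and all bounds [m] ignore the coordinates [r k] and [r' k], so [h] factors
   out of the average. *)
have hE a b b' : a \in family D -> b \in Nt -> b' \in Nt -> h (upd (upd a (r k) b) (r' k) b') = h a.
  move=> fa hb hb'; have fb : upd a (r k) b \in family D by rewrite upd_family // Dr.
  have qE j : (j < H)%N -> upd (upd a (r k) b) (r' k) b' (q j) = a (q j).
    by move=> jH; rewrite !upd_other ?qr ?qr'.
  congr (_ * _); apply: eq_big_nat => j /andP[jk1 jk2].
    have jH : (j < H)%N by apply: ltn_trans kH.
    by rewrite /bad qE // Fr_r' ?Fr_r ?(ltn_eqF jk2).
  by rewrite /m qE.
have -> : K ^+ 2 * \sum_(a in family D) (bad k a)%:R * h a =
   \sum_(a in family D) \sum_(b in Nt) \sum_(b' in Nt) (bad k (upd (upd a (r k) b) (r' k) b'))%:R * h a.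
  rewrite expr2 -mulrA (K_average _ (Dr' kH)).
  rewrite (K_average (fun a => \sum_(b' in Nt) (bad k (upd a (r' k) b'))%:R * h (upd a (r' k) b')) (Dr kH)).
  by apply: eq_bigr => a fa; apply: eq_bigr => b hb; apply: eq_bigr => b' hb'; rewrite hE.
rewrite mulr_sumr; apply: ler_sum => a fa.
rewrite mulrA; under eq_bigr do rewrite -mulr_suml; rewrite -mulr_suml.
by rewrite ler_wpM2r // pair_bad_average.
Qed.

(** The coordinates at distinct [q j] are independent and equal [s] with probability [1/K], so each
    factor averages to [1 - K^-3]. *)
Lemma average_value n : (n <= H)%N ->
  \sum_(a in family D) \prod_(0 <= j < n) m j a = (1 - K ^- 3) ^+ n * #|family D|%:R.
Proof.
have k0 : 0 < K by apply: lt_le_trans K1.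
elim: n => [|n IH] nH.
  by under eq_bigr do rewrite big_geq //; rewrite sumr_const expr0 mul1r.
rewrite exprS -mulrA -IH; last exact: ltnW.
apply: (mulfI (lt0r_neq0 k0)).
rewrite (K_average _ (Dq nH)) mulrA mulr_sumr.
apply: eq_bigr => a fa.
transitivity (\sum_(b in Nt) (if b == s then 1 - K ^- 2 else 1) * \prod_(0 <= j < n) m j a).
  apply: eq_bigr => b hb; rewrite big_nat_recr //= mulrC; congr (_ * _).
    by rewrite /m upd_same.
  apply: eq_big_nat => j /andP[_ jn]; rewrite /m upd_other // qinj ?(ltn_eqF jn) //.
  exact: ltn_trans nH.
rewrite -mulr_suml; congr (_ * _).
have sN : s \in Nt by rewrite !inE.
transitivity (\sum_(b in Nt) (1 - (if b == s then K ^- 2 else 0))).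
  by apply: eq_bigr => b _; case: ifP; rewrite ?subr0.
rewrite sumrB sumr_const -/K mulrBr mulr1; congr (_ - _).
rewrite -big_mkcondr (big_pred1 s) => [|b]; last by rewrite andbC /=; case: eqP => [->|].
by rewrite !exprS expr0 !mulr1; field; rewrite gt_eqF.
Qed.

Lemma few_bad_tuples :
  #|[set a in family D | [forall j : 'I_H, ~~ ((a (q j) == s) && (Fr j a == t))]]|%:R <=
  (1 - K ^- 3) ^+ H * #|family D|%:R.
Proof.
rewrite -average_value //.
have E0 : Phi 0 = \sum_(a in family D) \prod_(0 <= j < H) m j a.
  by apply: eq_bigr => a _; rewrite big_geq // mul1r.
rewrite -E0.
have step k : (k <= H)%N -> Phi k <= Phi 0.
  by elim: k => // k IH kH; apply: le_trans (swap_bad_step kH) (IH (ltnW kH)).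
apply: le_trans (step H (leqnn H)); rewrite /Phi.
rewrite -sum1_card natr_sum big_mkcond /= [X in _ <= X]big_mkcond /=.
apply: ler_sum => a _; rewrite inE; case: ifP => [/andP[-> /forallP h]|_].
  rewrite [X in _ * X]big_geq // mulr1 big_mkord big1 // => j _.
  by rewrite /bad h.
case: ifP => // _; rewrite mulr_ge0 ?prodr_ge0 //.
Qed.

End RandomTuples.

Lemma logn_prod_primes (I : finType) (S : pred I) (F : I -> nat) q : (forall i, S i -> prime (F i)) ->
  (0 < \prod_(i | S i) F i)%N /\ logn q (\prod_(i | S i) F i) = (\sum_(i | S i) (q == F i))%N.
Proof.
move=> pr.
elim/big_rec2: _ => [|i x y Si [x0 <-]]; first by rewrite logn1.
have p0 := prime_gt0 (pr i Si).
by rewrite muln_gt0 p0 x0 lognM // logn_prime // pr.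
Qed.

(** * Tuples of tame values and their supports *)

Section Support.

Variables (R : realType) (p : nat) (gT : finGroupType).
Variable N' : nat.
Local Notation I := 'I_N'.+1.
Implicit Types (a : {ffun I -> gT}) (n : nat).

(** The condition is that of [tame_order]. Forcing 1 at [p] and at composites allows tuples indexed
    by all integers up to [N']. *)
Definition tame_values (q : nat) : {set gT} :=
  if prime q && (q != p) then [set b | (b ^+ q.-1 == 1)%g] else [set 1%g].

Definition wt (q : nat) : R := #|tame_values q :\ 1%g|%:R.

Definition supp_prod a : nat := (\prod_(i | a i != 1%g) (i : nat))%N.

Definition supp_values n (q : nat) : {set gT} :=
  if q \in primes n then tame_values q :\ 1%g else [set 1%g].

Definition tuples (N : nat) : {set {ffun I -> gT}} :=
  [set a | (a \in family (fun i : I => tame_values i)) && (supp_prod a <= N)%N].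

Lemma one_tame q : 1%g \in tame_values q.
Proof. by rewrite /tame_values; case: ifP => _; rewrite inE // expg1n. Qed.

Lemma tame_prime q b : b \in tame_values q -> b != 1%g -> prime q /\ q != p.
Proof. by rewrite /tame_values; case: ifP => [/andP[]//|_]; rewrite inE => ->. Qed.

Lemma supp_logn a q : a \in family (fun i : I => tame_values i) ->
  (0 < supp_prod a)%N /\ logn q (supp_prod a) = (\sum_(i | a i != 1%g) (q == i :> nat))%N.
Proof.
move=> /familyP fa; apply: logn_prod_primes => i ai.
by have [] := tame_prime (fa i) ai.
Qed.

Lemma supp_logn_ord a (i : I) : a \in family (fun i : I => tame_values i) ->
  logn i (supp_prod a) = (a i != 1%g).
Proof.
move=> fa; have [_ ->] := supp_logn i fa.
case: (boolP (a i != 1%g)) => [ai|/negbNE/eqP ai].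
  rewrite (bigD1 i) //= eqxx big1 // => j /andP[_ ji]; rewrite eq_sym val_eqE (negbTE ji) //.
rewrite big1 // => j aj; case: eqP => // /val_inj e; by rewrite -e ai eqxx in aj.
Qed.

Lemma supp_squarefree a : a \in family (fun i : I => tame_values i) ->
  all (fun q => logn q (supp_prod a) == 1%N) (primes (supp_prod a)).
Proof.
move=> fa; apply/allP => q; rewrite -logn_gt0; have [_ e] := supp_logn q fa.
rewrite e => /[dup]; rewrite lt0n sum_nat_eq0 negb_forall => /existsP[i].
rewrite negb_imply => /andP[ai]; rewrite eqb0 negbK => /eqP qi _.
by rewrite -e qi supp_logn_ord // ai.
Qed.

Lemma big_primes_ord (T : Type) (idx : T) (op : Monoid.com_law idx) n (F : nat -> T) : (n <= N')%N ->
  \big[op/idx]_(q <- primes n) F q = \big[op/idx]_(i : I | (i : nat) \in primes n) F i.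
Proof.
move=> nN; rewrite -(big_mkord (fun i => i \in primes n) F) -[RHS]big_filter.
apply: perm_big; apply: uniq_perm; rewrite ?primes_uniq ?filter_uniq ?iota_uniq // => q.
rewrite mem_filter mem_index_iota /=; case qn: (q \in primes n) => //=; apply/esym.
by move: qn; rewrite mem_primes ltnS => /and3P[_ n0 /(dvdn_leq n0)] h; apply: leq_trans nN.
Qed.

(** Fixing the support turns tuples into a full product of sets, the independence that
    [few_bad_tuples] relies on. *)
Lemma supp_fibre n : (0 < n)%N -> (n <= N')%N -> all (fun q => logn q n == 1%N) (primes n) ->
  forall a, (a \in family (fun i : I => tame_values i)) && (supp_prod a == n) =
            (a \in family (fun i : I => supp_values n i)).
Proof.
move=> n0 nN sq a; apply/andP/idP => [[fa /eqP en]|/familyP fa].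
  apply/familyP => i; rewrite /supp_values -logn_gt0 -en supp_logn_ord //.
  move/familyP: fa => /(_ i) h; case: eqP => [->|/eqP ai] /=; first by rewrite inE.
  by rewrite !inE ai.
have ai i : (a i != 1%g) = ((i : nat) \in primes n).
  have := fa i; rewrite /supp_values; case: ifP => _; rewrite !inE; first by case/andP.
  by move=> ->.
have ft : a \in family (fun i : I => tame_values i).
  apply/familyP => i; have := fa i; rewrite /supp_values; case: ifP => _; first by rewrite inE => /andP[].
  by rewrite inE => /eqP ->; apply: one_tame.
split=> //; apply/eqP; have [s0 _] := supp_logn 0 ft.
apply: eqn_from_log => // q.
have [qn|qn] := boolP (q \in primes n).
  rewrite (eqP (allP sq q qn)).
  have qN : (q < N'.+1)%N.
    by move: qn; rewrite mem_primes ltnS => /and3P[_ _ /(dvdn_leq n0)] h; apply: leq_trans nN.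
  by have := supp_logn_ord (Ordinal qN) ft; rewrite ai /= qn.
have -> : logn q n = 0%N by apply/eqP; rewrite -leqn0 leqNgt logn_gt0.
have [_ ->] := supp_logn q ft; rewrite big1 // => i; rewrite ai => iq.
by case: eqP => // e; rewrite e iq in qn.
Qed.

Lemma swt_squarefree (w : nat -> R) n : ~~ all (fun q => logn q n == 1%N) (primes n) -> swt w n = 0.
Proof.
by move=> /allPn[q qn h]; rewrite /swt (bigD1_seq q) ?primes_uniq //= (negbTE h) mul0r.
Qed.

Lemma card_supp_values n : (0 < n)%N -> (n <= N')%N -> all (fun q => logn q n == 1%N) (primes n) ->
  #|family (fun i : I => supp_values n i)|%:R = swt wt n.
Proof.
move=> n0 nN sq; rewrite card_family foldrE big_map big_enum /= natr_prod /swt.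
rewrite (big_primes_ord _ _ nN) [RHS]big_mkcond /=; apply: eq_bigr => i _.
rewrite /supp_values; case: ifP => [iq|_]; last by rewrite cards1.
by rewrite (allP sq).
Qed.

Lemma card_supp n : (0 < n)%N -> (n <= N')%N ->
  #|[set a | (a \in family (fun i : I => tame_values i)) && (supp_prod a == n)]|%:R = swt wt n.
Proof.
move=> n0 nN; have [sq|nsq] := boolP (all (fun q => logn q n == 1%N) (primes n)).
  by rewrite -card_supp_values //; congr _%:R; apply: eq_card => a; rewrite inE supp_fibre.
rewrite swt_squarefree // (_ : [set a | _] = finset.set0) ?cards0 //.
apply/finset.setP => a; rewrite !inE; apply/negP => /andP[fa /eqP e].
by move: nsq; rewrite -e supp_squarefree.
Qed.

Lemma tuples_partition N (Q : pred {ffun I -> gT}) :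
  #|[set a in tuples N | Q a]| =
  (\sum_(1 <= n < N.+1) #|[set a | [&& a \in family (fun i : I => tame_values i), supp_prod a == n & Q a]]|)%N.
Proof.
rewrite -sum1_card; under [RHS]eq_bigr do rewrite -sum1_card big_mkcond /=.
rewrite exchange_big /= big_mkcond /=; apply: eq_bigr => a _.
rewrite finset.in_set finset.in_set; under [RHS]eq_bigr do rewrite finset.in_set.
case: (boolP (a \in family _)) => fa /=; last by rewrite big1.
case: (Q a); last by rewrite andbF big1 // => n _; rewrite andbF.
have [s0 _] := supp_logn 0 fa.
rewrite andbT; under eq_bigr do rewrite andbT.
have [sN|Ns] := leqP (supp_prod a) N; last first.
  rewrite big_nat_cond big1 // => n; rewrite andbT ltnS => /andP[_ nN].
  by rewrite (gtn_eqF (leq_ltn_trans nN Ns)).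
rewrite (big_cat_nat _ (n := supp_prod a)) //=; last by apply: leq_trans sN _.
rewrite big_nat_cond big1 ?add0n; last by move=> n; rewrite andbT => /andP[_ h]; rewrite (gtn_eqF h).
rewrite big_ltn // eqxx big_nat_cond big1 // => n; rewrite andbT => /andP[h _].
by rewrite (ltn_eqF h).
Qed.

Lemma card_tuples N : (N <= N')%N -> #|tuples N|%:R = swt_count wt N.
Proof.
move=> NN; have -> : tuples N = [set a in tuples N | predT a] by apply/finset.setP => a; rewrite !inE andbT.
rewrite tuples_partition natr_sum; apply: eq_big_nat => n /andP[n0 nN].
rewrite -card_supp ?(leq_trans _ NN) //; congr _%:R.
by apply: eq_card => a; rewrite !inE andbT.
Qed.

End Support.

Lemma swt_weight_off (R : realType) (Q : pred nat) (w : nat -> R) n : (0 < n)%N ->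
  swt (weight_off Q w) n = if has Q (primes n) then 0 else swt w n.
Proof.
move=> n0; case: ifP => [/hasP[q qn Qq]|/negbT/hasPn h].
  by rewrite (swt_vanish qn) // /weight_off Qq.
by apply: eq_big_seq => q qn; rewrite /weight_off (negbTE (h q qn)).
Qed.

(** Bernoulli's inequality in the form [(1-d)^n (1+nd) <= 1]. *)
Lemma pow_small (R : realType) (d e : R) : 0 < d -> d <= 1 -> 0 < e -> exists H, (1 - d) ^+ H <= e.
Proof.
move=> d0 d1 e0.
have bern n : (1 - d) ^+ n * (1 + n%:R * d) <= 1.
  elim: n => [|n IH]; first by rewrite expr0 mul0r addr0 mulr1.
  apply: le_trans IH; rewrite exprSr -mulrA ler_wpM2l ?exprn_ge0 ?subr_ge0 //.
  rewrite -natr1; have := ler0n R n; nra.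
exists (Num.trunc (e^-1 / d)).+1; set n := (Num.trunc _).+1.
have hn : e^-1 / d < n%:R.
  have := trunc_itv (_ : 0 <= e^-1 / d); rewrite divr_ge0 ?invr_ge0 ?(ltW e0) ?(ltW d0) // => /(_ isT)/andP[_].
  by [].
move: hn; rewrite ltr_pdivrMr // => hn.
have p0 : 0 < 1 + n%:R * d by rewrite ltr_pwDl // mulr_ge0 // ltW.
rewrite -(ler_pM2r p0); apply: le_trans (bern n) _.
by rewrite -ler_pdivrMl // mulr1 (le_trans (ltW hn)) // lerDr.
Qed.

(** * Residue classes for the large primes *)

Section Residues.

Variables (P : nat) (c : nat -> nat).
Hypothesis (P1 : (1 < P)%N) (c_coprime : forall r, prime r -> coprime r (c r)).

(** Chinese remainder theorem modulo [P] times the product of [S]; these moduli are pairwise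
    coprime, the members of [S] being distinct primes that are 1 modulo [P]. *)
Lemma residue_exists (S : seq nat) r r' : (forall x, x \in S -> prime x /\ x == 1 %[mod P]) -> uniq S ->
  r \in S -> r' \in S -> r != r' ->
  exists M b, [/\ (1 < M)%N, coprime M b & forall l, l == b %[mod M] ->
    [/\ l == 1 %[mod P], l == c r %[mod r], l == c r' %[mod r'] &
        forall x, x \in S -> x != r -> x != r' -> l == 1 %[mod x]]].
Proof.
move=> HS uS rS r'S nrr; have [prr r1] := HS r rS; have [prr' r'1] := HS r' r'S.
pose O := [seq x <- S | (x != r) && (x != r')].
pose M0 := (P * \prod_(x <- O) x)%N.
have cP x : x \in S -> coprime P x.
  by move=> /HS[_ /eqP e]; rewrite -coprime_modr e coprime_modr coprimen1.
have c0 x y : x \in S -> y \in S -> x != y -> coprime x y.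
  by move=> /HS[prx _] /HS[pry _] xy; rewrite prime_coprime // dvdn_prime2.
have cO y : y \in S -> (y == r) || (y == r') -> coprime M0 y.
  move=> yS hy; rewrite coprimeMl cP //= coprime_sym big_seq.
  elim/big_ind: _ => [|m n hm hn|x]; rewrite ?coprimen1 ?coprimeMr ?hm //.
  rewrite mem_filter => /andP[/andP[xr xr'] xS]; apply: c0 => //.
  by case/orP: hy => /eqP ->; rewrite eq_sym.
have cr : coprime r r' by apply: c0.
have cM0 : coprime M0 (r * r') by rewrite coprimeMr !cO ?eqxx ?orbT.
pose b0 := chinese r r' (c r) (c r'); pose b := chinese M0 (r * r') 1 b0.
pose M := (M0 * (r * r'))%N.
have down l d e : (d %| M)%N -> b = e %[mod d] -> l == b %[mod M] -> l == e %[mod d].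
  by move=> dM be /eqP lb; rewrite -(modn_dvdm l dM) lb (modn_dvdm b dM) be.
have bM0 : b = 1 %[mod M0] by apply: chinese_modl.
have brr : b = b0 %[mod r * r'] by apply: chinese_modr.
have br : b = c r %[mod r].
  by rewrite -(modn_dvdm b (dvdn_mulr r' (dvdnn r))) brr modn_dvdm ?dvdn_mulr // chinese_modl.
have br' : b = c r' %[mod r'].
  by rewrite -(modn_dvdm b (dvdn_mull r (dvdnn r'))) brr modn_dvdm ?dvdn_mull // chinese_modr.
have r0 := prime_gt0 prr; have r'0 := prime_gt0 prr'.
have O0 : (0 < \prod_(x <- O) x)%N.
  rewrite big_seq; apply: prodn_cond_gt0 => x; rewrite mem_filter => /andP[_ /HS[/prime_gt0]] //.
have b1 d : (d %| M0)%N -> b = 1 %[mod d].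
  by move=> dM; rewrite -(modn_dvdm b dM) bM0 modn_dvdm.
exists M, b; split.
- apply: leq_trans P1 _; rewrite /M /M0 -mulnA leq_pmulr //.
  by rewrite !muln_gt0 O0 r0 r'0.
- rewrite !coprimeMl; apply/andP; split.
    have cb d : (d %| M0)%N -> coprime d b.
      by move=> dM; rewrite -coprime_modr (b1 d dM) coprime_modr coprimen1.
    by apply/andP; split; apply: cb; [apply: dvdn_mulr | apply: dvdn_mull].
  by apply/andP; split; rewrite -coprime_modr ?br ?br' coprime_modr c_coprime.
move=> l lb; split.
- by apply: down lb; rewrite ?b1 // /M /M0 -?mulnA dvdn_mulr.
- by apply: down lb; rewrite ?br // /M dvdn_mull // dvdn_mulr.
- by apply: down lb; rewrite ?br' // /M dvdn_mull // dvdn_mull.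
move=> x xS xr xr'; have xO : (x %| M0)%N.
  by rewrite dvdn_mull // (big_rem x) ?dvdn_mulr // mem_filter xr xr'.
by apply: down lb; rewrite ?b1 // /M dvdn_mulr.
Qed.

End Residues.

Section FrobeniusValues.

Variables (gT : finGroupType) (N' : nat) (tw : nat -> gT -> nat -> gT) (U : nat -> gT).
Hypothesis abT : abelian [set: gT].
Hypothesis tw1 : forall r l, tw r 1%g l = 1%g.
Local Notation I := 'I_N'.+1.
Implicit Types (a : {ffun I -> gT}).

(** Abstract value at the Frobenius of [l]: [U] stands for the fixed factor [u], and [tw r b] for
    the character of conductor [r] with tame value [b]. *)
Definition frobval a (l : nat) : gT := (U l * \prod_(i : I) tw i (a i) l)%g.

Lemma abelian_mulC (x y : gT) : (x * y = y * x)%g.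
Proof. by apply: (centsP abT); rewrite inE. Qed.

Lemma frobval_upd a k b l : frobval (upd a k b) l = (frobval (upd a k 1%g) l * tw k b l)%g.
Proof.
rewrite /frobval -mulgA; congr (_ * _)%g.
have H (s : seq I) : uniq s -> (\prod_(i <- s) tw i (upd a k b i) l =
   \prod_(i <- s) tw i (upd a k 1 i) l * (if k \in s then tw k b l else 1))%g.
  elim: s => [|i s IH] /=; first by rewrite !big_nil mulg1.
  move=> /andP[iss us]; rewrite !big_cons IH // inE !ffunE eq_sym.
  case: eqP => [->|_] /=; last by rewrite mulgA.
  by rewrite (negbTE iss) tw1 mulg1 mul1g abelian_mulC.
by rewrite H ?index_enum_uniq // mem_index_enum.
Qed.

Lemma frobval_upd_triv a (k : I) b l : (forall x, tw k x l = 1%g) -> frobval (upd a k b) l = frobval a l.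
Proof.
move=> h; have e : upd a k (a k) = a by apply/ffunP => i; rewrite ffunE; case: eqP => [->|].
transitivity (frobval (upd a k 1%g) l); first by rewrite frobval_upd h mulg1.
by rewrite -[in RHS]e [RHS]frobval_upd h mulg1.
Qed.

End FrobeniusValues.

(** * Bad tuples over one typical support *)

Section Typical.

Variables (R : realType) (p : nat) (gT : finGroupType) (N' : nat).
Variables (tw : nat -> gT -> nat -> gT) (U : nat -> gT) (c : nat -> nat).
Hypothesis (hp : prime p) (pgT : (p %| #|gT|)%N) (card3 : (2 < #|gT|)%N) (abT : abelian [set: gT]).
Hypothesis tw1 : forall r l, tw r 1%g l = 1%g.
Hypothesis tw_triv : forall r l b, prime r -> prime l -> l != r -> (b ^+ r.-1 = 1)%g -> l == 1 %[mod r] -> tw r b l = 1%g.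
Hypothesis tw_gen : forall r l b, prime r -> prime l -> l != r -> (b ^+ r.-1 = 1)%g -> l == c r %[mod r] -> tw r b l = b.
Hypothesis c_ne1 : forall r b, prime r -> (b ^+ r.-1 = 1)%g -> b != 1%g :> gT -> c r != 1 %[mod r].
Local Notation I := 'I_N'.+1.
Local Notation P := #|gT|.
Local Notation K := (#|[set~ 1%g : gT]|%:R : R).

Lemma split_prime_exp r (b : gT) : r == 1 %[mod P] -> (0 < r)%N -> (b ^+ r.-1 = 1)%g.
Proof.
move=> r1 r0; have : (P %| r.-1)%N by rewrite -subn1 -eqn_mod_dvd.
by case/dvdnP => k ->; rewrite mulnC expgM -cardsT expg_cardG ?inE // expg1n.
Qed.

Lemma split_prime_neq r : r == 1 %[mod P] -> r != p.
Proof.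
apply: contraTneq => ->; apply/negP => /eqP e.
have := modn_dvdm p pgT; rewrite e modn_dvdm // modnn modn_small ?prime_gt1 //.
Qed.

Lemma split_prime_values r : prime r -> r == 1 %[mod P] -> tame_values p gT r = [set: gT].
Proof.
move=> pr r1; rewrite /tame_values pr split_prime_neq //; apply/finset.setP => b.
by rewrite !inE (split_prime_exp _ r1) ?eqxx // prime_gt0.
Qed.

Lemma split_supp_values n r : r \in primes n -> r == 1 %[mod P] -> supp_values p gT n r = [set~ 1%g].
Proof.
move=> rn r1; have pr : prime r by move: rn; rewrite mem_primes => /and3P[].
by rewrite /supp_values rn split_prime_values //; apply/finset.setP => b; rewrite !inE andbT.
Qed.

Lemma wt_le q : wt R p gT q <= K.
Proof.
rewrite ler_nat subset_leq_card //; apply/fintype.subsetP => b; rewrite !inE => /andP[->] //.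
Qed.

Lemma wt_ge1 q : prime q -> q == 1 %[mod P] -> 1 <= wt R p gT q.
Proof.
move=> pr q1; rewrite /wt split_prime_values // ler1n.
have -> : [set: gT] :\ 1%g = [set~ 1%g] by apply/finset.setP => b; rewrite !inE andbT.
by rewrite cardsC1; case: #|gT| card3 => [|[]].
Qed.

Variables (s t : gT) (H n z : nat) (r q : nat -> nat).
Hypothesis (s1 : s != 1%g) (n0 : (0 < n)%N) (nN : (n <= N')%N).
Hypothesis rn : forall k, (k < H.*2)%N -> r k \in primes n.
Hypothesis r1 : forall k, (k < H.*2)%N -> r k == 1 %[mod P].
Hypothesis rz : forall k, (k < H.*2)%N -> (r k <= z)%N.
Hypothesis rinj : forall k k', (k < H.*2)%N -> (k' < H.*2)%N -> k != k' -> r k != r k'.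
Hypothesis qn : forall j, (j < H)%N -> q j \in primes n.
Hypothesis qz : forall j, (j < H)%N -> (z < q j)%N.
Hypothesis q1 : forall j, (j < H)%N -> q j == 1 %[mod P].
Hypothesis qr : forall j, (j < H)%N -> q j == c (r j.*2) %[mod r j.*2].
Hypothesis qr' : forall j, (j < H)%N -> q j == c (r j.*2.+1) %[mod r j.*2.+1].
Hypothesis qother : forall j k, (j < H)%N -> (k < H.*2)%N -> k != j.*2 -> k != j.*2.+1 -> q j == 1 %[mod r k].

Lemma typical_few_bad :
  #|[set a : {ffun I -> gT} | (a \in family (fun i : I => supp_values p gT n i)) &&
      [forall l : I, (z < l)%N ==> ~~ ((a l == s) && (frobval tw U a l == t))]]|%:R <=
  (1 - K ^- 3) ^+ H * #|family (fun i : I => supp_values p gT n i)|%:R.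
Proof.
have prm x : x \in primes n -> prime x by rewrite mem_primes => /and3P[].
have ltN x : x \in primes n -> (x < N'.+1)%N.
  by rewrite mem_primes ltnS => /and3P[_ _ /(dvdn_leq n0)] h; apply: leq_trans nN.
have dH j : (j < H)%N -> (j.*2 < H.*2)%N /\ (j.*2.+1 < H.*2)%N by lia.
have ex k (b : gT) : (k < H.*2)%N -> (b ^+ (r k).-1 = 1)%g.
  by move=> kH; apply: split_prime_exp (r1 kH) _; rewrite prime_gt0 ?prm ?rn.
have nqr j k : (j < H)%N -> (k < H.*2)%N -> q j != r k.
  by move=> jH kH; rewrite gtn_eqF // (leq_ltn_trans (rz kH)) ?qz.
have ordE x : x \in primes n -> nat_of_ord (inord x : I) = x by move=> /ltN h; rewrite inordK.
have neqI x y : x \in primes n -> y \in primes n -> x != y -> (inord x : I) != inord y.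
  by move=> hx hy; apply: contra => /eqP/(congr1 (@nat_of_ord _)); rewrite !ordE // => ->.
have D x : x \in primes n -> x == 1 %[mod P] -> supp_values p gT n (inord x : I) = [set~ 1%g].
  by move=> hx h1; rewrite ordE // split_supp_values.
pose D' (i : I) := supp_values p gT n i.
pose rI j : I := inord (r j.*2); pose rI' j : I := inord (r j.*2.+1); pose qI j : I := inord (q j).
pose Fr j (a : {ffun I -> gT}) := frobval tw U a (q j).
pose G j (a : {ffun I -> gT}) := Fr j (upd (upd a (rI' j) 1%g) (rI j) 1%g).
have comm (a : {ffun I -> gT}) i j b b' : i != j -> upd (upd a i b) j b' = upd (upd a j b') i b.
  by move=> ij; apply/ffunP => k; rewrite !ffunE; case: eqP => [->|//]; rewrite eq_sym (negbTE ij).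
have triv i k b : (i < H)%N -> (k < H.*2)%N -> k != i.*2 -> k != i.*2.+1 -> tw (inord (r k) : I) b (q i) = 1%g.
  move=> iH kH k1 k2; rewrite ordE ?rn //.
  by apply: tw_triv; rewrite ?prm ?rn ?qn ?nqr ?ex ?qother.
have bound := @few_bad_tuples R _ gT D' H s t qI rI rI' Fr G s1 card3.
apply: le_trans (bound _ _ _ _ _ _ _ _ _).
- rewrite ler_nat subset_leq_card //; apply/fintype.subsetP => a.
  rewrite !finset.in_set => /andP[-> /forallP h] /=; apply/forallP => j.
  have := h (qI j); rewrite ordE ?qn ?qz //=; exact.
- by move=> j jH; apply: (D _ (qn jH) (q1 jH)).
- by move=> j /dH[jH _]; apply: (D _ (rn jH) (r1 jH)).
- by move=> j /dH[_ jH]; apply: (D _ (rn jH) (r1 jH)).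
(* The [q j] are distinct: modulo [r i.*2], [q i] is [c (r i.*2)], which is not 1, while the other
   [q j] are 1. *)
- move=> i j iH jH ij; apply: neqI; rewrite ?qn //.
  have [iH2 _] := dH i iH; apply/eqP => e.
  have b1 := c_ne1 (prm _ (rn iH2)) (ex _ s iH2) s1.
  case/negP: b1; rewrite -(eqP (qr iH)) e; apply: qother => //; lia.
- by move=> i j iH /dH[jH _]; apply: neqI; rewrite ?qn ?rn ?nqr.
- by move=> i j iH /dH[_ jH]; apply: neqI; rewrite ?qn ?rn ?nqr.
- move=> j a b b' jH _ _ _; have [jH1 jH2] := dH j jH.
  have rr : rI j != rI' j by apply: neqI; rewrite ?rn // rinj // neq_ltn ltnSn.
  have g1 x : tw (rI j) x (q j) = x.
    by rewrite ordE ?rn //; apply: tw_gen; rewrite ?prm ?rn ?qn ?nqr ?ex ?qr.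
  have g2 x : tw (rI' j) x (q j) = x.
    by rewrite ordE ?rn //; apply: tw_gen; rewrite ?prm ?rn ?qn ?nqr ?ex ?qr'.
  rewrite /G /Fr (frobval_upd _ abT tw1) g2 comm // (frobval_upd _ abT tw1) g1.
  by [].
- move=> i j a b iH jH ij _ _; have [jH1 jH2] := dH j jH.
  by apply: (frobval_upd_triv _ abT tw1) => x; apply: triv => //; lia.
move=> i j a b iH jH ij _ _; have [jH1 jH2] := dH j jH.
by apply: (frobval_upd_triv _ abT tw1) => x; apply: triv => //; lia.
Qed.

End Typical.

Lemma sum_ge_member (R : numDomainType) (T : eqType) (s : seq T) (f : T -> R) x :
  (forall y, 0 <= f y) -> x \in s -> f x <= \sum_(y <- s) f y.
Proof. by move=> f0 xs; rewrite (big_rem x xs) /= lerDl sumr_ge0. Qed.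

(** * Bad tuples over all supports *)

Section Core.

Variables (R : realType) (p : nat) (gT : finGroupType).
Variables (tw : nat -> gT -> nat -> gT) (c : nat -> nat).
Hypothesis (hp : prime p) (pgT : (p %| #|gT|)%N) (card3 : (2 < #|gT|)%N) (abT : abelian [set: gT]).
Hypothesis tw1 : forall r l, tw r 1%g l = 1%g.
Hypothesis tw_triv : forall r l b, prime r -> prime l -> l != r -> (b ^+ r.-1 = 1)%g -> l == 1 %[mod r] -> tw r b l = 1%g.
Hypothesis tw_gen : forall r l b, prime r -> prime l -> l != r -> (b ^+ r.-1 = 1)%g -> l == c r %[mod r] -> tw r b l = b.
Hypothesis c_ne1 : forall r b, prime r -> (b ^+ r.-1 = 1)%g -> b != 1%g :> gT -> c r != 1 %[mod r].
Hypothesis c_coprime : forall r, prime r -> coprime r (c r).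
Local Notation P := #|gT|.
Local Notation K := (#|[set~ 1%g : gT]|%:R : R).
Local Notation w := (wt R p gT).
Local Notation family_tame N' := (family (fun i : 'I_N'.+1 => tame_values p gT i)).

(** [Q i] selects candidates for [r i] in disjoint windows, which makes them distinct; [QQ x]
    selects candidates for a [q] serving the pair [x]. If [n] is not squarefree, both sides
    vanish. *)
Lemma few_bad_support (s t : gT) (H z n N' : nat) (Q : nat -> pred nat) (QQ : nat * nat -> pred nat)
  (tt : nat -> nat) (S : seq nat) U : s != 1%g -> (0 < n)%N -> (n <= N')%N ->
  (forall i j, (i <= j)%N -> (tt i <= tt j)%N) -> (tt H.*2 <= z)%N ->
  (forall i x, prime x -> Q i x -> [/\ x == 1 %[mod P], (tt i < x)%N & (x <= tt i.+1)%N]) ->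
  (forall x, (x \in S) = [&& (x <= tt H.*2)%N, prime x & x == 1 %[mod P]]) ->
  (forall x l, x.1 \in S -> x.2 \in S -> x.1 != x.2 -> prime l -> QQ x l -> [/\ (z < l)%N, l == 1 %[mod P],
     l == c x.1 %[mod x.1] & l == c x.2 %[mod x.2]] /\
     (forall y, y \in S -> y != x.1 -> y != x.2 -> l == 1 %[mod y])) ->
  (forall i, (i < H.*2)%N -> has (Q i) (primes n)) ->
  (forall x, x.1 \in S -> x.2 \in S -> x.1 != x.2 -> has (QQ x) (primes n)) ->
  #|[set a | [&& a \in family_tame N', supp_prod a == n &
     [forall l : 'I_N'.+1, (z < l)%N ==> ~~ ((a l == s) && (frobval tw U a l == t))]]]|%:R <=
  (1 - K ^- 3) ^+ H * swt w n.
Proof.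
move=> s1 n0 nN ttm tz HQ HS HQQ hasQ hasQQ.
have [sq|nsq] := boolP (all (fun q => logn q n == 1%N) (primes n)); last first.
  have := card_supp R p gT n0 nN; rewrite swt_squarefree // mulr0 => /eqP; rewrite pnatr_eq0 => /eqP e.
  rewrite lern0 -leqn0 -e; apply: subset_leq_card; apply/fintype.subsetP => a.
  by rewrite !finset.in_set => /and3P[-> ->].
have prm x : x \in primes n -> prime x by rewrite mem_primes => /and3P[].
have /choice[r Hr] : forall k, exists x, (k < H.*2)%N -> x \in primes n /\ Q k x.
  move=> k.
  case: (boolP (k < H.*2)%N) => [/hasQ/hasP[x xn Qx]|_]; [by exists x | by exists 0%N].
have rprop k : (k < H.*2)%N -> [/\ r k == 1 %[mod P], (tt k < r k)%N & (r k <= tt k.+1)%N].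
  by move=> kH; have [rn Qr] := Hr k kH; apply: HQ => //; apply: prm.
have rS k : (k < H.*2)%N -> r k \in S.
  move=> kH; have [h1 h2 h3] := rprop k kH; have [/prm h4 _] := Hr k kH.
  by rewrite HS h4 h1 (leq_trans h3) // ttm.
have rinj k k' : (k < H.*2)%N -> (k' < H.*2)%N -> k != k' -> r k != r k'.
  wlog lt : k k' / (k < k')%N.
    move=> hw kH kH'; case: ltngtP => // lt _; first by apply: hw; rewrite ?(ltn_eqF lt).
    by rewrite eq_sym; apply: hw; rewrite ?(ltn_eqF lt).
  move=> kH kH' _; have [_ _ h3] := rprop k kH; have [_ h2 _] := rprop k' kH'.
  by rewrite ltn_eqF // (leq_ltn_trans h3) // (leq_ltn_trans _ h2) // ttm.
have dH j : (j < H)%N -> (j.*2 < H.*2)%N /\ (j.*2.+1 < H.*2)%N by lia.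
have rr j : (j < H)%N -> r j.*2 != r j.*2.+1.
  by move=> /dH[h1 h2]; apply: rinj => //; rewrite neq_ltn ltnSn.
have /choice[q Hq] : forall j, exists x, (j < H)%N -> x \in primes n /\ QQ (r j.*2, r j.*2.+1) x.
  move=> j.
  case: (boolP (j < H)%N) => [jH|_]; last by exists 0%N.
  have [h1 h2] := dH j jH.
  have /hasP[x xn Qx] : has (QQ (r j.*2, r j.*2.+1)) (primes n) by apply: hasQQ; rewrite /= ?rS ?rr.
  by exists x.
have qprop j : (j < H)%N -> [/\ (z < q j)%N, q j == 1 %[mod P],
     q j == c (r j.*2) %[mod r j.*2] & q j == c (r j.*2.+1) %[mod r j.*2.+1]] /\
     (forall y, y \in S -> y != r j.*2 -> y != r j.*2.+1 -> q j == 1 %[mod y]).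
  move=> jH; have [h1 h2] := dH j jH; have [qn Qq] := Hq j jH.
  by apply: HQQ Qq; rewrite /= ?rS ?rr ?prm.
rewrite -(card_supp_values R p gT n0 nN sq).
apply: le_trans (@typical_few_bad R p gT N' tw U c hp pgT card3 abT tw1 tw_triv tw_gen c_ne1
  s t H n z r q s1 n0 nN _ _ _ rinj _ _ _ _ _ _) => //.
- rewrite ler_nat subset_leq_card //; apply/fintype.subsetP => a.
  by rewrite !finset.in_set andbA supp_fibre.
- by move=> k /Hr[].
- by move=> k /rprop[].
- by move=> k kH; have [_ _ h] := rprop k kH; rewrite (leq_trans h) // (leq_trans _ tz) // ttm.
- by move=> j /Hq[].
- by move=> j /qprop[[]].
- by move=> j /qprop[[]].
- by move=> j /qprop[[]].
- by move=> j /qprop[[]].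
move=> j k jH kH k1 k2; have [h1 h2] := dH j jH; have [_ h] := qprop j jH.
by apply: h; rewrite ?rS ?rinj.
Qed.

(** [eps / 2] pays for the failure of all [H] trials, [eps / 4] for supports missing a window [Q i],
    and [eps / 4] for those missing a class [QQ x]. The choices go in the order [H], windows, [S],
    classes, and only then [z] and [N]. *)
Theorem few_bad_fibre (eps : R) (s t : gT) : 0 < eps -> s != 1%g -> exists z0 K0, forall z N N' U,
  (z0 <= z)%N -> (z ^ K0 <= N)%N -> (N <= N')%N ->
  #|[set a in tuples p gT N' N | [forall l : 'I_N'.+1, (z < l)%N ==> ~~ ((a l == s) && (frobval tw U a l == t))]]|%:R
  <= eps * #|tuples p gT N' N|%:R.
Proof.
move=> e0 s1.
have P1 : (1 < P)%N by apply: ltnW.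
have K1 : 1 <= K by rewrite ler1n cardsC1; case: #|gT| card3 => [|[]].
have K0 : 0 < K by apply: lt_le_trans K1.
have [H HH] : exists H, (1 - K ^- 3) ^+ H <= eps / 2.
  apply: pow_small; rewrite ?invr_gt0 ?exprn_gt0 ?divr_gt0 //.
  by rewrite invf_le1 ?exprn_gt0 // exprn_ege1.
have [C [x0 sieve]] := swt_sieve (ltW K0) P1 (coprimen1 P).
pose C' := `|C| + 1.
have C'0 : 0 < C' by rewrite ltr_wpDl.
have CC' : C <= C' by apply: le_trans (ler_norm C) _; rewrite lerDl.
(* If the reciprocals over each of [m] sets of primes sum to at least [Lof m], the supports avoiding
   one of these sets weigh at most [eps / 4] in all. *)
pose Lof m : R := 4 * m%:R * C' / eps + 1.
have Lof0 m : 0 < Lof m by rewrite ltr_wpDl // divr_ge0 ?(ltW e0) // !mulr_ge0 // ltW.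
have Lof_bound m x F : 0 <= x -> 0 <= F -> x * Lof m <= C' * F -> m%:R * x <= eps / 4 * F.
  move=> xge0 F0 h; have h1 : 4 * m%:R * C' / eps * x <= C' * F.
    apply: le_trans h; have -> : x * Lof m = 4 * m%:R * C' / eps * x + x by rewrite /Lof; ring.
    by rewrite lerDl.
  rewrite -(ler_pM2l C'0) (_ : C' * (eps / 4 * F) = eps / 4 * (C' * F)); last by ring.
  have e4 : 0 < eps / 4 by rewrite divr_gt0.
  rewrite -ler_pdivrMl // (le_trans _ h1) // le_eqVlt; apply/orP; left; apply/eqP; field.
  by rewrite gt_eqF.
have sum_bound (A : eqType) (l : seq A) f F : 0 <= F -> (forall i, i \in l -> f i * Lof (size l) <= C' * F) ->
    \sum_(i <- l) f i <= eps / 4 * F.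
  move=> F0 h; pose b := C' * F / Lof (size l).
  apply: (@le_trans _ _ ((size l)%:R * b)).
    have fb i : i \in l -> f i <= b by move=> il; rewrite ler_pdivlMr ?Lof0 // h.
    elim: l b fb {h} => [|i l IH] b fb; first by rewrite big_nil mul0r.
    rewrite big_cons /= -natr1 mulrDl mul1r addrC lerD //; last by rewrite fb ?mem_head.
    by apply: IH => j jl; rewrite fb // inE jl orbT.
  by apply: Lof_bound; rewrite /b ?divfK ?gt_eqF // divr_ge0 ?mulr_ge0 // ltW.
have [v0 [K1' HT]] := sum_inv_AP (Lof H.*2) P1 (coprimen1 P).
(* [maxn] keeps the thresholds nondecreasing, while each window reaches the power required by
   [sum_inv_AP]. *)
pose tt i := iter i (fun v => maxn v (v ^ K1')) v0.
have ttS i : (tt i <= tt i.+1)%N by rewrite /tt /= leq_maxl.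
have ttm i j : (i <= j)%N -> (tt i <= tt j)%N.
  by move=> /subnKC <-; elim: (j - i)%N => [|k IH]; rewrite ?addn0 // addnS (leq_trans IH).
pose T := tt H.*2.
pose S := [seq r <- iota 0 T.+1 | prime r && (r == 1 %[mod P])].
have HS x : (x \in S) = [&& (x <= T)%N, prime x & x == 1 %[mod P]].
  by rewrite mem_filter mem_iota /= add0n ltnS andbC.
have uS : uniq S by rewrite filter_uniq // iota_uniq.
have HSp x : x \in S -> prime x /\ x == 1 %[mod P] by rewrite HS => /and3P[].
pose pairs := [seq x <- [seq (a, b) | a <- S, b <- S] | x.1 != x.2].
have pairsP (x : nat * nat) : (x \in pairs) = [&& x.1 \in S, x.2 \in S & x.1 != x.2].
  case: x => a b; rewrite mem_filter /= andbC andbA; congr (_ && _).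
  by apply/allpairsP/andP => [[[a' b'] /= [h1 h2 [-> ->]]]|[h1 h2]] //; exists (a, b).
have ex (x : nat * nat) : exists y : (nat * nat) * (nat * nat), x \in pairs ->
    [/\ forall l, l == y.1.2 %[mod y.1.1] -> [/\ l == 1 %[mod P], l == c x.1 %[mod x.1], l == c x.2 %[mod x.2] &
        forall u, u \in S -> u != x.1 -> u != x.2 -> l == 1 %[mod u]]
     & forall v N, (y.2.1 <= v)%N -> (v ^ y.2.2 <= N)%N ->
      Lof (size pairs) <= \sum_(v.+1 <= q < N.+1 | prime q && (q == y.1.2 %[mod y.1.1])) q%:R^-1].
  case: (boolP (x \in pairs)) => [xp|_]; last by exists ((0, 0), (0, 0))%N.
  move: (xp); rewrite pairsP => /and3P[h1 h2 h3].
  have [M [b [M1 cb Hb]]] := residue_exists P1 c_coprime HSp uS h1 h2 h3.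
  have [v [k Hv]] := sum_inv_AP (Lof (size pairs)) M1 cb.
  by exists ((M, b), (v, k)).
have [g Hg] := choice ex.
pose kmax := (\max_(x <- pairs) (g x).2.2).+1.
pose vmax := \max_(x <- pairs) (g x).2.1.
exists (maxn (maxn T x0) (maxn vmax 1)), kmax => z N N' U.
rewrite !geq_max => /andP[/andP[Tz xz] /andP[vz z1]] zN NN'.
have zleN : (z <= N)%N by apply: leq_trans zN; rewrite -{1}(expn1 z) leq_pexp2l.
pose Q i : pred nat := fun q => [&& q == 1 %[mod P], (tt i < q)%N & (q <= tt i.+1)%N].
pose QQ x : pred nat := fun q => (q == (g x).1.2 %[mod (g x).1.1]) && (z < q)%N.
have w0 q : 0 <= w q by apply: ler0n.
pose F := swt_count w N.
have F0 : 0 <= F by apply: swt_count_ge0.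
have offQ (A : pred nat) L : (forall q, prime q -> A q -> q == 1 %[mod P]) ->
    L <= \sum_(1 <= q < N.+1 | prime q && A q) q%:R^-1 -> swt_count (weight_off A w) N * L <= C' * F.
  move=> A1 HL.
  apply: (@le_trans _ _ (C * F)); last by rewrite ler_wpM2r.
  apply: le_trans (sieve w N A w0 _ _ _ _); last exact: leq_trans zleN.
  - by rewrite ler_wpM2l // swt_count_ge0 //; apply: weight_off_ge0.
  - by move=> q; apply: wt_le.
  - by move=> q pr q1; apply: wt_ge1.
  - by move=> q pr /A1 h; apply: wt_ge1 => //; apply: h.
have sub (A : pred nat) (B : pred nat) v y : (v <= y)%N -> (y <= N)%N ->
    (forall q, (v < q)%N -> (q <= y)%N -> B q -> A q) ->
    \sum_(v.+1 <= q < y.+1 | prime q && B q) (q%:R^-1 : R) <= \sum_(1 <= q < N.+1 | prime q && A q) q%:R^-1.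
  move=> vy yN AB; rewrite [X in _ <= X](@big_cat_nat _ _ _ v.+1) ?ltnS ?(leq_trans vy) //=.
  have i0 (q : nat) : 0 <= q%:R^-1 :> R by rewrite invr_ge0.
  apply: ler_wpDl; first exact: sumr_ge0.
  rewrite [X in _ <= X](@big_cat_nat _ _ _ y.+1) ?ltnS //=.
  apply: ler_wpDr; first exact: sumr_ge0.
  rewrite [X in X <= _]big_mkcond [X in _ <= X]big_mkcond [X in X <= _]big_nat_cond [X in _ <= X]big_nat_cond.
  apply: ler_sum => q; rewrite andbT ltnS => /andP[vq qy].
  case: (prime q) => //=; case: ifP => [/(AB q vq qy) ->//|_]; by case: ifP.
have boundQ i : (i < H.*2)%N -> swt_count (weight_off (Q i) w) N * Lof H.*2 <= C' * F.
  move=> iH; apply: offQ => [q _ /and3P[]//|].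
  have v0i : (v0 <= tt i)%N by rewrite -[v0]/(tt 0) ttm.
  apply: le_trans (HT (tt i) (tt i.+1) v0i _) _; first by rewrite leq_maxr.
  apply: sub; rewrite ?ttS //.
    by apply: leq_trans zleN; apply: leq_trans Tz; rewrite ttm.
  by move=> q vq qy q1; rewrite /Q q1 vq qy.
have boundQQ x : x \in pairs -> swt_count (weight_off (QQ x) w) N * Lof (size pairs) <= C' * F.
  move=> xp; have [h1 h2] := Hg x xp; apply: offQ => [q _ /andP[/h1[]]//|].
  have vx : ((g x).2.1 <= z)%N by apply: leq_trans vz; apply: (leq_bigmax_seq (F := fun x => (g x).2.1)).
  have kx : (z ^ (g x).2.2 <= N)%N.
    apply: leq_trans zN; rewrite leq_pexp2l // /kmax leqW //.
    by apply: (leq_bigmax_seq (F := fun x => (g x).2.2)).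
  apply: le_trans (h2 z N vx kx) _; apply: sub => // q vq qy q1.
  by rewrite /QQ q1 vq.
rewrite (card_tuples R p gT NN') tuples_partition natr_sum.
pose B n := #|[set a | [&& a \in family_tame N', supp_prod a == n &
     [forall l : 'I_N'.+1, (z < l)%N ==> ~~ ((a l == s) && (frobval tw U a l == t))]]]|.
have off0 A n : 0 <= swt (weight_off A w) n by apply: swt_ge0; apply: weight_off_ge0.
(* A support missing some [Q i] or [QQ x] is counted in full by the corresponding [weight_off]. *)
have pointwise n : (0 < n)%N -> (n <= N)%N ->
    (B n)%:R <= eps / 2 * swt w n + \sum_(i <- iota 0 H.*2) swt (weight_off (Q i) w) n
       + \sum_(x <- pairs) swt (weight_off (QQ x) w) n.
  move=> n0 nN; have nN' := leq_trans nN NN'.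
  have sn0 : 0 <= swt w n by apply: swt_ge0.
  have S1 : 0 <= \sum_(i <- iota 0 H.*2) swt (weight_off (Q i) w) n by apply: sumr_ge0.
  have S2 : 0 <= \sum_(x <- pairs) swt (weight_off (QQ x) w) n by apply: sumr_ge0.
  have esn : 0 <= eps / 2 * swt w n by rewrite mulr_ge0 // divr_ge0 // ltW.
  have Bn : (B n)%:R <= swt w n.
    rewrite -(card_supp R p gT n0 nN') ler_nat subset_leq_card //; apply/fintype.subsetP => a.
    by rewrite !finset.in_set => /and3P[-> ->].
  have [hQ|/allPn[i iH nQ]] := boolP (all (fun i => has (Q i) (primes n)) (iota 0 H.*2)); last first.
    apply: (@le_trans _ _ (\sum_(i <- iota 0 H.*2) swt (weight_off (Q i) w) n)); last by lra.
    apply: le_trans Bn _; have := sum_ge_member (fun i => off0 (Q i) n) iH.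
    by rewrite swt_weight_off // (negbTE nQ).
  have [hQQ|/allPn[x xp nQQ]] := boolP (all (fun x => has (QQ x) (primes n)) pairs); last first.
    apply: (@le_trans _ _ (\sum_(x <- pairs) swt (weight_off (QQ x) w) n)); last by lra.
    apply: le_trans Bn _; have := sum_ge_member (fun x => off0 (QQ x) n) xp.
    by rewrite swt_weight_off // (negbTE nQQ).
  apply: (@le_trans _ _ (eps / 2 * swt w n)); last by lra.
  apply: (@le_trans _ _ ((1 - K ^- 3) ^+ H * swt w n)); last by rewrite ler_wpM2r.
  apply: (@few_bad_support s t H z n N' Q QQ tt S U s1 n0 nN' ttm Tz) => //.
  - by move=> i x _ /and3P[].
  - move=> x l h1 h2 h3 _ /andP[hl zl].
    have xp : x \in pairs by rewrite pairsP h1 h2 h3.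
    by have [/(_ l hl)[l1 l2 l3 l4] _] := Hg x xp.
  - by move=> i iH; apply: (allP hQ); rewrite mem_iota.
  - by move=> x h1 h2 h3; apply: (allP hQQ); rewrite pairsP h1 h2 h3.
apply: (@le_trans _ _ (\sum_(1 <= n < N.+1) (eps / 2 * swt w n + \sum_(i <- iota 0 H.*2) swt (weight_off (Q i) w) n
       + \sum_(x <- pairs) swt (weight_off (QQ x) w) n))).
  rewrite big_nat_cond [X in _ <= X]big_nat_cond; apply: ler_sum => n; rewrite andbT ltnS => /andP[n0 nN].
  exact: pointwise.
rewrite !big_split /= -mulr_sumr exchange_big [X in _ + X]exchange_big /= -/(swt_count w N) -/F.
have half1 : \sum_(i <- iota 0 H.*2) \sum_(1 <= n < N.+1) swt (weight_off (Q i) w) n <= eps / 4 * F.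
  apply: sum_bound => // i; rewrite mem_iota size_iota => /= iH; exact: boundQ.
have half2 : \sum_(x <- pairs) \sum_(1 <= n < N.+1) swt (weight_off (QQ x) w) n <= eps / 4 * F.
  by apply: sum_bound => // x; apply: boundQQ.
lra.
Qed.

End Core.

(** * Counting homomorphisms *)

Section HomProducts.

Variable gT : finGroupType.
Hypothesis abT : abelian [set: gT].
Implicit Types f g : galQ -> gT.

Lemma hom_one : is_hom (fun _ => 1%g : gT).
Proof. by split=> [s t r _|]; [rewrite mulg1 | exists [::]]. Qed.

Lemma hom_mul f g : is_hom f -> is_hom g -> is_hom (fun s => f s * g s)%g.
Proof.
move=> [fM [S1 fS]] [gM [S2 gS]]; split=> [s t r h|].
  rewrite (fM _ _ _ h) (gM _ _ _ h) -!mulgA; congr (_ * _)%g.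
  by rewrite !mulgA (abelian_mulC abT (f t)).
exists (S1 ++ S2) => s t h; congr (_ * _)%g; [apply: fS | apply: gS] => x xS; apply: h;
  by rewrite mem_cat xS ?orbT.
Qed.

Lemma hom_invfun f : is_hom f -> is_hom (fun s => (f s)^-1)%g.
Proof.
move=> [fM [S fS]]; split=> [s t r h|]; last by exists S => s t /fS ->.
by rewrite (fM _ _ _ h) invMg (abelian_mulC abT).
Qed.

Lemma hom_prod (I : Type) (r : seq I) (F : I -> galQ -> gT) : (forall i, is_hom (F i)) ->
  is_hom (fun s => \prod_(i <- r) F i s)%g.
Proof.
move=> hF; elim: r => [|i r IH].
  by have := hom_one; congr is_hom; apply: funext => s; rewrite big_nil.
by have := hom_mul (hF i) IH; congr is_hom; apply: funext => s; rewrite big_cons.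
Qed.

Lemma prod_single (I : eqType) (r : seq I) (F : I -> gT) k : uniq r -> (forall i, i != k -> F i = 1%g) ->
  (\prod_(i <- r) F i = if k \in r then F k else 1)%g.
Proof.
move=> ur F1; elim: r ur => [|i r IH] /=; first by rewrite big_nil.
move=> /andP[ir ur]; rewrite big_cons IH // inE (eq_sym k).
case: eqP => [<-|/eqP ik] /=; first by rewrite (negbTE ir) mulg1.
by rewrite F1 // mul1g.
Qed.

End HomProducts.

Section TwistFamily.

Variables (gT : finGroupType) (Pq : nat -> algC -> Prop) (sig frob : nat -> galQ).
Hypothesis hPq : forall q, prime q -> qbar_prime_above q (Pq q).
Hypothesis hsig : forall q, prime q -> tame_generator (Pq q) (sig q).
Hypothesis hfrob : forall q, prime q -> frob_lift q (Pq q) (frob q).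

(** [twist] takes a proof that [r] is prime; deciding it inside gives a function of all [r], trivial
    at composites, as the abstract [tw] demands. *)
Definition conductor_twist (r : nat) (b : gT) (g : galQ) : gT :=
  match pselect (prime r) with
  | left prr => twist prr (hPq prr) (hsig prr) b g
  | right _ => 1%g
  end.

Lemma conductor_twist1 r g : conductor_twist r 1%g g = 1%g.
Proof. by rewrite /conductor_twist; case: pselect => // prr; rewrite /twist expg1n. Qed.

Lemma conductor_twist_hom r b : prime r -> (b ^+ r.-1 = 1)%g -> is_hom (conductor_twist r b).
Proof.
move=> prr hb; case e : (pselect (prime r)) => [pr|//].
have := twist_hom pr (hPq pr) (hsig pr) hb; congr is_hom.
by apply: funext => g; rewrite /conductor_twist e.
Qed.

Lemma conductor_twist_sig r b : prime r -> (b ^+ r.-1 = 1)%g -> conductor_twist r b (sig r) = b.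
Proof. by move=> prr hb; rewrite /conductor_twist; case: pselect => // pr; rewrite twist_sig. Qed.

Lemma conductor_twist_inertia r b l t : prime r -> prime l -> l != r -> (b ^+ r.-1 = 1)%g ->
  inertia (Pq l) t -> conductor_twist r b t = 1%g.
Proof.
move=> prr prl lr hb it; rewrite /conductor_twist; case: pselect => // pr.
by rewrite twist_frob_one // (inertia_zeta pr prl (hPq prl) lr it).
Qed.

Lemma zeta_exp_mod r l k : prime r -> l == k %[mod r] -> zeta r ^+ l = zeta r ^+ k.
Proof. by move=> prr /eqP e; rewrite -(prim_expr_mod (zetaP prr)) e (prim_expr_mod (zetaP prr)). Qed.

Lemma conductor_twist_frob_one r l b : prime r -> prime l -> l != r -> (b ^+ r.-1 = 1)%g ->
  l == 1 %[mod r] -> conductor_twist r b (frob l) = 1%g.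
Proof.
move=> prr prl lr hb l1; rewrite /conductor_twist; case: pselect => // pr.
rewrite twist_frob_one // (frob_zeta prr prl (hPq prl) lr (hfrob prl)).
by rewrite (zeta_exp_mod prr l1) expr1.
Qed.

Lemma conductor_twist_frob_gen r l b : prime r -> prime l -> l != r -> (b ^+ r.-1 = 1)%g ->
  l == cyc_exp r (sig r) %[mod r] -> conductor_twist r b (frob l) = b.
Proof.
move=> prr prl lr hb l1; rewrite /conductor_twist; case: pselect => // pr.
rewrite twist_frob_gen // (frob_zeta prr prl (hPq prl) lr (hfrob prl)).
by rewrite (zeta_exp_mod prr l1) -cyc_expP.
Qed.

(** Otherwise [sig r] would fix [zeta r], and the twist, whose value there is [b], would be trivial
    at it. *)
Lemma cyc_exp_sig_ne1 r (b : gT) : prime r -> (b ^+ r.-1 = 1)%g -> b != 1%g -> cyc_exp r (sig r) != 1 %[mod r].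
Proof.
move=> prr hb b1; apply: contraNN b1 => h.
rewrite -(twist_sig prr (hPq prr) (hsig prr) hb); apply/eqP; apply: twist_frob_one => //.
by rewrite cyc_expP // (zeta_exp_mod prr h) expr1.
Qed.

End TwistFamily.

(** * Homomorphisms as tuples with a fixed remaining factor *)

Section TupleHom.

Variables (R : realType) (p : nat) (gT : finGroupType).
Variables (Pq : nat -> algC -> Prop) (sig frob : nat -> galQ).
Hypothesis (hp : prime p) (hab : abelian [set: gT]) (hpg : pgroup p [set: gT]).
Hypothesis hPq : forall q, prime q -> qbar_prime_above q (Pq q).
Hypothesis hsig : forall q, prime q -> tame_generator (Pq q) (sig q).
Hypothesis hfrob : forall q, prime q -> frob_lift q (Pq q) (frob q).
Variable N' : nat.
Local Notation I := 'I_N'.+1.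
Local Notation tw := (@conductor_twist gT Pq sig hPq hsig).
Local Notation family_tame := (family (fun i : I => tame_values p gT i)).
Implicit Types (u phi : galQ -> gT) (a : {ffun I -> gT}).

Definition tuple_hom u a (g : galQ) : gT := (u g * \prod_(i : I) tw i (a i) g)%g.

Lemma tame_valuesP i a : a \in family_tame ->
  a i = 1%g \/ [/\ prime i, (i : nat) != p & (a i ^+ (i : nat).-1 = 1)%g].
Proof.
move=> /familyP/(_ i); rewrite /tame_values; case: ifP => [/andP[h1 h2]|_]; rewrite inE => /eqP; last by left.
by right.
Qed.

Lemma tw_tuple_inertia (i : I) a l t : a \in family_tame -> prime l -> (i : nat) != l -> inertia (Pq l) t -> tw i (a i) t = 1%g.
Proof.
move=> fa prl il it; have [->|[h1 h2 h3]] := tame_valuesP i fa; first exact: conductor_twist1.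
by apply: conductor_twist_inertia it; rewrite // eq_sym.
Qed.

Lemma tw_tuple_hom (i : I) a : a \in family_tame -> is_hom (tw i (a i)).
Proof.
move=> fa; have [->|[h1 h2 h3]] := tame_valuesP i fa; last exact: conductor_twist_hom.
by have := hom_one gT; congr is_hom; apply: funext => g; rewrite conductor_twist1.
Qed.

Lemma prod_tw_hom a : a \in family_tame -> is_hom (fun g => \prod_(i : I) tw i (a i) g)%g.
Proof. by move=> fa; apply: hom_prod => // i; apply: tw_tuple_hom. Qed.

Lemma tuple_hom_is_hom u a : is_hom u -> a \in family_tame -> is_hom (tuple_hom u a).
Proof. by move=> hu fa; apply: hom_mul => //; apply: prod_tw_hom. Qed.

Lemma sig_inertia q : prime q -> inertia (Pq q) (sig q).
Proof. by move=> /hsig[]. Qed.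

Lemma prod_tw_sig a (i : I) : a \in family_tame -> prime i -> (i : nat) != p ->
  (\prod_(j : I) tw j (a j) (sig i) = a i)%g.
Proof.
move=> fa pri ip; rewrite (prod_single (k := i)) ?index_enum_uniq // => [|j ji].
  rewrite mem_index_enum conductor_twist_sig //.
  by have [->|[]//] := tame_valuesP i fa; rewrite expg1n.
by apply: tw_tuple_inertia (sig_inertia pri).
Qed.

Lemma prod_tw_sig_big a q : a \in family_tame -> prime q -> (N' < q)%N ->
  (\prod_(j : I) tw j (a j) (sig q) = 1)%g.
Proof.
move=> fa prq Nq; rewrite big1 // => j _; apply: tw_tuple_inertia (sig_inertia prq) => //.
by rewrite ltn_eqF // (leq_trans _ Nq).
Qed.

(** No twist ramifies at [p], so ramification at [p] is decided by [u]. *)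
Lemma tuple_hom_inertia u a t : a \in family_tame -> inertia (Pq p) t -> tuple_hom u a t = u t.
Proof.
move=> fa it; rewrite /tuple_hom big1 ?mulg1 // => j _.
have [->|[_ jp _]] := tame_valuesP j fa; first exact: conductor_twist1.
exact: tw_tuple_inertia it.
Qed.

Definition tame_trivial u := forall q, prime q -> q != p -> u (sig q) = 1%g.

Lemma tuple_hom_sig u a (i : I) : tame_trivial u -> a \in family_tame -> prime i -> (i : nat) != p ->
  tuple_hom u a (sig i) = a i.
Proof. by move=> u1 fa pri ip; rewrite /tuple_hom u1 // mul1g prod_tw_sig. Qed.

Definition ram_factor u : nat := if `[<ramified u p>] then p else 1%N.

Definition cond_list u a : seq nat :=
  (if `[<ramified u p>] then [:: p] else [::]) ++ map (@nat_of_ord N'.+1) [seq i <- enum I | a i != 1%g].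

Lemma cond_list_prod u a : (\prod_(q <- cond_list u a) q = ram_factor u * supp_prod a)%N.
Proof.
rewrite /cond_list big_cat /= big_map big_filter big_enum_cond /=; congr (_ * _)%N.
by rewrite /ram_factor; case: ifP; rewrite ?big_seq1 ?big_nil.
Qed.

Lemma supp_mem a q : (q \in map (@nat_of_ord N'.+1) [seq i <- enum I | a i != 1%g]) <-> exists2 i : I, q = i & a i != 1%g.
Proof.
split=> [/mapP[i]|[i -> ai]]; first by rewrite mem_filter => /andP[ai _] ->; exists i.
by apply/mapP; exists i => //; rewrite mem_filter ai mem_enum.
Qed.

Lemma cond_list_uniq u a : a \in family_tame -> uniq (cond_list u a).
Proof.
move=> fa; rewrite cat_uniq map_inj_uniq; last exact: val_inj.
apply/and3P; split; [by case: ifP | | exact/filter_uniq/enum_uniq].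
apply/hasPn => q /supp_mem[i -> ai]; case: ifP => // _; rewrite inE.
by have [e|[]//] := tame_valuesP i fa; rewrite e eqxx in ai.
Qed.

Lemma cond_list_mem u a q : is_hom u -> tame_trivial u -> a \in family_tame ->
  (q \in cond_list u a) <-> (prime q /\ ramified (tuple_hom u a) q).
Proof.
move=> hu u1 fa; have ha := tuple_hom_is_hom hu fa.
have ramp : ramified (tuple_hom u a) p <-> ramified u p.
  rewrite (ramified_iff ha hp (hPq hp) (hfrob hp)) (ramified_iff hu hp (hPq hp) (hfrob hp)).
  by split=> -[t it h]; exists t => //; move: h; rewrite tuple_hom_inertia.
rewrite mem_cat; split=> [/orP[|/supp_mem[i -> ai]]|[prq rq]].
- by case: asboolP => // rp; rewrite inE => /eqP ->; split=> //; apply/ramp.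
- have [e|[pri ip _]] := tame_valuesP i fa; first by rewrite e eqxx in ai.
  split=> //; apply/(ramified_tame ha hpg pri (hPq pri) ip (hsig pri) (hfrob pri)).
  by rewrite tuple_hom_sig.
have [qp|qp] := eqVneq q p.
  by move: rq; rewrite qp => /ramp rp; rewrite asboolT // inE eqxx.
apply/orP; right; move: rq => /(ramified_tame ha hpg prq (hPq prq) qp (hsig prq) (hfrob prq)).
have [qN|Nq] := leqP q N'; last by rewrite /tuple_hom u1 // prod_tw_sig_big // mulg1 eqxx.
have qN' : (q < N'.+1)%N by [].
by rewrite (@tuple_hom_sig u a (Ordinal qN')) // => aq; apply/supp_mem; exists (Ordinal qN').
Qed.

Lemma cond_le_tuple u a (X : R) : is_hom u -> tame_trivial u -> a \in family_tame ->
  cond_le (tuple_hom u a) X <-> (ram_factor u * supp_prod a)%N%:R <= X.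
Proof.
move=> hu u1 fa; rewrite -cond_list_prod; split=> [[s [us ms le]]|le].
  rewrite (perm_big s) //; apply: uniq_perm; rewrite ?cond_list_uniq // => q.
  by apply/idP/idP => [/(cond_list_mem _ hu u1 fa)/ms|/ms/(cond_list_mem _ hu u1 fa)].
by exists (cond_list u a); split=> //; [apply: cond_list_uniq | move=> q; apply: cond_list_mem].
Qed.

Definition tame_tuple phi : {ffun I -> gT} :=
  [ffun i : I => if prime i && ((i : nat) != p) then phi (sig i) else 1%g].

Definition reduced phi (g : galQ) : gT := (phi g * (\prod_(i : I) tw i (tame_tuple phi i) g)^-1)%g.

Lemma tame_tuple_family phi : is_hom phi -> tame_tuple phi \in family_tame.
Proof.
move=> hphi; apply/familyP => i; rewrite ffunE /tame_values; case: ifP => [/andP[pri ip]|_]; rewrite inE //.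
by rewrite (tame_order hphi hpg hab pri (hPq pri) ip (sig_inertia pri) (hfrob pri)).
Qed.

Lemma tuple_hom_reduced phi : tuple_hom (reduced phi) (tame_tuple phi) = phi.
Proof. by apply: funext => g; rewrite /tuple_hom /reduced mulgKV. Qed.

Lemma reduced_hom phi : is_hom phi -> is_hom (reduced phi).
Proof.
by move=> hphi; apply: hom_mul => //; apply: hom_invfun => //; apply: prod_tw_hom; apply: tame_tuple_family.
Qed.

Lemma tame_tuple_hom u a : tame_trivial u -> a \in family_tame -> tame_tuple (tuple_hom u a) = a.
Proof.
move=> u1 fa; apply/ffunP => i; rewrite ffunE; case: ifP => [/andP[pri ip]|h]; first by rewrite tuple_hom_sig.
by have [->|[h1 h2 _]] := tame_valuesP i fa; rewrite // h1 h2 in h.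
Qed.

Lemma reduced_tuple_hom u a : tame_trivial u -> a \in family_tame -> reduced (tuple_hom u a) = u.
Proof. by move=> u1 fa; apply: funext => g; rewrite /reduced tame_tuple_hom // /tuple_hom mulgK. Qed.

(** Up to [N'] the twists cancel the tame values; a larger prime exceeds [X] and cannot divide a
    conductor bounded by [X]. *)
Lemma reduced_trivial phi (X : R) : is_hom phi -> 0 <= X -> N' = Num.trunc X -> cond_le phi X ->
  tame_trivial (reduced phi).
Proof.
move=> hphi X0 NX [s [us ms le]] q prq qp; have ft := tame_tuple_family hphi.
rewrite /reduced; have [qN|Nq] := leqP q N'.
  have qN' : (q < N'.+1)%N by [].
  have := @prod_tw_sig _ (Ordinal qN') ft prq qp => /= ->.
  by rewrite ffunE /= prq qp mulgV.
rewrite prod_tw_sig_big // invg1 mulg1; apply/eqP.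
apply: contraTT Nq => rq; rewrite -leqNgt NX truncn_ge_nat //.
have qs : q \in s.
  by apply/ms; split=> //; apply/(ramified_tame hphi hpg prq (hPq prq) qp (hsig prq) (hfrob prq)).
apply: le_trans le; rewrite ler_nat (big_rem q qs) /= leq_pmulr //.
rewrite big_seq; apply: prodn_cond_gt0 => l /mem_rem/ms[prl _]; exact: prime_gt0.
Qed.

End TupleHom.

(** * Finite cardinalities and comparison by fibres *)

Section Cardinality.

Variable T : Type.

Lemma ncard_eq (S : set T) n : (S #= `I_n)%card -> ncard S = n.
Proof.
move=> Sn; have h : (S #= `I_(ncard S))%card.
  exact: (@xgetPex _ 0%N [set n : nat | (S #= `I_n)%card]%classic (ex_intro _ n Sn)).
by apply/card_eq_II; apply: card_eq_trans Sn; rewrite card_eq_sym.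
Qed.

Lemma ncard_infinite (S : set T) : ~ finite_set S -> ncard S = 0%N.
Proof. by move=> h; apply: xgetPN => n Sn; apply: h; exists n. Qed.

Lemma ncard_range n (e : 'I_n -> T) : injective e -> ncard (range e) = n.
Proof.
move=> inj; apply: ncard_eq.
apply: (card_eq_trans (inj_card_eq (in2W inj))).
by rewrite card_eq_sym card_II.
Qed.

Lemma finite_enum (S : set T) : finite_set S ->
  exists n (e : 'I_n -> T), injective e /\ forall x, S x <-> exists k, e k = x.
Proof.
move=> [n /card_set_bijP[f [fI finj fsurj]]].
have /choice[e He] : forall k : 'I_n, exists x, S x /\ f x = k.
  by move=> k; have [x Sx fx] := fsurj k (ltn_ord k); exists x.
exists n, e; split=> [i j eij|x].
  by apply: val_inj; rewrite /= -(He i).2 -(He j).2 eij.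
split=> [Sx|[k <-]]; last by have [] := He k.
exists (Ordinal (fI x Sx)); have [h1 h2] := He (Ordinal (fI x Sx)).
by apply: finj; rewrite ?inE.
Qed.

(** The hypothesis is summed over the fibres of [f]. [key] chooses one index per fibre, so the
    fibres are indexed by a finite type although [T] is arbitrary. *)
Lemma class_ratio (R : realType) n (f : 'I_n -> T) (B : {set 'I_n}) (d : R) :
  (forall i, #|[set j | `[<f j = f i>] && (j \in B)]|%:R <= d * #|[set j | `[<f j = f i>]]|%:R) ->
  #|B|%:R <= d * n%:R.
Proof.
move=> H; pose key i := odflt i [pick j | `[<f j = f i>]].
have keyf i : f (key i) = f i by rewrite /key; case: pickP => //= j /asboolP.
have keyE i i' : f i = f i' -> key i = key i'.
  move=> e; rewrite /key (eq_pick (_ : _ =1 (fun j => `[<f j = f i'>]))); last by move=> j; rewrite e.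
  by case: pickP => //= /(_ i'); rewrite asboolT.
have part (A : pred 'I_n) : #|[set i | A i]|%:R = \sum_k (#|[set i | A i && (key i == k)]|%:R : R).
  rewrite -sum1_card (partition_big key predT) //= natr_sum; apply: eq_bigr => k _.
  by rewrite -sum1_card; congr _%:R; apply: eq_bigl => i; rewrite !inE.
have -> : B = [set i | i \in B] by apply/finset.setP => i; rewrite inE.
have -> : n%:R = #|[set i : 'I_n | true]|%:R :> R.
  by rewrite (_ : [set i : 'I_n | true] = [set: 'I_n]) ?cardsT ?card_ord //; apply/finset.setP => i; rewrite !inE.
rewrite !part mulr_sumr; apply: ler_sum => k _.
have [[i0 ki0]|nk] := pselect (exists i0, key i0 = k); last first.
  have e0 (A : pred 'I_n) : #|[set i | A i && (key i == k)]| = 0%N.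
    apply/eqP; rewrite cards_eq0; apply/eqP/finset.setP => i; rewrite !inE; apply/negP => /andP[_ /eqP e].
    by apply: nk; exists i.
  by rewrite !e0 mulr0.
have kE i : (key i == k) = `[<f i = f k>].
  apply/eqP/asboolP => [<-|e]; first by rewrite keyf.
  by rewrite -ki0; apply: keyE; rewrite e -ki0 keyf.
have := H k; congr (_%:R <= _ * _%:R); apply: eq_card => i; rewrite !inE kE //.
by rewrite andbC.
Qed.

End Cardinality.

(** * Epimorphisms with a common reduced part *)

Section Counting.

Variables (R : realType) (p : nat) (gT : finGroupType).
Variables (Pq : nat -> algC -> Prop) (sig frob : nat -> galQ).
Hypothesis (hp : prime p) (hodd : odd p) (hab : abelian [set: gT]) (hpg : pgroup p [set: gT]) (hnt : (1 < #|gT|)%N).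
Hypothesis hPq : forall q, prime q -> qbar_prime_above q (Pq q).
Hypothesis hsig : forall q, prime q -> tame_generator (Pq q) (sig q).
Hypothesis hfrob : forall q, prime q -> frob_lift q (Pq q) (frob q).
Local Notation tw := (@conductor_twist gT Pq sig hPq hsig).
Local Notation twf := (fun r b l => tw r b (frob l)).
Local Notation bad N' U z s t a :=
  [forall l : 'I_N'.+1, (z < l)%N ==> ~~ ((a l == s) && (frobval twf U a l == t))].

Lemma pgroup_dvd : (p %| #|gT|)%N.
Proof.
have := hpg; rewrite /pgroup cardsT => pn.
have [[|k] Dn] := p_natP pn; first by move: hnt; rewrite Dn expn0.
by rewrite Dn dvdn_exp.
Qed.

Lemma card_gt2 : (2 < #|gT|)%N.
Proof.
have p2 : (2 < p)%N by rewrite ltn_neqAle prime_gt1 // andbT; apply: contraTneq hodd => <-.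
by apply: leq_trans p2 _; rewrite dvdn_leq ?pgroup_dvd // ltnW.
Qed.

(** Thresholds uniform in the pair of values, by a maximum over finitely many pairs; non-surjective
    tuples have to be treated as bad for pairs other than [(s, t)]. *)
Lemma few_bad_all (d : R) : 0 < d -> exists z0 K0, forall s t z N N' U, s != 1%g ->
  (z0 <= z)%N -> (z ^ K0 <= N)%N -> (N <= N')%N ->
  #|[set a in tuples p gT N' N | bad N' U z s t a]|%:R <= d * #|tuples p gT N' N|%:R.
Proof.
move=> d0.
have ex (x : gT * gT) : exists y : nat * nat, x.1 != 1%g -> forall z N N' U,
  (y.1 <= z)%N -> (z ^ y.2 <= N)%N -> (N <= N')%N ->
  #|[set a in tuples p gT N' N | bad N' U z x.1 x.2 a]|%:R <= d * #|tuples p gT N' N|%:R.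
  have [_|x1] := eqVneq x.1 1%g; first by exists (0, 0)%N.
  have [|||||z0 [K0 h]] := @few_bad_fibre R p gT twf (fun r => cyc_exp r (sig r)) hp pgroup_dvd card_gt2 hab
    _ _ _ _ _ d x.1 x.2 d0 x1.
  - by move=> r l; apply: conductor_twist1.
  - by move=> r l b; apply: conductor_twist_frob_one hfrob _ _ _.
  - by move=> r l b; apply: conductor_twist_frob_gen hfrob _ _ _.
  - by move=> r b; apply: cyc_exp_sig_ne1 hPq hsig _ _.
  - by move=> r prr; apply: coprime_cyc_exp.
  by exists (z0, K0).
have [g Hg] := choice ex.
(* With [z >= 1] the power [z ^ k] is monotone in [k], so the largest exponent serves all pairs. *)
exists (maxn 1 (\max_x (g x).1)), (\max_x (g x).2) => s t z N N' U s1.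
rewrite geq_max => /andP[z1 zz] zN NN'.
apply: (Hg (s, t) s1) => //.
  by apply: leq_trans zz; apply: (leq_bigmax (F := fun x => (g x).1)).
by apply: leq_trans zN; rewrite leq_pexp2l //; apply: (leq_bigmax (F := fun x => (g x).2)).
Qed.

Variable X : R.
Hypothesis X0 : 0 <= X.
Let N' := Num.trunc X.
Let z := Num.trunc (expR (Num.sqrt (ln X))).
Local Notation family_tame := (family (fun i : 'I_N'.+1 => tame_values p gT i)).
Local Notation red := (@reduced p gT Pq sig hPq hsig N').
Local Notation tup := (@tame_tuple p gT sig N').
Local Notation thom := (@tuple_hom gT Pq sig hPq hsig N').

Lemma z_lt l : (z < l)%N -> expR (Num.sqrt (ln X)) < l%:R.
Proof. by rewrite !ltNge -truncn_ge_nat ?expR_ge0 // -ltnNge. Qed.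

Lemma epi_hom phi : @is_epi gT phi -> is_hom phi.
Proof. by case. Qed.

Lemma hom_surj_epi phi : is_hom phi -> (forall a : gT, exists s, phi s = a) -> is_epi phi.
Proof. by move=> [h1 h2] h3; split. Qed.

Section OneClass.

Variables (d : R) (s t : gT) (u : galQ -> gT).
Hypothesis (s1 : s != 1%g) (d0 : 0 < d) (dsmall : #|gT|%:R * d <= 1 / 2).
Hypothesis (hu : is_hom u) (u1 : tame_trivial p sig u).
Let N := Num.trunc (X / (ram_factor p u)%:R).
Hypothesis few : forall s t, s != 1%g ->
  #|[set a in tuples p gT N' N | bad N' (fun l => u (frob l)) z s t a]|%:R <= d * #|tuples p gT N' N|%:R.

Lemma ram_factor_gt0 : (0 < ram_factor p u)%N.
Proof. by rewrite /ram_factor; case: ifP => // _; apply: prime_gt0. Qed.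

Lemma tuples_cond a : (a \in tuples p gT N' N) <-> a \in family_tame /\ cond_le (thom u a) X.
Proof.
rewrite inE; split=> [/andP[fa h]|[fa /(cond_le_tuple hp hab hpg hPq hsig hfrob _ hu u1 fa) h]].
  split=> //; apply/(cond_le_tuple hp hab hpg hPq hsig hfrob _ hu u1 fa); move: h.
  rewrite /N truncn_ge_nat ?divr_ge0 // ler_pdivlMr ?ltr0n ?ram_factor_gt0 //.
  by rewrite mulnC natrM.
apply/andP; split=> //; rewrite /N truncn_ge_nat ?divr_ge0 // ler_pdivlMr ?ltr0n ?ram_factor_gt0 //.
by rewrite mulnC natrM in h.
Qed.

(** The union bound over possible missed values costs a proportion [#|gT| * d], at most one half by
    [dsmall]. *)
Lemma epi_tuples_bound : (#|tuples p gT N' N|%:R : R) <= 2 * #|[set a in tuples p gT N' N | `[<is_epi (thom u a)>]]|%:R.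
Proof.
set G := tuples p gT N' N; set E := [set a in G | _].
have cov : #|G|%:R <= #|E|%:R + \sum_(x | x != 1%g) (#|[set a in G | bad N' (fun l => u (frob l)) z x 1%g a]|%:R : R).
  rewrite -natr_sum -natrD ler_nat -!sum1_card.
  under [X in (_ <= _ + X)%N]eq_bigr do rewrite -sum1_card big_mkcond /=.
  rewrite exchange_big /= [X in (_ <= X + _)%N]big_mkcond /= -big_split /= big_mkcond /=.
  apply: leq_sum => a _; case: ifP => // aG; rewrite inE aG /=.
  case: asboolP => // nepi; rewrite add0n.
  have [fa _] := (tuples_cond a).1 aG.
  have ha := tuple_hom_is_hom hab hPq hsig hu fa.
  have [x nx] : exists x, forall g, thom u a g <> x.
    apply: contrapT => h; apply: nepi; apply: hom_surj_epi => // x.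
    apply: contrapT => h2; apply: h; exists x => g e; apply: h2; by exists g.
  have x1 : x != 1%g by apply/eqP => e; apply: (nx galQ_id); rewrite (hom_id ha) e.
  rewrite (bigD1 x) //= inE aG /=; suff -> : bad N' (fun l => u (frob l)) z x 1%g a by [].
  apply/forallP => l; apply/implyP => _; apply/negP => /andP[/eqP alx _].
  have [e|[prl lp _]] := tame_valuesP l fa; first by rewrite e in alx; rewrite -alx eqxx in x1.
  by apply: (nx (sig l)); rewrite (tuple_hom_sig hPq hsig u1 fa prl lp).
have sumle : \sum_(x | x != 1%g) (#|[set a in G | bad N' (fun l => u (frob l)) z x 1%g a]|%:R : R) <= #|gT|%:R * d * #|G|%:R.
  apply: (@le_trans _ _ (\sum_(x : gT | x != 1%g) d * #|G|%:R)); first by apply: ler_sum => x x1; apply: few.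
  rewrite sumr_const -[X in X <= _]mulr_natl -[X in _ <= X]mulrA ler_wpM2r ?mulr_ge0 ?(ltW d0) // ler_nat.
  exact: max_card.
have G0 : 0 <= #|G|%:R :> R by [].
have := ler_wpM2r G0 dsmall; lra.
Qed.

(** [tup] embeds the bad epimorphisms of the class into the bad tuples, and its image contains every
    tuple that gives an epimorphism. The factor 2 comes from [epi_tuples_bound]. *)
Lemma class_bound n (e : 'I_n -> galQ -> gT) : injective e ->
  (forall phi, (exists k, e k = phi) <-> is_epi phi /\ cond_le phi X) ->
  #|[set j | `[<red (e j) = u>] && `[<~ (exists q, prime q /\ expR (Num.sqrt (ln X)) < q%:R /\
       e j (sig q) = s /\ e j (frob q) = t)>]]|%:R <= 2 * d * #|[set j | `[<red (e j) = u>]]|%:R.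
Proof.
move=> einj eP; set G := tuples p gT N' N.
have eom k : is_epi (e k) /\ cond_le (e k) X by apply/eP; exists k.
have ehom k : is_hom (e k) by apply: epi_hom; case: (eom k).
have back k : red (e k) = u -> thom u (tup (e k)) = e k by move=> <-; apply: tuple_hom_reduced.
have tG k : red (e k) = u -> tup (e k) \in G.
  move=> rk; apply/tuples_cond; rewrite back //; split; last by case: (eom k).
  exact: (tame_tuple_family hab hpg hPq hsig hfrob).
have c1 : (#|[set j | `[<red (e j) = u>] && `[<~ (exists q, prime q /\ (expR (Num.sqrt (ln X)) < q%:R)%R /\
       e j (sig q) = s /\ e j (frob q) = t)>]]| <= #|[set a in G | bad N' (fun l => u (frob l)) z s t a]|)%N.
  rewrite -(card_in_imset (f := fun j => tup (e j))); last first.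
    move=> j j'; rewrite !inE => /andP[/asboolP r1 _] /andP[/asboolP r2 _] h.
    by apply: einj; rewrite -(back _ r1) -(back _ r2) h.
  apply: subset_leq_card; apply/fintype.subsetP => a /imsetP[j]; rewrite !inE => /andP[/asboolP rj /asboolP nq] ->.
  have := tG j rj; rewrite inE => -> /=.
  have [ft _] := (tuples_cond _).1 (tG j rj).
  apply/forallP => l; apply/implyP => zl; apply/negP => /andP[/eqP als /eqP fr].
  have [h|[prl lp _]] := tame_valuesP l ft; first by case/eqP: s1; rewrite -als h.
  apply: nq; exists l; split=> //; split; first exact: z_lt.
  rewrite -(back j rj) (tuple_hom_sig hPq hsig u1 ft prl lp) als; split=> //.
have c2 : (#|[set a in G | `[<is_epi (thom u a)>]]| <= #|[set j | `[<red (e j) = u>]]|)%N.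
  apply: leq_trans (leq_imset_card (fun j => tup (e j)) _); apply: subset_leq_card; apply/fintype.subsetP => a.
  rewrite finset.in_set => /andP[aG /asboolP epi]; have [fa ca] := (tuples_cond a).1 aG.
  have [k ek] := (eP (thom u a)).2 (conj epi ca).
  apply/imsetP; exists k; first by rewrite inE ek reduced_tuple_hom //; apply/asboolP.
  by rewrite ek tame_tuple_hom.
have := few t s1; have := epi_tuples_bound; rewrite -/G => h1 h2.
move: c1 c2; rewrite -!(ler_nat R) => c1 c2.
have := ler_wpM2l (ltW d0) (le_trans h1 (ler_wpM2l (ler0n _ 2) c2)); lra.
Qed.

End OneClass.

End Counting.

(** With [y = sqrt (ln X)], the power condition reduces to [K0 * y + ln p <= y^2], which holds once
    [y >= K0 + ln p + 1]. *)
Lemma threshold_growth (R : realType) (z0 K0 p : nat) : (0 < p)%N -> exists X0 : R, forall X, X0 <= X ->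
  [/\ 0 <= X, (z0 <= Num.trunc (expR (Num.sqrt (ln X))))%N &
    forall f, (0 < f <= p)%N -> ((Num.trunc (expR (Num.sqrt (ln X)))) ^ K0 <= Num.trunc (X / f%:R))%N].
Proof.
move=> p0; pose c : R := K0%:R + ln p%:R + z0%:R + 1.
have lp : 0 <= ln (p%:R : R) by rewrite ln_ge0 // ler1n.
have k0 := ler0n R K0; have zz0 := ler0n R z0.
have c1 : 1 <= c by rewrite /c; lra.
exists (expR (c ^+ 2)) => X hX.
have X0 : 0 < X by apply: lt_le_trans hX; apply: expR_gt0.
have lnX : c ^+ 2 <= ln X by rewrite -[X in X <= _]expRK ler_ln ?posrE ?expR_gt0.
set y := Num.sqrt (ln X).
have l0 : 0 <= ln X by apply: le_trans lnX; apply: sqr_ge0.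
have yc : c <= y by rewrite -(ger0_norm (le_trans ler01 c1)) -sqrtr_sqr ler_wsqrtr.
have y2 : y ^+ 2 = ln X by rewrite sqr_sqrtr.
set z := Num.trunc (expR y).
have zy : z%:R <= expR y by rewrite -truncn_ge_nat // expR_ge0.
split; first exact: ltW.
  rewrite truncn_ge_nat ?expR_ge0 //; apply: le_trans (expR_ge1Dx y).
  by rewrite /c in yc; lra.
move=> f /andP[f0 fp]; have f0' : 0 < f%:R :> R by rewrite ltr0n.
rewrite truncn_ge_nat; last by rewrite divr_ge0 // ltW.
rewrite ler_pdivlMr // natrX.
apply: (@le_trans _ _ (expR (K0%:R * y) * p%:R)).
  by rewrite ler_pM ?exprn_ge0 ?ler_nat // expRM_natl lerXn2r ?nnegrE ?expR_ge0.
rewrite -[p%:R]lnK ?posrE ?ltr0n // -expRD -[leRHS]lnK ?posrE // ler_expR -y2.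
have h1 : K0%:R + ln p%:R + 1 <= y by rewrite /c in yc; lra.
have h2 : 1 <= y by lra.
rewrite expr2; nra.
Qed.

Local Open Scope classical_set_scope.

Theorem mainTheorem16
  (R : realType) (p : nat) (gT : finGroupType)
  (Pq : nat -> algC -> Prop) (sig frob : nat -> galQ)
  (hp : prime p) (hodd : odd p)
  (hab : abelian [set: gT]%SET) (hpg : pgroup p [set: gT]%SET) (hnt : (1 < #|gT|)%N)
  (hPq : forall q, prime q -> qbar_prime_above q (Pq q))
  (hsig : forall q, prime q -> tame_generator (Pq q) (sig q))
  (hfrob : forall q, prime q -> frob_lift q (Pq q) (frob q))
  (s t : gT) (hs : s != 1%g) :
  (     (ncard [set phi : galQ -> gT | is_epi phi /\ cond_le phi X /\
              ~ (exists q : nat, prime q /\ expR (Num.sqrt (ln X)) < q%:R /\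
                   phi (sig q) = s /\ phi (frob q) = t)])%:R
     / (ncard [set phi : galQ -> gT | is_epi phi /\ cond_le phi X])%:R)
  @[X --> (+oo : set_system R)] --> (0 : R).
Proof.
apply/cvgrPdist_le => eps e0.
have g0 : 0 < #|gT|%:R :> R by rewrite ltr0n ltnW.
(* The first bound pays for the factor 2 of [class_bound]; the second makes at least half of the
   tuples surjective. *)
pose d := Num.min (eps / 2) (1 / 2 / #|gT|%:R).
have d0 : 0 < d by rewrite lt_min !divr_gt0.
have dsmall : #|gT|%:R * d <= 1 / 2.
  by rewrite mulrC -ler_pdivlMr // ge_min lexx orbT.
have deps : 2 * d <= eps.
  have : d <= eps / 2 by rewrite ge_min lexx.
  lra.
have [z0 [K0 few]] := few_bad_all hp hodd hab hpg hnt hPq hsig hfrob d0.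
have [X0 HX] := threshold_growth R z0 K0 (prime_gt0 hp).
exists X0; split; first exact: num_real.
move=> X /ltW /HX[Xge0 zz zK] /=.
rewrite sub0r normrN ger0_norm ?divr_ge0 //.
set Om := [set phi : galQ -> gT | is_epi phi /\ cond_le phi X].
set Bad := [set phi : galQ -> gT | _].
(* [ncard] of an infinite set is 0 and [x / 0 = 0]. *)
have [fin|inf] := pselect (finite_set Om); last by rewrite (ncard_infinite inf) invr0 mulr0 ltW.
have [n [e [einj eP]]] := finite_enum fin.
pose J : {set 'I_n} := [set j | `[<~ (exists q, prime q /\ expR (Num.sqrt (ln X)) < q%:R /\
       e j (sig q) = s /\ e j (frob q) = t)>]]%SET.
have nOm : ncard Om = n.
  rewrite -(ncard_range einj); congr ncard; apply/seteqP; split=> [x /eP[k <-]|x [k _ <-]]; first by exists k.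
  by apply/eP; exists k.
have nBad : ncard Bad = #|J|.
  pose e' (k : 'I_#|J|) := e (enum_val k).
  have e'inj : injective e' by move=> i j /einj/enum_val_inj.
  rewrite -(ncard_range e'inj); congr ncard; apply/seteqP; split=> [x [epi [c nq]]|x [k _ <-]].
    have [k ek] := (eP x).1 (conj epi c).
    have kJ : k \in J by rewrite inE; apply/asboolP; rewrite ek.
    by exists (enum_rank_in kJ k) => //; rewrite /e' enum_rankK_in.
  have [epi c] := (eP (e' k)).2 (ex_intro _ (enum_val k) erefl).
  by split=> //; split=> //; have := enum_valP k; rewrite inE => /asboolP.
have [->|n0] := posnP (ncard Om); first by rewrite invr0 mulr0 ltW.
rewrite nOm nBad; rewrite nOm in n0.
rewrite ler_pdivrMr ?ltr0n //; apply: le_trans (_ : 2 * d * n%:R <= _); last by rewrite ler_wpM2r.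
(* Epimorphisms are grouped by their reduced part, and each group satisfies the same bound. *)
apply: (@class_ratio _ R n (fun j => @reduced p gT Pq sig hPq hsig (Num.trunc X) (e j))) => i.
have [epi c] := (eP (e i)).2 (ex_intro _ i erefl).
have hi := epi_hom epi.
set u := reduced _ _ _ _ (e i).
have hu : is_hom u by apply: (reduced_hom hab hpg hPq hsig hfrob).
have u1 : tame_trivial p sig u by apply: (reduced_trivial hab hpg hPq hsig hfrob hi Xge0 erefl c).
have f0 := ram_factor_gt0 hp u.
have fp : (ram_factor p u <= p)%N by rewrite /ram_factor; case: ifP => // _; apply: prime_gt0.
have NN : (Num.trunc (X / (ram_factor p u)%:R) <= Num.trunc X)%N.
  have h : (Num.trunc (X / (ram_factor p u)%:R))%:R <= X / (ram_factor p u)%:R.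
    by rewrite -truncn_ge_nat // divr_ge0.
  rewrite truncn_ge_nat //; apply: le_trans h _; rewrite ler_pdivrMr ?ltr0n //.
  by rewrite ler_peMr // ler1n.
have := @class_bound R p gT Pq sig frob hp hab hpg hPq hsig hfrob X Xge0 d s t u hs d0 dsmall hu u1
  (fun s t s1 => few s t _ _ _ _ s1 zz (zK _ (introT andP (conj f0 fp))) NN) n e einj (fun phi => iff_sym (eP phi)).
by congr (_%:R <= _); apply: eq_card => j; rewrite !inE.
Qed.
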